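(* Let $r\geq 2$ be an integer and let $(\Lambda V,d)$ be a pure elliptic minimal Sullivan model (of a simply-connected space) which is formal. Then $$\mathrm{TC}_r(\Lambda V)=r\cdot \mathrm{cat}(\Lambda V)+\chi_{\pi}(\Lambda V).$$
   Context: All spaces are simply-connected CW-complexes of finite type, so Sullivan models are over $\mathbb{Q}$ with $V=V^{\geq 2}$ of finite type. A Sullivan model $(\Lambda V,d)$ is minimal if $dV\subset \Lambda^{\geq 2}V$. It is pure if $dV^{even}=0$ and $dV^{odd}\subset \Lambda V^{even}$; elliptic if $V$ and $H^*(\Lambda V,d)$ are both finite dimensional; formal if there is a quasi-isomorphism of commutative differential graded algebras (cdga's) $(\Lambda V,d)\xrightarrow{\simeq}(H(\Lambda V),0)$. The homotopy characteristic is $\chi_\pi(\Lambda V)=\dim V^{even}-\dim V^{odd}$. $\mathrm{cat}(\Lambda V)$ is the rational Lusternik–Schnirelmann category $\mathrm{cat}(Z_0)$ (normalized so that a point has category $0$), where $Z_0$ is the rational space with minimal model $(\Lambda V,d)$; equivalently (Félix–Halperin) the least $n$ such that the projection $\Lambda V\to \Lambda V/\Lambda^{>n}V$ admits a homotopy retraction. For a space $Z$, $\mathrm{TC}_r(Z)$ is the least $n$ such that $Z^r$ is covered by $n+1$ open sets on each of which the evaluation map $Z^{[0,1]}\to Z^r$, $\gamma\mapsto(\gamma(0),\gamma(\tfrac1{r-1}),\dots,\gamma(\tfrac{r-2}{r-1}),\gamma(1))$ has a continuous local section. One writes $\mathrm{TC}_r(\Lambda V)=\mathrm{TC}_r(Z_0)$.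 By a theorem of Carrasquel, $\mathrm{TC}_r(\Lambda V)$ is equivalently the least $n$ such that the projection $\rho^r_n:(\Lambda V)^{\otimes r}\to (\Lambda V)^{\otimes r}/(\ker \mu^r_{\Lambda V})^{n+1}$ admits a homotopy retraction, where $\mu^r_{\Lambda V}:(\Lambda V)^{\otimes r}\to\Lambda V$ is the multiplication. A cdga morphism $\rho:A\to B$ admits a homotopy retraction if, for a relative Sullivan model $A\xrightarrow{i} A\otimes\Lambda W\xrightarrow{\simeq}B$ of $\rho$, there is a cdga morphism $\tau:A\otimes\Lambda W\to A$ with $\tau\circ i=\mathrm{id}_A$. *)

(* Defs.v *)
From HB Require Import structures.
From mathcomp Require Import all_boot all_order all_algebra.
From mathcomp Require Import classical_sets.

Set Implicit Arguments.
Unset Strict Implicit.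
Unset Printing Implicit Defensive.

Import GRing.Theory.

Local Open Scope classical_set_scope.
Local Open Scope ring_scope.

Section LinearAlgebra.
Context {M : lmodType rat}.
Implicit Type S : set M.

Definition subspace S :=
  S 0 /\ forall (c : rat) x y, S x -> S y -> S (c *: x + y).

Definition span S : set M := smallest subspace S.

Definition has_dim S (n : nat) :=
  exists e : 'I_n -> M,
    (forall c : 'I_n -> rat, \sum_i c i *: e i = 0 -> forall i, c i = 0) /\
    S = [set x | exists c : 'I_n -> rat, x = \sum_i c i *: e i].

Definition fin_dim S := exists n, has_dim S n.

End LinearAlgebra.

Definition subalgebra {A : algType rat} (S : set A) :=
  [/\ subspace S, S 1 & forall x y, S x -> S y -> S (x * y)].

Definition subalg_gen {A : algType rat} (S : set A) : set A :=
  smallest subalgebra S.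

Definition prods_ge {A : algType rat} (S : set A) (k : nat) : set A :=
  [set x | exists s : seq A,
     [/\ (k <= size s)%N, {in s, forall a, S a} & x = \prod_(a <- s) a]].

(* For an ideal I, [ideal_exp I k] is I^k. *)
Definition ideal_exp {A : algType rat} (I : set A) (k : nat) : set A :=
  span (prods_ge I k).

(* An algebra is given by its total space, the direct sum of its homogeneous
   components [gr n], n >= 0.  Algebras are unital with 1 != 0. *)
HB.mixin Record isGradedComm A of GRing.Algebra rat A := {
  gr : nat -> set A;
  gr_subspace : forall n, subspace (gr n);
  gr_decomp : forall x : A, exists (n : nat) (f : nat -> A),
    (forall k, gr k (f k)) /\ x = \sum_(k < n) f k;
  gr_direct : forall (n : nat) (f : nat -> A), (forall k, gr k (f k)) ->
    \sum_(k < n) f k = 0 -> forall k, (k < n)%N -> f k = 0;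
  gr_one : gr 0%N 1;
  gr_mul : forall m n (x y : A), gr m x -> gr n y -> gr (m + n)%N (x * y);
  gr_comm : forall m n (x y : A), gr m x -> gr n y ->
    x * y = (-1) ^+ (m * n) * (y * x)
}.

#[short(type="gcaType")]
HB.structure Definition GradedComm :=
  {A of GRing.Algebra rat A & isGradedComm A}.

HB.mixin Record isCdga A of GradedComm A := {
  diff : A -> A;
  diff_linear : forall (c : rat) x y, diff (c *: x + y) = c *: diff x + diff y;
  diff_deg : forall n x, gr n x -> gr n.+1 (diff x);
  diff_diff : forall x, diff (diff x) = 0;
  diff_mul : forall n x y, gr n x ->
    diff (x * y) = diff x * y + (-1) ^+ n * (x * diff y)
}.

#[short(type="cdgaType")]
HB.structure Definition Cdga := {A of GradedComm A & isCdga A}.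

Definition graded_mor (A B : gcaType) (f : {lrmorphism A -> B}) :=
  forall n x, gr n x -> gr n (f x).

Definition cdga_mor (A B : cdgaType) (f : {lrmorphism A -> B}) :=
  graded_mor f /\ forall x, f (diff x) = diff (f x).

Definition quasi_iso (A B : cdgaType) (f : {lrmorphism A -> B}) :=
  [/\ cdga_mor f,
      forall a, diff a = 0 -> (exists b, f a = diff b) -> exists a', a = diff a'
    & forall b, diff b = 0 -> exists a b', diff a = 0 /\ f a = b + diff b'].

Definition graded_subspace (A : gcaType) (V : nat -> set A) :=
  forall n, subspace (V n) /\ V n `<=` gr n.

(* gtotal V and gparity b V consist of the homogeneous elements of V, resp. of
   V^odd (b = true) or V^even (b = false); the subspaces are their spans. *)
Definition gtotal (A : gcaType) (V : nat -> set A) : set A :=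
  \bigcup_n V n.

Definition gparity (b : bool) (A : gcaType) (V : nat -> set A) : set A :=
  \bigcup_(n in [set n | odd n = b]) V n.

(* g restricts to a degree-0 linear map from the graded subspace V to C *)
Definition graded_linear_on (A C : gcaType) (V : nat -> set A) (g : A -> C) :=
  forall n, (forall (c : rat) x y, V n x -> V n y ->
               g (c *: x + y) = c *: g x + g y) /\
            (forall x, V n x -> gr n (g x)).

(* A = Lambda V : A is the free graded commutative algebra on V. *)
Definition free_gca (A : gcaType) (V : nat -> set A) :=
  graded_subspace V /\
  forall (C : gcaType) (g : A -> C), graded_linear_on V g ->
    exists h : {lrmorphism A -> C},
      [/\ graded_mor h, {in gtotal V, h =1 g}
        & forall h' : {lrmorphism A -> C}, graded_mor h' ->
            {in gtotal V, h' =1 g} -> h' =1 h].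

(* E = A (x) Lambda W along i : a |-> a (x) 1, i.e. E is the free graded
   commutative A-algebra on W. *)
Definition rel_free_gca (A E : gcaType) (i : {lrmorphism A -> E})
    (W : nat -> set E) :=
  [/\ graded_subspace W, graded_mor i
    & forall (C : gcaType) (f : {lrmorphism A -> C}) (g : E -> C),
      graded_mor f -> graded_linear_on W g ->
      exists h : {lrmorphism E -> C},
        [/\ graded_mor h, h \o i =1 f, {in gtotal W, h =1 g}
          & forall h' : {lrmorphism E -> C}, graded_mor h' ->
              h' \o i =1 f -> {in gtotal W, h' =1 g} -> h' =1 h]].

Definition exhaustive_filtration (A : gcaType) (W : nat -> set A)
    (F : nat -> nat -> set A) :=
  [/\ forall k, graded_subspace (F k),
      forall k n, F k n `<=` F k.+1 n
    & forall n, W n = \bigcup_k F k n].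

(* Relative Sullivan algebra A -> A (x) Lambda W, W = W^{>=1}. *)
Definition rel_sullivan (A E : cdgaType) (i : {lrmorphism A -> E})
    (W : nat -> set E) :=
  [/\ cdga_mor i, rel_free_gca i W, W 0%N = [set 0]
    & exists F, [/\ exhaustive_filtration W F,
        forall w, gtotal (F 0%N) w -> range i (diff w)
      & forall k w, gtotal (F k.+1) w ->
          subalg_gen (range i `|` gtotal (F k)) (diff w)]].

Definition homotopy_retraction (A B : cdgaType) (rho : {lrmorphism A -> B}) :=
  exists (E : cdgaType) (i : {lrmorphism A -> E}) (W : nat -> set E)
         (p : {lrmorphism E -> B}) (tau : {lrmorphism E -> A}),
    [/\ rel_sullivan i W, quasi_iso p, p \o i =1 rho,
        cdga_mor tau & tau \o i =1 id].

Definition is_projection (A B : cdgaType) (rho : {lrmorphism A -> B})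
    (I : set A) :=
  [/\ cdga_mor rho, forall b, exists a, rho a = b
    & [set a | rho a = 0] = I].

(* Sullivan algebra A = Lambda V with V = V^{>=2} of finite type. *)
Definition sullivan (A : cdgaType) (V : nat -> set A) :=
  [/\ free_gca V,
      V 0%N = [set 0] /\ V 1%N = [set 0],
      forall n, fin_dim (V n)
    & exists F, [/\ exhaustive_filtration V F,
        forall v, gtotal (F 0%N) v -> diff v = 0
      & forall k v, gtotal (F k.+1) v ->
          subalg_gen (gtotal (F k)) (diff v)]].

(* Lambda^{>=k} V *)
Definition wordlength_ge (A : gcaType) (V : nat -> set A) (k : nat) : set A :=
  span (prods_ge (gtotal V) k).

Definition minimal (A : cdgaType) (V : nat -> set A) :=
  forall v, gtotal V v -> wordlength_ge V 2 (diff v).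

Definition pure (A : cdgaType) (V : nat -> set A) :=
  (forall v, gparity false V v -> diff v = 0) /\
  (forall v, gparity true V v -> subalg_gen (gparity false V) (diff v)).

Definition fin_dim_cohomology (A : cdgaType) :=
  exists s : seq A, {in s, forall a, diff a = 0} /\
    forall z : A, diff z = 0 ->
      exists b, span [set a | a \in s] (z - diff b).

Definition elliptic (A : cdgaType) (V : nat -> set A) :=
  fin_dim (span (gtotal V)) /\ fin_dim_cohomology A.

(* (H, 0) is the cohomology algebra of A, with z |-> [z] given by cls on the
   cocycles; the values of cls outside the cocycles are irrelevant. *)
Definition is_cohomology (A H : cdgaType) (cls : A -> H) :=
  [/\ forall h : H, diff h = 0,
      [/\ forall (c : rat) x y, diff x = 0 -> diff y = 0 ->
            cls (c *: x + y) = c *: cls x + cls y,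
          cls 1 = 1
        & forall x y, diff x = 0 -> diff y = 0 -> cls (x * y) = cls x * cls y],
      forall n x, diff x = 0 -> gr n x -> gr n (cls x),
      forall h, exists x, diff x = 0 /\ cls x = h
    & forall x, diff x = 0 -> (cls x = 0 <-> exists y, x = diff y)].

Definition formal (A : cdgaType) :=
  exists (H : cdgaType) (cls : A -> H) (phi : {lrmorphism A -> H}),
    is_cohomology cls /\ quasi_iso phi.

Definition multilinear (r : nat) (A M : lmodType rat)
    (phi : ('I_r -> A) -> M) :=
  forall (a : 'I_r -> A) (i : 'I_r) (c : rat) (x y : A),
    phi (@dfwith _ _ a i (c *: x + y)) =
    c *: phi (@dfwith _ _ a i x) + phi (@dfwith _ _ a i y).

(* T is the r-fold tensor power of A, iota i being the inclusion of the i-th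
   factor, so that a_0 (x) ... (x) a_{r-1} is \prod_i iota i (a_i).  The sign
   rule for the product of T is its graded commutativity. *)
Definition is_tensor_power (r : nat) (A T : cdgaType)
    (iota : 'I_r -> {lrmorphism A -> T}) :=
  (forall i, cdga_mor (iota i)) /\
  forall (M : lmodType rat) (phi : ('I_r -> A) -> M), multilinear phi ->
    exists h : {linear T -> M},
      (forall a, h (\prod_i iota i (a i)) = phi a) /\
      (forall h' : {linear T -> M},
         (forall a, h' (\prod_i iota i (a i)) = phi a) -> h' =1 h).

Definition is_least (P : nat -> Prop) (n : nat) :=
  P n /\ forall m, P m -> (n <= m)%N.

(* Lambda V -> Lambda V / Lambda^{>n} V admits a homotopy retraction. *)
Definition cat_le (A : cdgaType) (V : nat -> set A) (n : nat) :=
  exists (B : cdgaType) (rho : {lrmorphism A -> B}),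
    is_projection rho (wordlength_ge V n.+1) /\ homotopy_retraction rho.

(* A^{(x) r} -> A^{(x) r} / (ker mu)^{n+1} admits a homotopy retraction, where
   mu : A^{(x) r} -> A is the multiplication. *)
Definition TC_le (r : nat) (A : cdgaType) (n : nat) :=
  exists (T : cdgaType) (iota : 'I_r -> {lrmorphism A -> T})
         (mu : {lrmorphism T -> A}) (B : cdgaType) (rho : {lrmorphism T -> B}),
    [/\ is_tensor_power iota,
        forall a : 'I_r -> A, mu (\prod_i iota i (a i)) = \prod_i a i,
        is_projection rho (ideal_exp [set t | mu t = 0] n.+1)
      & homotopy_retraction rho].

Definition is_cat (A : cdgaType) (V : nat -> set A) (n : nat) :=
  is_least (cat_le V) n.

Definition is_TC (r : nat) (A : cdgaType) (n : nat) :=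
  is_least (TC_le r A) n.

(* Only meaningful when V is finite dimensional. *)
Definition is_chi_pi (A : gcaType) (V : nat -> set A) (z : int) :=
  exists p q, [/\ has_dim (span (gparity false V)) p,
                  has_dim (span (gparity true V)) q
                & z = p%:Z - q%:Z].

(* Main.v *)
From HB Require Import structures.
From mathcomp Require Import all_boot all_order all_algebra.
From mathcomp Require Import boolp classical_sets.
Require Import Defs.

(** Formality enters through an ideal: the kernel [K] of a quasi-isomorphism from
    [A] to its cohomology contains all boundaries, every cocycle in [K] is exact,
    and every element of [A] is a cocycle modulo [K].

    A pure algebra has even generators [x_i], [i < p], which are cocycles, odd
    generators [y_j] whose differentials are polynomials in the [x_i], and odd
    generators [z_k] which are cocycles.  Choose them with as few [y_j] as possible
    ([minimal_family]).  Then every cocycle of positive weight in the [y_j] is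
    exact ([exact_positive]): by minimality it lies in the ideal of the [x_i], by
    formality its coefficients may be taken to be cocycles, and one argues by
    induction on the degree.  In other words the polynomials [d y_j] form a regular
    sequence.  Since the cohomology is finite dimensional, a Koszul construction on
    the [x_i] shows that there are exactly [p] of them ([count_le], [count_ge]).
    So the number [l] of the [z_k] is minus the homotopy characteristic, and [A] is
    generated by the [x_i] and the [z_k] modulo [K].  Let [c] be the maximal number
    of letters of a word in the [x_i] outside [K].  By [polarization], some linear
    combination [u] of the [x_i] has [u ^+ c] outside [K], and then the product
    [w] of [u ^+ c] and all the [z_k] is outside [K] as well ([structure]).

    It turns out that [cat = c + l] and [TC_r = r * c + (r - 1) * l], from which the
    formula follows.

    For the upper bounds, [homotopy_retraction_of_ideal] builds a relative model of
    a projection, together with a homotopy retraction, degree by degree, as soon as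
    the kernel of the projection lies in an ideal with the properties of [K].  A
    tensor power inherits such an ideal from [A], because the acyclicity of [K] can
    be witnessed by a contraction ([acyclic_kernel], [tensor_power]).  It remains to
    see that the relevant power of the augmentation ideal of [A], or of the kernel
    of the multiplication of the tensor power, lies in the acyclic ideal.  Modulo
    this ideal it is generated by even elements with few nonzero words and by odd
    elements of square zero: [l] of them for [A], and [(r - 1) * l] differences for
    the tensor power ([nilpotence]).

    For the lower bounds, a projection with a homotopy retraction is injective in
    cohomology ([retraction_exact]).  So it suffices that [w] is a product of
    [c + l] elements of positive degree, and that the kernel of the multiplication
    contains [r * c + (r - 1) * l] elements whose product is not exact: the
    differences of the copies of [u] and of the [z_k] in the factors of the tensor
    power, that of [u] between the first two factors being used [2 * c] times
    ([long_product_notin]). *)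

Set Implicit Arguments.
Unset Strict Implicit.
Unset Printing Implicit Defensive.

Import GRing.Theory Num.Theory.

Local Open Scope classical_set_scope.
Local Open Scope ring_scope.

(** * Deciding identities in abelian groups *)

(** The tactic [zmod] proves an equation that holds in every abelian group:
    both sides are read as integer combinations of their atoms, and the
    coefficients are compared. *)
Inductive zexp := ZV of nat | Z0 | ZA of zexp & zexp | ZN of zexp.
Fixpoint zev (V : zmodType) (e : seq V) (t : zexp) : V := match t with
 | ZV n => nth 0 e n | Z0 => 0 | ZA a b => @zev V e a + @zev V e b | ZN a => - @zev V e a end.
Arguments zev [V].
Fixpoint zco (n : nat) (t : zexp) : int := match t with
 | ZV k => if (k == n)%N then 1 else 0 | Z0 => 0 | ZA a b => zco n a + zco n b | ZN a => - zco n a end.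
Lemma zevE (V : zmodType) (e : seq V) t : zev e t = \sum_(i < size e) nth 0 e i *~ zco i t.
Proof.
elim: t => /= [k||a -> b ->|a ->].
- have [h|h] := ltnP k (size e).
    rewrite (bigD1 (Ordinal h)) //= eqxx big1 ?addr0 //.
    by move=> i hi; rewrite -(inj_eq val_inj) /= eq_sym in hi; rewrite (negbTE hi).
  rewrite nth_default // big1 // => i _; rewrite gtn_eqF ?mulr0z //.
  exact: leq_trans h.
- by rewrite big1 // => i _; rewrite mulr0z.
- by rewrite -big_split; apply: eq_bigr => i _; rewrite mulrzDr.
- by rewrite -sumrN; apply: eq_bigr => i _; rewrite mulrNz.
Qed.
Lemma zev_eq (V : zmodType) (e : seq V) a b :
  all (fun i => zco i a == zco i b) (iota 0 (size e)) -> zev e a = zev e b.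
Proof.
move=> /allP h; rewrite !zevE; apply: eq_bigr => i _; congr (_ *~ _); apply/eqP/h.
by rewrite mem_iota add0n ltn_ord.
Qed.
Ltac zsame x y := match constr:((x, y)) with (?z, ?z) => constr:(true) end.
Ltac zconv x y := let _ := constr:(@erefl _ x : x = y) in constr:(true).
Ltac zin eq x l := match l with
 | nil => constr:(false)
 | cons ?y ?t => match constr:(Set) with
   | _ => let _ := eq x y in constr:(true) | _ => zin eq x t end end.
Ltac zidx eq x l := match l with
 | cons ?y ?t => match constr:(Set) with
   | _ => let _ := eq x y in constr:(O)
   | _ => let n := zidx eq x t in constr:(S n) end end.
Ltac zatoms eq l e := lazymatch e with
 | (?a + ?b)%R => let l1 := zatoms eq l a in zatoms eq l1 b
 | (- ?a)%R => zatoms eq l a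
 | (0)%R => l
 | _ => match zin eq e l with true => l | false => constr:(cons e l) end end.
Ltac zreify eq l e := lazymatch e with
 | (?a + ?b)%R => let a' := zreify eq l a in let b' := zreify eq l b in constr:(ZA a' b')
 | (- ?a)%R => let a' := zreify eq l a in constr:(ZN a')
 | (0)%R => constr:(Z0)
 | _ => let n := zidx eq e l in constr:(ZV n) end.
Ltac zmod_up_to eq := match goal with |- @Logic.eq ?T ?a ?b =>
  let l0 := zatoms eq (@nil T) a in let l := zatoms eq l0 b in
  let ra := zreify eq l a in let rb := zreify eq l b in
  refine (@zev_eq _ l ra rb _); vm_compute; reflexivity end.
Ltac zmod := first [zmod_up_to zsame | zmod_up_to zconv].

(** * Linear algebra over the rationals *)

Section Subspaces.
Variables (M : lmodType rat) (S : set M).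
Hypothesis hS : subspace S.

Lemma ss0 : S 0. Proof. by case: hS. Qed.
Lemma ssD x y : S x -> S y -> S (x + y).
Proof. by move=> hx hy; rewrite -[x]scale1r; apply: hS.2. Qed.
Lemma ssZ c x : S x -> S (c *: x).
Proof. by move=> hx; rewrite -[_ *: _]addr0; apply: hS.2 => //; apply: ss0. Qed.
Lemma ssN x : S x -> S (- x).
Proof. by rewrite -scaleN1r; apply: ssZ. Qed.
Lemma ssB x y : S x -> S y -> S (x - y).
Proof. by move=> hx /ssN; apply: ssD. Qed.
Lemma ss_sum (I : Type) (r : seq I) (P : pred I) (F : I -> M) :
  (forall i, P i -> S (F i)) -> S (\sum_(i <- r | P i) F i).
Proof. by move=> h; apply: big_ind => //; [apply: ss0 | apply: ssD]. Qed.

End Subspaces.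

Section Spans.
Variable M : lmodType rat.
Implicit Types (S G : set M) (s t : seq M).

Lemma subspaceI S T : subspace S -> subspace T -> subspace (S `&` T).
Proof.
move=> hS hT; split; first by split; apply: ss0.
by move=> c x y [? ?] [? ?]; split; [apply: hS.2|apply: hT.2].
Qed.

Lemma subspaceT : subspace (@setT M). Proof. by []. Qed.

Lemma subspace0 : subspace [set (0 : M)].
Proof. by split=> // c x y -> ->; rewrite scaler0 addr0. Qed.

Lemma span_subspace G : subspace (span G).
Proof.
split; first by move=> A [hA _]; apply: ss0.
by move=> c x y hx hy A hA; apply: hA.1.2; [apply: hx|apply: hy].
Qed.

Lemma span_sub G : G `<=` span G. Proof. exact: sub_gen_smallest. Qed.

Lemma span_min G S : subspace S -> G `<=` S -> span G `<=` S.
Proof. exact: smallest_sub. Qed.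

(** The recursive form allows case analysis on the coefficient of the head. *)
Fixpoint fspan s : set M :=
  if s is a :: s' then [set x | exists c y, fspan s' y /\ x = c *: a + y]
  else [set 0].

Lemma fspan_subspace s : subspace (fspan s).
Proof.
elim: s => [|a s IH]; first exact: subspace0.
split; first by exists 0, 0; split; [exact: ss0|rewrite scale0r addr0].
move=> c _ _ [c1 [y1 [h1 ->]]] [c2 [y2 [h2 ->]]].
exists (c * c1 + c2), (c *: y1 + y2); split; first exact: IH.2.
by rewrite scalerDl scalerDr scalerA !addrA; congr (_ + _); rewrite addrAC.
Qed.

Lemma fspan_mem s a : a \in s -> fspan s a.
Proof.
elim: s => // b s IH; rewrite inE => /orP[/eqP ->|/IH h].
  by exists 1, 0; rewrite scale1r addr0; split=> //; apply: ss0; exact: fspan_subspace.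
by exists 0, a; rewrite scale0r add0r.
Qed.

Lemma fspan_min s S : subspace S -> {in s, forall a, S a} -> fspan s `<=` S.
Proof.
move=> hS; elim: s => [|a s IH] h x /=; first by move=> ->; apply: ss0.
case=> c [y [hy ->]]; apply: hS.2; first by apply: h; rewrite inE eqxx.
by apply: IH hy => b hb; apply: h; rewrite inE hb orbT.
Qed.


Lemma fspan_sub s t : {subset s <= t} -> fspan s `<=` fspan t.
Proof.
by move=> h; apply: fspan_min; [exact: fspan_subspace|move=> a /h /fspan_mem].
Qed.

(** Gaussian elimination on one coordinate at a time. *)
Lemma fspan_subspace_gen s S : subspace S -> S `<=` fspan s ->
  exists t, {in t, forall a, S a} /\ S `<=` fspan t.
Proof.
elim: s S => [|a s IH] S hS hs; first by exists [::]; split.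
have [t [h1 h2]] := IH _ (subspaceI hS (fspan_subspace s)) (@subIsetr _ _ _).
have [[x0 [hx0 [c [y [hc hy e]]]]]|hno] := pselect (exists x0, S x0 /\ exists c y,
    [/\ c != 0, fspan s y & x0 = c *: a + y]).
  exists (x0 :: t); split.
    by move=> b; rewrite inE => /orP[/eqP ->|/h1 []].
  move=> x hx; have [c1 [y1 [hy1 e1]]] := hs _ hx.
  exists (c1 / c), (x - (c1 / c) *: x0); split; last by rewrite addrC subrK.
  apply: h2; split; first by apply: ssB => //; apply: ssZ.
  rewrite e1 e scalerDr scalerA divfK // opprD addrACA subrr add0r.
  by apply: ssB => //; [exact: fspan_subspace|apply: ssZ => //; exact: fspan_subspace].
exists t; split; first by move=> b /h1 [].
move=> x hx; apply: h2; split=> //.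
have [c [y [hy e]]] := hs _ hx.
have [c0|c0] := eqVneq c 0; first by rewrite e c0 scale0r add0r.
by exfalso; apply: hno; exists x; split=> //; exists c, y.
Qed.

Fixpoint indep s : Prop := if s is a :: s' then ~ fspan s' a /\ indep s' else True.

Lemma indep_extract s :
  exists t, [/\ {subset t <= s}, indep t & fspan s `<=` fspan t].
Proof.
elim: s => [|a s [t [h1 h2 h3]]]; first by exists [::]; split.
have [ha|ha] := pselect (fspan t a).
  exists t; split=> //; first by move=> x /h1; rewrite inE orbC => ->.
  move=> x [c [y [/h3 hy ->]]]; apply: (fspan_subspace t).2 => //.
exists (a :: t); split=> //.
  by move=> x; rewrite !inE => /orP[->//|/h1 ->]; rewrite orbT.
by move=> x [c [y [/h3 hy ->]]]; exists c, y.
Qed.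

Lemma fspanE s :
  fspan s = [set x | exists c : 'I_(size s) -> rat, x = \sum_i c i *: s`_i].
Proof.
elim: s => [|a s IH]; apply/seteqP; split=> x /=.
- by move=> ->; exists (fun _ => 0); rewrite big_ord0.
- by case=> c ->; rewrite big_ord0.
- rewrite IH => -[c [y [[d ->] ->]]].
  exists (fun i => if unlift ord0 i is Some j then d j else c).
  rewrite big_ord_recl /= unlift_none; congr (_ + _).
  by apply: eq_bigr => i _; rewrite liftK.
- case=> c ->; rewrite big_ord_recl /=; exists (c ord0).
  exists (\sum_(i < size s) c (lift ord0 i) *: s`_i); split=> //.
  by rewrite IH; exists (fun i => c (lift ord0 i)).
Qed.

Lemma indep_coef s (c : 'I_(size s) -> rat) :
  indep s -> \sum_i c i *: s`_i = 0 -> forall i, c i = 0.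
Proof.
elim: s c => [|a s IH] c /=; first by move=> _ _ [].
case=> ha hs; rewrite big_ord_recl /= => h.
have c0 : c ord0 = 0.
  apply/eqP; apply: contra_notT ha => c0.
  have -> : a = - (c ord0)^-1 *: (\sum_(i < size s) c (lift ord0 i) *: s`_i).
    by apply: (scalerI c0); rewrite scalerA mulrN divff // scaleN1r;
       apply/eqP; rewrite -addr_eq0 h.
  by apply: ssZ; [exact: fspan_subspace|rewrite fspanE; exists (fun i => c (lift ord0 i))].
move: h; rewrite c0 scale0r add0r => h i.
have := IH (fun i => c (lift ord0 i)) hs h.
by case: (unliftP ord0 i) => [j ->|->].
Qed.

Lemma indep_has_dim s : indep s -> has_dim (fspan s) (size s).
Proof.
by move=> hs; exists (fun i => s`_i); split; [move=> c; apply: indep_coef|exact: fspanE].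
Qed.

Lemma fin_dim_fspan S : fin_dim S -> exists s, S = fspan s.
Proof.
case=> n [e [_ ->]]; exists [seq e i | i <- enum 'I_n].
apply/seteqP; split=> [x /=|].
  case=> c ->; apply: ss_sum; first exact: fspan_subspace.
  move=> i _; apply: ssZ; first exact: fspan_subspace.
  by apply: fspan_mem; apply/map_f; rewrite mem_enum.
apply: fspan_min.
  split; first by exists (fun=> 0); rewrite big1 // => i _; rewrite scale0r.
  move=> c _ _ [d ->] [d' ->]; exists (fun i => c * d i + d' i).
  rewrite scaler_sumr -big_split /=; apply: eq_bigr => i _.
  by rewrite scalerDl scalerA.
move=> _ /mapP[i _ ->]; exists (fun j => (j == i)%:R).
rewrite (bigD1 i) //= eqxx scale1r big1 ?addr0 // => j /negbTE ->.
by rewrite scale0r.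
Qed.

(** Zorn's lemma on the subspaces of [K] that meet [B] trivially. *)
Lemma complement (B K : set M) : subspace B -> subspace K -> B `<=` K ->
  exists U, [/\ subspace U, U `<=` K, forall x, U x -> B x -> x = 0
     & forall x, K x -> exists b u, [/\ B b, U u & x = b + u]].
Proof.
move=> hB hK hBK.
pose good W := [/\ subspace W, W `<=` K & forall x, W x -> B x -> x = 0].
(* the empty set is allowed, as the union of the empty chain *)
pose P := [set W : set M | W = set0 \/ good W].
have [|A [PA maxA]] := @Zorn_bigcup _ P.
  move=> F FP totF.
  have [[W0 [FW0 gW0]]|none] := pselect (exists W, F W /\ good W); last first.
    left; apply/seteqP; split=> // x [W FW Wx].
    by case: (FP _ FW) => h; [rewrite h in Wx|apply: none; exists W].
  right; split.
  - split; first by exists W0 => //; apply: ss0; case: gW0.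
    have mem W x : F W -> W x -> good W.
      by move=> FW Wx; case: (FP _ FW) => // h; rewrite h in Wx.
    move=> c x y [W1 F1 Wx] [W2 F2 Wy].
    have [g1 _ _] := mem _ _ F1 Wx; have [g2 _ _] := mem _ _ F2 Wy.
    by case: (totF _ _ F1 F2) => h; [exists W2|exists W1] => //;
       [apply: g2.2 => //; apply: h|apply: g1.2 => //; apply: h].
  - move=> x [W FW Wx]; case: (FP _ FW) => [h|[_ + _]]; last exact.
    by rewrite h in Wx.
  - move=> x [W FW Wx]; case: (FP _ FW) => [h|[_ _]]; last exact.
    by rewrite h in Wx.
case: PA => [A0|[sA AK AB]].
  exfalso; apply: (maxA [set 0]).
    by rewrite A0; split=> // h; have := h 0 erefl.
  right; split=> //; first exact: subspace0.
  by move=> x ->; apply: ss0.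
exists A; split=> // x Kx; apply: contrapT => hx.
pose A' := [set y | exists c u, A u /\ y = c *: x + u].
apply: (maxA A').
  split; first by move=> u Au; exists 0, u; rewrite scale0r add0r.
  move=> /(_ x) h; apply: hx; exists 0, x; rewrite add0r; split=> //.
    exact: ss0.
  by apply: h; exists 1, 0; rewrite scale1r addr0; split=> //; apply: ss0.
right; split.
- split; first by exists 0, 0; rewrite scale0r addr0; split=> //; apply: ss0.
  move=> c _ _ [c1 [y1 [h1 ->]]] [c2 [y2 [h2 ->]]].
  exists (c * c1 + c2), (c *: y1 + y2); split; first exact: sA.2.
  by rewrite scalerDl scalerDr scalerA !addrA; congr (_ + _); rewrite addrAC.
- by move=> _ [c [u [Au ->]]]; apply: hK.2 => //; apply: AK.
- move=> _ [c [u [Au ->]]] hb.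
  have [c0|c0] := eqVneq c 0.
    by move: hb; rewrite c0 scale0r add0r; apply: AB.
  exfalso; apply: hx; exists (c^-1 *: (c *: x + u)), (- c^-1 *: u); split.
  + exact: ssZ.
  + exact: ssZ.
  + by rewrite scalerDr scalerA mulVf // scale1r scaleNr addrK.
Qed.

End Spans.

Section LinearMaps.
Variables M N : lmodType rat.

Definition mk_linear (f : M -> N)
    (h : forall (c : rat) x y, f (c *: x + y) = c *: f x + f y) : {linear M -> N} :=
  HB.pack f (GRing.isLinear.Build rat M N *:%R f h).

Lemma ker_subspace (f : {linear M -> N}) : subspace [set x | f x = 0].
Proof. by split=> /= [|c x y hx hy]; rewrite ?linear0 // linearP hx hy scaler0 addr0. Qed.

Lemma preim_subspace (f : {linear M -> N}) S : subspace S -> subspace [set x | S (f x)].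
Proof.
by move=> hS; split=> /= [|c x y hx hy]; rewrite ?linear0 ?linearP; [apply: ss0|apply: hS.2].
Qed.

Lemma image_subspace (f : {linear M -> N}) S : subspace S -> subspace (f @` S).
Proof.
move=> hS; split; first by exists 0; rewrite ?linear0 //; apply: ss0.
by move=> c _ _ [x hx <-] [y hy <-]; exists (c *: x + y); rewrite ?linearP //; apply: hS.2.
Qed.

Lemma eq_subspace (f g : {linear M -> N}) : subspace [set x | f x = g x].
Proof.
by split=> /= [|c x y hx hy]; rewrite ?linear0 // !linearP hx hy.
Qed.

(** Most linear maps below are obtained in this way, since their values are known
    through existence statements only. *)
Lemma linear_of_rel (R : M -> N -> Prop) :
  (forall x, exists y, R x y) -> (forall x y y', R x y -> R x y' -> y = y') ->
  (forall (c : rat) x y x' y', R x y -> R x' y' -> R (c *: x + x') (c *: y + y')) ->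
  exists f : {linear M -> N}, forall x, R x (f x).
Proof.
move=> hex hun hlin; have [f hf] := choice hex.
by exists (mk_linear (fun c x y => hun _ _ _ (hf _) (hlin c _ _ _ _ (hf x) (hf y)))).
Qed.

End LinearMaps.

Lemma projection (M : lmodType rat) (U W : set M) : subspace U -> subspace W ->
  (forall x, U x -> W x -> x = 0) -> (forall x, exists u w, [/\ U u, W w & x = u + w]) ->
  exists f : {linear M -> M}, forall x, U (f x) /\ W (x - f x).
Proof.
move=> hU hW h0 hs.
apply: (linear_of_rel (R := fun x y => U y /\ W (x - y))).
- by move=> x; have [u [w [hu hw ->]]] := hs x; exists u; rewrite addrAC subrr add0r.
- move=> x y y' [u w] [u' w']; apply/eqP; rewrite -subr_eq0; apply/eqP.
  apply: h0; first exact: ssB.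
  have -> : y - y' = (x - y') - (x - y) by zmod.
  exact: ssB.
- move=> c x y x' y' [u w] [u' w']; split; first exact: hU.2.
  have -> : c *: x + x' - (c *: y + y') = c *: (x - y) + (x' - y').
    by rewrite scalerBr opprD addrACA.
  exact: hW.2.
Qed.

(** A complement of the line through [a] inside [M / K] gives the functional.  Such
    functionals replace bases: they separate a vector from a subspace. *)
Lemma functional (M : lmodType rat) (K : set M) (a : M) : subspace K -> ~ K a ->
  exists f : {linear M -> rat^o}, (forall x, K x -> f x = 0) /\ f a = 1.
Proof.
move=> hK ha.
pose L := [set x | exists c k, K k /\ x = c *: a + k].
have hL : subspace L.
  split; first by exists 0, 0; rewrite scale0r addr0; split=> //; apply: ss0.
  move=> c _ _ [c1 [y1 [h1 ->]]] [c2 [y2 [h2 ->]]].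
  exists (c * c1 + c2), (c *: y1 + y2); split; first exact: hK.2.
  by rewrite scalerDl scalerDr scalerA !addrA; congr (_ + _); rewrite addrAC.
have [U [hU _ LU hs]] := complement hL (@subspaceT M) (@subsetT _ _).
have un c k u : K k -> U u -> c *: a + k + u = 0 -> c = 0.
  move=> hk hu e; have u0 : u = 0.
    apply: LU => //; exists (- c), (- k); split; first exact: ssN.
    by apply/eqP; rewrite scaleNr -opprD -addr_eq0 addrC e.
  move: e; rewrite u0 addr0 => e; apply/eqP; apply: contra_notT ha => c0.
  have -> : a = - c^-1 *: k.
    by apply: (scalerI c0); rewrite scalerA mulrN divff // scaleN1r;
       apply/eqP; rewrite -addr_eq0 e.
  exact: ssZ.
have [f hf] : exists f : {linear M -> rat^o}, forall x,
    exists k u, [/\ K k, U u & x = f x *: a + k + u].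
  apply: (linear_of_rel (R := fun x (c : rat^o) =>
    exists k u, [/\ K k, U u & x = c *: a + k + u])).
  - by move=> x; have [_ [u [[c [k [hk ->]]] hu ->]]] := hs x I; exists c, k, u.
  - move=> x c c' [k [u [hk hu ->]]] [k' [u' [hk' hu' e]]].
    apply/eqP; rewrite -subr_eq0; apply/eqP.
    apply: (un _ (k - k') (u - u')); [exact: ssB|exact: ssB|].
    move: e => /(congr1 (fun t => t - (c' *: a + k' + u'))); rewrite subrr => <-.
    by rewrite scalerBl; zmod.
  - move=> c x d x' d' [k [u [hk hu ->]]] [k' [u' [hk' hu' ->]]].
    exists (c *: k + k'), (c *: u + u'); split; [exact: hK.2|exact: hU.2|].
    by rewrite !scalerDr scalerDl scalerA; zmod.
exists f; split.
  move=> x hx; have [k [u [hk hu e]]] := hf x.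
  apply: (un _ (k - x) u) => //; first exact: ssB.
  by rewrite -[RHS](subrr x) [X in _ = X - _]e; zmod.
have [k [u [hk hu e]]] := hf a.
apply/eqP; rewrite -subr_eq0; apply/eqP; apply: (un _ k u) => //.
by rewrite scalerBl scale1r -[RHS](subrr a) [X in _ = X - _]e; zmod.
Qed.
Arguments gr_mul {s} [m n x y].
Arguments gr_comm {s} [m n x y].
Arguments gr_direct {s} [n f].
Arguments diff_mul {s} [n x y].
Arguments diff_deg {s} [n x].

(** * Homogeneous components and signs *)

Section Algebras.
Variable A : algType rat.
Implicit Types S G : set A.

Lemma signE n (x : A) : (-1) ^+ n * x = (-1) ^+ n *: x.
Proof. by rewrite -signr_odd -[in RHS]signr_odd; case: (odd n); rewrite ?mulN1r ?scaleN1r ?mul1r ?scale1r. Qed.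

Lemma subalg_gen_subalg G : subalgebra (subalg_gen G).
Proof.
split; first split.
- by move=> S [[/ss0]].
- move=> c x y hx hy S hS; have [[[_ h] _ _] _] := hS.
  by apply: h; [apply: hx|apply: hy].
- by move=> S [[]].
- move=> x y hx hy S hS; have [[_ _ h] _] := hS.
  by apply: h; [apply: hx|apply: hy].
Qed.

Lemma subalg_gen_sub G : G `<=` subalg_gen G. Proof. exact: sub_gen_smallest. Qed.

Lemma subalg_gen_min G S : subalgebra S -> G `<=` S -> subalg_gen G `<=` S.
Proof. exact: smallest_sub. Qed.

Lemma subalg_gen_mono G G' : G `<=` subalg_gen G' -> subalg_gen G `<=` subalg_gen G'.
Proof. by apply: subalg_gen_min; exact: subalg_gen_subalg. Qed.

(** Left multiplications suffice, since the [b] with [P (b * a)] for all [a] in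
    [P] form a subalgebra. *)
Lemma subalg_gen_ind G (P : set A) : subspace P -> P 1 ->
  (forall g a, G g -> P a -> P (g * a)) -> subalg_gen G `<=` P.
Proof.
move=> hP h1 hg x hx; rewrite -[x]mulr1.
suff : subalg_gen G `<=` [set b | forall a, P a -> P (b * a)] by move/(_ _ hx _ h1).
apply: subalg_gen_min; last by move=> g Gg a; apply: hg.
split.
- split; first by move=> a _; rewrite mul0r; apply: ss0.
  by move=> c u v hu hv a ha; rewrite mulrDl -scalerAl; apply: hP.2; [apply: hu|apply: hv].
- by move=> a; rewrite mul1r.
- by move=> u v hu hv a ha; rewrite -mulrA; apply/hu/hv.
Qed.

Lemma gen_ind G (P : set A) : (forall a, subalg_gen G a) -> subspace P -> P 1 ->
  (forall g a, G g -> P a -> P (g * a)) -> forall a, P a.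
Proof. by move=> hG hP h1 hg a; exact: (subalg_gen_ind hP h1 hg (hG a)). Qed.

Lemma gen_sub G (P : set A) : (forall a, subalg_gen G a) -> subalgebra P ->
  (forall g, G g -> P g) -> forall a, P a.
Proof. by move=> hG hP hg a; exact: (subalg_gen_min hP hg (hG a)). Qed.

Lemma subalg_prod S (I : Type) (r : seq I) (P : pred I) (F : I -> A) : subalgebra S ->
  (forall i, P i -> S (F i)) -> S (\prod_(i <- r | P i) F i).
Proof. by move=> [_ h1 hM] h; apply: big_ind. Qed.

Lemma subalgX S x n : subalgebra S -> S x -> S (x ^+ n).
Proof. by case=> [_ h1 hM] h; elim: n => [|n IH]; rewrite ?expr0 // exprS; apply: hM. Qed.

End Algebras.

Definition mk_lrmorphism (A B : algType rat) (f : A -> B)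
    (hl : forall (c : rat) x y, f (c *: x + y) = c *: f x + f y)
    (h1 : f 1 = 1) (hM : forall x y, f (x * y) = f x * f y) : {lrmorphism A -> B} :=
  HB.pack f (GRing.isLinear.Build rat A B *:%R f hl)
    (GRing.isMonoidMorphism.Build A B f (conj h1 hM)).

Section LRMorphisms.
Variables (A B : algType rat) (f : {lrmorphism A -> B}).
Lemma lrZ c x : f (c *: x) = c *: f x. Proof. exact: linearZ. Qed.
Lemma lrM x y : f (x * y) = f x * f y. Proof. exact: rmorphM. Qed.
Lemma lrD x y : f (x + y) = f x + f y. Proof. exact: linearD. Qed.
Lemma lrB x y : f (x - y) = f x - f y. Proof. exact: linearB. Qed.
Lemma lrN x : f (- x) = - f x. Proof. exact: linearN. Qed.
Lemma lr0 : f 0 = 0. Proof. exact: linear0. Qed.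
Lemma lr1 : f 1 = 1. Proof. exact: rmorph1. Qed.
Lemma lr_sum (I : Type) (r : seq I) (P : pred I) (F : I -> A) :
  f (\sum_(i <- r | P i) F i) = \sum_(i <- r | P i) f (F i).
Proof. exact: linear_sum. Qed.
Lemma lr_prod (I : Type) (r : seq I) (P : pred I) (F : I -> A) :
  f (\prod_(i <- r | P i) F i) = \prod_(i <- r | P i) f (F i).
Proof. exact: rmorph_prod. Qed.
Lemma lrX x n : f (x ^+ n) = f x ^+ n. Proof. exact: rmorphXn. Qed.
End LRMorphisms.

Lemma eq_subalgebra (A B : algType rat) (f g : {lrmorphism A -> B}) :
  subalgebra [set x | f x = g x].
Proof.
split=> /=; first exact: eq_subspace.
- by rewrite !rmorph1.
- by move=> x y hx hy; rewrite [LHS]rmorphM [RHS]rmorphM; congr (_ * _).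
Qed.

Lemma preim_subalgebra (A B : algType rat) (f : {lrmorphism A -> B}) S :
  subalgebra S -> subalgebra [set x | S (f x)].
Proof.
case=> h0 h1 hM; split=> /=; first exact: preim_subspace.
- by rewrite rmorph1.
- by move=> x y hx hy; rewrite rmorphM; apply: hM.
Qed.

Section Components.
Variable A : gcaType.
Implicit Types x y z : A.

Lemma cmp_ex x : exists f : nat -> A, (forall k, gr k (f k)) /\
  exists n, (forall k, (n <= k)%N -> f k = 0) /\ x = \sum_(k < n) f k.
Proof.
have [n [f [h ->]]] := gr_decomp x.
exists (fun k => if (k < n)%N then f k else 0); split.
  by move=> k; case: ifP => // _; apply: ss0; exact: gr_subspace.
exists n; split; first by move=> k; rewrite ltnNge => ->.
by apply: eq_bigr => i _; rewrite ltn_ord.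
Qed.

Definition cmp x : nat -> A := sval (cid (cmp_ex x)).

Lemma cmp_gr x k : gr k (cmp x k).
Proof. by rewrite /cmp; case: cid => f []. Qed.

Lemma cmp_bound x : exists n, forall k, (n <= k)%N -> cmp x k = 0.
Proof. by rewrite /cmp; case: cid => f [_ [n []]] /=; exists n. Qed.

Lemma cmp_sum_bound x N : (forall k, (N <= k)%N -> cmp x k = 0) -> x = \sum_(k < N) cmp x k.
Proof.
have [n [h1 h2]] : exists n, (forall k, (n <= k)%N -> cmp x k = 0) /\ x = \sum_(k < n) cmp x k.
  by rewrite /cmp; case: cid => f [_ [n []]] /=; exists n.
move=> hN; rewrite {1}h2.
have pad m : (m <= maxn n N)%N -> (forall k, (m <= k)%N -> cmp x k = 0) ->
    \sum_(k < m) cmp x k = \sum_(k < maxn n N) cmp x k.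
  move=> hm h; rewrite -!(big_mkord xpredT (cmp x)) (big_cat_nat _ hm) //= [X in _ = _ + X]big1_seq ?addr0 //.
  by move=> i /andP[_]; rewrite mem_index_iota => /andP[/h].
by rewrite (pad n (leq_maxl _ _) h1) (pad N (leq_maxr _ _) hN).
Qed.

Lemma cmp_sum x : exists n, x = \sum_(k < n) cmp x k.
Proof. by have [n /cmp_sum_bound h] := cmp_bound x; exists n. Qed.

Lemma cmp_uniq n (f : nat -> A) k : (forall k, gr k (f k)) ->
  cmp (\sum_(k < n) f k) k = if (k < n)%N then f k else 0.
Proof.
move=> hf; set x := \sum_(_ < _) _.
have [m hm] := cmp_bound x.
pose g j := (if (j < n)%N then f j else 0) - cmp x j.
have gg j : gr j (g j).
  apply: ssB; [exact: gr_subspace| |exact: cmp_gr].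
  by case: ifP => // _; apply: ss0; exact: gr_subspace.
have s0 N : (n <= N)%N -> (m <= N)%N -> \sum_(j < N) g j = 0.
  move=> nN mN; rewrite sumrB -(@cmp_sum_bound x N); last first.
    by move=> j hj; apply: hm; apply: leq_trans hj.
  apply/eqP; rewrite subr_eq0; apply/eqP.
  by rewrite -big_mkcond -(big_ord_widen N f nN).
pose N := maxn (maxn n m) k.+1.
have [nN [mN kN]] : (n <= N /\ (m <= N /\ k < N))%N by rewrite !leq_max !leqnn !orbT.
by have /eqP := gr_direct gg (s0 N nN mN) k kN; rewrite subr_eq0 => /eqP.
Qed.

Lemma cmp_hom n x k : gr n x -> cmp x k = if k == n then x else 0.
Proof.
move=> hx; pose f j := if j == n then x else 0.
have hf j : gr j (f j).
  by rewrite /f; case: eqP => [->//|_]; apply: ss0; exact: gr_subspace.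
have e : x = \sum_(j < n.+1) f j.
  rewrite big_ord_recr /= {2}/f eqxx big1 ?add0r // => i _.
  by rewrite /f ltn_eqF.
rewrite {1}e cmp_uniq // /f; case: (k =P n) => [->|_]; first by rewrite ltnSn.
by case: ifP.
Qed.

Lemma cmp_linear k (c : rat) x y : cmp (c *: x + y) k = c *: cmp x k + cmp y k.
Proof.
have [n hn] := cmp_bound x; have [m hm] := cmp_bound y.
pose N := maxn (maxn n m) k.+1.
have ex : x = \sum_(j < N) cmp x j.
  by apply: cmp_sum_bound => j; rewrite !geq_max => /andP[/andP[/hn]].
have ey : y = \sum_(j < N) cmp y j.
  by apply: cmp_sum_bound => j; rewrite !geq_max => /andP[/andP[_ /hm]].
rewrite {1}ex {1}ey scaler_sumr -big_split /=.
rewrite (@cmp_uniq N (fun j => c *: cmp x j + cmp y j)); last first.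
  by move=> j; apply: (gr_subspace j).2; exact: cmp_gr.
by rewrite leq_max leqnn orbT.
Qed.

Definition cmpL k : {linear A -> A} := mk_linear (cmp_linear k).
Lemma cmpLE k x : cmpL k x = cmp x k. Proof. by []. Qed.

Lemma cmp_inj x y : (forall k, cmp x k = cmp y k) -> x = y.
Proof.
move=> h; have [n hn] := cmp_bound x.
rewrite (cmp_sum_bound hn) (@cmp_sum_bound y n); first by apply: eq_bigr => i _; rewrite h.
by move=> k /hn; rewrite h.
Qed.

Lemma cmp0 k : cmp 0 k = 0. Proof. by rewrite -cmpLE linear0. Qed.
Lemma cmpB x y k : cmp (x - y) k = cmp x k - cmp y k. Proof. by rewrite -!cmpLE linearB. Qed.
Lemma cmpD x y k : cmp (x + y) k = cmp x k + cmp y k. Proof. by rewrite -!cmpLE linearD. Qed.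
Lemma cmpZ c x k : cmp (c *: x) k = c *: cmp x k. Proof. by rewrite -!cmpLE linearZ. Qed.

Lemma gr_cmp n x : gr n x -> cmp x n = x.
Proof. by move=> hx; rewrite (cmp_hom _ hx) eqxx. Qed.

Lemma gr_eq0 m n x : gr m x -> gr n x -> m != n -> x = 0.
Proof. by move=> hm hn /negbTE e; rewrite -(gr_cmp hm) (cmp_hom _ hn) e. Qed.

Lemma hom_ind (P : set A) : subspace P -> (forall n x, gr n x -> P x) -> forall x, P x.
Proof. by move=> hP h x; have [n ->] := cmp_sum x; apply: ss_sum => // i _; apply: h (cmp_gr _ _). Qed.

Lemma cmpMl m x y k : gr m x -> cmp (x * y) k = if (m <= k)%N then x * cmp y (k - m) else 0.
Proof.
move=> hx; move: y; apply: hom_ind.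
  split; first by rewrite mulr0 !cmp0 mulr0 if_same.
  move=> c y z hy hz; rewrite /= mulrDr -scalerAr cmp_linear hy hz.
  by case: ifP; rewrite ?scaler0 ?addr0 // cmp_linear mulrDr -scalerAr.
move=> n y hy; rewrite (cmp_hom _ (gr_mul hx hy)) (cmp_hom _ hy).
case: leqP => h; last by rewrite ltn_eqF // ltn_addr.
by rewrite -(eqn_add2l m (k - m)) subnKC //; case: eqP; rewrite ?mulr0.
Qed.


Lemma diagop_ex (c : nat -> rat) : exists f : {linear A -> A},
  forall x k, cmp (f x) k = c k *: cmp x k.
Proof.
apply: (linear_of_rel (R := fun x y => forall k, cmp y k = c k *: cmp x k)).
- move=> x; have [n hn] := cmp_bound x; exists (\sum_(k < n) c k *: cmp x k) => k.
  rewrite (@cmp_uniq n (fun k => c k *: cmp x k)); last first.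
    by move=> j; apply: ssZ (cmp_gr _ _); exact: gr_subspace.
  by case: ltnP => // /hn ->; rewrite scaler0.
- by move=> x y y' h h'; apply: cmp_inj => k; rewrite h h'.
- move=> a x y x' y' h h' k.
  by rewrite !cmp_linear h h' scalerDr !scalerA [a * _]mulrC.
Qed.

Definition diagop c : {linear A -> A} := sval (cid (diagop_ex c)).

Lemma diagopE c n x : gr n x -> diagop c x = c n *: x.
Proof.
move=> hx; rewrite /diagop; case: cid => f /= hf; apply: cmp_inj => k.
rewrite hf cmpZ (cmp_hom _ hx); case: eqP => [->//|_]; by rewrite !scaler0.
Qed.

(** The grading involution [sg] states sign rules for elements that need not be
    homogeneous; [evp] and [odp] are the even and the odd part. *)
Definition sg : {linear A -> A} := diagop (fun n => (-1) ^+ n).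
Definition evp : {linear A -> A} := diagop (fun n => (~~ odd n)%:R).
Definition odp : {linear A -> A} := diagop (fun n => (odd n)%:R).
Definition sgp (b : bool) x := if b then sg x else x.

Lemma sgE n x : gr n x -> sg x = (-1) ^+ n *: x. Proof. exact: diagopE. Qed.
Lemma evpE n x : gr n x -> evp x = if odd n then 0 else x.
Proof. by move/diagopE ->; case: odd; rewrite ?scale0r ?scale1r. Qed.
Lemma odpE n x : gr n x -> odp x = if odd n then x else 0.
Proof. by move/diagopE ->; case: odd; rewrite ?scale0r ?scale1r. Qed.

Lemma sgpE b n x : gr n x -> sgp b x = (-1) ^+ (b * n) *: x.
Proof. by move=> hx; rewrite /sgp; case: b; rewrite ?mul1n ?(sgE hx) // mul0n scale1r. Qed.

Lemma sg_gr n x : gr n x -> gr n (sg x).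
Proof. by move=> hx; rewrite (sgE hx); apply: ssZ hx; exact: gr_subspace. Qed.

Lemma sgp_linear b (c : rat) x y : sgp b (c *: x + y) = c *: sgp b x + sgp b y.
Proof. by case: b; rewrite //= linearP. Qed.

Lemma hom_eq (M : lmodType rat) (f g : {linear A -> M}) :
  (forall n x, gr n x -> f x = g x) -> f =1 g.
Proof. by move=> h; apply: hom_ind; [exact: eq_subspace|exact: h]. Qed.

Lemma sgK x : sg (sg x) = x.
Proof.
apply: (hom_eq (f := sg \o sg) (g := idfun)) => n y hy /=.
by rewrite (sgE (sg_gr hy)) (sgE hy) scalerA -expr2 sqrr_sign scale1r.
Qed.

Lemma sg1 : sg 1 = 1. Proof. by rewrite (sgE (gr_one)) expr0 scale1r. Qed.

Lemma sgM x y : sg (x * y) = sg x * sg y.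
Proof.
move: x; apply: hom_ind.
  split; first by rewrite /= mul0r linear0 mul0r.
  by move=> c x z hx hz; rewrite /= mulrDl -scalerAl !linearP hx hz mulrDl -scalerAl.
move=> n x hx; move: y; apply: hom_ind.
  split; first by rewrite /= mulr0 linear0 mulr0.
  by move=> c y z hy hz; rewrite /= mulrDr -scalerAr !linearP hy hz mulrDr -scalerAr.
move=> m y hy.
by rewrite (sgE hx) (sgE hy) (sgE (gr_mul hx hy)) -scalerAl -scalerAr scalerA -exprD.
Qed.

Lemma grC n x y : gr n x -> y * x = x * sgp (odd n) y.
Proof.
move=> hx; move: y; apply: hom_ind.
  split; first by rewrite /= mul0r; case: odd => /=; rewrite ?linear0 mulr0.
  by move=> c y z hy hz; rewrite /= sgp_linear mulrDl mulrDr -scalerAl -scalerAr hy hz.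
move=> m y hy; rewrite (gr_comm hy hx) signE (sgpE _ hy) -scalerAr; congr (_ *: _).
by rewrite -signr_odd oddM andbC -[RHS]signr_odd oddM; case: odd.
Qed.

Lemma grC' n x y : gr n x -> x * y = sgp (odd n) y * x.
Proof. by move=> hx; rewrite (grC _ hx); congr (_ * _); case: odd => //=; rewrite sgK. Qed.

Lemma gr_evenC n x y : gr n x -> ~~ odd n -> x * y = y * x.
Proof. by move=> hx /negbTE h; rewrite (grC _ hx) h. Qed.

Lemma gr_odd_sqr n x : gr n x -> odd n -> x * x = 0.
Proof.
move=> hx h; have := gr_comm hx hx; rewrite signE -signr_odd oddM h /= expr1 scaleN1r.
move/eqP; rewrite -addr_eq0 -mulr2n -scaler_nat scaler_eq0 => /orP[|/eqP //].
by rewrite pnatr_eq0.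
Qed.

Lemma grX n x k : gr n x -> gr (n * k) (x ^+ k).
Proof.
by move=> hx; elim: k => [|k IH]; rewrite ?expr0 ?muln0 ?exprS ?mulnS; [exact: gr_one|exact: gr_mul].
Qed.

Lemma evp_odp x : x = evp x + odp x.
Proof.
apply: (hom_eq (f := idfun) (g := evp \+ odp)) => n y hy /=.
by rewrite (evpE hy) (odpE hy); case: odd; rewrite ?add0r ?addr0.
Qed.

End Components.

Arguments sg {A}.
Arguments evp {A}.
Arguments odp {A}.
Arguments cmpL {A}.

Section Morphisms.
Variables A B : gcaType.
Variable f : {lrmorphism A -> B}.
Hypothesis hf : graded_mor f.

Lemma cmp_mor x k : f (cmp x k) = cmp (f x) k.
Proof.
apply: (hom_eq (f := f \o cmpL k) (g := cmpL k \o f)) => n y hy /=.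
by rewrite ?cmpLE (cmp_hom _ hy) (cmp_hom _ (hf hy)); case: eqP => _; rewrite ?linear0.
Qed.

Lemma sg_mor x : f (sg x) = sg (f x).
Proof.
apply: (hom_eq (f := f \o sg) (g := sg \o f)) => n y hy /=.
by rewrite (sgE hy) (sgE (hf hy)) linearZ.
Qed.
End Morphisms.

Section Differentials.
Variable A : cdgaType.
Implicit Types x y : A.

Definition dL : {linear A -> A} := mk_linear (@diff_linear A).
Lemma dLE x : dL x = diff x. Proof. by []. Qed.
Lemma d0 : diff (0 : A) = 0. Proof. by rewrite -dLE linear0. Qed.
Lemma dB x y : diff (x - y) = diff x - diff y. Proof. by rewrite -!dLE linearB. Qed.
Lemma dD x y : diff (x + y) = diff x + diff y. Proof. by rewrite -!dLE linearD. Qed.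
Lemma dN x : diff (- x) = - diff x. Proof. by rewrite -!dLE linearN. Qed.
Lemma dZ c x : diff (c *: x) = c *: diff x. Proof. by rewrite -!dLE linearZ. Qed.
Lemma d_sum (I : Type) (r : seq I) (P : pred I) (F : I -> A) :
  diff (\sum_(i <- r | P i) F i) = \sum_(i <- r | P i) diff (F i).
Proof. by rewrite -dLE linear_sum. Qed.

Lemma dM x y : diff (x * y) = diff x * y + sg x * diff y.
Proof.
move: x; apply: hom_ind.
  split; first by rewrite /= mul0r d0 linear0 !mul0r addr0.
  move=> c x z hx hz; rewrite /= linearP mulrDl -scalerAl !diff_linear hx hz.
  by rewrite !mulrDl -!scalerAl scalerDr; zmod.
by move=> n x hx; rewrite (diff_mul hx) (sgE hx) signE scalerAl.
Qed.

Lemma d1 : diff (1 : A) = 0.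
Proof.
by have /eqP := dM 1 1; rewrite sg1 !mul1r mulr1 -subr_eq0 opprD addrA subrr add0r oppr_eq0 => /eqP.
Qed.

Lemma d_sg x : diff (sg x) = - sg (diff x).
Proof.
apply: (hom_eq (f := dL \o sg) (g := -%R \o (sg \o dL))) => n y hy /=.
by rewrite ?dLE (sgE hy) (sgE (diff_deg hy)) dZ exprS mulN1r scaleNr opprK.
Qed.

Lemma sg_d x : sg (diff x) = - diff (sg x). Proof. by rewrite d_sg opprK. Qed.

Lemma cmp_d x k : cmp (diff x) k.+1 = diff (cmp x k).
Proof.
apply: (hom_eq (f := cmpL k.+1 \o dL) (g := dL \o cmpL k)) => n y hy /=.
by rewrite ?cmpLE ?dLE (cmp_hom _ hy) (cmp_hom _ (diff_deg hy)) eqSS; case: eqP; rewrite ?d0.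
Qed.

Lemma cmp_d0 x : cmp (diff x) 0 = 0.
Proof.
apply: (hom_eq (f := cmpL 0 \o dL) (g := \0)) => n y hy /=.
by rewrite ?cmpLE ?dLE (cmp_hom _ (diff_deg hy)).
Qed.

Definition cocycle : set A := [set x | diff x = 0].
Definition coboundary : set A := [set x | exists y, x = diff y].

Lemma cocycle_subalg : subalgebra cocycle.
Proof.
split; [split; first exact: d0|exact: d1|].
  by move=> c x y hx hy; rewrite /cocycle /= diff_linear hx hy scaler0 addr0.
by move=> x y hx hy; rewrite /cocycle /= dM hx hy mul0r mulr0 addr0.
Qed.

Lemma cob_subspace : subspace coboundary.
Proof.
split; first by exists 0; rewrite d0.
by move=> c _ _ [x ->] [y ->]; exists (c *: x + y); rewrite diff_linear.
Qed.

Lemma cob_cocycle x : coboundary x -> diff x = 0.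
Proof. by case=> y ->; rewrite diff_diff. Qed.


Lemma cobMl x y : diff x = 0 -> coboundary y -> coboundary (x * y).
Proof.
move=> hx [z ->]; exists (sg x * z).
by rewrite dM sgK d_sg hx linear0 oppr0 mul0r add0r.
Qed.

Lemma cocycle_cmp x k : diff x = 0 -> diff (cmp x k) = 0.
Proof. by move=> h; rewrite -cmp_d h cmp0. Qed.

Lemma cob_cmp x k : coboundary x -> coboundary (cmp x k).
Proof.
case=> y ->; case: k => [|k]; last by exists (cmp y k); rewrite cmp_d.
by rewrite cmp_d0; apply: ss0; exact: cob_subspace.
Qed.

Lemma cob_hom n x : gr n.+1 x -> coboundary x -> exists2 y, gr n y & x = diff y.
Proof.
move=> hx [y e]; exists (cmp y n); first exact: cmp_gr.
by rewrite -cmp_d -e gr_cmp.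
Qed.

End Differentials.

Arguments dL {A}.
(** * Algebras given by representatives *)

(** An algebra may be described by representatives, with operations that
    satisfy the laws only up to an equivalence relation.  Quotients of
    algebras, tensor products and sequential colimits all arise in this way. *)
Record presentation := Presentation {
  rT : Type;
  req : rT -> rT -> Prop;
  r0 : rT;
  r1 : rT;
  radd : rT -> rT -> rT;
  rscale : rat -> rT -> rT;
  rmul : rT -> rT -> rT;
  req_refl : forall x, req x x;
  req_sym : forall x y, req x y -> req y x;
  req_trans : forall x y z, req x y -> req y z -> req x z;
  raddP : forall x x' y y', req x x' -> req y y' -> req (radd x y) (radd x' y');
  rscaleP : forall c x x', req x x' -> req (rscale c x) (rscale c x');
  rmulP : forall x x' y y', req x x' -> req y y' -> req (rmul x y) (rmul x' y');
  raddA : forall x y z, req (radd x (radd y z)) (radd (radd x y) z);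
  raddC : forall x y, req (radd x y) (radd y x);
  radd0 : forall x, req (radd r0 x) x;
  rscale0 : forall x, req (rscale 0 x) r0;
  rscale1 : forall x, req (rscale 1 x) x;
  rscaleA : forall c d x, req (rscale c (rscale d x)) (rscale (c * d) x);
  rscaleDr : forall c x y, req (rscale c (radd x y)) (radd (rscale c x) (rscale c y));
  rscaleDl : forall c d x, req (rscale (c + d) x) (radd (rscale c x) (rscale d x));
  rmulA : forall x y z, req (rmul x (rmul y z)) (rmul (rmul x y) z);
  rmul1l : forall x, req (rmul r1 x) x;
  rmul1r : forall x, req (rmul x r1) x;
  rmulDl : forall x y z, req (rmul (radd x y) z) (radd (rmul x z) (rmul y z));
  rmulDr : forall x y z, req (rmul x (radd y z)) (radd (rmul x y) (rmul x z));
  rscaleAl : forall c x y, req (rscale c (rmul x y)) (rmul (rscale c x) y);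
  rscaleAr : forall c x y, req (rscale c (rmul x y)) (rmul x (rscale c y));
  r1neq0 : ~ req r1 r0
}.

Section Presented.
Variable R : presentation.

Definition presented := {c : set (rT R) | exists x, c = req x}.
HB.instance Definition _ := gen_eqMixin presented.
HB.instance Definition _ := gen_choiceMixin presented.

Definition rcls (x : rT R) : presented := exist _ (req x) (ex_intro _ x erefl).

Lemma rclsP x y : rcls x = rcls y <-> req x y.
Proof.
split=> [[e]|h]; first by rewrite e; exact: req_refl.
apply: eq_exist; apply/seteqP; split=> z hz; last exact: req_trans h hz.
exact: req_trans (req_sym h) hz.
Qed.

Lemma rcls_surj (u : presented) : exists x, rcls x = u.
Proof. by case: u => c [x e]; exists x; apply: eq_exist. Qed.

Definition rrep u := sval (cid (rcls_surj u)).
Lemma rrepK u : rcls (rrep u) = u. Proof. exact: (svalP (cid (rcls_surj u))). Qed.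
Lemma rrepP x : req (rrep (rcls x)) x. Proof. by apply/rclsP; exact: rrepK. Qed.

Definition padd u v := rcls (radd (rrep u) (rrep v)).
Definition pscale c u := rcls (rscale c (rrep u)).
Definition pmul u v := rcls (rmul (rrep u) (rrep v)).
Definition popp u := pscale (-1) u.

Lemma paddE x y : padd (rcls x) (rcls y) = rcls (radd x y).
Proof. by apply/rclsP; apply: raddP; exact: rrepP. Qed.
Lemma pscaleE c x : pscale c (rcls x) = rcls (rscale c x).
Proof. by apply/rclsP; apply: rscaleP; exact: rrepP. Qed.
Lemma pmulE x y : pmul (rcls x) (rcls y) = rcls (rmul x y).
Proof. by apply/rclsP; apply: rmulP; exact: rrepP. Qed.

Local Ltac rep u := case: (rcls_surj u) => ? <-.

Lemma paddA : associative padd.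
Proof. by move=> u v w; rep u; rep v; rep w; rewrite !paddE; apply/rclsP; exact: raddA. Qed.
Lemma paddC : commutative padd.
Proof. by move=> u v; rep u; rep v; rewrite !paddE; apply/rclsP; exact: raddC. Qed.
Lemma padd0 : left_id (rcls (r0 R)) padd.
Proof. by move=> u; rep u; rewrite !paddE; apply/rclsP; exact: radd0. Qed.
Lemma paddN : left_inverse (rcls (r0 R)) popp padd.
Proof.
move=> u; case: (rcls_surj u) => x <-; rewrite /popp pscaleE paddE; apply/rclsP.
apply: req_trans (rscale0 x).
apply: req_trans (raddP (req_refl _) (req_sym (rscale1 x))) _.
by apply: req_trans (req_sym (rscaleDl _ _ _)) _; rewrite addNr; exact: req_refl.
Qed.

HB.instance Definition _ := GRing.isZmodule.Build presented paddA paddC padd0 paddN.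

Lemma pscaleA c d u : pscale c (pscale d u) = pscale (c * d) u.
Proof. by rep u; rewrite !pscaleE; apply/rclsP; exact: rscaleA. Qed.
Lemma pscale1 : left_id 1 pscale.
Proof. by move=> u; rep u; rewrite !pscaleE; apply/rclsP; exact: rscale1. Qed.
Lemma pscaleDr : right_distributive pscale +%R.
Proof. by move=> c u v; change (pscale c (padd u v) = padd (pscale c u) (pscale c v)); rep u; rep v; rewrite paddE !pscaleE paddE; apply/rclsP; exact: rscaleDr. Qed.
Lemma pscaleDl u : {morph pscale^~ u : c d / c + d}.
Proof. by move=> c d; change (pscale (c + d) u = padd (pscale c u) (pscale d u)); rep u; rewrite !pscaleE !paddE; apply/rclsP; exact: rscaleDl. Qed.

HB.instance Definition _ :=
  GRing.Zmodule_isLmodule.Build rat presented pscaleA pscale1 pscaleDr pscaleDl.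

Lemma pmulA : associative pmul.
Proof. by move=> u v w; rep u; rep v; rep w; rewrite !pmulE; apply/rclsP; exact: rmulA. Qed.
Lemma pmul1l : left_id (rcls (r1 R)) pmul.
Proof. by move=> u; rep u; rewrite !pmulE; apply/rclsP; exact: rmul1l. Qed.
Lemma pmul1r : right_id (rcls (r1 R)) pmul.
Proof. by move=> u; rep u; rewrite !pmulE; apply/rclsP; exact: rmul1r. Qed.
Lemma pmulDl : left_distributive pmul +%R.
Proof. by move=> u v w; change (pmul (padd u v) w = padd (pmul u w) (pmul v w)); rep u; rep v; rep w; rewrite paddE !pmulE paddE; apply/rclsP; exact: rmulDl. Qed.
Lemma pmulDr : right_distributive pmul +%R.
Proof. by move=> u v w; change (pmul u (padd v w) = padd (pmul u v) (pmul u w)); rep u; rep v; rep w; rewrite paddE !pmulE paddE; apply/rclsP; exact: rmulDr. Qed.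
Lemma p1neq0 : rcls (r1 R) != 0.
Proof. by apply/eqP => /rclsP; exact: r1neq0. Qed.

HB.instance Definition _ :=
  GRing.Zmodule_isNzRing.Build presented pmulA pmul1l pmul1r pmulDl pmulDr p1neq0.

Lemma pscaleAl c (u v : presented) : c *: (u * v) = (c *: u) * v.
Proof. by change (pscale c (pmul u v) = pmul (pscale c u) v); rep u; rep v; rewrite pmulE !pscaleE pmulE; apply/rclsP; exact: rscaleAl. Qed.
Lemma pscaleAr c (u v : presented) : c *: (u * v) = u * (c *: v).
Proof. by change (pscale c (pmul u v) = pmul u (pscale c v)); rep u; rep v; rewrite pmulE !pscaleE pmulE; apply/rclsP; exact: rscaleAr. Qed.

HB.instance Definition _ := GRing.Lmodule_isLalgebra.Build rat presented pscaleAl.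
HB.instance Definition _ := GRing.Lalgebra_isAlgebra.Build rat presented pscaleAr.

Lemma rclsD x y : rcls (radd x y) = rcls x + rcls y. Proof. by rewrite -paddE. Qed.
Lemma rclsZ c x : rcls (rscale c x) = c *: rcls x. Proof. by rewrite -pscaleE. Qed.
Lemma rclsM x y : rcls (rmul x y) = rcls x * rcls y. Proof. by rewrite -pmulE. Qed.

End Presented.

(** The Leibniz rule and graded commutativity are stated with scalar signs, which
    do not refer to the product. *)
Record dga_on (A : algType rat) := DgaOn {
  ogr : nat -> set A;
  odiff : A -> A;
  ogr_subspace : forall n, subspace (ogr n);
  ogr_decomp : forall x : A, exists (n : nat) (f : nat -> A),
    (forall k, ogr k (f k)) /\ x = \sum_(k < n) f k;
  ogr_direct : forall (n : nat) (f : nat -> A), (forall k, ogr k (f k)) ->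
    \sum_(k < n) f k = 0 -> forall k, (k < n)%N -> f k = 0;
  ogr_one : ogr 0%N 1;
  ogr_mul : forall m n (x y : A), ogr m x -> ogr n y -> ogr (m + n)%N (x * y);
  ogr_comm : forall m n (x y : A), ogr m x -> ogr n y ->
    x * y = (-1) ^+ (m * n) *: (y * x);
  odiff_linear : forall (c : rat) x y, odiff (c *: x + y) = c *: odiff x + odiff y;
  odiff_deg : forall n x, ogr n x -> ogr n.+1 (odiff x);
  odiff_diff : forall x, odiff (odiff x) = 0;
  odiff_mul : forall n x y, ogr n x ->
    odiff (x * y) = odiff x * y + (-1) ^+ n *: (x * odiff y)
}.

Definition dgaT (A : algType rat) (D : dga_on A) : Type := A.

Section MkCdga.
Variables (A : algType rat) (D : dga_on A).
HB.instance Definition _ := GRing.Algebra.copy (dgaT D) A.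

Lemma dgaT_comm m n (x y : dgaT D) : ogr D m x -> ogr D n y ->
  x * y = (-1) ^+ (m * n) * (y * x).
Proof. by move=> hx hy; rewrite signE; exact: (ogr_comm hx hy). Qed.

HB.instance Definition _ := isGradedComm.Build (dgaT D)
  (ogr_subspace D) (@ogr_decomp _ D) (@ogr_direct _ D) (ogr_one D) (@ogr_mul _ D) dgaT_comm.

Lemma dgaT_mul n (x y : dgaT D) : gr n x ->
  odiff D (x * y) = odiff D x * y + (-1) ^+ n * (x * odiff D y).
Proof. by move=> hx; rewrite signE; exact: (odiff_mul _ hx). Qed.

HB.instance Definition _ := isCdga.Build (dgaT D)
  (@odiff_linear _ D) (@odiff_deg _ D) (@odiff_diff _ D) dgaT_mul.
End MkCdga.

Definition mk_cdga (A : algType rat) (D : dga_on A) : cdgaType := dgaT D.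
(** * Quotients, subalgebras and sequential colimits *)

Definition ideal (A : algType rat) (I : set A) :=
  [/\ subspace I, forall a x, I x -> I (a * x) & forall a x, I x -> I (x * a)].

Definition homogeneous (A : gcaType) (I : set A) := forall x k, I x -> I (cmp x k).

Definition diff_stable (A : cdgaType) (I : set A) := forall x, I x -> I (diff x).

Section Quotient.
Variables (T : cdgaType) (I : set T).
Hypotheses (hI : ideal I) (hI1 : ~ I 1).

Let hS : subspace I. Proof. by case: hI. Qed.
Let hl a x : I x -> I (a * x). Proof. by case: hI => _ + _; apply. Qed.
Let hr a x : I x -> I (x * a). Proof. by case: hI => _ _; apply. Qed.

Let eqI (x y : T) : x = y -> I (x - y).
Proof. by move=> ->; rewrite subrr; exact: ss0. Qed.

Definition quot_presentation : presentation.
Proof.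
apply: (@Presentation T (fun x y => I (x - y)) 0 1 +%R *:%R *%R).
- by move=> x; apply: eqI.
- by move=> x y h; rewrite -opprB; apply: ssN.
- move=> x y z h1 h2; have -> : x - z = (x - y) + (y - z) by zmod.
  exact: ssD.
- move=> x x' y y' h1 h2; have -> : x + y - (x' + y') = (x - x') + (y - y') by zmod.
  exact: ssD.
- by move=> c x x' h; rewrite -scalerBr; apply: ssZ.
- move=> x x' y y' h1 h2; have -> : x * y - x' * y' = x * (y - y') + (x - x') * y'.
    by rewrite mulrBl mulrBr; zmod.
  by apply: ssD => //; [apply: hl|apply: hr].
- by move=> x y z; apply: eqI; rewrite addrA.
- by move=> x y; apply: eqI; rewrite addrC.
- by move=> x; apply: eqI; rewrite add0r.
- by move=> x; apply: eqI; rewrite scale0r.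
- by move=> x; apply: eqI; rewrite scale1r.
- by move=> c d x; apply: eqI; rewrite scalerA.
- by move=> c x y; apply: eqI; rewrite scalerDr.
- by move=> c d x; apply: eqI; rewrite scalerDl.
- by move=> x y z; apply: eqI; rewrite mulrA.
- by move=> x; apply: eqI; rewrite mul1r.
- by move=> x; apply: eqI; rewrite mulr1.
- by move=> x y z; apply: eqI; rewrite mulrDl.
- by move=> x y z; apply: eqI; rewrite mulrDr.
- by move=> c x y; apply: eqI; rewrite scalerAl.
- by move=> c x y; apply: eqI; rewrite scalerAr.
- by rewrite subr0.
Defined.

Let Q : algType rat := presented quot_presentation.
Let pi (x : T) : Q := @rcls quot_presentation x.

Let piP x y : pi x = pi y <-> I (x - y). Proof. exact: rclsP. Qed.
Let pi_linear (c : rat) x y : pi (c *: x + y) = c *: pi x + pi y.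
Proof. by rewrite -rclsZ -rclsD. Qed.
Let pi_mul x y : pi (x * y) = pi x * pi y. Proof. by rewrite -rclsM. Qed.
Let piM : {lrmorphism T -> Q} := mk_lrmorphism pi_linear erefl pi_mul.
Let piMM x y : piM (x * y) = piM x * piM y. Proof. exact: rmorphM. Qed.
Let piD x y : piM (x + y) = piM x + piM y. Proof. exact: linearD. Qed.
Let piZ c x : piM (c *: x) = c *: piM x. Proof. exact: linearZ. Qed.
Let pi_surj (u : Q) : exists x, piM x = u. Proof. exact: (rcls_surj u). Qed.
Let pi0 x : piM x = 0 <-> I x.
Proof. by rewrite -[I x]/(I x) -{2}[x]subr0; exact: piP. Qed.

Hypotheses (hIh : homogeneous I) (hId : diff_stable I).

Let qgr n : set Q := piM @` gr n.
Let qdiff (u : Q) : Q := piM (diff (sval (cid (pi_surj u)))).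

Let qdiffE x : qdiff (piM x) = piM (diff x).
Proof.
rewrite /qdiff; case: cid => y /= e; apply: ((piP _ _).2); rewrite -dB.
by apply: hId; exact: ((piP _ _).1 e).
Qed.

Definition quot_dga : dga_on Q.
Proof.
apply: (@DgaOn Q qgr qdiff).
- by move=> n; apply: image_subspace; exact: gr_subspace.
- move=> u; have [x <-] := pi_surj u; have [n [f [h ->]]] := gr_decomp x.
  exists n, (fun k => piM (f k)); split; first by move=> k; exists (f k).
  exact: (linear_sum piM).
- move=> n f hf h k hk.
  have /choice[g hg] : forall k, exists x, gr k x /\ piM x = f k.
    by move=> i; have [x hx e] := hf i; exists x.
  have [_ <-] := hg k; apply/pi0.
  have <- : cmp (\sum_(i < n) g i) k = g k.
    by rewrite (@cmp_uniq _ n g) ?hk // => j; case: (hg j).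
  apply: hIh; apply/pi0; rewrite linear_sum -[RHS]h; apply: eq_bigr => i _.
  by case: (hg i).
- by exists 1; [exact: gr_one|rewrite rmorph1].
- by move=> m n _ _ [x hx <-] [y hy <-]; exists (x * y); [exact: gr_mul|rewrite piMM].
- move=> m n _ _ [x hx <-] [y hy <-].
  by rewrite -!piMM (gr_comm hx hy) signE piZ.
- move=> c u v; have [x <-] := pi_surj u; have [y <-] := pi_surj v.
  by rewrite -piZ -piD !qdiffE diff_linear piD piZ.
- by move=> n _ [x hx <-]; rewrite qdiffE; exists (diff x) => //; exact: diff_deg.
- by move=> u; have [x <-] := pi_surj u; rewrite !qdiffE diff_diff linear0.
- move=> n u v [x hx <-]; have [y <-] := pi_surj v.
  by rewrite -piMM !qdiffE (diff_mul hx) signE piD piZ !piMM.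
Defined.

(** Two elements represent the same class when their difference lies in [I]; the
    components are well defined because [I] is homogeneous. *)
Lemma quotient_cdga :
  exists (B : cdgaType) (rho : {lrmorphism T -> B}), is_projection rho I.
Proof.
exists (mk_cdga quot_dga), piM; split.
- split; first by move=> n x hx; exists x.
  by move=> x; rewrite -[RHS]/(qdiff (piM x)) qdiffE.
- exact: pi_surj.
- by apply/seteqP; split=> x /= /pi0.
Qed.

End Quotient.

Section Subalgebra.
Variables (A : gcaType) (S : set A).
Hypotheses (hS : subalgebra S) (hSh : homogeneous S).

Let h0 : subspace S. Proof. by case: hS. Qed.
Let h1 : S 1. Proof. by case: hS. Qed.
Let hM x y : S x -> S y -> S (x * y). Proof. by case: hS => _ _; apply. Qed.
Let X := {x : A | S x}.
Let mk x (h : S x) : X := exist _ x h.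

Definition sub_presentation : presentation.
Proof.
apply: (@Presentation X (fun x y => sval x = sval y) (mk (ss0 h0)) (mk h1)
  (fun x y => mk (ssD h0 (svalP x) (svalP y)))
  (fun c x => mk (ssZ h0 c (svalP x)))
  (fun x y => mk (hM (svalP x) (svalP y)))) => /=.
- by [].
- by move=> x y ->.
- by move=> x y z -> ->.
- by move=> x x' y y' -> ->.
- by move=> c x x' ->.
- by move=> x x' y y' -> ->.
- by move=> x y z; rewrite addrA.
- by move=> x y; rewrite addrC.
- by move=> x; rewrite add0r.
- by move=> x; rewrite scale0r.
- by move=> x; rewrite scale1r.
- by move=> c d x; rewrite scalerA.
- by move=> c x y; rewrite scalerDr.
- by move=> c d x; rewrite scalerDl.
- by move=> x y z; rewrite mulrA.
- by move=> x; rewrite mul1r.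
- by move=> x; rewrite mulr1.
- by move=> x y z; rewrite mulrDl.
- by move=> x y z; rewrite mulrDr.
- by move=> c x y; rewrite scalerAl.
- by move=> c x y; rewrite scalerAr.
- by apply/eqP; exact: oner_neq0.
Defined.

Let Q : algType rat := presented sub_presentation.
Let inc (u : Q) : A := sval (rrep u).
Let incE x : inc (@rcls sub_presentation x) = sval x.
Proof. exact: (@rrepP sub_presentation x). Qed.
Let inc_linear (c : rat) u v : inc (c *: u + v) = c *: inc u + inc v.
Proof.
have [x <-] := rcls_surj u; have [y <-] := rcls_surj v.
by rewrite -rclsZ -rclsD !incE.
Qed.
Let inc_mul u v : inc (u * v) = inc u * inc v.
Proof.
have [x <-] := rcls_surj u; have [y <-] := rcls_surj v.
by rewrite -rclsM !incE.
Qed.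
Let incM : {lrmorphism Q -> A} := mk_lrmorphism inc_linear (incE _) inc_mul.
Let incZ c u : incM (c *: u) = c *: incM u. Proof. exact: linearZ. Qed.
Let inc_inj : injective incM.
Proof.
move=> u v; have [x <-] := rcls_surj u; have [y <-] := rcls_surj v.
by rewrite /= !incE => h; apply/rclsP.
Qed.
Let inc_S u : S (incM u).
Proof. by have [x <-] := rcls_surj u; rewrite /= incE; exact: svalP. Qed.
Let inc_onto x : S x -> exists u, incM u = x.
Proof. by move=> hx; exists (@rcls sub_presentation (exist _ x hx)); rewrite /= incE. Qed.

Let sgr n : set Q := [set u | gr n (incM u)].

Definition sub_dga : dga_on Q.
Proof.
apply: (@DgaOn Q sgr (fun=> 0)).
- by move=> n; apply: preim_subspace; exact: gr_subspace.
- move=> u; have [n e] := cmp_sum (incM u).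
  have /choice[f hf] : forall k, exists v, incM v = cmp (incM u) k.
    by move=> k; apply/inc_onto/hSh.
  exists n, f; split; first by move=> k; have := cmp_gr (incM u) k; rewrite -hf.
  by apply: inc_inj; rewrite (linear_sum incM) e; apply: eq_bigr => i _; exact/esym/hf.
- move=> n f hf h k hk; apply: inc_inj; rewrite linear0.
  apply: (gr_direct (f := fun k => incM (f k)) (n := n)) => //.
  by rewrite -(linear_sum incM) h linear0.
- by have := @gr_one A; rewrite -(rmorph1 incM).
- by move=> m n u v hu hv; have := gr_mul hu hv; rewrite -(rmorphM incM).
- move=> m n u v hu hv; apply: inc_inj.
  by rewrite incZ !(rmorphM incM) (gr_comm hu hv) signE.
- by move=> c u v; rewrite scaler0 addr0.
- by move=> n u hu; have := ss0 (@gr_subspace A n.+1); rewrite -(linear0 incM).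
- by [].
- by move=> n u v _; rewrite mul0r mulr0 scaler0 addr0.
Defined.

(** Universal properties speak of whole algebras; to apply them to a subalgebra it
    has to be made one. *)
Lemma sub_gca : exists (B : gcaType) (i : {lrmorphism B -> A}),
  [/\ graded_mor i, injective i, forall u, S (i u), forall x, S x -> exists u, i u = x
     & forall n u, gr n (i u) -> gr n u].
Proof. by exists (mk_cdga sub_dga), incM; split. Qed.

End Subalgebra.
(** Below index [n] the sequence is zero. *)
Lemma coherent_extension (E : nat -> cdgaType) (j : forall n, {lrmorphism E n -> E n.+1})
    n (x : E n) : exists s : forall k, E k,
  s n = x /\ forall k, (n <= k)%N -> s k.+1 = j k (s k).
Proof.
elim: n E j x => [|n IH] E j x.
  by exists (nat_rect (fun k => E k) x (fun k => j k)).
have [s [h1 h2]] := IH (fun k => E k.+1) (fun k => j k.+1) x.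
by exists (fun k => if k is k'.+1 then s k' else 0); split=> // -[|k] // /h2.
Qed.

Section Colimit.
Variables (E : nat -> cdgaType) (j : forall n, {lrmorphism E n -> E n.+1}).
Hypothesis hj : forall n, cdga_mor (j n).
Hypothesis inj_j : forall n, injective (j n).

Let coh (s : forall k, E k) := exists N, forall k, (N <= k)%N -> s k.+1 = j k (s k).
Let X := {s : forall k, E k | coh s}.
Let evq (s t : X) := exists N, forall k, (N <= k)%N -> sval s k = sval t k.

Let mk0 : coh (fun=> 0). Proof. by exists 0%N => k _; rewrite linear0. Qed.
Let mk1 : coh (fun=> 1). Proof. by exists 0%N => k _; rewrite rmorph1. Qed.
Let coh2 (f : forall k, E k -> E k -> E k) (s t : forall k, E k) :
  (forall k x y, j k (f k x y) = f k.+1 (j k x) (j k y)) -> coh s -> coh t ->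
  coh (fun k => f k (s k) (t k)).
Proof.
move=> hf [N hN] [M hM]; exists (maxn N M) => k; rewrite geq_max => /andP[h1 h2].
by rewrite hN // hM // hf.
Qed.
Let mkD (s t : X) : coh (fun k => sval s k + sval t k).
Proof. by apply: (@coh2 (fun k => +%R)); [move=> k x y; rewrite linearD|exact: svalP|exact: svalP]. Qed.
Let mkM (s t : X) : coh (fun k => sval s k * sval t k).
Proof. by apply: (@coh2 (fun k => *%R)); [move=> k x y; rewrite rmorphM|exact: svalP|exact: svalP]. Qed.
Let mkZ c (s : X) : coh (fun k => c *: sval s k).
Proof. by apply: (@coh2 (fun k x _ => c *: x) _ (sval s)); [move=> k x y; rewrite linearZ|exact: svalP|exact: svalP]. Qed.
Let mkd (s : X) : coh (fun k => diff (sval s k)).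
Proof. by apply: (@coh2 (fun k x _ => diff x) _ (sval s)); [move=> k x y; rewrite (hj k).2|exact: svalP|exact: svalP]. Qed.

Let evq2 (s t s' t' : X) (f : forall k, E k -> E k -> E k) (u u' : X) :
  (forall k, sval u k = f k (sval s k) (sval t k)) ->
  (forall k, sval u' k = f k (sval s' k) (sval t' k)) ->
  evq s s' -> evq t t' -> evq u u'.
Proof.
move=> hu hu' [N hN] [M hM]; exists (maxn N M) => k; rewrite geq_max => /andP[h1 h2].
by rewrite hu hu' hN // hM.
Qed.

Definition colim_presentation : presentation.
Proof.
apply: (@Presentation X evq (exist _ _ mk0) (exist _ _ mk1)
  (fun s t => exist _ _ (mkD s t)) (fun c s => exist _ _ (mkZ c s))
  (fun s t => exist _ _ (mkM s t))).
- by move=> s; exists 0%N.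
- by move=> s t [N h]; exists N => k /h.
- move=> s t u [N h] [M h']; exists (maxn N M) => k; rewrite geq_max => /andP[h1 h2].
  by rewrite h // h'.
- by move=> s s' t t'; apply: evq2.
- by move=> c s s' h; apply: (@evq2 s s s' s' (fun k x _ => c *: x)).
- by move=> s s' t t'; apply: evq2.
- by move=> s t u; exists 0%N => k _ /=; rewrite addrA.
- by move=> s t; exists 0%N => k _ /=; rewrite addrC.
- by move=> s; exists 0%N => k _ /=; rewrite add0r.
- by move=> s; exists 0%N => k _ /=; rewrite scale0r.
- by move=> s; exists 0%N => k _ /=; rewrite scale1r.
- by move=> c d s; exists 0%N => k _ /=; rewrite scalerA.
- by move=> c s t; exists 0%N => k _ /=; rewrite scalerDr.
- by move=> c d s; exists 0%N => k _ /=; rewrite scalerDl.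
- by move=> s t u; exists 0%N => k _ /=; rewrite mulrA.
- by move=> s; exists 0%N => k _ /=; rewrite mul1r.
- by move=> s; exists 0%N => k _ /=; rewrite mulr1.
- by move=> s t u; exists 0%N => k _ /=; rewrite mulrDl.
- by move=> s t u; exists 0%N => k _ /=; rewrite mulrDr.
- by move=> c s t; exists 0%N => k _ /=; rewrite scalerAl.
- by move=> c s t; exists 0%N => k _ /=; rewrite scalerAr.
- by case=> N /(_ N (leqnn N)) /= /eqP; rewrite oner_eq0.
Defined.

Let Q : algType rat := presented colim_presentation.
Let cl (s : X) : Q := @rcls colim_presentation s.
Let cl_surj (u : Q) : exists s, cl s = u. Proof. exact: (rcls_surj u). Qed.
Let clP s t : cl s = cl t <-> evq s t. Proof. exact: rclsP. Qed.

Let start n (x : E n) := sval (cid (coherent_extension j x)).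
Let start_at n x : @start n x n = x.
Proof. by rewrite /start; case: cid => s []. Qed.
Let start_coh n x k : (n <= k)%N -> @start n x k.+1 = j k (start x k).
Proof. by rewrite /start; case: cid => s [_ h] /=; apply: h. Qed.
Let startX n (x : E n) : X := exist _ _ (ex_intro _ n (@start_coh n x)).

Let coh_eq n (s t : forall k, E k) : (forall k, (n <= k)%N -> s k.+1 = j k (s k)) ->
  (forall k, (n <= k)%N -> t k.+1 = j k (t k)) -> s n = t n ->
  forall k, (n <= k)%N -> s k = t k.
Proof.
move=> hs ht e k; elim: k => [|k IH]; first by rewrite leqn0 => /eqP h; rewrite h in e.
by rewrite leq_eqVlt => /orP[/eqP <- //|h]; rewrite hs // ht // IH.
Qed.

Let start_cl n (x : E n) (s : X) : (forall k, (n <= k)%N -> sval s k.+1 = j k (sval s k)) ->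
  sval s n = x -> cl (startX x) = cl s.
Proof.
move=> hs e; apply/clP; exists n; apply: coh_eq => //; first exact: start_coh.
by rewrite /= start_at.
Qed.

Let lam_linear n (c : rat) (x y : E n) : cl (startX (c *: x + y)) = c *: cl (startX x) + cl (startX y).
Proof.
rewrite -rclsZ -rclsD; apply: start_cl => [k hk|] /=; last by rewrite !start_at.
by rewrite !start_coh // linearP.
Qed.
Let lam_mul n (x y : E n) : cl (startX (x * y)) = cl (startX x) * cl (startX y).
Proof.
rewrite -rclsM; apply: start_cl => [k hk|] /=; last by rewrite !start_at.
by rewrite !start_coh // rmorphM.
Qed.
Let lam1 n : cl (startX (1 : E n)) = 1.
Proof. by apply: start_cl => [k hk|] //=; rewrite rmorph1. Qed.

Let lam n : {lrmorphism E n -> Q} := mk_lrmorphism (@lam_linear n) (lam1 n) (@lam_mul n).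

Let lamS n (x : E n) : lam n.+1 (j n x) = lam n x.
Proof.
apply: start_cl => [k hk|]; first exact/start_coh/ltnW.
by rewrite /= start_coh // start_at.
Qed.

Let lam_sval (s : X) N n : (forall k, (N <= k)%N -> sval s k.+1 = j k (sval s k)) ->
  (N <= n)%N -> lam n (sval s n) = cl s.
Proof. by move=> h hn; apply: start_cl => // k hk; apply: h; apply: leq_trans hk. Qed.

Let lam_surj (u : Q) : exists N, forall n, (N <= n)%N -> exists x, lam n x = u.
Proof.
have [s <-] := cl_surj u; have [N hN] := svalP s; exists N => n hn.
by exists (sval s n); apply: lam_sval hN hn.
Qed.

Let lam_inj n : injective (lam n).
Proof.
move=> x y /clP[N hN].
suff back d : start x (n + d) = start y (n + d) -> x = y.
  by apply: (back N); apply: hN; exact: leq_addl.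
elim: d => [|d IH]; first by rewrite addn0 !start_at.
by rewrite addnS !start_coh ?leq_addr // => /inj_j.
Qed.

Let lam_shift n d (x : E n) : exists y : E (n + d)%N, lam _ y = lam n x /\
  forall e, gr e x -> gr e y.
Proof.
elim: d => [|d [y [e hy]]]; first by rewrite addn0; exists x.
by rewrite addnS; exists (j _ y); rewrite lamS; split=> // k /hy; exact: (hj _).1.
Qed.

Let lam_up n m (x : E n) : (n <= m)%N -> exists y : E m, lam _ y = lam n x /\
  forall e, gr e x -> gr e y.
Proof. by move/subnKC <-; exact: lam_shift. Qed.

Let cgr d : set Q := [set u | exists n x, gr d x /\ lam n x = u].

Let cgr_up d u : cgr d u -> exists N, forall n, (N <= n)%N -> exists2 x, gr d x & lam n x = u.
Proof.
case=> N [x [hx <-]]; exists N => n hn.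
by have [y [e hy]] := lam_up x hn; exists y => //; exact: hy.
Qed.

Let cgr_up_all (f : nat -> Q) m : (forall k, cgr k (f k)) ->
  exists n, forall k, (k < m)%N -> exists2 x, gr k x & lam n x = f k.
Proof.
move=> h; have /choice[N hN] := fun k => cgr_up (h k).
exists (\max_(k < m) N k)%N => k hk; apply: hN.
exact: (leq_bigmax (Ordinal hk)).
Qed.

Let cgr_up2 d e u v : cgr d u -> cgr e v ->
  exists n x y, [/\ gr d x, gr e y, lam n x = u & lam n y = v].
Proof.
move=> /cgr_up[N hN] /cgr_up[M hM]; exists (maxn N M).
have [x hx ex] := hN _ (leq_maxl N M); have [y hy ey] := hM _ (leq_maxr N M).
by exists x, y.
Qed.

Let lam_surj2 u v : exists n x y, lam n x = u /\ lam n y = v.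
Proof.
have [N hN] := lam_surj u; have [M hM] := lam_surj v; exists (maxn N M).
have [x ex] := hN _ (leq_maxl N M); have [y ey] := hM _ (leq_maxr N M).
by exists x, y.
Qed.

Let dX (s : X) : X := exist _ _ (mkd s).
Let cdiff (u : Q) : Q := cl (dX (sval (cid (cl_surj u)))).
Let cdiffE n (x : E n) : cdiff (lam n x) = lam n (diff x).
Proof.
rewrite /cdiff; case: cid => s /= /clP[N hN]; apply/clP.
have e k : (maxn N n <= k)%N -> diff (sval s k) = start (diff x) k.
  rewrite geq_max => /andP[h1 h2]; rewrite (hN _ h1) /=.
  apply: (@coh_eq n (fun k => diff (start x k))) => // [i hi|i hi|].
  - by rewrite start_coh // (hj _).2.
  - by rewrite start_coh.
  - by rewrite !start_at.
by exists (maxn N n).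
Qed.

Definition colim_dga : dga_on Q.
Proof.
apply: (@DgaOn Q cgr cdiff).
- move=> d; split; first by exists 0%N, 0; rewrite linear0; split=> //; apply: ss0; exact: gr_subspace.
  move=> c u v hu hv; have [n [x [y [hx hy <- <-]]]] := cgr_up2 hu hv.
  by exists n, (c *: x + y); rewrite linearP; split=> //; apply: (gr_subspace _).2.
- move=> u; have [N /(_ N (leqnn N))[x <-]] := lam_surj u.
  have [n [f [hf ->]]] := gr_decomp x.
  by exists n, (fun k => lam N (f k)); split; [move=> k; exists N, (f k)|exact: (linear_sum (lam N))].
- move=> m f hf h k hk; have [n hn] := cgr_up_all m hf.
  have /choice[g hg] : forall i, exists x, gr i x /\ ((i < m)%N -> lam n x = f i).
    move=> i; have [/hn[x hx e]|_] := ltnP i m; first by exists x.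
    by exists 0; split=> //; apply: ss0; exact: gr_subspace.
  rewrite -(hg k).2 // (_ : g k = 0) ?linear0 //.
  apply: (gr_direct (f := g) (n := m)) => // [i|]; first by case: (hg i).
  apply: (@lam_inj n); rewrite linear0 -[RHS]h (linear_sum (lam n)); apply: eq_bigr => i _.
  exact: (hg i).2.
- by exists 0%N, 1; rewrite rmorph1; split=> //; exact: gr_one.
- move=> d e u v hu hv; have [n [x [y [hx hy <- <-]]]] := cgr_up2 hu hv.
  by exists n, (x * y); rewrite rmorphM; split=> //; exact: gr_mul.
- move=> d e u v hu hv; have [n [x [y [hx hy <- <-]]]] := cgr_up2 hu hv.
  by rewrite -!(lrM (lam n)) (gr_comm hx hy) signE lrZ.
- move=> c u v; have [n [x [y [<- <-]]]] := lam_surj2 u v.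
  by rewrite -linearP !cdiffE diff_linear linearP.
- by move=> d _ [n [x [hx <-]]]; exists n, (diff x); rewrite cdiffE; split=> //; exact: diff_deg.
- move=> u; have [N /(_ N (leqnn N))[x <-]] := lam_surj u.
  by rewrite !cdiffE diff_diff linear0.
- move=> d u v hu; have [N hN] := cgr_up hu; have [M hM] := lam_surj v.
  have [x hx <-] := hN _ (leq_maxl N M); have [y <-] := hM _ (leq_maxr N M).
  by rewrite -lrM !cdiffE (diff_mul hx) signE lrD lrZ !lrM.
Defined.

(** Elements are represented by sequences that are eventually coherent, two of them
    being identified when they eventually agree; so the operations are pointwise. *)
Lemma colimit : exists (L : cdgaType) (l : forall n, {lrmorphism E n -> L}),
  [/\ forall n, cdga_mor (l n), forall n x, l n.+1 (j n x) = l n x,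
      forall n, injective (l n) & forall u, exists n x, l n x = u].
Proof.
exists (mk_cdga colim_dga), lam; split=> //.
- by move=> n; split=> [d x hx|x]; [exists n, x|rewrite -[RHS]/(cdiff (lam n x)) cdiffE].
- by move=> u; have [N /(_ N (leqnn N))] := lam_surj u; exists N.
Qed.

End Colimit.
(** * Tensor products *)

Section ParityParts.
Variable A : gcaType.
Implicit Types x y : A.

Lemma parity_part_mul (f g h : {linear A -> A}) :
  (forall m n x y, gr m x -> gr n y -> g (f x * y) = f x * h y) ->
  forall x y, g (f x * y) = f x * h y.
Proof.
move=> e x; apply: hom_ind.
  by split; rewrite /= ?mulr0 ?linear0 ?mulr0 // => c u v hu hv; rewrite mulrDr -scalerAr !linearP hu hv mulrDr -scalerAr.
move=> n y hy; move: x; apply: hom_ind.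
  by split; rewrite /= ?linear0 ?mul0r ?linear0 // => c u v hu hv; rewrite linearP !mulrDl -!scalerAl linearP hu hv.
by move=> m x hx; apply: e hx hy.
Qed.

Lemma evp_evpM x y : evp (evp x * y) = evp x * evp y.
Proof.
apply: parity_part_mul => m n u v hu hv; rewrite (evpE hu) (evpE hv).
case: (boolP (odd m)) => om; rewrite ?mul0r ?linear0 // (evpE (gr_mul hu hv)) oddD (negbTE om).
by case: odd; rewrite //= mulr0.
Qed.
Lemma odp_evpM x y : odp (evp x * y) = evp x * odp y.
Proof.
apply: parity_part_mul => m n u v hu hv; rewrite (evpE hu) (odpE hv).
case: (boolP (odd m)) => om; rewrite ?mul0r ?linear0 // (odpE (gr_mul hu hv)) oddD (negbTE om).
by case: odd; rewrite //= mulr0.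
Qed.
Lemma evp_odpM x y : evp (odp x * y) = odp x * odp y.
Proof.
apply: parity_part_mul => m n u v hu hv; rewrite (odpE hu) (odpE hv).
case: (boolP (odd m)) => om; rewrite ?mul0r ?linear0 // (evpE (gr_mul hu hv)) oddD om.
by case: odd; rewrite //= mulr0.
Qed.
Lemma odp_odpM x y : odp (odp x * y) = odp x * evp y.
Proof.
apply: parity_part_mul => m n u v hu hv; rewrite (odpE hu) (evpE hv).
case: (boolP (odd m)) => om; rewrite ?mul0r ?linear0 // (odpE (gr_mul hu hv)) oddD om.
by case: odd; rewrite //= mulr0.
Qed.
Lemma evp1 : evp (1 : A) = 1. Proof. exact: (evpE gr_one). Qed.
Lemma odp1 : odp (1 : A) = 0. Proof. exact: (odpE gr_one). Qed.
End ParityParts.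

Definition bilinear_map (A B M : lmodType rat) (beta : A -> B -> M) :=
  (forall b (c : rat) x y, beta (c *: x + y) b = c *: beta x b + beta y b) /\
  (forall a (c : rat) x y, beta a (c *: x + y) = c *: beta a x + beta a y).

Section Bilinear.
Variables (A B M : lmodType rat) (beta : A -> B -> M).
Hypothesis hb : bilinear_map beta.
Lemma bil0l b : beta 0 b = 0.
Proof. by have := hb.1 b (-1) 0 0; rewrite !scaleN1r oppr0 addr0 addNr. Qed.
Lemma bil0r a : beta a 0 = 0.
Proof. by have := hb.2 a (-1) 0 0; rewrite !scaleN1r oppr0 addr0 addNr. Qed.
Lemma bilDl x y b : beta (x + y) b = beta x b + beta y b.
Proof. by rewrite -[x]scale1r hb.1 !scale1r. Qed.
Lemma bilDr a x y : beta a (x + y) = beta a x + beta a y.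
Proof. by rewrite -[x]scale1r hb.2 !scale1r. Qed.
Lemma bilZl c x b : beta (c *: x) b = c *: beta x b.
Proof. by rewrite -[c *: x]addr0 hb.1 bil0l addr0. Qed.
Lemma bilZr c a x : beta a (c *: x) = c *: beta a x.
Proof. by rewrite -[c *: x]addr0 hb.2 bil0r addr0. Qed.
End Bilinear.

Section Tensor.
Variables A B : cdgaType.

Let X := seq (A * B).
Definition teval (M : lmodType rat) (beta : A -> B -> M) (s : X) : M :=
  \sum_(p <- s) beta p.1 p.2.

(** Formal sums of pairs represent the same tensor when no bilinear map
    separates them. *)
Definition teq (s t : X) := forall (M : lmodType rat) (beta : A -> B -> M),
  bilinear_map beta -> teval beta s = teval beta t.

(** The Koszul sign enters through the parity parts of the inner factors. *)
Definition tmulp (p q : A * B) : X :=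
  [:: (p.1 * q.1, evp p.2 * q.2); (p.1 * sg q.1, odp p.2 * q.2)].
Definition tmul (s t : X) : X :=
  flatten [seq flatten [seq tmulp p q | q <- t] | p <- s].

Lemma teval_mul (M : lmodType rat) (beta : A -> B -> M) s t :
  teval beta (tmul s t) = \sum_(p <- s) \sum_(q <- t)
    (beta (p.1 * q.1) (evp p.2 * q.2) + beta (p.1 * sg q.1) (odp p.2 * q.2)).
Proof.
rewrite /teval /tmul big_flatten big_map; apply: eq_bigr => p _.
rewrite big_flatten big_map; apply: eq_bigr => q _.
by rewrite /tmulp big_cons big_seq1.
Qed.

Lemma teval_cat (M : lmodType rat) (beta : A -> B -> M) s t :
  teval beta (s ++ t) = teval beta s + teval beta t.
Proof. exact: big_cat. Qed.

Lemma teval_scale (M : lmodType rat) (beta : A -> B -> M) c (s : X) : bilinear_map beta ->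
  teval beta [seq (c *: p.1, p.2) | p <- s] = c *: teval beta s.
Proof. by move=> hb; rewrite /teval big_map scaler_sumr; apply: eq_bigr => p _; rewrite (bilZl hb). Qed.

Lemma bil_mull (M : lmodType rat) (beta : A -> B -> M) (t : X) : bilinear_map beta ->
  bilinear_map (fun a b => \sum_(q <- t) (beta (a * q.1) (evp b * q.2) + beta (a * sg q.1) (odp b * q.2))).
Proof.
move=> hb; split=> [b c x y|a c x y]; rewrite scaler_sumr -big_split /=; apply: eq_bigr => q _.
  by rewrite !mulrDl -!scalerAl !(hb.1) scalerDr; zmod.
by rewrite !linearP !mulrDl -!scalerAl !(hb.2) scalerDr; zmod.
Qed.

Lemma bil_mulr (M : lmodType rat) (beta : A -> B -> M) (s : X) : bilinear_map beta ->
  bilinear_map (fun a b => \sum_(p <- s) (beta (p.1 * a) (evp p.2 * b) + beta (p.1 * sg a) (odp p.2 * b))).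
Proof.
move=> hb; split=> [b c x y|a c x y]; rewrite scaler_sumr -big_split /=; apply: eq_bigr => q _.
  by rewrite !linearP !mulrDr -!scalerAr !(hb.1) scalerDr; zmod.
by rewrite !mulrDr -!scalerAr !(hb.2) scalerDr; zmod.
Qed.

Lemma teval_mull (M : lmodType rat) (beta : A -> B -> M) s t :
  teval beta (tmul s t) = teval (fun a b =>
    \sum_(q <- t) (beta (a * q.1) (evp b * q.2) + beta (a * sg q.1) (odp b * q.2))) s.
Proof. exact: teval_mul. Qed.

Lemma teval_mulr (M : lmodType rat) (beta : A -> B -> M) s t :
  teval beta (tmul s t) = teval (fun a b =>
    \sum_(p <- s) (beta (p.1 * a) (evp p.2 * b) + beta (p.1 * sg a) (odp p.2 * b))) t.
Proof. by rewrite teval_mul exchange_big. Qed.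

Definition tens_presentation : presentation.
Proof.
apply: (@Presentation X teq [::] [:: (1, 1)] cat (fun c s => [seq (c *: p.1, p.2) | p <- s]) tmul).
- by [].
- by move=> s t h M b hb; rewrite h.
- by move=> s t u h1 h2 M b hb; rewrite h1 // h2.
- by move=> s s' t t' h1 h2 M b hb; rewrite !teval_cat h1 // h2.
- by move=> c s s' h M b hb; rewrite !teval_scale // h.
- move=> s s' t t' h1 h2 M b hb; rewrite teval_mull h1; last exact: bil_mull.
  by rewrite -teval_mull teval_mulr h2 -?teval_mulr //; exact: bil_mulr.
- by move=> s t u M b hb; rewrite !teval_cat addrA.
- by move=> s t M b hb; rewrite !teval_cat addrC.
- by [].
- by move=> s M b hb; rewrite teval_scale // scale0r /teval big_nil.
- by move=> s M b hb; rewrite teval_scale // scale1r.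
- by move=> c d s M b hb; rewrite !teval_scale // scalerA.
- by move=> c s t M b hb; rewrite teval_scale // !teval_cat !teval_scale // scalerDr.
- by move=> c d s M b hb; rewrite teval_cat !teval_scale // scalerDl.
- move=> s t u M b hb; rewrite [RHS]teval_mull !teval_mul; apply: eq_bigr => p _.
  have := teval_mul (fun x y => b (p.1 * x) (evp p.2 * y) + b (p.1 * sg x) (odp p.2 * y)) t u.
  rewrite /teval => ->; apply: eq_bigr => q _; rewrite -big_split; apply: eq_bigr => v _ /=.
  by rewrite !sgM !sgK !mulrA evp_evpM odp_evpM evp_odpM odp_odpM; zmod.
- move=> s M b hb; rewrite teval_mul big_seq1; apply: eq_bigr => q _ /=.
  by rewrite evp1 odp1 !mul1r mul0r (bil0r hb) addr0.
- move=> s M b hb; rewrite teval_mul; apply: eq_bigr => p _; rewrite big_seq1 /=.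
  by rewrite sg1 !mulr1 -(bilDr hb) -evp_odp.
- by move=> s t u M b hb; rewrite teval_cat !teval_mul big_cat.
- move=> s t u M b hb; rewrite teval_cat !teval_mul -big_split.
  by apply: eq_bigr => p _; rewrite big_cat.
- by move=> c s t M b hb; rewrite teval_scale // !teval_mull teval_scale //; exact: bil_mull.
- by move=> c s t M b hb; rewrite teval_scale // !teval_mulr teval_scale //; exact: bil_mulr.
- move=> h.
  have [f [_ f1]] := functional (@subspace0 A) (elimN eqP (oner_neq0 A)).
  have [g [_ g1]] := functional (@subspace0 B) (elimN eqP (oner_neq0 B)).
  have /h : bilinear_map (fun a b => f a * g b : rat^o).
    split=> [b c x y|a c x y]; rewrite linearP /=; first by rewrite mulrDl -scalerAl.
    by rewrite mulrDr -scalerAr.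
  rewrite /teval big_seq1 big_nil /= f1 g1 mulr1; apply/eqP; exact: oner_neq0.
Defined.

Let T : algType rat := presented tens_presentation.
Let cl (s : X) : T := @rcls tens_presentation s.
Let clP s t : cl s = cl t <-> teq s t. Proof. exact: rclsP. Qed.
Definition tprod a b : T := cl [:: (a, b)].

Lemma pure_bil : bilinear_map tprod.
Proof.
split=> [b c x y|a c x y]; rewrite /tprod /cl -rclsZ -rclsD; apply/clP => M beta hb;
  rewrite /teval /= !big_cons !big_nil /= !addr0.
  by rewrite hb.1 (bilZl hb).
by rewrite hb.2 (bilZl hb).
Qed.

Lemma cl_sum s : cl s = \sum_(p <- s) tprod p.1 p.2.
Proof.
elim: s => [|p s IH]; first by rewrite big_nil.
by rewrite big_cons -IH /tprod /cl -rclsD; congr rcls; case: p.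
Qed.

Lemma tens_ind (P : set T) : subspace P -> (forall a b, P (tprod a b)) -> forall t, P t.
Proof.
move=> hP h t; have [s <-] := rcls_surj t.
by rewrite -[rcls s]/(cl s) cl_sum; apply: ss_sum.
Qed.

Lemma tens_univ (M : lmodType rat) (beta : A -> B -> M) : bilinear_map beta ->
  exists h : {linear T -> M}, forall a b, h (tprod a b) = beta a b.
Proof.
move=> hb.
have [h hh] : exists h : {linear T -> M}, forall t, exists s, t = cl s /\ h t = teval beta s.
  apply: (linear_of_rel (R := fun t m => exists s, t = cl s /\ m = teval beta s)).
  - by move=> t; have [s <-] := rcls_surj t; exists (teval beta s), s.
  - by move=> t m m' [s [-> ->]] [s' [/clP h ->]]; apply: h.
  - move=> c t m t' m' [s [-> ->]] [s' [-> ->]].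
    exists ([seq (c *: p.1, p.2) | p <- s] ++ s'); rewrite teval_cat teval_scale //.
    by rewrite /cl -rclsZ -rclsD.
by exists h => a b; have [s [/clP e ->]] := hh (tprod a b); rewrite -e // /teval big_seq1.
Qed.

Lemma pureM a b a' b' :
  tprod a b * tprod a' b' = tprod (a * a') (evp b * b') + tprod (a * sg a') (odp b * b').
Proof. by rewrite /tprod /cl -rclsM -rclsD; congr rcls. Qed.

Lemma pureM_hom a b a' b' i j : gr j b -> gr i a' ->
  tprod a b * tprod a' b' = (-1) ^+ (j * i) *: tprod (a * a') (b * b').
Proof.
move=> hb ha; rewrite pureM (evpE hb) (odpE hb) (sgE ha) -[in RHS]signr_odd [in RHS]oddM.
case: (odd j) => /=; last by rewrite mul0r (bil0r pure_bil) addr0 scale1r.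
by rewrite mul0r (bil0r pure_bil) add0r signr_odd -scalerAr (bilZl pure_bil).
Qed.

Let tgr n : set T := span [set t | exists i j a b,
  [/\ gr i a, gr j b, (i + j)%N = n & t = tprod a b]].

Let tgr_pure i j a b : gr i a -> gr j b -> tgr (i + j) (tprod a b).
Proof. by move=> ha hb; apply: span_sub; exists i, j, a, b. Qed.

Let tgr_sub n : subspace (tgr n). Proof. exact: span_subspace. Qed.

Let tgr_ind n (P : set T) : subspace P ->
  (forall i j a b, gr i a -> gr j b -> (i + j)%N = n -> P (tprod a b)) -> tgr n `<=` P.
Proof. by move=> hP h; apply: span_min => // _ [i [j [a [b [ha hb e ->]]]]]; apply: h hb e. Qed.

Let hom_pure (P : set T) : subspace P ->
  (forall i j a b, gr i a -> gr j b -> P (tprod a b)) -> forall t, P t.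
Proof.
move=> hP h; apply: tens_ind => // a b; move: a; apply: hom_ind.
  split; first by rewrite /= (bil0l pure_bil); exact: (ss0 hP).
  by move=> c x y hx hy; rewrite /= pure_bil.1; apply: hP.2.
move=> i a ha; move: b; apply: hom_ind; last by move=> j b hb; exact: h ha hb.
split; first by rewrite /= (bil0r pure_bil); exact: (ss0 hP).
by move=> c x y hx hy; rewrite /= pure_bil.2; apply: hP.2.
Qed.

Let tproj_ex n : exists f : {linear T -> T}, forall i j a b, gr i a -> gr j b ->
  f (tprod a b) = if (i + j)%N == n then tprod a b else 0.
Proof.
have [|f hf] := @tens_univ T (fun a b => \sum_(i < n.+1) tprod (cmp a i) (cmp b (n - i))).
  split=> [b c x y|a c x y]; rewrite scaler_sumr -big_split; apply: eq_bigr => i _ /=.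
    by rewrite cmp_linear pure_bil.1.
  by rewrite cmp_linear pure_bil.2.
exists f => i j a b ha hb; rewrite hf; case: eqP => [<-|ne].
  rewrite (bigD1 (inord i)) //= inordK ?ltnS ?leq_addr // big1.
    by rewrite addr0 addKn !gr_cmp.
  move=> k /eqP ne; rewrite (cmp_hom _ ha); case: eqP => e; last by rewrite (bil0l pure_bil).
  by case: ne; apply/val_inj; rewrite /= inordK ?ltnS ?leq_addr.
rewrite big1 // => k _; rewrite (cmp_hom _ ha) (cmp_hom _ hb).
case: eqP => [e|_]; last by rewrite (bil0l pure_bil).
case: eqP => [e'|_]; last by rewrite (bil0r pure_bil).
by case: ne; rewrite -e -e' subnKC // -ltnS.
Qed.

Let tproj n := sval (cid (tproj_ex n)).
Let tproj_pure n i j a b : gr i a -> gr j b ->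
  tproj n (tprod a b) = if (i + j)%N == n then tprod a b else 0.
Proof. by rewrite /tproj; case: cid => f /= h; exact: h. Qed.

Let tproj_gr n t : tgr n (tproj n t).
Proof.
move: t; apply: hom_pure; first exact: preim_subspace.
move=> i j a b ha hb; rewrite /= (tproj_pure _ ha hb); case: eqP => [<-|_]; first exact: tgr_pure.
exact: ss0.
Qed.

Let tproj_hom n m t : tgr m t -> tproj n t = if m == n then t else 0.
Proof.
move: t; apply: tgr_ind.
  split; first by rewrite /= linear0 if_same.
  by move=> c x y /= hx hy; rewrite linearP hx hy; case: eqP => _; rewrite ?scaler0 ?addr0.
by move=> i j a b ha hb <-; exact: tproj_pure.
Qed.

Let tdiff_ex : exists f : {linear T -> T}, forall a b,
  f (tprod a b) = tprod (diff a) b + tprod (sg a) (diff b).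
Proof.
apply: tens_univ; split=> [b c x y|a c x y].
  by rewrite diff_linear !linearP !pure_bil.1 scalerDr; zmod.
by rewrite diff_linear !pure_bil.2 scalerDr; zmod.
Qed.
Let tdiff := sval (cid tdiff_ex).
Let tdiff_pure a b : tdiff (tprod a b) = tprod (diff a) b + tprod (sg a) (diff b).
Proof. exact: (svalP (cid tdiff_ex)). Qed.

Let sign_odd m n (t : T) : odd m = odd n -> (-1) ^+ m *: t = (-1) ^+ n *: t.
Proof. by move=> h; rewrite -(signr_odd rat m) h signr_odd. Qed.

Let leib_pure i j i' j' a b a' b' : gr i a -> gr j b -> gr i' a' -> gr j' b' ->
  tdiff (tprod a b * tprod a' b') = tdiff (tprod a b) * tprod a' b' +
    (-1) ^+ (i + j) *: (tprod a b * tdiff (tprod a' b')).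
Proof.
move=> ha hb ha' hb'.
rewrite (pureM_hom _ _ hb ha') linearZ /= !tdiff_pure mulrDl mulrDr.
rewrite (pureM_hom _ _ hb ha') (pureM_hom _ _ (diff_deg hb) ha').
rewrite (pureM_hom _ _ hb (diff_deg ha')) (pureM_hom _ _ hb (sg_gr ha')).
rewrite (diff_mul ha) (diff_mul hb) !signE (sgE (gr_mul ha ha')) (sgE ha) (sgE ha').
rewrite !(bilDl pure_bil) !(bilDr pure_bil) -?scalerAl -?scalerAr.
rewrite !(bilZl pure_bil, bilZr pure_bil) !scalerDr !scalerA -!exprD.
set t1 := tprod (diff a * _) _; set t2 := tprod (a * diff a') _.
set t3 := tprod _ (diff b * _); set t4 := tprod _ (b * diff b').
rewrite (@sign_odd (j * i' + i) (i + j + j * i'.+1)); last by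
  rewrite !oddD !oddM /=; case: (odd i); case: (odd j); case: (odd i').
rewrite (@sign_odd (j * i' + (i + i')) (j.+1 * i' + i)); last by
  rewrite !oddD !oddM /=; case: (odd i); case: (odd j); case: (odd i').
rewrite (@sign_odd (i + j + j * i' + i') (j * i' + (i + i' + j))); last by
  rewrite !oddD !oddM /=; case: (odd i); case: (odd j); case: (odd i').
by rewrite ?addnA; zmod.
Qed.

Definition tens_dga : dga_on T.
Proof.
apply: (@DgaOn T tgr tdiff).
- exact: tgr_sub.
- move=> t; suff [n hn] : exists n, forall m, (n <= m)%N -> t = \sum_(k < m) tproj k t.
    by exists n, (fun k => tproj k t); split=> //; exact: hn.
  move: t; apply: hom_pure.
    split; first by exists 0%N => m _; rewrite big1 // => k _; rewrite linear0.
    move=> c x y [n hn] [n' hn']; exists (maxn n n') => m; rewrite geq_max => /andP[h h'].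
    rewrite {1}(hn _ h) {1}(hn' _ h') scaler_sumr -big_split /=.
    by apply: eq_bigr => k _; rewrite linearP.
  move=> i j a b ha hb; exists (i + j).+1 => m hm.
  rewrite (bigD1 (Ordinal hm)) //= (tproj_pure _ ha hb) eqxx big1 ?addr0 // => k ne.
  rewrite (tproj_pure _ ha hb) eq_sym; case: eqP => // e; case/eqP: ne.
  exact/val_inj.
- move=> n f hf h k hk.
  have := congr1 (tproj k) h; rewrite linear0 linear_sum (bigD1 (Ordinal hk)) //=.
  rewrite (tproj_hom _ (hf k)) eqxx big1 ?addr0 // => i ne.
  rewrite (tproj_hom _ (hf i)); case: eqP => // e; case/eqP: ne; exact/val_inj.
- by have := tgr_pure (@gr_one A) (@gr_one B).
- move=> m n x y hx hy; move: x hx; apply: tgr_ind.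
    split; first by rewrite /= mul0r; apply: (ss0 (tgr_sub _)).
    by move=> c u v hu hv; rewrite /= mulrDl -scalerAl; apply: (tgr_sub _).2.
  move=> i j a b ha hb <-; move: y hy; apply: tgr_ind.
    split; first by rewrite /= mulr0; apply: (ss0 (tgr_sub _)).
    by move=> c u v hu hv; rewrite /= mulrDr -scalerAr; apply: (tgr_sub _).2.
  move=> i' j' a' b' ha' hb' <-; rewrite /= (pureM_hom _ _ hb ha') addnACA.
  by apply: (ssZ (tgr_sub _)); apply: tgr_pure; apply: gr_mul.
- move=> m n x y hx hy; move: x hx; apply: tgr_ind.
    split; first by rewrite /= mul0r mulr0 scaler0.
    by move=> c u v hu hv; rewrite /= mulrDl mulrDr -scalerAl -scalerAr hu hv !scalerDr !scalerA mulrC.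
  move=> i j a b ha hb <-; move: y hy; apply: tgr_ind.
    split; first by rewrite /= mul0r mulr0 scaler0.
    by move=> c u v hu hv; rewrite /= mulrDl mulrDr -scalerAl -scalerAr hu hv !scalerDr !scalerA mulrC.
  move=> i' j' a' b' ha' hb' <-; rewrite /= (pureM_hom _ _ hb ha') (pureM_hom _ _ hb' ha).
  rewrite (gr_comm ha ha') (gr_comm hb hb') !signE (bilZl pure_bil) (bilZr pure_bil) !scalerA -!exprD.
  apply: sign_odd; rewrite !oddD !oddM !oddD.
  by case: (odd i); case: (odd j); case: (odd i'); case: (odd j').
- by move=> c u v; rewrite linearP.
- move=> n; apply: tgr_ind; first exact: preim_subspace.
  move=> i j a b ha hb <-; rewrite /= tdiff_pure; apply: (ssD (tgr_sub _)).
    by rewrite -addSn; apply: tgr_pure => //; exact: diff_deg.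
  by rewrite -addnS; apply: tgr_pure; [exact: sg_gr|exact: diff_deg].
- apply: tens_ind; first exact: (ker_subspace (tdiff \o tdiff)).
  move=> a b /=; rewrite tdiff_pure linearD /= !tdiff_pure !diff_diff d_sg sgK.
  rewrite (bil0l pure_bil) (bil0r pure_bil) -scaleN1r (bilZl pure_bil) scaleN1r; zmod.
- move=> n x y hx; move: x hx; apply: tgr_ind.
    split; first by rewrite /= !(mul0r, linear0) ?scaler0 addr0.
    move=> c u v hu hv; rewrite /= !linearP !mulrDl -!scalerAl !linearP hu hv.
    by rewrite !scalerDr !scalerA mulrC; zmod.
  move=> i j a b ha hb <-; move: y; apply: hom_pure.
    split; first by rewrite /= !(mulr0, linear0) ?scaler0 addr0.
    move=> c u v hu hv; rewrite /= !linearP !mulrDr -!scalerAr !linearP hu hv.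
    by rewrite !scalerDr !scalerA mulrC; zmod.
  by move=> i' j' a' b' ha' hb'; exact: leib_pure ha hb ha' hb'.
Defined.

Lemma tensor_product : exists (T : cdgaType) (l : {lrmorphism A -> T}) (r : {lrmorphism B -> T}),
  [/\ cdga_mor l, cdga_mor r,
     forall (M : lmodType rat) (beta : A -> B -> M), bilinear_map beta ->
       exists h : {linear T -> M}, forall a b, h (l a * r b) = beta a b
   & forall P : set T, subspace P -> (forall a b, P (l a * r b)) -> forall t, P t].
Proof.
have l_lin (c : rat) x y : tprod (c *: x + y) 1 = c *: tprod x 1 + tprod y 1 by exact: pure_bil.1.
have r_lin (c : rat) x y : tprod 1 (c *: x + y) = c *: tprod 1 x + tprod 1 y by exact: pure_bil.2.
have l_mul x y : tprod (x * y) 1 = tprod x 1 * tprod y 1.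
  by rewrite pureM evp1 odp1 mul0r mulr1 (bil0r pure_bil) addr0.
have r_mul x y : tprod 1 (x * y) = tprod 1 x * tprod 1 y.
  by rewrite pureM sg1 mulr1 -(bilDr pure_bil) -mulrDl -evp_odp.
have lr a b : tprod a 1 * tprod 1 b = tprod a b.
  by rewrite pureM evp1 odp1 mul0r mulr1 mul1r (bil0r pure_bil) addr0.
exists (mk_cdga tens_dga), (mk_lrmorphism l_lin erefl l_mul), (mk_lrmorphism r_lin erefl r_mul).
split.
- split=> [n x hx|x]; first by have := tgr_pure hx (@gr_one B); rewrite addn0.
  by rewrite -[RHS]/(tdiff (tprod x 1)) tdiff_pure d1 (bil0r pure_bil) addr0.
- split=> [n x hx|x]; first by have := tgr_pure (@gr_one A) hx.
  by rewrite -[RHS]/(tdiff (tprod 1 x)) tdiff_pure d1 (bil0l pure_bil) add0r sg1.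
- move=> M beta hb; have [h hh] := tens_univ hb; exists h => a b.
  by rewrite -hh; exact: (congr1 h (lr a b)).
- by move=> P hP h; apply: tens_ind => // a b; exact: (eq_ind _ P (h a b) _ (lr a b)).
Qed.

End Tensor.
(** * Adjoining one generator *)

(** The possible coefficients of a generator of degree [n] in an element of degree
    [m]; only [0] when [m < n]. *)
Definition shifted (A : gcaType) n m : set A :=
  [set b | b = 0 \/ exists k, m = (n + k)%N /\ gr k b].

Section Shifted.
Variable A : gcaType.

Lemma shifted_subspace n m : subspace (@shifted A n m).
Proof.
split; first by left.
move=> c x y [->|[k [e hx]]] [->|[k' [e' hy]]].
- by left; rewrite scaler0 addr0.
- by right; exists k'; rewrite scaler0 add0r.
- by right; exists k; rewrite addr0; split=> //; apply: ssZ hx; exact: gr_subspace.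
- right; exists k; split=> //; apply: (gr_subspace _).2 => //.
  by move/eqP: e'; rewrite e eqn_add2l => /eqP ->.
Qed.

Lemma shifted_cmp n m (b : A) : shifted n m (if (n <= m)%N then cmp b (m - n) else 0).
Proof.
case: leqP => h; last by left.
by right; exists (m - n)%N; rewrite subnKC //; split=> //; exact: cmp_gr.
Qed.

Lemma cmp_shifted n m k (b : A) : shifted n m b ->
  (if (n <= k)%N then cmp b (k - n) else 0) = if m == k then b else 0.
Proof.
case=> [->|[i [-> hb]]]; first by rewrite cmp0 !if_same.
case: leqP => h; last by rewrite gtn_eqF // ltn_addr.
by rewrite (cmp_hom _ hb) -(eqn_add2l n) subnKC // eq_sym.
Qed.

Lemma shifted_sum n (b : A) : exists N, forall M, (N <= M)%N ->
  b = \sum_(k < M) if (n <= k)%N then cmp b (k - n) else 0.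
Proof.
have [N hN] := cmp_bound b; exists (n + N)%N => M hM.
rewrite -(subnKC (leq_trans (leq_addr N n) hM)) big_split_ord /= big1 ?add0r.
  rewrite {1}(@cmp_sum_bound _ b (M - n)) => [|k hk]; last first.
    by apply: hN; apply: leq_trans hk; rewrite leq_subRL // (leq_trans (leq_addr N n) hM).
  by apply: eq_bigr => i _; rewrite leq_addr addKn.
by move=> i _; rewrite leqNgt ltn_ord.
Qed.
End Shifted.

Lemma direct_of_projections (A : lmodType rat) (G : nat -> set A) (P : nat -> {linear A -> A}) :
  (forall n m x, G m x -> P n x = if m == n then x else 0) ->
  forall (n : nat) (f : nat -> A), (forall k, G k (f k)) ->
    \sum_(k < n) f k = 0 -> forall k, (k < n)%N -> f k = 0.
Proof.
move=> hP n f hf h k hk.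
have := congr1 (P k) h; rewrite linear0 linear_sum (bigD1 (Ordinal hk)) //=.
rewrite (hP _ _ _ (hf k)) eqxx big1 ?addr0 // => i ne.
by rewrite (hP _ _ _ (hf i)); case: eqP => // e; case/eqP: ne; exact/val_inj.
Qed.

Lemma sign_odd (V : lmodType rat) m n (t : V) :
  odd m = odd n -> (-1) ^+ m *: t = (-1) ^+ n *: t.
Proof. by move=> h; rewrite -(signr_odd rat m) h signr_odd. Qed.

(** For [w] of odd degree, the pair [(a, b)] stands for [a + w b]. *)
Definition oext (E : cdgaType) : Type := (E * E)%type.

Section OddExtension.
Variable E : cdgaType.
HB.instance Definition _ := GRing.Lmodule.copy (oext E) (E * E)%type.

Definition omul (u v : oext E) : oext E := (u.1 * v.1, u.2 * v.1 + sg u.1 * v.2).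
Definition oone : oext E := (1, 0).

Lemma oaddE (u v : oext E) : u + v = (u.1 + v.1, u.2 + v.2). Proof. by []. Qed.
Lemma oscaleE c (u : oext E) : c *: u = (c *: u.1, c *: u.2). Proof. by []. Qed.

Lemma omulA : associative omul.
Proof. by move=> [a b] [a' b'] [x y]; rewrite /omul /= sgM !mulrA mulrDr mulrDl !mulrA addrA. Qed.
Lemma omul1l : left_id oone omul.
Proof. by move=> [a b]; rewrite /omul /= sg1 !mul1r mul0r add0r. Qed.
Lemma omul1r : right_id oone omul.
Proof. by move=> [a b]; rewrite /omul /= !mulr1 mulr0 addr0. Qed.
Lemma omulDl : left_distributive omul +%R.
Proof.
by move=> [a b] [a' b'] [x y]; rewrite /omul !oaddE /= linearD /= !mulrDl; congr (_, _); zmod.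
Qed.
Lemma omulDr : right_distributive omul +%R.
Proof.
by move=> [a b] [a' b'] [x y]; rewrite /omul !oaddE /= !mulrDr; congr (_, _); zmod.
Qed.
Lemma oone_neq0 : oone != 0.
Proof. by apply/eqP => -[] /eqP; rewrite oner_eq0. Qed.

HB.instance Definition _ :=
  GRing.Zmodule_isNzRing.Build (oext E) omulA omul1l omul1r omulDl omulDr oone_neq0.

Lemma omulE (u v : oext E) : u * v = (u.1 * v.1, u.2 * v.1 + sg u.1 * v.2). Proof. by []. Qed.

Lemma oscaleAl c (u v : oext E) : c *: (u * v) = (c *: u : oext E) * v.
Proof.
by rewrite -[RHS]/(omul (c *: u) v) -[u * v]/(omul u v) /omul !oscaleE /= linearZ /= scalerDr -!scalerAl.
Qed.
Lemma oscaleAr c (u v : oext E) : c *: (u * v) = u * (c *: v : oext E).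
Proof.
by rewrite -[RHS]/(omul u (c *: v)) -[u * v]/(omul u v) /omul !oscaleE /= scalerDr -!scalerAr.
Qed.
HB.instance Definition _ := GRing.Lmodule_isLalgebra.Build rat (oext E) oscaleAl.
HB.instance Definition _ := GRing.Lalgebra_isAlgebra.Build rat (oext E) oscaleAr.

Variables (n : nat) (z : E).
Hypotheses (on : odd n) (hz : gr n.+1 z) (dz : diff z = 0).

Let gro m : set (oext E) := [set u | gr m u.1 /\ shifted n m u.2].
Let diffo (u : oext E) : oext E := (diff u.1 + z * u.2, - diff u.2).

Let zC (a : E) : a * z = z * a.
Proof. by rewrite (gr_evenC _ hz) //= on. Qed.

Let proj_lin k (c : rat) (u v : oext E) :
  ((cmp (c *: u + v).1 k, if (n <= k)%N then cmp (c *: u + v).2 (k - n) else 0) : oext E) =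
  c *: ((cmp u.1 k, if (n <= k)%N then cmp u.2 (k - n) else 0) : oext E) +
  (cmp v.1 k, if (n <= k)%N then cmp v.2 (k - n) else 0).
Proof.
apply: (congr2 pair (cmp_linear k c u.1 v.1)).
case: leqP => _; first exact: cmp_linear.
by rewrite -[RHS]/(c *: (0 : E) + 0) scaler0 addr0.
Qed.
Let proj k : {linear oext E -> oext E} := mk_linear (proj_lin k).

Let osum (I : Type) (r : seq I) (F : I -> oext E) :
  \sum_(i <- r) F i = (\sum_(i <- r) (F i).1, \sum_(i <- r) (F i).2).
Proof. by elim: r => [|i r IH]; rewrite ?big_nil // !big_cons IH. Qed.

Definition odd_dga : dga_on (oext E).
Proof.
apply: (@DgaOn _ gro diffo).
- move=> m; split.
    by split; [exact: (ss0 (gr_subspace m))|exact: (ss0 (shifted_subspace E n m))].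
  move=> c u v [h1 h2] [h3 h4]; split; first exact: (gr_subspace m).2.
  exact: (shifted_subspace E n m).2.
- case=> a b; have [N hN] := cmp_bound a; have [M hM] := shifted_sum n b.
  exists (maxn N M), (fun k => proj k (a, b)); split.
    by move=> k; split; [exact: cmp_gr|exact: shifted_cmp].
  rewrite osum; congr (_, _) => /=; last exact: (hM _ (leq_maxr N M)).
  by apply: cmp_sum_bound => k; rewrite geq_max => /andP[/hN].
- apply: (@direct_of_projections _ _ proj) => k m [a b] [ha hb].
  by rewrite /proj /= (cmp_shifted _ hb) (cmp_hom _ ha) eq_sym; case: eqP.
- by split; [exact: gr_one|left].
- move=> k m [a b] [a' b'] [ha hb] [ha' hb']; split; first exact: gr_mul.
  apply: (ssD (shifted_subspace E n _)).
    case: hb => [-> |[i [-> hb]]]; first by left; rewrite mul0r.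
    by right; exists (i + m)%N; rewrite addnA; split=> //; exact: gr_mul.
  case: hb' => [-> |[i [-> hb']]]; first by left; rewrite mulr0.
  by right; exists (k + i)%N; rewrite addnCA; split=> //; apply: gr_mul => //; exact: sg_gr.
- move=> k m [a b] [a' b'] [/= ha hb] [/= ha' hb']; rewrite !omulE oscaleE /=.
  rewrite {1}(gr_comm ha ha') signE; congr (_, _); rewrite addrC scalerDr; congr (_ + _).
    rewrite (sgE ha); case: hb' => [->|[i [-> hb']]]; first by rewrite mulr0 mul0r scaler0.
    rewrite -scalerAl (gr_comm ha hb') signE scalerA -exprD; apply: sign_odd.
    by rewrite !oddD !oddM oddD on; case: (odd k); case: (odd i).
  rewrite (sgE ha'); case: hb => [->|[i [-> hb]]]; first by rewrite mulr0 mul0r scaler0.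
  rewrite -scalerAl (gr_comm hb ha') signE scalerA -exprD; apply: sign_odd.
  by rewrite !oddD !oddM oddD on; case: (odd m); case: (odd i).
- move=> c u v.
  apply: (@etrans _ _ (c *: (diff u.1 + z * u.2) + (diff v.1 + z * v.2), c *: (- diff u.2) + - diff v.2)) => //.
  rewrite /diffo oscaleE oaddE /= !diff_linear mulrDr -scalerAr scalerDr scalerN opprD.
  by congr (_, _); zmod.
- move=> m [a b] [/= ha hb]; split=> /=.
    apply: (ssD (gr_subspace _)); first exact: diff_deg.
    case: hb => [->|[i [-> hb]]]; first by rewrite mulr0; exact: (ss0 (gr_subspace _)).
    by rewrite -addSn; exact: gr_mul.
  apply: (ssN (shifted_subspace E n _)); case: hb => [->|[i [-> hb]]]; first by left; rewrite d0.
  by right; exists i.+1; rewrite addnS; split=> //; exact: diff_deg.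
- move=> [a b]; rewrite /diffo /=; congr (_, _); last by rewrite dN diff_diff !oppr0.
  by rewrite dD diff_diff dM dz mul0r (sgE hz) -signr_odd /= on expr0 scale1r mulrN; zmod.
- move=> m [a b] [a' b'] [/= ha hb]; rewrite !omulE /diffo /= oscaleE oaddE /=.
  have sb : sg b = - ((-1) ^+ m *: b).
    case: hb => [->|[i [-> hb]]]; first by rewrite linear0 scaler0 oppr0.
    by rewrite (sgE hb) exprD -(signr_odd rat n) on expr1 mulN1r scaleNr opprK.
  congr (_, _).
    rewrite dM (sgE ha) !mulrDl !mulrDr scalerDr -!scalerAl -!scalerAr !mulrA zC.
    by zmod.
  have sz : sg z = z by rewrite (sgE hz) -signr_odd /= on expr0 scale1r.
  rewrite dD !dM sgK d_sg [sg (diff a + _)]linearD [sg (z * b)]sgM sz sb (sgE ha).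
  have zb x : (-1) ^+ m *: (b * (z * x)) = z * ((-1) ^+ m *: b) * x.
    by rewrite mulrA zC -scalerAr -scalerAl.
  have ss x : (-1) ^+ m *: ((-1) ^+ m *: x) = x.
    by rewrite scalerA -expr2 sqrr_sign scale1r.
  rewrite !mulrDl !mulrDr !scalerDr zb !(mulNr, mulrN) -!scalerAl scalerN ss.
  by zmod.
Defined.

Lemma adjoin_odd : exists (E' : cdgaType) (i : {lrmorphism E -> E'}) (w : E'),
  [/\ [/\ cdga_mor i, gr n w & diff w = i z],
      forall e, exists a b, e = i a + w * i b,
      forall a b, i a + w * i b = 0 -> a = 0 /\ b = 0
    & forall (C : gcaType) (f : {lrmorphism E -> C}) (c : C), graded_mor f -> gr n c ->
      exists h : {lrmorphism E' -> C}, [/\ graded_mor h, forall a, h (i a) = f a & h w = c]].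
Proof.
have i_lin (c : rat) x y : ((c *: x + y, 0) : oext E) = c *: ((x, 0) : oext E) + (y, 0).
  by rewrite oscaleE oaddE /= scaler0 addr0.
have i_mul x y : ((x * y, 0) : oext E) = ((x, 0) : oext E) * (y, 0).
  by rewrite omulE /= mul0r mulr0 addr0.
pose i : {lrmorphism E -> oext E} := mk_lrmorphism i_lin erefl i_mul.
pose w : oext E := (0, 1).
have iw a b : i a + w * i b = (a, b).
  by rewrite omulE oaddE /= mul0r mul1r linear0 mul0r !addr0 add0r.
exists (mk_cdga odd_dga), i, w; split.
- split; first split.
  + by move=> m x hx; split=> //; left.
  + by move=> x; rewrite -[RHS]/(diffo (i x)) /diffo /= mulr0 addr0 d0 oppr0.
  + split; first exact: (ss0 (gr_subspace n)).
    by right; exists 0%N; rewrite addn0; split=> //; exact: gr_one.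
  + by rewrite -[LHS]/(diffo w) /diffo /= d0 d1 mulr1 add0r oppr0.
- by case=> a b; exists a, b; rewrite iw.
- by move=> a b; rewrite [LHS]iw => -[].
- move=> C f c hf hc.
  have cC x : f x * c = c * f (sg x) by rewrite (grC _ hc) on /= -(sg_mor hf).
  have h_lin (d : rat) (u v : oext E) : f (d *: u + v).1 + c * f (d *: u + v).2 =
      d *: (f u.1 + c * f u.2) + (f v.1 + c * f v.2).
    by rewrite oscaleE oaddE /= !linearP mulrDr -scalerAr scalerDr; zmod.
  have h_mul (u v : oext E) : f (u * v).1 + c * f (u * v).2 =
      (f u.1 + c * f u.2) * (f v.1 + c * f v.2).
    case: u v => [a b] [a' b']; rewrite omulE /= lrD !lrM !mulrDl !mulrDr.
    rewrite !mulrA cC -[c * f b * c]mulrA cC [c * (c * _)]mulrA (gr_odd_sqr hc on) !mul0r addr0.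
    by zmod.
  have h1 : f (1 : oext E).1 + c * f (1 : oext E).2 = 1 by rewrite lr1 lr0 mulr0 addr0.
  exists (mk_lrmorphism h_lin h1 h_mul); split.
  + move=> m [a b] [/= ha hb]; apply: (ssD (gr_subspace _)); first exact: hf.
    case: hb => [->|[k [-> hb]]]; first by rewrite lr0 mulr0; exact: (ss0 (gr_subspace _)).
    by apply: gr_mul => //; exact: hf.
  + by move=> a; rewrite /= lr0 mulr0 addr0.
  + by rewrite /= lr0 lr1 mulr1 add0r.
Qed.

End OddExtension.
(** For [w] of even degree, the polynomial [p] stands for the sum of the
    [p`_i * w ^+ i]. *)
Definition eext (E : cdgaType) : Type := {poly E}.

Section EvenExtension.
Variable E : cdgaType.
HB.instance Definition _ := GRing.NzRing.copy (eext E) {poly E}.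

Definition escale (c : rat) (p : eext E) : eext E := (c *: (1 : E)) *: (p : {poly E}).

Lemma coef_escale c (p : eext E) i : (escale c p : {poly E})`_i = c *: (p : {poly E})`_i.
Proof. by rewrite coefZ -scalerAl mul1r. Qed.

Lemma escaleA c d (p : eext E) : escale c (escale d p) = escale (c * d) p.
Proof. by apply/polyP => i; rewrite !coef_escale scalerA. Qed.
Lemma escale1 : left_id 1 escale.
Proof. by move=> p; apply/polyP => i; rewrite coef_escale scale1r. Qed.
Lemma escaleDr : right_distributive escale +%R.
Proof. by move=> c p q; apply/polyP => i; rewrite coefD !coef_escale coefD scalerDr. Qed.
Lemma escaleDl (p : eext E) : {morph escale^~ p : c d / c + d}.
Proof. by move=> c d; apply/polyP => i; rewrite coefD !coef_escale scalerDl. Qed.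
HB.instance Definition _ :=
  GRing.Zmodule_isLmodule.Build rat (eext E) escaleA escale1 escaleDr escaleDl.

Lemma coef_scale c (p : eext E) i : (c *: p : {poly E})`_i = c *: (p : {poly E})`_i.
Proof. exact: coef_escale. Qed.

Lemma escaleAl c (p q : eext E) : c *: (p * q) = (c *: p : eext E) * q.
Proof.
apply/polyP => i; rewrite coef_scale !coefM scaler_sumr; apply: eq_bigr => j _.
by rewrite coef_scale scalerAl.
Qed.
Lemma escaleAr c (p q : eext E) : c *: (p * q) = p * (c *: q : eext E).
Proof.
apply/polyP => i; rewrite coef_scale !coefM scaler_sumr; apply: eq_bigr => j _.
by rewrite coef_scale scalerAr.
Qed.
HB.instance Definition _ := GRing.Lmodule_isLalgebra.Build rat (eext E) escaleAl.
HB.instance Definition _ := GRing.Lalgebra_isAlgebra.Build rat (eext E) escaleAr.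

Variables (n : nat) (z : E).
Hypotheses (en : ~~ odd n) (hz : gr n.+1 z) (dz : diff z = 0).

Local Notation P p := (p : {poly E}).

Let gre m : set (eext E) := [set p | forall i, shifted (n * i) m (P p)`_i].
Let diffe (p : eext E) : eext E := map_poly dL (P p) + z *: (P p)^`().

Let coefd (p : eext E) i : (P (diffe p))`_i = diff (P p)`_i + z * (P p)`_i.+1 *+ i.+1.
Proof. by rewrite coefD coef_map coefZ coef_deriv mulrnAr. Qed.

Let sgmap (p : eext E) : eext E := map_poly sg (P p).

Let zC (a : E) : z * a = sg a * z.
Proof. by rewrite (grC' _ hz) /= en. Qed.

Let leib (p q : eext E) : diffe (p * q) = diffe p * q + sgmap p * diffe q.
Proof.
change (map_poly dL (P p * P q) + z *: (P p * P q)^`() =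
  (map_poly dL (P p) + z *: (P p)^`()) * P q +
  map_poly sg (P p) * (map_poly dL (P q) + z *: (P q)^`())).
rewrite derivM mulrDl mulrDr scalerDr -scalerAl.
have -> : map_poly dL (P p * P q) = map_poly dL (P p) * P q + map_poly sg (P p) * map_poly dL (P q).
  apply/polyP => i; rewrite coefD coef_map !coefM.
  apply: etrans (d_sum _ _ _) _; rewrite -big_split; apply: eq_bigr => j _.
  by rewrite !coef_map; exact: dM.
have -> : z *: (P p * (P q)^`()) = map_poly sg (P p) * (z *: (P q)^`()).
  apply/polyP => i; rewrite coefZ !coefM mulr_sumr; apply: eq_bigr => j _ /=.
  by rewrite coefZ coef_map /= mulrA zC mulrA.
by zmod.
Qed.

Let sg_shift i m (a : E) : shifted (n * i) m a -> sg a = (-1) ^+ m *: a.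
Proof.
case=> [->|[k [-> ha]]]; first by rewrite linear0 scaler0.
by rewrite (sgE ha); apply: sign_odd; rewrite oddD oddM (negbTE en).
Qed.

Let ecoef (p : eext E) k := \poly_(i < size (P p)) (if (n * i <= k)%N then cmp (P p)`_i (k - n * i) else 0).

Let ecoefE (p : eext E) k i :
  (ecoef p k)`_i = if (n * i <= k)%N then cmp (P p)`_i (k - n * i) else 0.
Proof. by rewrite coef_poly; case: ltnP => // h; rewrite nth_default // cmp0 if_same. Qed.

Let ecoef_lin k (c : rat) (p q : eext E) :
  (ecoef (c *: p + q) k : eext E) = c *: (ecoef p k : eext E) + (ecoef q k : eext E).
Proof.
apply/polyP => i; rewrite coefD coef_scale !ecoefE coefD coef_scale.
by case: leqP => _; [exact: cmp_linear|rewrite scaler0 addr0].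
Qed.
Let eproj k : {linear eext E -> eext E} := mk_linear (ecoef_lin k).

Definition even_dga : dga_on (eext E).
Proof.
apply: (@DgaOn _ gre diffe).
- move=> m; split=> [i|c p q hp hq i]; first by rewrite coef0; left.
  by rewrite coefD coef_scale; apply: (shifted_subspace _ _ _).2.
- move=> p.
  have /choice[N hN] := fun i => shifted_sum (n * i) (P p)`_i.
  exists (\max_(i < size (P p)) N i)%N, (fun k => eproj k p); split.
    by move=> k i; rewrite /= ecoefE; exact: shifted_cmp.
  apply/polyP => i; rewrite coef_sum.
  have [h|h] := ltnP i (size (P p)).
    apply: etrans (hN i _ (leq_bigmax (Ordinal h))) _; apply: eq_bigr => k _.
    by rewrite /= ecoefE.
  rewrite nth_default // big1 // => k _ /=; rewrite ecoefE nth_default //.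
  by rewrite cmp0 if_same.
- apply: (@direct_of_projections _ _ eproj) => k m p hp; apply/polyP => i /=.
  by rewrite ecoefE (cmp_shifted _ (hp i)); case: eqP => _ //; rewrite coef0.
- by move=> i; rewrite coef1; case: i => [|i]; [right; exists 0%N; rewrite muln0; split=> //; exact: gr_one|left].
- move=> k m p q hp hq i; rewrite coefM; apply: ss_sum; first exact: shifted_subspace.
  move=> j _; case: (hp j) => [->|[a [-> ha]]]; first by rewrite mul0r; left.
  case: (hq (i - j)%N) => [->|[b [-> hb]]]; first by rewrite mulr0; left.
  right; exists (a + b)%N; split; last exact: gr_mul.
  by rewrite addnACA -mulnDr subnKC // -ltnS.
- move=> k m p q hp hq; apply/polyP => i; apply: etrans _ (esym (coef_scale _ _ _)).
  rewrite coefM coefMr scaler_sumr; apply: eq_bigr => j _; case: (hp j) => [->|[a [-> ha]]]; first by rewrite mulr0 mul0r scaler0.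
  case: (hq (i - j)%N) => [->|[b [-> hb]]]; first by rewrite mulr0 mul0r scaler0.
  rewrite (gr_comm ha hb) signE; apply: sign_odd.
  by rewrite !oddM !oddD !oddM (negbTE en).
- move=> c p q; apply/polyP => i; apply: etrans (coefd _ _) _.
  apply: etrans _ (esym (coefD _ _ _)); rewrite coef_scale !coefd !coefD !coef_scale.
  by rewrite diff_linear mulrDr -scalerAr mulrnDl scalerMnr scalerDr; zmod.
- move=> m p hp i; rewrite coefd; apply: ssD; first exact: shifted_subspace.
    case: (hp i) => [->|[k [-> h]]]; first by rewrite d0; left.
    by right; exists k.+1; rewrite addnS; split=> //; exact: diff_deg.
  rewrite -scaler_nat; apply: ssZ; first exact: shifted_subspace.
  case: (hp i.+1) => [->|[k [-> h]]]; first by rewrite mulr0; left.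
  right; exists (n.+1 + k)%N; split; last exact: gr_mul.
  by rewrite mulnS !addnA addnS addSn [(n * i + n)%N]addnC.
- move=> p; apply/polyP => i; rewrite coef0 !coefd.
  rewrite dD diff_diff add0r -[_ *+ i.+1]scaler_nat dZ dM dz mul0r add0r (sgE hz).
  rewrite -signr_odd /= en expr1 scaleN1r mulNr mulrDr mulrnDl scalerN.
  rewrite -scaler_nat addrA addNr add0r mulrnAr mulrA (gr_odd_sqr hz) //=.
  by rewrite mul0r !mul0rn.
- move=> m p q hp; rewrite leib; congr (_ + _); apply/polyP => i.
  apply: etrans _ (esym (coef_scale _ _ _)); rewrite !coefM scaler_sumr; apply: eq_bigr => j _.
  have -> : (P (sgmap p))`_j = (-1) ^+ m *: (P p)`_j.
    by rewrite coef_map; exact: sg_shift (hp j).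
  by rewrite scalerAl.
Defined.

Lemma adjoin_even : exists (E' : cdgaType) (i : {lrmorphism E -> E'}) (w : E'),
  [/\ [/\ cdga_mor i, gr n w & diff w = i z],
      forall e, exists a e', e = i a + w * e',
      forall a b, i a + w * b = 0 -> a = 0 /\ b = 0,
      forall e, subalg_gen (range i `|` [set w]) e
    & forall (C : gcaType) (f : {lrmorphism E -> C}) (c : C), graded_mor f -> gr n c ->
      exists h : {lrmorphism E' -> C}, [/\ graded_mor h, forall a, h (i a) = f a & h w = c]].
Proof.
have i_lin (c : rat) (x y : E) : ((c *: x + y)%:P : eext E) = c *: (x%:P : eext E) + y%:P.
  by apply/polyP => i; rewrite coefD coef_scale !coefC; case: eqP => _ //; rewrite scaler0 addr0.
pose i : {lrmorphism E -> eext E} := mk_lrmorphism i_lin erefl (@polyCM E).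
pose w : eext E := 'X.
have wC (p : eext E) : w * p = p * w by rewrite -commr_polyX.
exists (mk_cdga even_dga), i, w; split.
- split; first split.
  + move=> m x hx j; rewrite /= coefC; case: j => [|j]; last by left.
    by right; exists m; rewrite muln0.
  + move=> x; rewrite -[RHS]/(diffe (i x)); apply/polyP => j; rewrite coefd /= !coefC.
    by case: j => [|j] /=; rewrite mulr0 mul0rn addr0 ?d0.
  + move=> j; rewrite coefX; case: j => [|[|j]]; [by left| |by left].
    by right; exists 0%N; rewrite muln1 addn0; split=> //; exact: gr_one.
  + rewrite -[LHS]/(diffe w); apply/polyP => j; rewrite coefd !coefX /= coefC.
    by case: j => [|[|j]] /=; rewrite ?mulr1 ?mulr0 ?mul0rn ?d0 ?d1 ?addr0 ?add0r.
- move=> e; elim/poly_ind: e => [|p c _]; first by exists 0, 0; rewrite mulr0 addr0 lr0.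
  by exists c, p; rewrite addrC wC.
- move=> a b e; suff b0 : b = 0.
    split=> //; move: e; rewrite b0 mulr0 addr0 => /(congr1 (fun p : {poly E} => p`_0)).
    by rewrite coefC coef0.
  apply/polyP => j; move/(congr1 (fun p : {poly E} => p`_j.+1)): e.
  by rewrite wC coefD coefC coefMX !coef0 /= add0r.
- move=> e; have [_ hS1 hM] := subalg_gen_subalg (range i `|` [set w]).
  have [hS _ _] := subalg_gen_subalg (range i `|` [set w]).
  elim/poly_ind: e => [|p c IH]; first exact: (ss0 hS).
  apply: (ssD hS); last by apply: subalg_gen_sub; left; exists c.
  by apply: hM => //; apply: subalg_gen_sub; right.
- move=> C f c hf hc.
  have cfu : commr_rmorph f c by move=> x; rewrite /GRing.comm (gr_evenC _ hc en).
  pose h0 : eext E -> C := horner_morph cfu.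
  have h_lin (d : rat) (p q : eext E) : h0 (d *: p + q) = d *: h0 p + h0 q.
    rewrite /h0 rmorphD; congr (_ + _).
    rewrite -[d *: p]/((d *: (1 : E)) *: (p : {poly E})) -mul_polyC.
    apply: etrans (rmorphM (horner_morph cfu) _ _) _.
    apply: etrans (congr2 *%R (horner_morphC cfu _) erefl) _.
    apply: etrans (congr2 *%R (etrans (lrZ f _ _) (congr1 _ (lr1 f))) erefl) _.
    by rewrite -scalerAl mul1r.
  exists (mk_lrmorphism h_lin (rmorph1 _) (rmorphM _)); split.
  + move=> m p hp; rewrite /= /h0 /horner_morph horner_coef; apply: ss_sum; first exact: gr_subspace.
    move=> j _; rewrite coef_map /=; case: (hp j) => [->|[k [-> ha]]].
      by rewrite lr0 mul0r; exact: (ss0 (gr_subspace _)).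
    by rewrite addnC; apply: gr_mul; [exact: hf|exact: grX].
  + by move=> a; rewrite /= /h0 horner_morphC.
  + by rewrite /= /h0 horner_morphX.
Qed.

End EvenExtension.

Section Adjoin.
Variables (E : cdgaType) (n : nat) (z : E).
Hypotheses (hz : gr n.+1 z) (dz : diff z = 0).

(** Both parities have these properties in common: [w] is linearly new, and a
    morphism is determined by its values on [E] and on [w]. *)
Lemma adjoin : exists (E' : cdgaType) (i : {lrmorphism E -> E'}) (w : E'),
  [/\ [/\ cdga_mor i, injective i, gr n w & diff w = i z],
      forall e, exists a e', e = i a + w * e',
      forall a c, i a + c *: w = 0 -> c = 0,
      forall e, subalg_gen (range i `|` [set w]) e
    & forall (C : gcaType) (f : {lrmorphism E -> C}) (c : C), graded_mor f -> gr n c ->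
      exists h : {lrmorphism E' -> C}, [/\ graded_mor h, forall a, h (i a) = f a & h w = c]].
Proof.
have scal (E' : cdgaType) (i : {lrmorphism E -> E'}) (w : E') a c :
    (forall a b, i a + w * i b = 0 -> a = 0 /\ b = 0) -> i a + c *: w = 0 -> c = 0.
  move=> hu e; have [_ /eqP] : a = 0 /\ c *: (1 : E) = 0.
    by apply: hu; rewrite lrZ lr1 -scalerAr mulr1.
  by rewrite scaler_eq0 oner_eq0 orbF => /eqP.
have inj (E' : cdgaType) (i : {lrmorphism E -> E'}) (w : E') :
    (forall a b, i a + w * i b = 0 -> a = 0 /\ b = 0) -> injective i.
  move=> hu x y e; apply/eqP; rewrite -subr_eq0; apply/eqP.
  by apply: (hu _ 0 _).1; rewrite lr0 mulr0 addr0 lrB e subrr.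
have [on|en] := boolP (odd n).
  have [E' [i [w [[h1 h2 h3] hs hu hw]]]] := adjoin_odd on hz dz.
  exists E', i, w; split=> //.
  - by split=> //; exact: inj hu.
  - by move=> e; have [a [b ->]] := hs e; exists a, (i b).
  - by move=> a c; exact: scal.
  - move=> e; have [a [b ->]] := hs e.
    have [hS _ hM] := subalg_gen_subalg (range i `|` [set w]).
    apply: (ssD hS); first by apply: subalg_gen_sub; left; exists a.
    by apply: hM; apply: subalg_gen_sub; [right|left; exists b].
have [E' [i [w [[h1 h2 h3] hs hu0 hg hw]]]] := adjoin_even en hz dz.
have hu a b : i a + w * i b = 0 -> a = 0 /\ b = 0.
  move=> /hu0[-> e]; split=> //; suff : i b + w * 0 = 0 by case/hu0.
  by rewrite mulr0 addr0.
exists E', i, w; split=> //; last by move=> a c; exact: scal.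
by split=> //; exact: inj hu.
Qed.

End Adjoin.
(** * A criterion for homotopy retractions *)

Section GradedMaps.
Variables A B : gcaType.
Variable f : {lrmorphism A -> B}.
Hypothesis hf : graded_mor f.

Lemma inj_reflect_gr : injective f -> forall n x, gr n (f x) -> gr n x.
Proof.
move=> hi n x h; have -> : x = cmp x n by apply: hi; rewrite cmp_mor // gr_cmp.
exact: cmp_gr.
Qed.

Lemma lift_gr n x : gr n (f x) -> f (cmp x n) = f x.
Proof. by move=> h; rewrite cmp_mor // gr_cmp. Qed.
End GradedMaps.

Lemma cdga_mor_gen (A B : cdgaType) (f : {lrmorphism A -> B}) (G : set A) :
  graded_mor f -> (forall a, subalg_gen G a) ->
  (forall g, G g -> f (diff g) = diff (f g)) -> cdga_mor f.
Proof.
move=> hf hG h; split=> //; apply: (gen_sub hG) => //.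
split=> /=.
- split=> /=; first by rewrite !(d0, lr0).
  by move=> c x y hx hy; rewrite dD dZ !lrD !lrZ dD dZ hx hy.
- by rewrite lr1 !d1 lr0.
- by move=> x y hx hy; rewrite lrM !dM lrD !lrM hx hy sg_mor.
Qed.

Lemma cdga_mor_cob (A B : cdgaType) (f : {lrmorphism A -> B}) x :
  cdga_mor f -> coboundary x -> coboundary (f x).
Proof. by move=> hf [y ->]; exists (f y); rewrite hf.2. Qed.

Lemma cdga_mor_cocycle (A B : cdgaType) (f : {lrmorphism A -> B}) x :
  cdga_mor f -> diff x = 0 -> diff (f x) = 0.
Proof. by move=> hf h; rewrite -hf.2 h lr0. Qed.

Lemma inj_cocycle (A B : cdgaType) (f : {lrmorphism A -> B}) x :
  cdga_mor f -> injective f -> diff (f x) = 0 -> diff x = 0.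
Proof. by move=> hf hi h; apply: hi; rewrite hf.2 h lr0. Qed.

(** Connectedness, simple connectedness and finite type in one. *)
Definition fin_gen (A : gcaType) := exists s : seq A,
  (forall x, x \in s -> exists d, (2 <= d)%N /\ gr d x) /\
  forall a, subalg_gen [set x | x \in s] a.

Section FinGen.
Variable A : gcaType.
Hypothesis hA : fin_gen A.

Lemma fin_gen0 (x : A) : gr 0 x -> exists c : rat, x = c *: 1.
Proof.
have [s [hs hg]] := hA; suff h : forall a : A, exists c : rat, cmp a 0 = c *: 1.
  by move=> hx; have := h x; rewrite gr_cmp.
apply: (gen_ind hg).
- split; first by exists 0; rewrite cmp0 scale0r.
  move=> c x' y [e hx] [e' hy]; exists (c * e + e').
  by rewrite cmp_linear hx hy scalerDl scalerA.
- by exists 1; rewrite (gr_cmp gr_one) scale1r.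
- move=> g b hgs _; have [d [d2 hd]] := hs g hgs.
  by exists 0; rewrite (cmpMl _ _ hd) leqn0; case: d d2 {hd} => // d _; rewrite scale0r.
Qed.

Lemma fin_gen1 (x : A) : gr 1 x -> x = 0.
Proof.
have [s [hs hg]] := hA; suff h : forall a : A, cmp a 1 = 0.
  by move=> hx; rewrite -(gr_cmp hx) h.
apply: (gen_ind hg).
- exact: (ker_subspace (cmpL 1)).
- by rewrite (cmp_hom _ gr_one).
- move=> g b hgs _; have [d [d2 hd]] := hs g hgs.
  by rewrite (cmpMl _ _ hd) leqNgt d2.
Qed.

Lemma fin_gen_type n : exists l : seq A, @gr A n `<=` fspan l.
Proof.
have [s [hs hg]] := hA.
suff [l hl] : exists l : seq A, forall a, fspan l (cmp a n).
  by exists l => x hx; rewrite -(gr_cmp hx).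
elim/ltn_ind: n => n IH.
have /choice[l hl] : forall m, exists l : seq A, (m < n)%N -> forall a, fspan l (cmp a m).
  by move=> m; case: (ltnP m n) => [/IH[l hl]|_]; [exists l|exists [::]].
have /choice[dg hdg] : forall g, exists d, g \in s -> (2 <= d)%N /\ gr d g.
  by move=> g; case: (pselect (g \in s)) => [/hs[d hd]|]; [exists d|exists 0%N].
pose L := 1 :: flatten [seq [seq g * x | x <- l (n - dg g)%N] | g <- s].
exists L; apply: (gen_ind hg).
- exact: (preim_subspace (cmpL n) (fspan_subspace L)).
- rewrite (cmp_hom _ gr_one); case: eqP => _; first by apply: fspan_mem; rewrite inE eqxx.
  exact: (ss0 (fspan_subspace L)).
- move=> g b hgs _; have [d2 hd] := hdg g hgs.
  rewrite (cmpMl _ _ hd); case: leqP => hdn; last exact: (ss0 (fspan_subspace L)).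
  have h : fspan (l (n - dg g)%N) (cmp b (n - dg g)).
    by apply: hl; rewrite ltn_subrL (leq_trans _ d2) // (leq_trans _ hdn) // (leq_trans _ d2).
  suff : fspan (l (n - dg g)%N) `<=` [set x | fspan L (g * x)] by move/(_ _ h).
  apply: fspan_min => [|x hx].
    split; first by have := ss0 (fspan_subspace L); rewrite -{1}(mulr0 g).
    by move=> c x y hx hy; have := (fspan_subspace L).2 c _ _ hx hy; rewrite scalerAr -mulrDr.
  apply: fspan_mem; rewrite inE; apply/orP; right; apply/flattenP.
  by exists [seq g * x | x <- l (n - dg g)%N]; [apply: map_f|apply: map_f].
Qed.

End FinGen.

Lemma subalg_gen_image (A B : algType rat) (f : {lrmorphism A -> B}) (G : set A) (G' : set B) a :
  (forall g, G g -> subalg_gen G' (f g)) -> subalg_gen G a -> subalg_gen G' (f a).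
Proof.
move=> h; exact: (subalg_gen_min (preim_subalgebra f (subalg_gen_subalg G')) h).
Qed.

Lemma fin_gen_surj (A B : gcaType) (f : {lrmorphism A -> B}) : graded_mor f ->
  (forall b, exists a, f a = b) -> fin_gen A -> fin_gen B.
Proof.
move=> hf hs [s [h1 h2]]; exists [seq f x | x <- s]; split.
  by move=> _ /mapP[x hx ->]; have [d [d2 hd]] := h1 x hx; exists d; split=> //; exact: hf.
move=> b; have [a <-] := hs b; apply: subalg_gen_image (h2 a) => g hg.
by apply: subalg_gen_sub; apply: map_f.
Qed.

Section Retraction.
Variables (T B : cdgaType) (rho : {lrmorphism T -> B}) (K : set T).
Hypotheses (hrho : cdga_mor rho) (rho_surj : forall b, exists t, rho t = b).
Hypotheses (hK : ideal K) (hKh : homogeneous K) (ker_rho : forall t, rho t = 0 -> K t).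
Hypotheses (hKd : forall t, K (diff t))
  (hKz : forall t, exists u, diff u = 0 /\ K (t - u))
  (hKe : forall t, diff t = 0 -> K t -> coboundary t).
Hypothesis hT : fin_gen T.

Let hB : fin_gen B. Proof. exact: fin_gen_surj hrho.1 rho_surj hT. Qed.
Let sK : subspace K. Proof. by case: hK. Qed.

(** An approximation of a relative model of [rho], with its retraction. *)
Record stage := Stage {
  sE : cdgaType;
  si : {lrmorphism T -> sE};
  sp : {lrmorphism sE -> B};
  st : {lrmorphism sE -> T}
}.

Definition inj_upto (S : stage) n := forall k (e : sE S), (k <= n)%N -> gr k e ->
  diff e = 0 -> coboundary (sp S e) -> coboundary e.
Definition surj_upto (S : stage) n := forall k (b : B), (k <= n)%N -> gr k b ->
  diff b = 0 -> exists e, [/\ gr k e, diff e = 0 & coboundary (b - sp S e)].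

(** The maps to [B] and [T] agree modulo [K]; this is what allows the
    retraction to be extended to a new generator. *)
Definition good n (S : stage) := [/\
  [/\ cdga_mor (si S), cdga_mor (sp S) & cdga_mor (st S)],
  (forall t, sp S (si S t) = rho t) /\ (forall t, st S (si S t) = t),
  forall e, exists t, rho t = sp S e /\ K (t - st S e),
  fin_gen (sE S) & inj_upto S n.+1 /\ surj_upto S n].

Definition free_over d (E E' : cdgaType) (j : {lrmorphism E -> E'}) (W : set E') :=
  forall (C : gcaType) (f : {lrmorphism E -> C}) (g : E' -> C), graded_mor f ->
    (forall (c : rat) x y, W x -> W y -> g (c *: x + y) = c *: g x + g y) ->
    (forall x, W x -> gr d (g x)) ->
    exists h : {lrmorphism E' -> C}, [/\ graded_mor h, forall e, h (j e) = f e
      & forall w, W w -> h w = g w].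

Definition extension d (S S' : stage) (j : {lrmorphism sE S -> sE S'}) (W : set (sE S')) :=
  [/\ [/\ cdga_mor j, injective j & forall t, si S' t = j (si S t)],
      (forall e, sp S' (j e) = sp S e) /\ (forall e, st S' (j e) = st S e),
      [/\ subspace W, W `<=` gr d & forall w, W w -> range j (diff w)],
      forall e, subalg_gen (range j `|` W) e
    & free_over d j W].

(** Cocycles of the mapping cone of [sp S].  They treat at the same time the classes
    of [sE S] that die in [B] and the classes of [B] that have to be reached. *)
Definition cone_cocycle (S : stage) n (x : sE S * B) :=
  [/\ gr n.+2 x.1, diff x.1 = 0, gr n.+1 x.2 & sp S x.1 = diff x.2].
Definition cone_boundary (S : stage) (x : sE S * B) :=
  exists e b, x.1 = diff e /\ x.2 = sp S e + diff b.

Lemma cone_cocycle_sub S n : subspace (@cone_cocycle S n).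
Proof.
split; first split=> /=; rewrite ?d0 ?lr0 //; try exact: (ss0 (gr_subspace _)).
move=> c [z b] [z' b'] [/= h1 h2 h3 h4] [/= h1' h2' h3' h4']; split=> /=.
- exact: (gr_subspace _).2.
- by rewrite diff_linear h2 h2' scaler0 addr0.
- exact: (gr_subspace _).2.
- by rewrite lrD lrZ h4 h4' diff_linear.
Qed.

Lemma cone_boundary_sub S : subspace (@cone_boundary S).
Proof.
split; first by exists 0, 0; split; rewrite /= ?d0 ?lr0 ?addr0.
move=> c [z b] [z' b'] [e [u [/= -> ->]]] [e' [u' [/= -> ->]]].
exists (c *: e + e'), (c *: u + u'); rewrite /= !diff_linear lrD lrZ; split=> //.
by rewrite scalerDr; zmod.
Qed.

(** A cone class is killed by a new generator [w] with [dw = z] and value [b] in [B].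
    The retraction extends to [w]: [st S z] lies in [K], hence bounds, and the
    bounding element can be corrected by a cocycle so as to agree with a lift of
    [b] modulo [K]. *)
Lemma adjoin_one S n (x : sE S * B) : (1 <= n)%N -> good n S ->
  cone_cocycle n x -> ~ cone_boundary x ->
  exists S' j W, [/\ extension n.+1 j W, good n S',
    forall e' : sE S', gr n.+2 e' -> exists e : sE S, e' = j e
    & cone_boundary (j x.1, x.2)].
Proof.
case: x => z b n1 [[mi mp mt] [epi eti] hcomp hfg [hinj hsurj]] [/= zg dz bg pz] nbd.
have [t [tg dt [tb [etb Ktb]]]] : exists t, [/\ gr n.+1 t, diff t = st S z
    & exists t', rho t' = b /\ K (t' - t)].
  have [tb0 etb0] := rho_surj b; pose tb := cmp tb0 n.+1.
  have etb : rho tb = b by rewrite /tb lift_gr ?etb0 //; exact: hrho.1.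
  have Kz : K (st S z).
    have [t' [e' Kt']] := hcomp z.
    have -> : st S z = (t' - diff tb) + diff tb - (t' - st S z) by zmod.
    apply: ssB => //; apply: ssD => //; apply: ker_rho.
    by rewrite lrB e' hrho.2 etb pz subrr.
  have [t0 t0g et0] : exists2 t0, gr n.+1 t0 & st S z = diff t0.
    apply: cob_hom; first exact: mt.1.
    by apply: hKe => //; rewrite -mt.2 dz lr0.
  have [u [du Ku]] := hKz (tb - t0).
  exists (t0 + cmp u n.+1); split.
  - by apply: (ssD (gr_subspace _)) => //; exact: cmp_gr.
  - by rewrite dD -cmp_d du cmp0 addr0.
  - exists tb; split=> //; have := hKh n.+1 Ku; rewrite !cmpB (gr_cmp t0g) (gr_cmp (cmp_gr tb0 n.+1)).
    by rewrite opprD addrA.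
have [E' [j [w [[mj ij wg dw] hdec hscal hgen huniv]]]] := adjoin zg dz.
have [p [gp ejp ewp]] := huniv B (sp S) b mp.1 bg.
have [tau [gt ejt ewt]] := huniv T (st S) t mt.1 tg.
have mp' : cdga_mor p.
  apply: (cdga_mor_gen gp hgen) => _ [[e _ <-]|->].
    by rewrite -mj.2 !ejp mp.2.
  by rewrite dw ejp ewp pz.
have mt' : cdga_mor tau.
  apply: (cdga_mor_gen gt hgen) => _ [[e _ <-]|->].
    by rewrite -mj.2 !ejt mt.2.
  by rewrite dw ejt ewt dt.
have [i' ei'] : exists i' : {lrmorphism T -> E'}, forall t, i' t = j (si S t).
  by exists (j \o si S).
pose S' := Stage i' p tau.
have fg' : fin_gen E'.
  have [s [h1 h2]] := hfg; exists (w :: [seq j y | y <- s]); split.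
    move=> y; rewrite inE => /orP[/eqP ->|/mapP[v /h1[d [d2 hd]] ->]]; first by exists n.+1.
    by exists d; split=> //; exact: mj.1.
  move=> e; move: (hgen e); apply: subalg_gen_mono => _ [[v _ <-]|->]; last first.
    by apply: subalg_gen_sub; rewrite /= inE eqxx.
  apply: subalg_gen_image (h2 v) => g hg; apply: subalg_gen_sub.
  by rewrite /= inE map_f ?orbT.
(* the low degree part of E': w occurs linearly, with scalar coefficient *)
have low k (e' : E') : gr k e' -> (k <= n.+2)%N ->
    exists (e : sE S) (c : rat), [/\ gr k e, e' = j e + c *: w & c = 0 \/ k = n.+1].
  move=> ge hk; have [a [v e]] := hdec e'.
  have := congr1 (fun y => cmp y k) e; rewrite (gr_cmp ge) cmpD -(cmp_mor mj.1) (cmpMl _ _ wg).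
  case: (ltngtP k n.+1) => [_|hlt|ek].
  - by move=> ->; exists (cmp a k), 0; rewrite scale0r; split; [exact: cmp_gr| |left].
  - have -> : k = n.+2 by apply/eqP; rewrite eqn_leq hk.
    rewrite subSn // subnn (fin_gen1 fg' (cmp_gr v 1)) mulr0 => ->.
    by exists (cmp a n.+2), 0; rewrite scale0r; split; [exact: cmp_gr| |left].
  - have -> : (k - n.+1 = 0)%N by rewrite ek subnn.
    have [c ->] := fin_gen0 fg' (cmp_gr v 0).
    rewrite -scalerAr mulr1 => ->.
    by exists (cmp a k), c; split; [exact: cmp_gr| |right].
have gd : good n S'.
  split=> //=.
  - split=> //; split=> [d y hy|y]; first by rewrite ei'; apply: mj.1; exact: mi.1.
    by rewrite !ei' mi.2 mj.2.
  - by split=> y; rewrite ei' ?ejp ?ejt ?epi ?eti.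
  - apply: (gen_sub hgen).
      have [_ Kl Kr] := hK; split=> /=.
      - split; first by exists 0; rewrite !lr0 subr0; split=> //; exact: (ss0 sK).
        move=> c y y' [s1 [e1 K1]] [s2 [e2 K2]]; exists (c *: s1 + s2); rewrite !lrD !lrZ e1 e2.
        split=> //; have -> : c *: s1 + s2 - (c *: tau y + tau y') = c *: (s1 - tau y) + (s2 - tau y').
          by rewrite scalerBr; zmod.
        exact: sK.2.
      - by exists 1; rewrite !lr1 subrr; split=> //; exact: (ss0 sK).
      - move=> y y' [s1 [e1 K1]] [s2 [e2 K2]]; exists (s1 * s2); rewrite !lrM e1 e2; split=> //.
        have -> : s1 * s2 - tau y * tau y' = (s1 - tau y) * s2 + tau y * (s2 - tau y').
          by rewrite mulrBl mulrBr; zmod.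
        by apply: ssD => //; [exact: Kr|exact: Kl].
    move=> _ [[v _ <-]|->] /=; first by rewrite ejp ejt; exact: hcomp.
    by exists tb; rewrite ewp ewt.
  - split; last first.
      move=> k b0 hk gb db; have [e [ge de he]] := hsurj k b0 hk gb db.
      by exists (j e); rewrite /= ejp; split; [exact: mj.1|exact: cdga_mor_cocycle|].
    move=> k e' hk ge de hp /=.
    have [e [c [eg ee hc]]] := low k e' ge (leq_trans hk (leqnSn _)).
    have c0 : c = 0.
      have [//|ek] := hc; apply/eqP; apply: contra_notT nbd => c0.
      have [b1 eb1] := hp; rewrite /= ee lrD lrZ ejp ewp in eb1.
      have de' : diff e = - c *: z.
        apply: ij; rewrite mj.2; apply/eqP; rewrite lrZ scaleNr -addr_eq0 -dw -dZ -dD -ee.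
        by rewrite de.
      exists (- c^-1 *: e), (c^-1 *: b1) => /=; split.
        by rewrite dZ de' scalerA mulrNN mulVf // scale1r.
      by rewrite lrZ dZ -eb1 scalerDr scalerA mulVf // scale1r scaleNr addKr.
    rewrite c0 scale0r addr0 in ee; rewrite ee in de hp *.
    apply: cdga_mor_cob => //; apply: (hinj k) => //; first exact: inj_cocycle de.
    by rewrite /= ejp in hp.
exists S', j, [set y | exists c : rat, y = c *: w]; split=> //.
- split=> //.
  + split.
    * split; first by exists 0; rewrite scale0r.
      move=> c _ _ [c1 ->] [c2 ->]; exists (c * c1 + c2).
      by rewrite scalerDl scalerA.
    * by move=> _ [c ->]; apply: ssZ => //; exact: gr_subspace.
    * by move=> _ [c ->]; exists (c *: z) => //; rewrite lrZ -dw dZ.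
  + move=> e; move: (hgen e); apply: subalg_gen_mono => v [hv|->]; apply: subalg_gen_sub.
      by left.
    by right; exists 1; rewrite scale1r.
  + move=> C f g gf glin gdeg.
    have hw : exists c : rat, w = c *: w by exists 1; rewrite scale1r.
    have [h [h1 h2 h3]] := huniv C f (g w) gf (gdeg w hw).
    exists h; split=> // _ [c ->]; rewrite lrZ h3.
    have g0 : g 0 = 0.
      have := glin (-1) w w hw hw.
      by rewrite scaleN1r addNr => ->; rewrite scaleN1r addNr.
    rewrite -[c *: w]addr0 glin //; first by rewrite g0 addr0.
    by exists 0; rewrite scale0r.
- move=> e' ge; have [e [c [_ -> [->|/eqP]]]] := low _ e' ge (leqnn _).
    by exists e; rewrite scale0r addr0.
  by rewrite eqn_leq ltnn.
- by exists w, 0; rewrite /= dw ewp d0 addr0.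
Qed.

Lemma free_over_comp d (E0 E1 E2 : cdgaType) (j1 : {lrmorphism E0 -> E1})
    (j2 : {lrmorphism E1 -> E2}) (j : {lrmorphism E0 -> E2}) W1 W2 :
  (forall e, j e = j2 (j1 e)) -> W1 0 -> W2 0 ->
  free_over d j1 W1 -> free_over d j2 W2 ->
  free_over d j [set w | exists w1 w2, [/\ W1 w1, W2 w2 & w = j2 w1 + w2]].
Proof.
move=> ej z1 z2 f1 f2 C f g gf glin gdeg.
have [||h1 [g1 e1 w1]] := f1 C f (g \o j2) gf.
- move=> c x y hx hy /=; rewrite lrD lrZ glin //.
    by exists x, 0; rewrite addr0.
  by exists y, 0; rewrite addr0.
- by move=> x hx; apply: gdeg; exists x, 0; rewrite addr0.
have [||h2 [g2 e2 w2]] := f2 C h1 g g1.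
- by move=> c x y hx hy; apply: glin; [exists 0, x|exists 0, y]; rewrite lr0 add0r.
- by move=> x hx; apply: gdeg; exists 0, x; rewrite lr0 add0r.
exists h2; split=> //; first by move=> e; rewrite ej e2 e1.
move=> _ [x [y [hx hy ->]]]; rewrite lrD e2 w1 // w2 //=.
have := glin 1 (j2 x) y; rewrite !scale1r => -> //; first by exists x, 0; rewrite addr0.
by exists 0, y; rewrite lr0 add0r.
Qed.

Lemma adjoin_list n (l : nat) : (1 <= n)%N -> forall (S : stage) (s : seq (sE S * B)),
  size s = l -> good n S -> {in s, forall x, cone_cocycle n x} ->
  (forall x : sE S * B, cone_cocycle n x -> exists y, fspan s y /\ cone_boundary (x - y)) ->
  exists S' j W, @extension n.+1 S S' j W /\ good n.+1 S'.
Proof.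
move=> n1; elim: l => [|l IH] S s hsz gS hs hspan.
  (* the cone is acyclic in the degree at hand *)
  have acyc (x : sE S * B) : cone_cocycle n x -> cone_boundary x.
    move=> hx; have [y [hy]] := hspan x hx; move: hy; rewrite (size0nil hsz) /= => ->.
    by rewrite subr0.
  exists S, idfun, [set 0]; split.
    split=> //=.
    - by split=> //; split=> // k x.
    - split; first exact: subspace0.
        by move=> _ ->; exact: (ss0 (gr_subspace _)).
      by move=> _ ->; exists 0 => //; rewrite d0.
    - by move=> e; apply: subalg_gen_sub; left; exists e.
    - move=> C f g gf glin gdeg; exists f; split=> // _ ->.
      by have := glin (-1) 0 0 erefl erefl; rewrite !scaleN1r addr0 oppr0 addNr lr0.
  have [m1 m2 m3 m4 [hinj hsurj]] := gS; split=> //; split.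
    move=> k e; rewrite leq_eqVlt => /orP[/eqP ->|h]; last exact: hinj.
    move=> ge de [b0 eb].
    have [|e0 [b1 [ee _]]] := acyc (e, cmp b0 n.+1); last by exists e0.
    split=> //=; first exact: cmp_gr.
    by rewrite -cmp_d -eb gr_cmp //; case: m1 => _ h _; exact: h.1.
  move=> k b; rewrite leq_eqVlt => /orP[/eqP ->|h]; last exact: hsurj.
  move=> gb db.
  have [|e0 [b1 [/= e1 e2]]] := acyc (0, b).
    by split=> //=; rewrite ?d0 ?lr0 ?db //; exact: (ss0 (gr_subspace _)).
  exists (cmp e0 n.+1); split; [exact: cmp_gr|by rewrite -cmp_d -e1 cmp0|].
  exists (cmp b1 n); rewrite -cmp_d -[in LHS](gr_cmp gb) e2 cmpD cmp_mor; first by zmod.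
  by case: m1 => _ h _; exact: h.1.
case: s hsz hs hspan => // x s [hsz] hs hspan.
have hx : cone_cocycle n x by apply: hs; rewrite inE eqxx.
have hs' : {in s, forall y, cone_cocycle n y} by move=> y hy; apply: hs; rewrite inE hy orbT.
have bs := @cone_boundary_sub.
have [hbd|hbd] := pselect (cone_boundary x).
  apply: (IH S s) => // y hy; have [_ [[c [y' [hy' ->]]] hb]] := hspan y hy.
  exists y'; split=> //; have -> : y - y' = (y - (c *: x + y')) + c *: x by zmod.
  by apply: ssD => //; exact: ssZ.
have [S1 [j1 [W1 [ex1 g1 hj1 hb1]]]] := adjoin_one n1 gS hx hbd.
have [[mj1 ij1 ei1] [ep1 et1] [sW1 dW1 rW1] gen1 fr1] := ex1.
pose jj (y : sE S * B) : sE S1 * B := (j1 y.1, y.2).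
have jj_lin (c : rat) y y' : jj (c *: y + y') = c *: jj y + jj y'.
  by rewrite /jj /= lrD lrZ.
have hjb y : cone_boundary y -> cone_boundary (jj y).
  by case=> e [b [e1 e2]]; exists (j1 e), b; rewrite /= e1 e2 mj1.2 ep1.
have [||||S2 [j2 [W2 [ex2 g2]]]] := IH S1 [seq jj y | y <- s].
- by rewrite size_map.
- by [].
- move=> _ /mapP[y /hs'[h1 h2 h3 h4] ->]; split=> //=; [exact: mj1.1|exact: cdga_mor_cocycle|].
  by rewrite ep1.
- move=> [z b] [/= h1 h2 h3 h4]; have [z0 ez] := hj1 z h1; rewrite ez in h1 h2 h4 *.
  have [|_ [[c [y' [hy' ->]]] hb]] := hspan (z0, b).
    split=> //=; [exact: (inj_reflect_gr mj1.1 ij1)|exact: inj_cocycle h2|].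
    by rewrite -h4 ep1.
  exists (jj y'); split.
    suff : fspan s `<=` [set y | fspan [seq jj y | y <- s] (jj y)] by move/(_ _ hy').
    apply: fspan_min => [|y hy]; last by apply/fspan_mem/map_f.
    exact: (preim_subspace (mk_linear jj_lin) (fspan_subspace _)).
  have -> : (j1 z0, b) - jj y' = jj ((z0, b) - (c *: x + y')) + c *: jj x.
    pose jjL := mk_linear jj_lin.
    have e : jjL ((z0, b) - (c *: x + y')) = jjL (z0, b) - (c *: jjL x + jjL y').
      by rewrite linearB linearP.
    rewrite -[jj (_ - _)]/(jjL _) e -[jj x]/(jjL x) -[jj y']/(jjL y') -[(j1 z0, b)]/(jjL (z0, b)).
    by zmod.
  by apply: ssD => //; [exact: hjb|exact: ssZ].
have [[mj2 ij2 ei2] [ep2 et2] [sW2 dW2 rW2] gen2 fr2] := ex2.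
exists S2, (j2 \o j1), [set w | exists w1 w2, [/\ W1 w1, W2 w2 & w = j2 w1 + w2]].
split=> //; split.
- split; [|exact: inj_comp|by move=> t /=; rewrite ei2 ei1].
  by split=> [k y hy|y] /=; [exact/mj2.1/mj1.1|rewrite mj1.2 mj2.2].
- by split=> e /=; rewrite ?ep2 ?ep1 ?et2 ?et1.
- split.
  + split; first by exists 0, 0; rewrite lr0 addr0; split=> //; exact: ss0.
    move=> c _ _ [a [b [ha hb ->]]] [a' [b' [ha' hb' ->]]].
    exists (c *: a + a'), (c *: b + b'); split; [exact: sW1.2|exact: sW2.2|].
    by rewrite lrD lrZ scalerDr; zmod.
  + move=> _ [a [b [ha hb ->]]]; apply: (ssD (gr_subspace _)); last exact: dW2.
    exact/mj2.1/dW1.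
  + move=> _ [a [b [ha hb ->]]]; rewrite dD -mj2.2.
    have [a' _ ea] := rW1 _ ha; have [e _ ee] := rW2 _ hb.
    (* generators of the later steps also bound in the first algebra *)
    have [e0 e0E] : exists e0, e = j1 e0.
      apply: hj1; apply: (inj_reflect_gr mj2.1 ij2); rewrite ee.
      by apply: diff_deg; exact: dW2.
    by exists (a' + e0) => //=; rewrite !lrD ea -e0E ee.
- move=> e; move: (gen2 e); apply: subalg_gen_mono => v0 [[v _ <-]|hw]; last first.
    by apply: subalg_gen_sub; right; exists 0, v0; rewrite lr0 add0r; split=> //; exact: ss0.
  apply: subalg_gen_image (gen1 v) => g hg; apply: subalg_gen_sub; case: hg => [[u _ <-]|hw].
    by left; exists u.
  by right; exists g, 0; rewrite addr0; split=> //; exact: ss0.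
- by apply: (free_over_comp _ _ _ fr1 fr2) => //; exact: ss0.
Qed.

(** By finite type a degree needs finitely many new generators. *)
Lemma next_stage n S : (1 <= n)%N -> good n S ->
  exists S' j W, @extension n.+1 S S' j W /\ good n.+1 S'.
Proof.
move=> n1 gS; have [_ _ _ hfg _] := gS.
have [l1 hl1] := fin_gen_type hfg n.+2; have [l2 hl2] := fin_gen_type hB n.+1.
have [|s [hs1 hs2]] := @fspan_subspace_gen _ ([seq (x, 0 : B) | x <- l1] ++ [seq (0 : sE S, y) | y <- l2])
    _ (@cone_cocycle_sub S n).
  move=> [z b] [/= zg _ bg _].
  set L := _ ++ _; have sL := fspan_subspace L.
  have l_lin (c : rat) (x y : sE S) : ((c *: x + y, 0) : sE S * B) = c *: ((x, 0) : sE S * B) + (y, 0).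
    by apply: (congr2 pair) => //; rewrite -[RHS]/(c *: (0 : B) + 0) scaler0 addr0.
  have r_lin (c : rat) (x y : B) : ((0, c *: x + y) : sE S * B) = c *: ((0, x) : sE S * B) + (0, y).
    by apply: (congr2 pair) => //; rewrite -[RHS]/(c *: (0 : sE S) + 0) scaler0 addr0.
  have -> : (z, b) = (z, 0) + (0, b) by congr (_, _); rewrite /= ?addr0 ?add0r.
  apply: ssD => //.
    suff : fspan l1 `<=` [set x | fspan L (x, 0)] by move/(_ _ (hl1 _ zg)).
    apply: fspan_min => [|x hx]; last by apply: fspan_mem; rewrite mem_cat map_f.
    exact: (preim_subspace (mk_linear l_lin) sL).
  suff : fspan l2 `<=` [set y | fspan L (0, y)] by move/(_ _ (hl2 _ bg)).
  apply: fspan_min => [|y hy]; last by apply: fspan_mem; rewrite mem_cat map_f ?orbT.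
  exact: (preim_subspace (mk_linear r_lin) sL).
apply: (@adjoin_list n (size s) n1 S s) => // x hx.
by exists x; rewrite subrr; split; [exact: hs2|exact: (ss0 (@cone_boundary_sub _))].
Qed.

End Retraction.
Section ColimitMaps.
Variables (E : nat -> cdgaType) (j : forall n, {lrmorphism E n -> E n.+1}).
Variables (L : cdgaType) (l : forall n, {lrmorphism E n -> L}).
Hypotheses (hl : forall n, cdga_mor (l n)) (lS : forall n x, l n.+1 (j n x) = l n x)
  (linj : forall n, injective (l n)) (lsurj : forall u, exists n x, l n x = u).
Hypothesis hj : forall n, cdga_mor (j n).

Lemma colim_up n x m : (n <= m)%N -> exists y, l m y = l n x.
Proof.
move/subnK <-; elim: (m - n)%N => [|d [y e]]; first by exists x.
by exists (j _ y); rewrite -[X in l X]/((d + n).+1) lS.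
Qed.

Lemma colim_surj2 u v : exists n x y, l n x = u /\ l n y = v.
Proof.
have [n [x <-]] := lsurj u; have [m [y <-]] := lsurj v; exists (maxn n m).
have [x' ex] := colim_up x (leq_maxl n m); have [y' ey] := colim_up y (leq_maxr n m).
by exists x', y'.
Qed.

Lemma colim_eq (C : Type) (f : forall n, E n -> C) :
  (forall n x, f n.+1 (j n x) = f n x) ->
  forall n m x y, l n x = l m y -> f n x = f m y.
Proof.
move=> fS; have up n m x : (n <= m)%N -> exists y, l m y = l n x /\ f m y = f n x.
  move/subnK <-; elim: (m - n)%N => [|d [y [e1 e2]]]; first by exists x.
  by exists (j _ y); rewrite -[X in l X]/((d + n).+1) -[X in f X]/((d + n).+1) lS fS.
move=> n m x y e.
have [x' [e1 <-]] := up _ _ x (leq_maxl n m); have [y' [e2 <-]] := up _ _ y (leq_maxr n m).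
by congr f; apply: linj; rewrite e1 e2.
Qed.

Lemma colim_map (C : algType rat) (f : forall n, {lrmorphism E n -> C}) :
  (forall n x, f n.+1 (j n x) = f n x) ->
  exists h : {lrmorphism L -> C}, forall n x, h (l n x) = f n x.
Proof.
move=> fS.
have /choice[h hh] : forall u, exists c, forall n x, l n x = u -> f n x = c.
  move=> u; have [n [x <-]] := lsurj u; exists (f n x) => m y.
  exact: (colim_eq (f := fun n => f n)).
have hE n x : h (l n x) = f n x by symmetry; exact: hh.
have h_lin (c : rat) u v : h (c *: u + v) = c *: h u + h v.
  by have [n [x [y [<- <-]]]] := colim_surj2 u v; rewrite -lrZ -lrD !hE lrD lrZ.
have h_mul u v : h (u * v) = h u * h v.
  by have [n [x [y [<- <-]]]] := colim_surj2 u v; rewrite -lrM !hE lrM.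
have h1 : h 1 = 1 by rewrite -(lr1 (l 0)) hE lr1.
by exists (mk_lrmorphism h_lin h1 h_mul).
Qed.

Lemma colim_gr d u : gr d u -> exists n x, gr d x /\ l n x = u.
Proof.
have [n [x <-]] := lsurj u => h; exists n, x; split=> //.
exact: (inj_reflect_gr (hl n).1 (@linj n)).
Qed.

Lemma colim_gr_up d u N : gr d u -> exists n x, [/\ (N <= n)%N, gr d x & l n x = u].
Proof.
move=> hu; have [n [x e]] := lsurj u; have [y ey] := colim_up x (leq_maxl n N).
exists (maxn n N), y; rewrite leq_maxr ey e; split=> //.
by apply: (inj_reflect_gr (hl _).1 (@linj _)); rewrite ey e.
Qed.

Lemma colim_graded (C : gcaType) (f : forall n, {lrmorphism E n -> C}) (h : {lrmorphism L -> C}) :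
  (forall n, graded_mor (f n)) -> (forall n x, h (l n x) = f n x) -> graded_mor h.
Proof.
by move=> hf hh d u /colim_gr[n [x [hx <-]]]; rewrite hh; exact: hf.
Qed.

Lemma colim_cdga (C : cdgaType) (f : forall n, {lrmorphism E n -> C}) (h : {lrmorphism L -> C}) :
  (forall n, cdga_mor (f n)) -> (forall n x, h (l n x) = f n x) -> cdga_mor h.
Proof.
move=> hf hh; split; first by apply: (colim_graded _ hh) => n; case: (hf n).
by move=> u; have [n [x <-]] := lsurj u; rewrite -(hl n).2 !hh (hf n).2.
Qed.

End ColimitMaps.

Lemma quasi_iso_hom (A B : cdgaType) (f : {lrmorphism A -> B}) : cdga_mor f ->
  (forall k a, gr k a -> diff a = 0 -> coboundary (f a) -> coboundary a) ->
  (forall k b, gr k b -> diff b = 0 -> exists a, diff a = 0 /\ coboundary (b - f a)) ->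
  quasi_iso f.
Proof.
move=> hf hi hs; split=> //.
  move=> a da [b eb]; have [n ->] := cmp_sum a.
  apply: (ss_sum (@cob_subspace A)) => k _.
  apply: (hi k); [exact: cmp_gr|exact: cocycle_cmp|].
  by rewrite (cmp_mor hf.1) eb; apply: cob_cmp; exists b.
move=> b db; have [n eb] := cmp_sum b.
have /choice[a ha] := fun k => hs k (cmp b k) (cmp_gr b k) (cocycle_cmp k db).
exists (\sum_(k < n) a k).
have [v ev] : coboundary (b - f (\sum_(k < n) a k)).
  rewrite {1}eb lr_sum -sumrB; apply: (ss_sum (@cob_subspace B)) => k _.
  by case: (ha k).
exists (- v); split; first by rewrite d_sum big1 // => k _; case: (ha k).
by rewrite dN -ev; zmod.
Qed.

Section Tower.
Variables (T B : cdgaType) (rho : {lrmorphism T -> B}) (K : set T).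
Hypotheses (hrho : cdga_mor rho) (rho_surj : forall b, exists t, rho t = b).
Hypotheses (hK : ideal K) (hKh : homogeneous K) (ker_rho : forall t, rho t = 0 -> K t).
Hypotheses (hKd : forall t, K (diff t))
  (hKz : forall t, exists u, diff u = 0 /\ K (t - u))
  (hKe : forall t, diff t = 0 -> K t -> coboundary t).
Hypothesis hT : fin_gen T.

Let start : stage T B := Stage idfun rho idfun.

Let start_good : good rho K 1 start.
Proof.
have hB := fin_gen_surj hrho.1 rho_surj hT.
split=> //=.
- by split=> //; split=> // k x.
- by move=> e; exists e; split=> //; rewrite subrr; apply: ss0; case: hK.
- split=> k.
    move=> e hk ge de hc; apply: hKe => //; apply: ker_rho.
    have rg := hrho.1 _ _ ge; case: k hk ge rg => [|[|[|k]]] // _ ge rg.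
    + by have := hc; rewrite /= => -[b eb]; rewrite -(gr_cmp rg) [rho e]eb cmp_d0.
    + exact: (fin_gen1 hB).
    + have [b gb ->] := cob_hom rg hc.
      by rewrite (fin_gen1 hB gb) d0.
  move=> b hk gb db; case: k hk gb => [|[|k]] // _ gb.
    have [c ->] := fin_gen0 hB gb; exists (c *: 1); split.
    + by apply: (ssZ (gr_subspace _)); exact: gr_one.
    + by rewrite dZ d1 scaler0.
    + by rewrite /= lrZ lr1 subrr; exact: (ss0 (@cob_subspace _)).
  rewrite (fin_gen1 hB gb); exists 0; split.
  + exact: (ss0 (gr_subspace _)).
  + exact: d0.
  + by rewrite /= lr0 subrr; exact: (ss0 (@cob_subspace _)).
Qed.

Let tstage n := {S : stage T B | good rho K n.+1 S}.

Let step n (x : tstage n) : exists (y : tstage n.+1) j W,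
  @extension _ _ n.+2 (sval x) (sval y) j W.
Proof.
have [S' [j [W [h1 h2]]]] := next_stage hrho rho_surj hK hKh ker_rho hKd hKz hKe hT (isT : 1 <= n.+1)%N (svalP x).
by exists (exist _ S' h2), j, W.
Qed.

Let tower : forall n, tstage n :=
  nat_rect tstage (exist _ start start_good) (fun n x => sval (cid (step x))).
Let E n : cdgaType := sE (sval (tower n)).
Let stepn n : exists j W, @extension _ _ n.+2 (sval (tower n)) (sval (tower n.+1)) j W.
Proof. exact: (svalP (cid (step (tower n)))). Qed.
Let j n : {lrmorphism E n -> E n.+1} := sval (cid (stepn n)).
Let Wn n : set (E n.+1) := sval (cid (svalP (cid (stepn n)))).
Let ext n : extension n.+2 (j n) (@Wn n).
Proof. exact: (svalP (cid (svalP (cid (stepn n))))). Qed.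

Let hj n : cdga_mor (j n). Proof. by case: (ext n) => -[]. Qed.
Let jinj n : injective (j n). Proof. by case: (ext n) => -[]. Qed.

(** A relative model is built degree by degree together with the retraction, which
    extends to new generators because modulo [K], an ideal that contains the kernel
    of [rho], boundaries vanish and every element is a cocycle. *)
Lemma homotopy_retraction_of_ideal : homotopy_retraction rho.
Proof.
have [L [l [hl lS linj lsurj]]] := colimit hj jinj.
have [pL hpL] := colim_map lS linj lsurj (f := fun n => sp (sval (tower n)))
  (fun n => let: And5 _ (conj h _) _ _ _ := ext n in h).
have [tL htL] := colim_map lS linj lsurj (f := fun n => st (sval (tower n)))
  (fun n => let: And5 _ (conj _ h) _ _ _ := ext n in h).
have gd n : good rho K n.+1 (sval (tower n)) := svalP (tower n).
pose i : {lrmorphism T -> L} := l 0%N.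
have mpL : cdga_mor pL.
  by apply: (colim_cdga hl linj lsurj _ hpL) => n; case: (gd n) => -[].
have mtL : cdga_mor tL.
  by apply: (colim_cdga hl linj lsurj _ htL) => n; case: (gd n) => -[].
pose W d : set L := if d is n.+2 then l n.+1 @` @Wn n else [set 0].
have Wsub d : subspace (W d) /\ W d `<=` gr d.
  case: d => [|[|n]]; try by split; [exact: subspace0|move=> _ ->; exact: (ss0 (gr_subspace _))].
  have [_ _ [h1 h2 _] _ _] := ext n; split; first exact: image_subspace.
  by move=> _ [w hw <-]; apply: (hl _).1; exact: h2.
have genL (P : set L) : subalgebra P -> range i `<=` P ->
    forall m, (forall n, (n < m)%N -> W n.+2 `<=` P) -> forall e, P (l m e).
  move=> hP hi; elim=> [|m IH] hW e; first by apply: hi; exists e.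
  have [_ _ _ hg _] := ext m.
  have := hg e; apply: (subalg_gen_min (preim_subalgebra (l m.+1) hP)) => e0 [[x _ <-]|hx] /=.
    by rewrite lS; apply: IH => n hn; apply: hW; apply: leq_trans hn _.
  by apply: (hW m) => //; exists e0.
exists L, i, W, pL, tL; split.
- split=> //; first exact: (hl 0%N).
    split=> //; first exact: (hl 0%N).1.
    move=> C f g gf hg.
    have next n (x : {h : {lrmorphism E n -> C} | graded_mor h}) :
        exists y : {h : {lrmorphism E n.+1 -> C} | graded_mor h},
        (forall e, sval y (j n e) = sval x e) /\ (forall w, Wn w -> sval y w = g (l n.+1 w)).
      have [_ _ _ _ hf] := ext n.
      have [||h [h1 h2 h3]] := hf C (sval x) (fun w => g (l n.+1 w)) (svalP x).
      + move=> c w w' hw hw'; rewrite lrD lrZ; apply: (hg n.+2).1; [by exists w|by exists w'].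
      + by move=> w hw; apply: (hg n.+2).2; exists w.
      by exists (exist _ h h1).
    pose F : forall n, {h : {lrmorphism E n -> C} | graded_mor h} :=
      nat_rect (fun n => {h : {lrmorphism E n -> C} | graded_mor h})
        (exist _ f gf) (fun n x => sval (cid (next n x))).
    have FS n : (forall e, sval (F n.+1) (j n e) = sval (F n) e) /\
        (forall w, Wn w -> sval (F n.+1) w = g (l n.+1 w)) := svalP (cid (next n (F n))).
    have [h hh] := colim_map lS linj lsurj (f := fun n => sval (F n)) (fun n => (FS n).1).
    have gh : graded_mor h.
      by apply: (colim_graded hl linj lsurj _ hh) => n; exact: svalP.
    have g0 (d : nat) : g 0 = 0.
      by have := (hg d).1 (-1) 0 0 (ss0 (Wsub d).1) (ss0 (Wsub d).1); rewrite !scaleN1r addr0 oppr0 addNr.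
    have hW : {in gtotal W, h =1 g}.
      move=> u /set_mem[[|[|n]] _].
      + by move=> ->; rewrite lr0 (g0 0%N).
      + by move=> ->; rewrite lr0 (g0 0%N).
      + by case=> w hw <-; rewrite hh (FS n).2.
    exists h; split=> //; first by move=> t; exact: (hh 0%N t).
    move=> h' gh' hi' hW' u; have [n [x <-]] := lsurj u.
    apply: (genL [set y | h' y = h y]); first exact: eq_subalgebra.
      by move=> _ [t _ <-]; apply: etrans (hi' t) (esym (hh 0%N t)).
    move=> m _ w hw; have hw' : w \in gtotal W by apply: mem_set; exists m.+2.
    by rewrite /= hW' // hW.
  exists (fun k n => if (n <= k.+1)%N then W n else [set 0]); split.
  + split.
    * move=> k n; case: ifP => _; first exact: Wsub.
      by split; [exact: subspace0|move=> _ ->; exact: (ss0 (gr_subspace _))].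
    * move=> k n u; case: ifP => h; first by rewrite (leq_trans h (leqnSn _)).
      by move=> ->; case: ifP => _ //; exact: (ss0 (Wsub n).1).
    * move=> n; apply/seteqP; split=> u; first by move=> hu; exists n => //; rewrite leqnSn.
      by case=> k _; case: ifP => _ // ->; exact: (ss0 (Wsub n).1).
  + move=> u [n _]; case: ifP => [|_ ->]; last by exists 0 => //; rewrite d0 lr0.
    by case: n => [|[|n]] // _ ->; exists 0 => //; rewrite d0 lr0.
  + move=> k u [n _]; set S := subalg_gen _.
    have hS : subalgebra S by exact: subalg_gen_subalg.
    have S0 : S (diff 0) by rewrite d0; apply: ss0; case: hS.
    case: ifP => [|_ -> //]; case: n => [|[|n]] // hn; try by move=> ->.
    case=> w hw <-; have [_ _ [_ _ hr] _ _] := ext n.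
    have [e _ ee] := hr _ hw; rewrite -(hl _).2 -ee lS.
    apply: (genL S) => // [y hy|m hm y hy]; apply: subalg_gen_sub; first by left.
    right; exists m.+2 => //.
    by rewrite (_ : (m.+2 <= k.+1)%N) //; exact: leq_trans hm hn.
- apply: quasi_iso_hom => //.
    move=> k u gu du cu; have [n [x [hn gx ex]]] := colim_gr_up hl lS linj lsurj k gu.
    rewrite -ex; apply: cdga_mor_cob; first exact: hl.
    have [_ _ _ _ [hinj _]] := gd n.
    apply: (hinj k) => //.
    + by apply: leq_trans hn _; rewrite -addn2 leq_addr.
    + by apply: (inj_cocycle (hl n) (@linj n)); rewrite ex.
    + by rewrite -ex hpL in cu.
  move=> k b gb db; have [_ _ _ _ [_ hsurj]] := gd k.
  have [e [ge de he]] := hsurj k b (leqnSn _) gb db.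
  by exists (l k e); rewrite hpL; split=> //; exact: cdga_mor_cocycle.
- by move=> t; exact: (hpL 0%N t).
- exact: mtL.
- by move=> t; exact: (htL 0%N t).
Qed.

End Tower.
(** * Acyclic ideals *)

Section SignStable.
Variable A : gcaType.

Definition sg_stable (S : set A) := forall x, S x -> S (sg x).

Lemma homogeneous_sg S : subspace S -> homogeneous S -> sg_stable S.
Proof.
move=> hS hh x hx; have [n hn] := cmp_bound x.
rewrite (cmp_sum_bound hn) linear_sum; apply: ss_sum => // k _.
by rewrite (sgE (cmp_gr x k)); apply: ssZ => //; exact: hh.
Qed.

Lemma evp_sg x : evp x = 2^-1 *: (x + sg x) :> A.
Proof.
apply: (hom_eq (f := evp) (g := 2^-1 \*: (idfun \+ sg))) => n y hy /=.
rewrite (evpE hy) (sgE hy) -signr_odd; case: odd => /=; first by rewrite expr1 scaleN1r subrr scaler0.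
by rewrite expr0 scale1r -mulr2n -scaler_nat scalerA mulVf // scale1r.
Qed.

Lemma evp_stable S x : subspace S -> sg_stable S -> S x -> S (evp x).
Proof. by move=> hS hs hx; rewrite evp_sg; apply: ssZ => //; apply: ssD => //; exact: hs. Qed.

Lemma odp_stable S x : subspace S -> sg_stable S -> S x -> S (odp x).
Proof.
move=> hS hs hx; have -> : odp x = x - evp x by rewrite {2}[x]evp_odp; zmod.
by apply: ssB => //; exact: evp_stable.
Qed.

Lemma sg_evp x : sg (evp x) = evp x :> A.
Proof.
apply: (hom_eq (f := sg \o evp) (g := evp)) => n y hy /=; rewrite (evpE hy).
by case: (boolP (odd n)) => on; rewrite ?linear0 // (sgE hy) -signr_odd (negbTE on) scale1r.
Qed.

Lemma sg_odp x : sg (odp x) = - odp x :> A.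
Proof.
apply: (hom_eq (f := sg \o odp) (g := -%R \o odp)) => n y hy /=; rewrite (odpE hy).
by case: (boolP (odd n)) => on; rewrite ?linear0 ?oppr0 // (sgE hy) -signr_odd on scaleN1r.
Qed.

(** Split into even and odd parts. *)
Lemma complement_sg (S K : set A) : subspace S -> subspace K -> S `<=` K ->
  sg_stable S -> sg_stable K ->
  exists U, [/\ subspace U, U `<=` K, sg_stable U, forall x, U x -> S x -> x = 0
     & forall x, K x -> exists b u, [/\ S b, U u & x = b + u]].
Proof.
move=> hS hK hSK sS sK.
pose Ev := [set x : A | odp x = 0]; pose Od := [set x : A | evp x = 0].
have sEv : subspace Ev by exact: ker_subspace.
have sOd : subspace Od by exact: ker_subspace.
have EvE x : Ev x -> evp x = x by move=> h; rewrite {2}[x]evp_odp h addr0.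
have OdE x : Od x -> odp x = x by move=> h; rewrite {2}[x]evp_odp h add0r.
have [U0 [u1 u2 u3 u4]] := complement (subspaceI hS sEv) (subspaceI hK sEv)
  (fun x h => conj (hSK _ h.1) h.2).
have [U1 [v1 v2 v3 v4]] := complement (subspaceI hS sOd) (subspaceI hK sOd)
  (fun x h => conj (hSK _ h.1) h.2).
have ee x : evp (evp x) = evp x :> A.
  apply: (hom_eq (f := evp \o evp) (g := evp)) => n y hy /=; rewrite (evpE hy).
  by case: ifP => h; rewrite ?linear0 // (evpE hy) h.
have oe x : odp (evp x) = 0 :> A.
  by apply: (addrI (evp (evp x))); rewrite -evp_odp addr0 ee.
have eo x : evp (odp x) = 0 :> A.
  have : evp x = evp (evp x) + evp (odp x) by rewrite -linearD -evp_odp.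
  by rewrite ee -[X in X = _]addr0 => /addrI.
exists [set x | exists a b, [/\ U0 a, U1 b & x = a + b]]; split.
- split; first by exists 0, 0; rewrite addr0; split=> //; exact: ss0.
  move=> c _ _ [a [b [ha hb ->]]] [a' [b' [ha' hb' ->]]].
  exists (c *: a + a'), (c *: b + b'); split; [exact: u1.2|exact: v1.2|].
  by rewrite scalerDr; zmod.
- by move=> _ [a [b [/u2[ha _] /v2[hb _] ->]]]; exact: ssD.
- move=> _ [a [b [ha hb ->]]]; exists a, (- b); split=> //; first exact: ssN.
  by rewrite linearD /= -{1}(EvE _ (u2 _ ha).2) -{1}(OdE _ (v2 _ hb).2) sg_evp sg_odp
     (EvE _ (u2 _ ha).2) (OdE _ (v2 _ hb).2).
- move=> _ [a [b [ha hb ->]]] hx.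
  have ea : evp (a + b) = a by rewrite linearD /= (EvE _ (u2 _ ha).2) (v2 _ hb).2 addr0.
  have eb : odp (a + b) = b by rewrite linearD /= (OdE _ (v2 _ hb).2) (u2 _ ha).2 add0r.
  have a0 : a = 0.
    by apply: u3 => //; split; [rewrite -ea; exact: evp_stable|exact: (u2 _ ha).2].
  have b0 : b = 0.
    by apply: v3 => //; split; [rewrite -eb; exact: odp_stable|exact: (v2 _ hb).2].
  by rewrite a0 b0 addr0.
- move=> x hx.
  have [|b [u [[hb _] hu e]]] := u4 (evp x); first by split; [exact: evp_stable|exact: oe].
  have [|b' [u' [[hb' _] hu' e']]] := v4 (odp x); first by split; [exact: odp_stable|exact: eo].
  exists (b + b'), (u + u'); split; [exact: ssD|by exists u, u'|].
  by rewrite {1}[x]evp_odp e e'; zmod.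
Qed.

End SignStable.

(** A chain-level form of the acyclicity of [K], which unlike exactness passes to
    tensor products.  That [h] has odd degree is recorded only as anticommutation
    with [sg]. *)
Definition contraction (A : cdgaType) (K : set A) (s h : {linear A -> A}) :=
  [/\ forall x, K x -> s x = 0, forall x, K (x - s x),
      forall x, diff (h x) + h (diff x) = x - s x & forall x, h (sg x) = - sg (h x)].

(** Then [A -> A / K] is a quasi-isomorphism to an algebra with zero differential:
    this is formality, expressed inside [A]. *)
Definition acyclic_ideal (A : cdgaType) (K : set A) :=
  [/\ ideal K, homogeneous K, forall x, K (diff x) & exists s h, contraction K s h].

Section Contraction.
Variables (A : cdgaType) (K : set A) (s h : {linear A -> A}).
Hypothesis c : contraction K s h.

Lemma contr_comm x : diff (s x) = s (diff x).
Proof.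
have [_ _ c3 _] := c.
have e1 := congr1 diff (c3 x); have e2 := c3 (diff x).
rewrite dD diff_diff add0r dB in e1; rewrite diff_diff linear0 addr0 in e2.
have e3 : diff x - diff (s x) = diff x - s (diff x) by rewrite -e1 -e2.
by move/addrI/oppr_inj: e3.
Qed.

Lemma contr_sg x : s (sg x) = sg (s x).
Proof.
have [_ _ c3 c4] := c.
have e1 := congr1 sg (c3 x); have e2 := c3 (sg x).
rewrite linearD linearB /= sg_d -[sg (h (diff x))]opprK -c4 sg_d linearN opprK in e1.
rewrite -[sg (h x)]opprK -c4 dN opprK e2 in e1.
by move/addrI/oppr_inj: e1.
Qed.
End Contraction.

Section AcyclicIdeal.
Variables (A : cdgaType) (K : set A).
Hypothesis hK : acyclic_ideal K.

Lemma acyclic_cocycle_rep x : exists u, diff u = 0 /\ K (x - u).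
Proof.
have [_ _ kd [s [h c]]] := hK; have [c1 c2 _ _] := c.
by exists (s x); rewrite (contr_comm c) c1.
Qed.

Lemma acyclic_exact x : diff x = 0 -> K x -> coboundary x.
Proof.
have [_ _ kd [s [h [c1 _ c3 _]]]] := hK => dx kx; exists (h x).
by have := c3 x; rewrite dx linear0 addr0 c1 // subr0.
Qed.

Lemma coboundary_acyclic x : coboundary x -> K x.
Proof. by have [_ _ kd _] := hK; case=> y ->. Qed.
End AcyclicIdeal.

Lemma ker_ideal (A B : algType rat) (f : {lrmorphism A -> B}) : ideal [set x | f x = 0].
Proof.
split=> /=; first exact: ker_subspace.
  by move=> a x hx; rewrite lrM hx mulr0.
by move=> a x hx; rewrite lrM hx mul0r.
Qed.

Lemma ker_homogeneous (A B : gcaType) (f : {lrmorphism A -> B}) : graded_mor f ->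
  homogeneous [set x | f x = 0].
Proof. by move=> hf x k /= hx; rewrite cmp_mor // hx cmp0. Qed.

(** Linear complements, chosen compatibly with parities, contract the kernel of
    a quasi-isomorphism to an algebra with trivial differential. *)
Lemma acyclic_kernel (A H : cdgaType) (f : {lrmorphism A -> H}) :
  (forall x : H, diff x = 0) -> quasi_iso f -> acyclic_ideal [set x | f x = 0].
Proof.
move=> dH [mf finj fsurj]; set K := [set x | f x = 0].
have iK : ideal K by exact: ker_ideal.
have hK : homogeneous K by exact: ker_homogeneous mf.1.
have sK : subspace K by case: iK.
have Kd x : K (diff x) by rewrite /K /= mf.2 dH.
have KZ x : K x -> diff x = 0 -> coboundary x.
  by move=> kx dx; have [] := finj x dx; [exists 0; rewrite d0|move=> y ->; exists y].
have BK x : @coboundary A x -> K x by case=> y ->.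
have sB := @cob_subspace A.
have sZ : subspace (@cocycle A) by have [] := cocycle_subalg A.
have gB : sg_stable (@coboundary A).
  by move=> _ [y ->]; exists (- sg y); rewrite dN d_sg opprK.
have gZ : sg_stable (@cocycle A) by move=> x hx; rewrite /cocycle /= d_sg hx linear0 oppr0.
have gK : sg_stable K by exact: homogeneous_sg.
have [Hc [h1 h2 h3 h4 h5]] := complement_sg sB sZ (@cob_cocycle A) gB gZ.
have [U [u1 u2 u3 u4 u5]] := complement_sg sB sK BK gB gK.
have HK x : Hc x -> K x -> x = 0 by move=> hx kx; apply: h4 => //; apply: KZ => //; exact: h2.
have [s hs] : exists s : {linear A -> A}, forall x, Hc (s x) /\ K (x - s x).
  apply: projection => // x.
  have [z [b [dz]]] := fsurj (f x) (dH _); rewrite dH addr0 => ez.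
  have [b' [u [hb hu e]]] := h5 z dz.
  exists u, (b' + (x - z)); split=> //; last by rewrite e; zmod.
  by apply: ssD => //; [exact: BK|rewrite /K /= lrB ez subrr].
have sK0 x : K x -> s x = 0.
  move=> kx; apply: HK; first exact: (hs x).1.
  have -> : s x = x - (x - s x) by zmod.
  by apply: ssB => //; exact: (hs x).2.
have sH x : Hc x -> s x = x.
  move=> hx; apply/eqP; rewrite eq_sym -subr_eq0; apply/eqP; apply: HK; last exact: (hs x).2.
  by apply: ssB => //; exact: (hs x).1.
have ssg x : s (sg x) = sg (s x).
  have -> : sg x = sg (s x) + sg (x - s x) by rewrite -linearD; congr (sg _); zmod.
  have k1 : s (sg (x - s x)) = 0 by apply: sK0; apply: gK; exact: (hs x).2.
  by rewrite [s _]linearD k1 addr0; apply: sH; apply: h3; exact: (hs x).1.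
have ds x : diff (s x) = 0 by exact: (h2 _ (hs x).1).
pose R x y := U y /\ U (x - s x - diff y).
have Rex x : exists y, R x y.
  have [b [u [[a ->] hu e]]] := u5 _ (hs x).2.
  have [b' [u' [hb' hu' e']]] := u5 _ (hs a).2.
  exists u'; split=> //; have -> : diff u' = diff a.
    by have := congr1 diff e'; rewrite dB ds subr0 dD (cob_cocycle hb') add0r.
  by rewrite e addrAC subrr add0r.
have Run x y y' : R x y -> R x y' -> y = y'.
  move=> [a b] [a' b']; apply/eqP; rewrite -subr_eq0; apply/eqP.
  apply: (u4); first exact: ssB.
  apply: KZ; first by apply: u2; exact: ssB.
  rewrite dB; apply: u4; last by exists (y - y'); rewrite dB.
  by have := ssB u1 b' b; congr U; zmod.
have Rlin (c : rat) x y x' y' : R x y -> R x' y' -> R (c *: x + x') (c *: y + y').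
  move=> [a b] [a' b']; split; first exact: u1.2.
  have := u1.2 c _ _ b b'; congr U.
  by rewrite linearP diff_linear !scalerBr; zmod.
have [h hh] := linear_of_rel Rex Run Rlin.
split=> //; exists s, h; split=> //; first by move=> x; exact: (hs x).2.
- move=> x; have [hU1 hU2] := hh x.
  have -> : h (diff x) = x - s x - diff (h x).
    apply: (Run (diff x)); first exact: hh.
    split=> //; rewrite sK0 // subr0 dB dB ds diff_diff !subr0 subrr; exact: ss0.
  by zmod.
- move=> x; have [hU1 hU2] := hh x.
  apply: (Run (sg x)); first exact: hh.
  split; first by apply: ssN => //; exact: u3.
  have := u3 _ hU2; congr U; rewrite !linearB /= ssg dN d_sg; zmod.
Qed.
(** * Tensor powers *)

Section TensorFacts.
Variables (A B T : cdgaType) (l : {lrmorphism A -> T}) (r : {lrmorphism B -> T}).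
Hypotheses (ml : cdga_mor l) (mr : cdga_mor r).
Hypothesis univ : forall (M : lmodType rat) (beta : A -> B -> M), bilinear_map beta ->
  exists h : {linear T -> M}, forall a b, h (l a * r b) = beta a b.
Hypothesis ind : forall P : set T, subspace P -> (forall a b, P (l a * r b)) -> forall t, P t.

Lemma lr_bil : bilinear_map (fun a b => l a * r b).
Proof.
split=> [b c x y|a c x y]; first by rewrite lrD lrZ mulrDl -scalerAl.
by rewrite lrD lrZ mulrDr -scalerAr.
Qed.

Lemma ind_hom (P : set T) : subspace P ->
  (forall i j a b, gr i a -> gr j b -> P (l a * r b)) -> forall t, P t.
Proof.
move=> hP h; apply: ind => // a b; move: a; apply: hom_ind.
  split; first by rewrite /= lr0 mul0r; exact: (ss0 hP).
  by move=> c x y hx hy; rewrite /= lr_bil.1; apply: hP.2.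
move=> i a ha; move: b; apply: hom_ind; last by move=> j b hb; exact: h ha hb.
split; first by rewrite /= lr0 mulr0; exact: (ss0 hP).
by move=> c x y hx hy; rewrite /= lr_bil.2; apply: hP.2.
Qed.

Lemma lrM_hom a b a' b' j : gr j b ->
  (l a * r b) * (l a' * r b') = l (a * sgp (odd j) a') * r (b * b').
Proof.
move=> hb; rewrite !lrM !mulrA; congr (_ * _); rewrite -!mulrA; congr (_ * _).
by rewrite (grC' _ (mr.1 _ _ hb)); congr (_ * _); case: odd => //=; rewrite sg_mor //; exact: ml.1.
Qed.

Lemma tensor_copair (C : gcaType) (f : {lrmorphism A -> C}) (g : {lrmorphism B -> C}) :
  graded_mor f -> graded_mor g -> exists h : {lrmorphism T -> C},
    [/\ graded_mor h, forall a, h (l a) = f a & forall b, h (r b) = g b].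
Proof.
move=> hf hg.
have [|h hh] := univ (beta := fun a b => f a * g b).
  split=> [b c x y|a c x y]; first by rewrite lrD lrZ mulrDl -scalerAl.
  by rewrite lrD lrZ mulrDr -scalerAr.
have hl a : h (l a) = f a by rewrite -[l a]mulr1 -(lr1 r) hh lr1 mulr1.
have hr b : h (r b) = g b by rewrite -[r b]mul1r -(lr1 l) hh lr1 mul1r.
have hM x y : h (x * y) = h x * h y.
  move: x; apply: ind_hom.
    split; first by rewrite /= mul0r linear0 mul0r.
    by move=> c u v hu hv; rewrite /= mulrDl -scalerAl !linearP hu hv mulrDl -scalerAl.
  move=> i j a b ha hb; move: y; apply: ind.
    split; first by rewrite /= mulr0 linear0 mulr0.
    by move=> c u v hu hv; rewrite /= mulrDr -scalerAr !linearP hu hv mulrDr -scalerAr.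
  move=> a' b'; rewrite (lrM_hom _ _ _ hb) !hh !lrM !mulrA; congr (_ * _); rewrite -!mulrA; congr (_ * _).
  by rewrite (grC' _ (hg _ _ hb)); congr (_ * _); case: odd => //=; rewrite sg_mor.
have h1 : h 1 = 1 by rewrite -(lr1 l) hl lr1.
exists (mk_lrmorphism (fun c x y => linearP h c x y) h1 hM); split=> // n x hx.
have hc k t : h (cmp t k) = cmp (h t) k.
  move: t; apply: ind_hom; first exact: (eq_subspace (h \o cmpL k) (cmpL k \o h)).
  move=> i j a b ha hb; rewrite (cmp_hom _ (gr_mul (ml.1 _ _ ha) (mr.1 _ _ hb))) hh.
  by rewrite (cmp_hom _ (gr_mul (hf _ _ ha) (hg _ _ hb))) -(hh a b); case: eqP; rewrite ?linear0.
by rewrite /= -(gr_cmp hx) hc; exact: cmp_gr.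
Qed.

Variables (K : set A) (K' : set B).
Hypotheses (hK : acyclic_ideal K) (hK' : acyclic_ideal K').

Definition tensor_ideal : set T := span [set t | exists a b, (K a \/ K' b) /\ t = l a * r b].

Lemma tensor_ideal_sub : subspace tensor_ideal. Proof. exact: span_subspace. Qed.

Lemma tensor_idealI a b : K a \/ K' b -> tensor_ideal (l a * r b).
Proof. by move=> h; apply: span_sub; exists a, b. Qed.

(** With the usual signs, the homotopy is [h] on the left factor plus [s] on the left
    factor times [h'] on the right one. *)
Lemma tensor_ideal_acyclic : acyclic_ideal tensor_ideal.
Proof.
have [[sK Kl Kr] Kh Kd [s [h c]]] := hK; have [[sK' Kl' Kr'] Kh' Kd' [s' [h' c']]] := hK'.
have [c1 c2 c3 c4] := c; have [c1' c2' c3' c4'] := c'.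
have sI := tensor_ideal_sub.
have gK b a : K a -> K (sgp b a) by case: b => //; exact: homogeneous_sg.
have pieces (P : set T) : subspace P ->
    (forall i j a b, gr i a -> gr j b -> K a \/ K' b -> P (l a * r b)) -> tensor_ideal `<=` P.
  move=> hP hp; apply: span_min => // _ [a [b [hab ->]]].
  have [n ->] := cmp_sum a; have [m ->] := cmp_sum b.
  rewrite !lr_sum mulr_suml; apply: ss_sum => // i _; rewrite mulr_sumr; apply: ss_sum => // j _.
  apply: (hp i j); [exact: cmp_gr|exact: cmp_gr|].
  by case: hab => hx; [left; exact: Kh|right; exact: Kh'].
have hdiff a b : diff (l a * r b) = l (diff a) * r b + l (sg a) * r (diff b).
  by rewrite dM -ml.2 -mr.2 -(sg_mor ml.1).
have dI t : tensor_ideal (diff t).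
  move: t; apply: ind; first exact: (preim_subspace dL sI).
  by move=> a b; rewrite hdiff; apply: (ssD sI); apply: tensor_idealI; [left|right].
split=> //.
- split=> //.
    move=> t x hx; move: t; apply: ind_hom.
      split; first by rewrite /= mul0r; exact: ss0.
      by move=> d u v hu hv; rewrite /= mulrDl -scalerAl; apply: sI.2.
    move=> i j a b ha hb; move: x hx; apply: pieces.
      split; first by rewrite /= mulr0; exact: ss0.
      by move=> d u v hu hv; rewrite /= mulrDr -scalerAr; apply: sI.2.
    move=> i' j' a' b' _ _ hab; rewrite /= (lrM_hom _ _ _ hb); apply: tensor_idealI.
    by case: hab => hx; [left; apply/Kl/gK|right; exact: Kl'].
  move=> t x hx; move: t; apply: ind.
    split; first by rewrite /= mulr0; exact: ss0.
    by move=> d u v hu hv; rewrite /= mulrDr -scalerAr; apply: sI.2.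
  move=> a b; move: x hx; apply: pieces.
    split; first by rewrite /= mul0r; exact: ss0.
    by move=> d u v hu hv; rewrite /= mulrDl -scalerAl; apply: sI.2.
  move=> i' j' a' b' ha' hb' hab; rewrite /= (lrM_hom _ _ _ hb'); apply: tensor_idealI.
  by case: hab => hx; [left; exact: Kr|right; exact: Kr'].
- move=> x k hx; move: x hx; apply: pieces; first exact: (preim_subspace (cmpL k) sI).
  move=> i j a b ha hb hab; rewrite /= (cmp_hom _ (gr_mul (ml.1 _ _ ha) (mr.1 _ _ hb))).
  by case: eqP => _; [exact: tensor_idealI|exact: ss0].
have [|S hS] := univ (beta := fun a b => l (s a) * r (s' b)).
  by split=> [b d x y|a d x y]; rewrite linearP; [exact: lr_bil.1|exact: lr_bil.2].
have [|H hH] := univ (beta := fun a b => l (h a) * r b + l (s (sg a)) * r (h' b)).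
  split=> [b d x y|a d x y].
    by rewrite !linearP !mulrDl -!scalerAl scalerDr; zmod.
  by rewrite !linearP !mulrDr -!scalerAr scalerDr; zmod.
exists S, H; split.
- apply: span_min => [|_ [a [b [hab ->]]]]; first exact: ker_subspace.
  by rewrite /= hS; case: hab => hx; [rewrite c1 // lr0 mul0r|rewrite c1' // lr0 mulr0].
- apply: ind; first exact: (preim_subspace (idfun \- S) sI).
  move=> a b; rewrite /= hS.
  have -> : l a * r b - l (s a) * r (s' b) = l (a - s a) * r b + l (s a) * r (b - s' b).
    by rewrite !lrB mulrBl mulrBr; zmod.
  by apply: (ssD sI); apply: tensor_idealI; [left|right].
- move=> t; apply: (ind (P := [set t | ((dL \o H) \+ (H \o dL)) t = (idfun \- S) t])) => [|a b].
    exact: eq_subspace.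
  rewrite /= hH hdiff linearD /= !hH hS dD !hdiff -!(contr_sg c) !sgK.
  have e1 : h (diff a) = a - s a - diff (h a) by rewrite -c3; zmod.
  have e2 : h' (diff b) = b - s' b - diff (h' b) by rewrite -c3'; zmod.
  rewrite e1 e2 (contr_comm c) d_sg [s (- _)]linearN c4 !lrN !lrB !mulrBl !mulrBr !mulNr; zmod.
- move=> t; apply: (ind (P := [set t | (H \o sg) t = (-%R \o (sg \o H)) t])) => [|a b].
    exact: eq_subspace.
  rewrite /= sgM -(sg_mor ml.1) -(sg_mor mr.1) !hH [sg (_ + _)]linearD /= !sgM.
  rewrite -!(sg_mor ml.1) -!(sg_mor mr.1) c4 c4' !sgK -(contr_sg c) sgK.
  by rewrite !lrN mulNr mulrN opprD.
Qed.

End TensorFacts.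

Section TensorPowerFacts.
Variables (r : nat) (A T : cdgaType) (iota : 'I_r -> {lrmorphism A -> T}).
Hypothesis h : is_tensor_power iota.

Lemma tensor_power_ind (P : set T) : subspace P -> (forall a, P (\prod_i iota i (a i))) ->
  forall t, P t.
Proof.
move=> hP hp t; apply: contrapT => /(functional hP)[f [f0 f1]].
have [|g [_ gu]] := h.2 rat^o (fun=> 0); first by move=> a i c x y; rewrite scaler0 addr0.
have e1 : f =1 g by apply: gu => a; exact: f0.
have e2 : \0 =1 g by apply: gu => a.
by move: f1; rewrite e1 -e2 /= => /eqP; rewrite eq_sym oner_eq0.
Qed.

Lemma tensor_power_gen t : subalg_gen (\bigcup_i range (iota i)) t.
Proof.
have hS := subalg_gen_subalg (\bigcup_i range (iota i)).
move: t; apply: tensor_power_ind; first by case: hS.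
by move=> a; apply: subalg_prod => // i _; apply: subalg_gen_sub; exists i => //; exists (a i).
Qed.
End TensorPowerFacts.


Definition fcons (A : Type) n (a : A) (b : 'I_n -> A) : 'I_n.+1 -> A :=
  fun i => if unlift ord0 i is Some k then b k else a.

Lemma fcons0 (A : Type) n (a : A) (b : 'I_n -> A) : fcons a b ord0 = a.
Proof. by rewrite /fcons unlift_none. Qed.

Lemma fconsS (A : Type) n (a : A) (b : 'I_n -> A) k : fcons a b (lift ord0 k) = b k.
Proof. by rewrite /fcons liftK. Qed.

Lemma fcons_eta (A : Type) n (f : 'I_n.+1 -> A) :
  fcons (f ord0) (fun k => f (lift ord0 k)) = f.
Proof. by apply: funext => i; case: (unliftP ord0 i) => [k ->|->]; rewrite ?fconsS ?fcons0. Qed.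

Lemma dfwith_fcons (A : Type) n (a : A) (b : 'I_n -> A) k x :
  fcons a (@dfwith _ (fun=> A) b k x) = @dfwith _ (fun=> A) (fcons a b) (lift ord0 k) x.
Proof.
apply: funext => i; case: (unliftP ord0 i) => [m ->|->]; last first.
  by rewrite fcons0 dfwith_out ?fcons0 // eq_sym neq_lift.
rewrite fconsS; case: (eqVneq k m) => [<-|ne]; first by rewrite !dfwith_in.
by rewrite !dfwith_out ?fconsS // (inj_eq lift_inj).
Qed.

Lemma dfwith_fcons0 (A : Type) n (a x : A) (b : 'I_n -> A) :
  @dfwith _ (fun=> A) (fcons a b) ord0 x = fcons x b.
Proof.
apply: funext => i; case: (unliftP ord0 i) => [m ->|->]; last by rewrite dfwith_in fcons0.
by rewrite dfwith_out ?neq_lift // !fconsS.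
Qed.

(** One factor is added at a time, so that contractions only have to be composed
    along a tensor product of two algebras. *)
Lemma tensor_power (A : cdgaType) (K : set A) n : acyclic_ideal K -> fin_gen A ->
  exists (T : cdgaType) (iota : 'I_n.+1 -> {lrmorphism A -> T}) (mu : {lrmorphism T -> A})
    (KT : set T),
  [/\ is_tensor_power iota, cdga_mor mu /\ forall i a, mu (iota i a) = a,
      acyclic_ideal KT, forall i k, K k -> KT (iota i k) & fin_gen T].
Proof.
move=> hK hA; elim: n => [|n [T [iota [mu [KT [hT [mmu emu] hKT hKi fT]]]]]].
  exists A, (fun=> idfun), idfun, K; split=> //.
    split; first by move=> i; split=> // k x.
    move=> M phi hphi.
    have e1 a : \prod_(i < 1) (idfun : {lrmorphism A -> A}) (a i) = a ord0 by rewrite big_ord1.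
    have ec (a : 'I_1 -> A) : (fun=> a ord0) = a by apply: funext => i; rewrite (ord1 i).
    have dfc (x y : A) : @dfwith _ (fun=> A) (fun=> x) (ord0 : 'I_1) y = (fun=> y).
      by apply: funext => i; rewrite (ord1 i) dfwith_in.
    have hl (c : rat) x y : phi (fun=> c *: x + y) = c *: phi (fun=> x) + phi (fun=> y).
      by have := hphi (fun=> 0) ord0 c x y; rewrite !dfc.
    exists (mk_linear hl); split; first by move=> a; rewrite /= e1 ec.
    move=> h' hh' x; have := hh' (fun=> x); rewrite e1 /= => ->; by [].
  by split=> //; split=> // k x.
have [T' [l [r [ml mr univ ind]]]] := tensor_product A T.
have [mu' [gmu' emul emur]] := tensor_copair ml mr univ ind (f := idfun) (g := mu)
  (fun _ _ h => h) mmu.1.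
pose iota' (i : 'I_n.+2) : {lrmorphism A -> T'} :=
  if unlift ord0 i is Some k then (r \o iota k) else l.
have i0 : iota' ord0 = l by rewrite /iota' unlift_none.
have iS k : iota' (lift ord0 k) = r \o iota k by rewrite /iota' liftK.
have mr_iota k : cdga_mor (r \o iota k : {lrmorphism A -> T'}).
  have [m1 m2] := hT.1 k.
  by split=> [d x hx|x] /=; [apply/mr.1/m1|rewrite m2 mr.2].
have miota' i : cdga_mor (iota' i).
  by case: (unliftP ord0 i) => [k ->|->]; rewrite ?iS ?i0 //; exact: mr_iota.
have prodE a : \prod_i iota' i (a i) = l (a ord0) * r (\prod_i iota i (a (lift ord0 i))).
  rewrite big_ord_recl i0 lr_prod; congr (_ * _); apply: eq_bigr => k _.
  by rewrite iS.
have gens t : subalg_gen (range l `|` range r) t.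
  have hS := subalg_gen_subalg (range l `|` range r).
  move: t; apply: ind; first by case: hS.
  by move=> a b; case: hS => _ _; apply; apply: subalg_gen_sub; [left; exists a|right; exists b].
exists T', iota', mu', (tensor_ideal l r K KT); split.
- split=> // M phi hphi.
  have hph a : multilinear (fun b => phi (fcons a b)).
    move=> b k c x y; rewrite !dfwith_fcons; exact: hphi.
  have /choice[h hh] := fun a => hT.2 M _ (hph a).
  have [|g hg] := univ M (fun a t => h a t).
    split=> [t c x y|a c x y]; last by rewrite linearP.
    move: t; apply: (tensor_power_ind hT).
      exact: (eq_subspace (h (c *: x + y)) (c \*: h x \+ h y)).
    move=> b; rewrite /= !(hh _).1.
    by have := hphi (fcons 0 b) ord0 c x y; rewrite !dfwith_fcons0.
  exists g; split; first by move=> a; rewrite prodE hg (hh _).1 fcons_eta.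
  move=> g' hg'; apply: ind; first exact: eq_subspace.
  move=> a t; rewrite hg; move: t; apply: (tensor_power_ind hT).
    have l_lin (c : rat) x y : l a * r (c *: x + y) = c *: (l a * r x) + l a * r y.
      by rewrite lrD lrZ mulrDr -scalerAr.
    exact: (eq_subspace (g' \o mk_linear l_lin) (h a)).
  move=> b; have := hg' (fcons a b); rewrite prodE fcons0 => e.
  rewrite (hh _).1 -e; congr (g' (_ * r _)).
  by apply: eq_bigr => i _; rewrite fconsS.
- split.
    apply: (cdga_mor_gen gmu' gens) => _ [[a _ <-]|[b _ <-]].
      by rewrite -ml.2 !emul.
    by rewrite -mr.2 !emur mmu.2.
  move=> i a; case: (unliftP ord0 i) => [k ->|->]; rewrite ?iS ?i0 ?emul //=.
  by rewrite emur emu.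
- exact: (tensor_ideal_acyclic ml mr univ ind hK hKT).
- move=> i k hk; case: (unliftP ord0 i) => [m ->|->]; rewrite ?iS ?i0 /=.
    rewrite -[r _]mul1r -(lr1 l); apply: tensor_idealI; right; exact: hKi.
  by rewrite -[l _]mulr1 -(lr1 r); apply: tensor_idealI; left.
- have [s [s1 s2]] := hA; have [s' [s1' s2']] := fT.
  exists ([seq l x | x <- s] ++ [seq r x | x <- s']); split.
    move=> x; rewrite mem_cat => /orP[] /mapP[y hy ->].
      by have [d [d2 hd]] := s1 y hy; exists d; split=> //; exact: ml.1.
    by have [d [d2 hd]] := s1' y hy; exists d; split=> //; exact: mr.1.
  move=> t; move: (gens t); apply: subalg_gen_mono => _ [[a _ <-]|[b _ <-]].
    apply: subalg_gen_image (s2 a) => g hg; apply: subalg_gen_sub.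
    by rewrite /= mem_cat map_f.
  apply: subalg_gen_image (s2' b) => g hg; apply: subalg_gen_sub.
  by rewrite /= mem_cat map_f ?orbT.
Qed.
(** * Free families of generators *)

Section MoreSpans.
Variable M : lmodType rat.
Implicit Types (G : set M) (s t l : seq M).

Lemma span_list G x : span G x -> exists l, {in l, forall y, G y} /\ fspan l x.
Proof.
move: x; apply: span_min.
  split; first by exists [::].
  move=> c x y [l [h1 h2]] [l' [h1' h2']]; exists (l ++ l'); split.
    by move=> z; rewrite mem_cat => /orP[/h1|/h1'].
  apply: (fspan_subspace _).2.
    by apply: fspan_sub h2 => z hz; rewrite mem_cat hz.
  by apply: fspan_sub h2' => z hz; rewrite mem_cat hz orbT.
by move=> x hx; exists [:: x]; split; [move=> y; rewrite inE => /eqP ->|apply: fspan_mem; rewrite inE].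
Qed.

Lemma span_fin_list G : fin_dim (span G) -> exists l, {in l, forall y, G y} /\ span G `<=` fspan l.
Proof.
move=> /fin_dim_fspan[s es]; rewrite es.
have : {in s, forall x, span G x} by move=> x hx; rewrite es; exact: fspan_mem.
elim: s {es} => [|a s IH] hs; first by exists [::]; split.
have [l [h1 h2]] := IH (fun x hx => hs x (mem_behead (s := a :: s) hx)).
have [l' [h1' h2']] := span_list (hs a (mem_head _ _)).
exists (l ++ l'); split; first by move=> z; rewrite mem_cat => /orP[/h1|/h1'].
move=> _ [c [y [/h2 hy ->]]]; apply: (fspan_subspace _).2.
  by apply: fspan_sub h2' => z hz; rewrite mem_cat hz orbT.
by apply: fspan_sub hy => z hz; rewrite mem_cat hz.
Qed.

Lemma indep_linear (N : lmodType rat) s (c : nat -> N) : indep s ->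
  exists f : {linear M -> N}, forall i, (i < size s)%N -> f s`_i = c i.
Proof.
elim: s c => [|a s IH] c; first by exists \0.
case=> ha hs; have [f hf] := IH (fun i => c i.+1) hs.
have [g [g0 g1]] := functional (fspan_subspace s) ha.
have lin (d : rat) x y : f (d *: x + y) + (g (d *: x + y) : rat) *: (c 0%N - f a) =
    d *: (f x + (g x : rat) *: (c 0%N - f a)) + (f y + (g y : rat) *: (c 0%N - f a)).
  have -> : g (d *: x + y) = (d * g x + g y : rat) by rewrite linearP.
  rewrite linearP scalerDl !scalerDr !scalerA.
  by zmod.
exists (mk_linear lin) => -[|i] hi /=; first by rewrite g1 scale1r; zmod.
by rewrite g0 ?scale0r ?addr0 ?hf //; apply: fspan_mem; exact: mem_nth.
Qed.
End MoreSpans.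

Definition gens (A : gcaType) N (v : nat -> A) : set A := [set x | exists2 k, (k < N)%N & x = v k].

(** Uniqueness of the induced morphism follows from generation. *)
Definition free_family (A : gcaType) N (deg : nat -> nat) (v : nat -> A) :=
  [/\ forall k, (k < N)%N -> gr (deg k) (v k), forall a, subalg_gen (gens N v) a
   & forall (C : gcaType) (c : nat -> C), (forall k, (k < N)%N -> gr (deg k) (c k)) ->
     exists h : {lrmorphism A -> C}, graded_mor h /\ forall k, (k < N)%N -> h (v k) = c k].

Lemma subalg_gen_homogeneous (A : gcaType) (G : set A) :
  (forall g, G g -> exists d, gr d g) -> homogeneous (subalg_gen G).
Proof.
move=> hG x k hx; move: x hx k; have hS := subalg_gen_subalg G; have [sS S1 SM] := hS.
have s0 := ss0 sS.
apply: subalg_gen_ind.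
- split; first by move=> k; rewrite cmp0.
  by move=> c x y hx hy k; rewrite cmp_linear; apply: sS.2.
- by move=> k; rewrite (cmp_hom _ gr_one); case: eqP.
- move=> g a Gg ha k; have [d hd] := hG g Gg; rewrite (cmpMl _ _ hd); case: leqP => // _.
  by apply: SM => //; exact: subalg_gen_sub.
Qed.

Section FreeGca.
Variables (A : cdgaType) (V : nat -> set A).
Hypothesis hV : free_gca V.

(** The subalgebra generated by [V] also has the universal property, so its inclusion
    has a section, which uniqueness makes inverse to it. *)
Lemma free_gca_gen a : subalg_gen (gtotal V) a.
Proof.
have [gV univ] := hV; set S := subalg_gen _.
have hS : subalgebra S by exact: subalg_gen_subalg.
have hSh : homogeneous S.
  by apply: subalg_gen_homogeneous => g [n _ hg]; exists n; exact: (gV n).2.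
have [B [i [gi ii iS iso igr]]] := sub_gca hS hSh.
have /choice[g hg] : forall x, exists u, S x -> i u = x.
  by move=> x; case: (pselect (S x)) => [/iso[u hu]|]; [exists u|exists 0].
have VS n x : V n x -> S x by move=> hx; apply: subalg_gen_sub; exists n.
have [|h [gh h1 _]] := univ B g.
  move=> n; split=> [c x y hx hy|x hx].
    by apply: ii; rewrite lrD lrZ !hg //; [exact: VS hy|exact: VS hx|exact: VS ((gV n).1.2 _ _ _ hx hy)].
  by apply: igr; rewrite hg; [exact: (gV n).2|exact: VS hx].
have [|h0 [_ _ hu]] := univ A idfun; first by move=> n; split=> // x hx; exact: (gV n).2.
have -> : a = i (h a); last exact: iS.
transitivity (h0 a).
  by apply: (hu idfun) => // n x.
symmetry; apply: (hu (i \o h)) => [n x hx|x] /=; first exact/gi/gh.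
move=> hx; rewrite h1 // hg //; have [n _] := set_mem hx; exact: VS.
Qed.

(** A basis of the even part of [V] is put before a basis of the odd part, hence the
    form of the parity condition. *)
Lemma free_family_of_free_gca : (forall n x, V n x -> x != 0 -> (2 <= n)%N) ->
  fin_dim (span (gtotal V)) ->
  exists p q deg v, [/\ free_family (p + q) deg v,
    forall k, (k < p + q)%N -> V (deg k) (v k) /\ odd (deg k) = (p <= k)%N,
    forall k, (k < p + q)%N -> (2 <= deg k)%N,
    has_dim (span (gparity false V)) p /\ span (gparity false V) `<=` span (gens p v)
    & has_dim (span (gparity true V)) q].
Proof.
move=> V2 /span_fin_list[l0 [l1 l2]]; have [gV univ] := hV.
pose prj (b : bool) : {linear A -> A} := if b then odp else evp.
have prjE b n x : gr n x -> prj b x = if odd n == b then x else 0.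
  by case: b => hx; rewrite /prj ?(odpE hx) ?(evpE hx); case: odd.
have basis b : exists t, [/\ indep t, {in t, forall x, gparity b V x}
    & span (gparity b V) = fspan t].
  pose l := [seq x <- l0 | x \in gparity b V].
  have [t [t1 t2 t3]] := indep_extract l.
  have tV : {in t, forall x, gparity b V x}.
    by move=> x /t1; rewrite mem_filter => /andP[/set_mem].
  exists t; split=> //; apply/seteqP; split; last first.
    by apply: fspan_min; [exact: span_subspace|move=> x /tV; exact: span_sub].
  apply: span_min; first exact: fspan_subspace.
  move=> x [n /= on hx]; apply: t3.
  have : fspan l0 x by apply: l2; apply: span_sub; exists n.
  suff : fspan l0 `<=` [set y | fspan l (prj b y)].
    by move=> h /h /=; rewrite (prjE _ _ _ ((gV n).2 _ hx)) on eqxx.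
  apply: fspan_min; first exact: (preim_subspace (prj b) (fspan_subspace l)).
  move=> y hy; have [m _ hym] := l1 y hy.
  rewrite /= (prjE _ _ _ ((gV m).2 _ hym)); case: eqP => om; last exact: (ss0 (fspan_subspace l)).
  by apply: fspan_mem; rewrite mem_filter hy andbT; apply: mem_set; exists m.
have [t0 [i0 h0 s0]] := basis false; have [t1 [i1 h1 s1]] := basis true.
pose v k := (t0 ++ t1)`_k; pose p := size t0; pose q := size t1.
have vE k : v k = if (k < p)%N then t0`_k else t1`_(k - p) by exact: nth_cat.
have /choice[deg hdeg] : forall k, exists n, (k < p + q)%N -> V n (v k) /\ odd n = (p <= k)%N.
  move=> k; case: (ltnP k (p + q)) => hk; last by exists 0%N.
  rewrite vE; case: ltnP => hkp.
    by have [n on hn] := h0 _ (mem_nth 0 hkp); exists n.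
  have /h1[n on hn] : t1`_(k - p) \in t1 by apply: mem_nth; rewrite ltn_subLR.
  by exists n.
have gdeg k : (k < p + q)%N -> gr (deg k) (v k) by move=> /hdeg[h _]; exact: (gV _).2.
exists p, q, deg, v; split=> //; last first.
- by rewrite s1; exact: indep_has_dim.
- rewrite s0; split; first exact: indep_has_dim.
  apply: fspan_min; first exact: span_subspace.
  move=> _ /(nthP 0)[i hi <-]; apply: span_sub; exists i => //.
  by rewrite vE hi.
- move=> k hk; apply: (V2 _ (v k)); first by case: (hdeg k hk).
  have nz t i : indep t -> (i < size t)%N -> t`_i != 0.
    move=> ht hi; have [f hf] := indep_linear (N := rat^o) (fun=> 1) ht.
    by apply/eqP => e; have := hf i hi; rewrite e linear0 => /eqP; rewrite eq_sym oner_eq0.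
  by rewrite vE; case: ltnP => hkp; apply: nz => //; rewrite ltn_subLR.
split=> //.
  move=> a; move: (free_gca_gen a); apply: subalg_gen_mono => x [n _ hx].
  have [sS _ _] := subalg_gen_subalg (gens (p + q) v).
  suff h b t : span (gparity b V) = fspan t -> {in t, forall y, exists2 k, (k < p + q)%N & y = v k} ->
      odd n = b -> subalg_gen (gens (p + q) v) x.
    case: (boolP (odd n)) => on.
      apply: (h true t1) => // y /(nthP 0)[i hi <-]; exists (p + i)%N; first by rewrite ltn_add2l.
      by rewrite vE ltnNge leq_addr /= addKn.
    apply: (h false t0) => //; last exact: negbTE.
    move=> y /(nthP 0)[i hi <-]; exists i; first exact: leq_trans hi (leq_addr _ _).
    by rewrite vE hi.
  move=> es ht on; have : fspan t x by rewrite -es; apply: span_sub; exists n.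
  by apply: fspan_min => // y /ht[k hk ->]; apply: subalg_gen_sub; exists k.
move=> C c hc.
have [f0 hf0] := indep_linear (fun i => c i) i0.
have [f1 hf1] := indep_linear (fun i => c (p + i)%N) i1.
have gf (f : {linear A -> C}) b t : span (gparity b V) = fspan t ->
    {in t, forall y, exists k, [/\ (k < p + q)%N, y = v k & f y = c k]} ->
    forall n x, V n x -> odd n = b -> gr n (f x).
  move=> es hf n x hx on.
  have : fspan t x by rewrite -es; apply: span_sub; exists n.
  suff : fspan t `<=` [set y | forall n, gr n (f (cmp y n))].
    by move=> h /h /(_ n); rewrite gr_cmp //; exact: (gV n).2.
  apply: fspan_min.
    split; first by move=> m; rewrite cmp0 linear0; exact: (ss0 (gr_subspace m)).
    by move=> d y z hy hz m; rewrite cmp_linear linearP; apply: (gr_subspace m).2.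
  move=> y /hf[k [hk -> e]] m; rewrite (cmp_hom _ (gdeg k hk)).
  case: eqP => [->|_]; first by rewrite e; exact: hc.
  by rewrite linear0; exact: (ss0 (gr_subspace m)).
have [h [gh hh _]] : exists h : {lrmorphism A -> C},
    [/\ graded_mor h, {in gtotal V, h =1 (f0 \o evp) \+ (f1 \o odp)} & True].
  have [|h [g1 g2 _]] := univ C ((f0 \o evp) \+ (f1 \o odp)); last by exists h.
  move=> n; split=> [d x y _ _|x hx]; first by rewrite /= !linearP scalerDr; zmod.
  have gx := (gV n).2 _ hx; rewrite /= (evpE gx) (odpE gx); case: (boolP (odd n)) => on.
    rewrite linear0 add0r; apply: (gf f1 true t1) => // y /(nthP 0)[i hi <-].
    exists (p + i)%N; rewrite ltn_add2l hf1 //; split=> //.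
    by rewrite vE ltnNge leq_addr /= addKn.
  rewrite linear0 addr0; apply: (gf f0 false t0) => // [y /(nthP 0)[i hi <-]|]; last exact: negbTE.
  by exists i; rewrite hf0 // (leq_trans hi (leq_addr _ _)) vE hi.
exists h; split=> // k hk; have [hVk ok] := hdeg k hk.
rewrite hh; last by apply: mem_set; exists (deg k).
rewrite /= (evpE (gdeg k hk)) (odpE (gdeg k hk)) ok leqNgt vE; case: ltnP => hkp /=.
  by rewrite linear0 addr0 hf0.
by rewrite linear0 add0r hf1 ?ltn_subLR // subnKC.
Qed.

End FreeGca.

Section FreeFamily.
Variables (A : cdgaType) (N : nat) (deg : nat -> nat) (v : nat -> A).
Hypothesis hv : free_family N deg v.

Lemma family_gr k : (k < N)%N -> gr (deg k) (v k). Proof. by case: hv => h _ _; exact: h. Qed.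

Lemma family_ind (P : set A) : subspace P -> P 1 ->
  (forall k a, (k < N)%N -> P a -> P (v k * a)) -> forall a, P a.
Proof. by case: hv => _ hg _ hP h1 h; apply: (gen_ind hg) => // _ a [k hk ->]; exact: h. Qed.

(** A derivation of odd degree [-n] is a map to the extension by an odd
    variable of degree [n] that lifts the identity. *)
Lemma odd_derivation n (w : nat -> A) : odd n ->
  (forall k, (k < N)%N -> shifted n (deg k) (w k)) ->
  exists th : {linear A -> A}, (forall k, (k < N)%N -> th (v k) = w k) /\
    forall a b, th (a * b) = th a * b + sg a * th b.
Proof.
move=> on hw; have [_ hg univ] := hv.
have [E [i [e [[mi ge _] hdec hun _]]]] := adjoin_odd on (ss0 (@gr_subspace A n.+1)) (d0 A).
have [|h [gh hh]] := univ E (fun k => i (v k) + e * i (w k)).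
  move=> k hk; apply: (ssD (gr_subspace _)); first exact/mi.1/family_gr.
  case: (hw k hk) => [->|[m [-> hm]]]; first by rewrite lr0 mulr0; exact: (ss0 (gr_subspace _)).
  by apply: gr_mul => //; exact: mi.1.
pose R a b := h a = i a + e * i b.
have RM a b a' b' : R a b -> R a' b' -> R (a * a') (b * a' + sg a * b').
  rewrite /R => h1 h2; rewrite lrM h1 h2 mulrDl !mulrDr lrD !lrM mulrDr.
  have ae x : i x * e = e * i (sg x) by rewrite (grC _ ge) on /= (sg_mor mi.1).
  have -> : e * i b * (e * i b') = 0.
    by rewrite -!mulrA [i b * _]mulrA ae !mulrA (gr_odd_sqr ge on) !mul0r.
  by rewrite addr0 [i a * (e * _)]mulrA ae !mulrA; zmod.
have Run a b b' : R a b -> R a b' -> b = b'.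
  rewrite /R => -> /eqP; rewrite -subr_eq0 => /eqP e1; apply/eqP; rewrite -subr_eq0; apply/eqP.
  by apply: (hun 0 (b - b') _).2; rewrite lr0 add0r lrB mulrBr -e1; zmod.
have [|||th hth] := linear_of_rel (R := R).
- move=> a; move: a; apply: (gen_sub hg).
    split.
    + split; first by exists 0; rewrite /R !lr0 mulr0 addr0.
      move=> c x y [b hb] [b' hb']; exists (c *: b + b'); rewrite /R !lrD !lrZ hb hb'.
      by rewrite scalerDr mulrDr -scalerAr; zmod.
    + by exists 0; rewrite /R !lr1 lr0 mulr0 addr0.
    + by move=> x y [b hb] [b' hb']; exists (b * y + sg x * b'); exact: RM.
  by move=> _ [k hk ->]; exists (w k); exact: hh.
- exact: Run.
- move=> c x y x' y'; rewrite /R => h1 h2; rewrite !lrD !lrZ h1 h2.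
  by rewrite scalerDr mulrDr -scalerAr; zmod.
exists th; split; first by move=> k hk; apply: (Run (v k)) => //; exact: hh.
by move=> a b; apply: (Run (a * b)) => //; exact: RM.
Qed.

(** The substitution is triangular: the generators in [B] are kept, and those outside
    [B] are corrected by expressions in them. *)
Lemma free_family_change (B : pred nat) (u : nat -> A) :
  (forall k, (k < N)%N -> gr (deg k) (u k)) ->
  (forall k, (k < N)%N -> B k -> u k = 0) ->
  (forall k, (k < N)%N -> subalg_gen [set x | exists2 i, (i < N)%N && B i & x = v i] (u k)) ->
  free_family N deg (fun k => v k + u k).
Proof.
move=> gu uB hu; have [gv hg univ] := hv; set G := [set x | _] in hu.
split.
- by move=> k hk; apply: (ssD (gr_subspace _)); [exact: gv|exact: gu].
- move=> a; have hS := subalg_gen_subalg (gens N (fun k => v k + u k)).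
  have [sS _ _] := hS.
  have GS : subalg_gen G `<=` subalg_gen (gens N (fun k => v k + u k)).
    apply: subalg_gen_mono => _ [i /andP[hi Bi] ->]; apply: subalg_gen_sub.
    by exists i => //; rewrite uB // addr0.
  move: (hg a); apply: subalg_gen_mono => _ [k hk ->].
  have -> : v k = (v k + u k) - u k by zmod.
  apply: (ssB sS); first by apply: subalg_gen_sub; exists k.
  exact: (GS _ (hu k hk)).
- move=> C c hc.
  have [|h0 [g0 e0]] := univ C (fun k => if B k then c k else 0).
    by move=> k hk; case: ifP => _; [exact: hc|exact: (ss0 (gr_subspace _))].
  have [|h [gh eh]] := univ C (fun k => c k - h0 (u k)).
    by move=> k hk; apply: (ssB (gr_subspace _)); [exact: hc|exact/g0/gu].
  exists h; split=> // k hk; rewrite lrD eh //.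
  suff -> : h (u k) = h0 (u k) by zmod.
  move: (hu k hk); apply: (subalg_gen_min (eq_subalgebra h h0)) => _ [i /andP[hi Bi] ->] /=.
  by rewrite eh // e0 // Bi uB // lr0 subr0.
Qed.


Lemma kill_generators (B : pred nat) : exists h : {lrmorphism A -> A},
  graded_mor h /\ forall k, (k < N)%N -> h (v k) = if B k then 0 else v k.
Proof.
have [gv _ univ] := hv; apply: (univ A (fun k => if B k then 0 else v k)) => k hk.
by case: ifP => _; [exact: (ss0 (gr_subspace _))|exact: gv].
Qed.

End FreeFamily.
(** * Calculus on a free family *)

Section Weights.
Variables (M : lmodType rat) (s : {linear M -> M}).

(** A grading by weights is encoded by the operator that multiplies the part of
    weight [w] by [2 ^ w]: a multiplicative operator gives a multiplicative
    grading, and independence of the parts comes from linear algebra. *)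
Definition weight w : set M := [set a | s a = 2 ^+ w *: a].

Lemma weight_subspace w : subspace (weight w).
Proof.
split; first by rewrite /weight /= linear0 scaler0.
by move=> c x y; rewrite /weight /= => hx hy; rewrite linearP hx hy scalerDr !scalerA mulrC.
Qed.

Lemma pow2_inj m n : (2 : rat) ^+ m = 2 ^+ n -> m = n.
Proof. exact: ieexprIn. Qed.

(** The operator with its largest eigenvalue subtracted kills the last term and rescales
    the other ones. *)
Lemma weight_direct n (f : nat -> M) : (forall k, weight k (f k)) ->
  \sum_(k < n) f k = 0 -> forall k, (k < n)%N -> f k = 0.
Proof.
elim: n f => // n IH f hf e0.
have h k : (k < n)%N -> f k = 0.
  move=> hk; have e : \sum_(k < n) (2 ^+ k - 2 ^+ n) *: f k = 0.
    have : s (\sum_(k < n.+1) f k) - 2 ^+ n *: (\sum_(k < n.+1) f k) = 0.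
      by rewrite e0 linear0 scaler0 subrr.
    rewrite linear_sum scaler_sumr -sumrB big_ord_recr /= (hf n) subrr addr0 => e; rewrite -[RHS]e.
    by apply: eq_bigr => i _; rewrite (hf i) scalerBl.
  have /eqP := IH (fun k => (2 ^+ k - 2 ^+ n) *: f k) (fun k => ssZ (weight_subspace k) _ (hf k)) e k hk.
  by rewrite scaler_eq0 subr_eq0 => /orP[/eqP/pow2_inj kn|/eqP //]; rewrite kn ltnn in hk.
move: e0; rewrite big_ord_recr big1 /= ?add0r => [fn k|i _]; last exact: h.
by rewrite ltnS leq_eqVlt => /orP[/eqP ->|/h].
Qed.

Lemma sum_widen n N (f : nat -> M) : (forall k, (n <= k)%N -> f k = 0) -> (n <= N)%N ->
  \sum_(k < N) f k = \sum_(k < n) f k.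
Proof.
move=> hf nN; rewrite (big_ord_widen N f nN) [RHS]big_mkcond.
by apply: eq_bigr => i _; case: ltnP => // /hf.
Qed.

Hypothesis decomp : forall a, exists n f, (forall k, weight k (f k)) /\ a = \sum_(k < n) f k.

Lemma weight_proj : exists P : nat -> {linear M -> M},
  [/\ forall w a, weight w (P w a), forall w u a, weight u a -> P w a = if w == u then a else 0
    & forall a, exists n, a = \sum_(k < n) P k a].
Proof.
pose good a n (f : nat -> M) := [/\ forall k, weight k (f k), forall k, (n <= k)%N -> f k = 0
  & a = \sum_(k < n) f k].
have ex a : exists n f, good a n f.
  have [n [f [hf ->]]] := decomp a; exists n, (fun k => if (k < n)%N then f k else 0); split.
  - by move=> k; case: ifP => _; [exact: hf|exact: (ss0 (weight_subspace k))].
  - by move=> k; rewrite ltnNge => ->.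
  - by apply: eq_bigr => i _; rewrite ltn_ord.
have un a n f n' f' w : good a n f -> good a n' f' -> f w = f' w.
  move=> [h1 h2 h3] [h1' h2' h3']; apply/eqP; rewrite -subr_eq0; apply/eqP.
  pose N := maxn (maxn n n') w.+1.
  apply: (@weight_direct N (fun k => f k - f' k)) => [k||].
  - by apply: (ssB (weight_subspace k)).
  - rewrite sumrB (sum_widen (N := N) h2) ?(sum_widen (N := N) h2') ?leq_max ?leqnn ?orbT //.
    by rewrite -h3 -h3' subrr.
  - by rewrite /N leq_max leqnn orbT.
have /choice[P hP] : forall w, exists f : {linear M -> M}, forall a, exists n g, good a n g /\ f a = g w.
  move=> w; apply: (linear_of_rel (R := fun a b => exists n g, good a n g /\ b = g w)).
  - by move=> a; have [n [f h]] := ex a; exists (f w), n, f.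
  - by move=> a b b' [n [f [h ->]]] [n' [f' [h' ->]]]; exact: un h h'.
  - move=> c a b a' b' [n [f [[h1 h2 h3] ->]]] [n' [f' [[h1' h2' h3'] ->]]].
    exists (maxn n n'), (fun k => c *: f k + f' k); split=> //; split.
    + by move=> k; apply: (weight_subspace k).2.
    + by move=> k; rewrite geq_max => /andP[/h2 -> /h2' ->]; rewrite scaler0 addr0.
    + rewrite big_split /= -scaler_sumr (sum_widen h2) ?leq_maxl // (sum_widen h2') ?leq_maxr //.
      by rewrite -h3 -h3'.
exists P; split.
- by move=> w a; have [n [g [[h _ _] ->]]] := hP w a.
- move=> w u a ha; have [n [g [h ->]]] := hP w a.
  rewrite (un _ _ _ u.+1 (fun k => if k == u then a else 0) w h) //; split.
  + by move=> k; case: eqP => [->//|_]; exact: (ss0 (weight_subspace k)).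
  + by move=> k hk; rewrite gtn_eqF.
  + by rewrite big_ord_recr /= eqxx big1 ?add0r // => i _; rewrite ltn_eqF.
- move=> a; have [n [f h]] := ex a; exists n; have [_ _ {1}->] := h.
  apply: eq_bigr => i _; have [n' [g [h' ->]]] := hP i a.
  exact: un h h'.
Qed.

End Weights.

Section Calculus.
Variables (A : cdgaType) (N : nat) (deg : nat -> nat) (v : nat -> A).
Hypothesis hv : free_family N deg v.

Lemma family_lr_eq (C : algType rat) (f g : {lrmorphism A -> C}) :
  (forall k, (k < N)%N -> f (v k) = g (v k)) -> f =1 g.
Proof.
move=> h a; have [_ hg _] := hv; move: a; apply: (gen_sub hg (eq_subalgebra f g)).
by move=> _ [k hk ->]; exact: h.
Qed.

Lemma v_gr k : (k < N)%N -> gr (deg k) (v k). Proof. exact: family_gr. Qed.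

Lemma sg_v k : (k < N)%N -> sg (v k) = (-1) ^+ odd (deg k) *: v k.
Proof. by move=> hk; rewrite (sgE (v_gr hk)) signr_odd. Qed.

Definition kill B : {lrmorphism A -> A} := sval (cid (kill_generators hv B)).

Lemma kill_gr (B : pred nat) : graded_mor (kill B).
Proof. by rewrite /kill; case: cid => h /= []. Qed.

Lemma kill_gen (B : pred nat) k : (k < N)%N -> kill B (v k) = if B k then 0 else v k.
Proof. by rewrite /kill; case: cid => h /= [_ hh] /hh. Qed.

Lemma kill_kill (B B' : pred nat) a : kill B (kill B' a) = kill (fun k => B k || B' k) a.
Proof.
move: a; apply: (family_lr_eq (f := kill B \o kill B')) => k hk /=.
rewrite !kill_gen //; case: (B' k); first by rewrite lr0 orbT.
by rewrite kill_gen // orbF.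
Qed.

Lemma eq_kill (B B' : pred nat) a : (forall k, (k < N)%N -> B k = B' k) -> kill B a = kill B' a.
Proof. by move=> h; move: a; apply: family_lr_eq => k hk; rewrite !kill_gen // h. Qed.

Lemma kill_all (B : pred nat) a : (forall k, (k < N)%N -> B k) -> exists c : rat, kill B a = c *: 1.
Proof.
move=> hB; move: a; apply: (family_ind hv).
- split; first by exists 0; rewrite lr0 scale0r.
  move=> c x y [d hd] [e he]; exists (c * d + e).
  by rewrite lrD lrZ hd he scalerDl scalerA.
- by exists 1; rewrite lr1 scale1r.
- by move=> k a hk _; exists 0; rewrite lrM kill_gen // hB // mul0r scale0r.
Qed.

Lemma kill_in (B : pred nat) a : subalg_gen [set x | exists2 k, (k < N)%N && ~~ B k & x = v k] (kill B a).
Proof.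
set S := subalg_gen _; have hS : subalgebra S by exact: subalg_gen_subalg.
have [sS S1 SM] := hS.
move: a; apply: (family_ind hv) => [||k a hk ha].
- by split; [rewrite /= lr0; exact: ss0|move=> c x y hx hy; rewrite /= lrD lrZ; exact: sS.2].
- by rewrite /= lr1.
- rewrite /= lrM kill_gen //; case: ifP => Bk; first by rewrite mul0r; exact: ss0.
  by apply: SM => //; apply: subalg_gen_sub; exists k; rewrite ?hk ?Bk.
Qed.

(** Partial derivatives with respect to the odd generators.  They anticommute with
    each other, and with the differential if it is given by expressions that do
    not involve the odd generators; so they act on cohomology. *)
Lemma pd_ex j : exists th : {linear A -> A}, (j < N)%N -> odd (deg j) ->
  (forall k, (k < N)%N -> th (v k) = (k == j)%:R) /\
  forall a b, th (a * b) = th a * b + sg a * th b.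
Proof.
case: (boolP ((j < N)%N && odd (deg j))) => [/andP[hj oj]|nj]; last first.
  by exists \0 => hj oj; rewrite hj oj in nj.
have [|th [h1 h2]] := odd_derivation hv (w := fun k => (k == j)%:R) oj.
  move=> k hk; case: eqP => [->|_]; last by left.
  by right; exists 0%N; rewrite addn0; split=> //; exact: gr_one.
by exists th.
Qed.

Definition pd j : {linear A -> A} := sval (cid (pd_ex j)).

Section Partial.
Variable j : nat.
Hypotheses (hj : (j < N)%N) (oj : odd (deg j)).

Lemma pd_gen k : (k < N)%N -> pd j (v k) = (k == j)%:R.
Proof. by move=> hk; rewrite /pd; case: cid => th /= /(_ hj oj)[h _]; exact: h. Qed.

Lemma pdM a b : pd j (a * b) = pd j a * b + sg a * pd j b.
Proof. by rewrite /pd; case: cid => th /= /(_ hj oj)[_]; exact. Qed.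

Lemma pd1 : pd j 1 = 0.
Proof.
have /eqP := pdM 1 1; rewrite sg1 !mul1r mulr1 -subr_eq0 opprD addrA subrr add0r oppr_eq0.
by move=> /eqP.
Qed.

Lemma pd_vM k a : (k < N)%N ->
  pd j (v k * a) = (k == j)%:R * a + (-1) ^+ odd (deg k) *: (v k * pd j a).
Proof. by move=> hk; rewrite pdM pd_gen // sg_v // scalerAl. Qed.

Lemma pd_shifted n a : gr n a -> shifted (deg j) n (pd j a).
Proof.
move=> ha; rewrite -(gr_cmp ha); move: a n {ha}; apply: (family_ind hv).
- split; first by move=> n; rewrite cmp0 linear0; left.
  by move=> c x y hx hy n; rewrite cmp_linear linearP; apply: (shifted_subspace A (deg j) n).2.
- move=> n; rewrite (cmp_hom _ gr_one); case: eqP => _; rewrite ?linear0 ?pd1; by left.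
- move=> k a hk ha n; rewrite (cmpMl _ _ (v_gr hk)); case: leqP => hkn; last by rewrite linear0; left.
  rewrite pd_vM //; apply: (ssD (shifted_subspace A (deg j) n)).
    case: eqP => [ek|_]; last by rewrite mul0r; left.
    rewrite mul1r; right; exists (n - deg j)%N; rewrite -ek subnKC //; split=> //; exact: cmp_gr.
  apply: (ssZ (shifted_subspace A (deg j) n)).
  case: (ha (n - deg k)%N) => [->|[m [e hm]]]; first by rewrite mulr0; left.
  right; exists (deg k + m)%N; split; last by apply: gr_mul => //; exact: v_gr.
  by rewrite addnCA -e subnKC.
Qed.

(** Since [v j] squares to zero, an element has degree at most one in it. *)
Lemma pd_expand a : a = kill (pred1 j) a + v j * pd j a.
Proof.
move: a; apply: (family_ind hv).
- split; first by rewrite /= lr0 linear0 mulr0 addr0.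
  move=> c x y hx hy; rewrite /= lrD lrZ linearP {1}hx {1}hy mulrDr -scalerAr scalerDr.
  by zmod.
- by rewrite /= lr1 pd1 mulr0 addr0.
- move=> k a hk ha; rewrite /= lrM kill_gen // pd_vM //=.
  have jj : v j * v j = 0 by apply: (gr_odd_sqr (v_gr hj)).
  case: eqP => [->|_]; first by rewrite mul0r mul1r mulrDr -scalerAr [v j * (v j * _)]mulrA jj mul0r scaler0 addr0 add0r.
  rewrite mul0r add0r {1}ha mulrDr -scalerAr; congr (_ + _).
  have -> : v j * (v k * pd j a) = (-1) ^+ odd (deg k) *: (v k * (v j * pd j a)).
    rewrite !mulrA (gr_comm (v_gr hj) (v_gr hk)) signE -scalerAl; congr (_ *: _).
    by rewrite -signr_odd oddM oj.
  by rewrite scalerA -expr2 sqrr_sign scale1r.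
Qed.

Lemma pd_kill (B : pred nat) a : ~~ B j -> pd j (kill B a) = kill B (pd j a).
Proof.
move=> Bj; move: a; apply: (family_ind hv).
- split; first by rewrite /= !(lr0, linear0).
  by move=> c x y hx hy; rewrite /= lrD lrZ !linearP hx hy ?lrD ?lrZ.
- by rewrite /= lr1 pd1 lr0.
- move=> k a hk ha; rewrite /= lrM kill_gen // pd_vM // lrD lrZ !lrM kill_gen //.
  case: (boolP (B k)) => Bk; last by rewrite pd_vM // ha; case: eqP; rewrite ?mul0r ?mul1r ?lr0 ?lr1 ?mul0r ?mul1r.
  rewrite !mul0r linear0 scaler0 addr0; case: eqP => [ek|_]; last by rewrite lr0 mul0r.
  by rewrite -ek Bk in Bj.
Qed.

Lemma pd_d : (forall k, (k < N)%N -> pd j (diff (v k)) = 0) -> forall a, pd j (diff a) = - diff (pd j a).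
Proof.
move=> h0; apply: (family_ind hv).
- split; first by rewrite /= !(linear0, d0) ?oppr0.
  by move=> c x y hx hy; rewrite /= diff_linear !linearP hx hy diff_linear scalerN; zmod.
- by rewrite /= pd1 !d1 d0 linear0 ?oppr0.
- move=> k a hk ha; rewrite /= pd_vM // dM linearD pdM h0 // mul0r add0r sg_v // -scalerAl linearZZ.
  have dn (b : bool) x : diff (b%:R * x) = b%:R * diff x :> A.
    by case: b; rewrite ?mul1r // !mul0r d0.
  rewrite pd_vM // ha dD dn dZ (dM (v k)) sg_d sg_v // dZ mulrN !scalerDr !scalerN.
  rewrite mulNr -!scalerAl !scalerA -!expr2 !sqrr_sign !scale1r.
  case: eqP => [->|_]; last by rewrite !mul0r scaler0; zmod.
  by rewrite oj expr1 !mul1r !scaleN1r; zmod.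
Qed.
End Partial.

Lemma pd_anti i j a : (i < N)%N -> odd (deg i) -> (j < N)%N -> odd (deg j) ->
  pd i (pd j a) = - pd j (pd i a).
Proof.
move=> hi oi hj oj; move: a; apply: (family_ind hv).
- split; first by rewrite /= !linear0 ?oppr0.
  by move=> c x y hx hy; rewrite /= !(linearP (pd _)) hx hy scalerN; zmod.
- by rewrite /= !pd1 // !linear0 ?oppr0.
- have pdn (b : bool) l x : (l < N)%N -> odd (deg l) -> pd l (b%:R * x) = b%:R * pd l x.
    by move=> _ _; case: b; rewrite ?mul1r // !mul0r linear0.
  move=> k a hk ha; rewrite /= !pd_vM // !(linearD (pd _)) !(linearZZ (pd _)) !pdn // !pd_vM // ha.
  rewrite !scalerDr mulrN !scalerN !scalerA -!expr2 !sqrr_sign !scale1r.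
  have sx (b : bool) x : (b -> odd (deg k)) -> (-1) ^+ odd (deg k) *: (b%:R * x) = - (b%:R * x) :> A.
    by case: b => [/(_ isT) ->|_]; [rewrite expr1 scaleN1r|rewrite mul0r scaler0 oppr0].
  by rewrite !sx => [|/eqP ->|/eqP ->] //; zmod.
Qed.

(** Successive derivatives lead back to [1]. *)
Lemma pd_prod_neq0 l : uniq l -> {in l, forall j, (j < N)%N /\ odd (deg j)} ->
  \prod_(j <- l) v j != 0.
Proof.
elim: l => [|j l IH] /=; first by rewrite big_nil oner_neq0.
case/andP=> jl ul h; have [hj oj] := h j (mem_head _ _).
have hl : {in l, forall j, (j < N)%N /\ odd (deg j)} by move=> i hi; apply: h; rewrite inE hi orbT.
rewrite big_cons; apply: contraNneq (IH ul hl) => /(congr1 (pd j)).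
rewrite linear0 pd_vM // eqxx mul1r.
have -> : pd j (\prod_(i <- l) v i) = 0; last by rewrite mulr0 scaler0 addr0 => ->.
elim: l jl hl {ul IH h} => [|i l IH]; first by rewrite big_nil pd1.
rewrite inE negb_or => /andP[/negbTE ji jl] hl; have [hi oi] := hl i (mem_head _ _).
rewrite big_cons pd_vM // IH // ?mulr0 ?scaler0 ?addr0; first by rewrite eq_sym ji mul0r.
by move=> k hk; apply: hl; rewrite inE hk orbT.
Qed.

(** The expansion in one variable, iterated over [l]; the terms that involve a
    derivative vanish by hypothesis. *)
Lemma kill_expand (B : pred nat) l a : uniq l -> {in l, forall j, [/\ (j < N)%N, odd (deg j) & ~~ B j]} ->
  {in l, forall j, kill B (pd j a) = 0} -> kill B a = kill B (kill (mem l) a).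
Proof.
elim: l a => [|j l IH] a /=.
  move=> _ _ _; have -> // : kill (mem [::]) a = a.
  by move: a; apply: (family_lr_eq (g := idfun)) => k hk; rewrite kill_gen.
case/andP=> jl ul h h0; have [hj oj Bj] := h j (mem_head _ _).
have e : kill B (kill (pred1 j) a) = kill B a.
  by rewrite {2}(pd_expand hj oj a) lrD lrM h0 ?mem_head // mulr0 addr0.
rewrite -e (IH (kill (pred1 j) a)) //.
- rewrite (kill_kill (mem l)); congr (kill B _); apply: eq_kill => k hk.
  by rewrite /= inE orbC.
- by move=> i hi; apply: h; rewrite inE hi orbT.
- move=> i hi; have [hin oin Bi] := h i (mem_behead (s := j :: l) hi).
  rewrite pd_kill //=; last by apply: contraNneq jl => <-.
  rewrite kill_kill; have := congr1 (kill (pred1 j)) (h0 i (mem_behead (s := j :: l) hi)).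
  rewrite kill_kill lr0 => <-; apply: eq_kill => k hk /=; exact: orbC.
Qed.

Lemma scaling_ex (c : nat -> rat) : exists h : {lrmorphism A -> A},
  graded_mor h /\ forall k, (k < N)%N -> h (v k) = c k *: v k.
Proof.
by have [_ _ univ] := hv; apply: univ => k hk; apply: (ssZ (gr_subspace _)); exact: v_gr.
Qed.

Definition scaling (wt : nat -> nat) : {lrmorphism A -> A} := sval (cid (scaling_ex (fun k => 2 ^+ wt k))).

Lemma scaling_gr wt : graded_mor (scaling wt).
Proof. by rewrite /scaling; case: cid => h /= []. Qed.

Lemma scaling_gen wt k : (k < N)%N -> scaling wt (v k) = 2 ^+ wt k *: v k.
Proof. by rewrite /scaling; case: cid => h /= [_ hh] /hh. Qed.

End Calculus.

Section ScaledWeights.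
Variables (A : cdgaType) (s : {lrmorphism A -> A}).

Lemma weight1 : weight s 0 1. Proof. by rewrite /weight /= lr1 expr0 scale1r. Qed.

Lemma weightM m n a b : weight s m a -> weight s n b -> weight s (m + n) (a * b).
Proof. by rewrite /weight /= => ha hb; rewrite lrM ha hb -scalerAl -scalerAr scalerA exprD. Qed.

Lemma weight0_subalg : subalgebra (weight s 0).
Proof. by split; [exact: weight_subspace|exact: weight1|move=> x y; exact: weightM]. Qed.

Lemma weight_cmp w a n : graded_mor s -> weight s w a -> weight s w (cmp a n).
Proof. by rewrite /weight /= => hs ha; rewrite (cmp_mor hs) ha cmpZ. Qed.

Variables (N : nat) (deg : nat -> nat) (v : nat -> A).
Hypothesis hv : free_family N deg v.
Variable wt : nat -> nat.
Hypothesis hs : forall k, (k < N)%N -> weight s (wt k) (v k).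

Lemma family_weights a : exists n f, (forall k, weight s k (f k)) /\ a = \sum_(k < n) f k.
Proof.
move: a; apply: (family_ind hv).
- split; first by exists 0%N, (fun=> 0); rewrite big_ord0; split=> // k; exact: (ss0 (weight_subspace s k)).
  move=> c _ _ [n [f [hf ->]]] [m [g [hg ->]]].
  exists (maxn n m), (fun k => (if (k < n)%N then c *: f k else 0) + if (k < m)%N then g k else 0).
  split.
    move=> k; apply: (ssD (weight_subspace s k)); case: ifP => _ //; try exact: (ss0 (weight_subspace s k)).
    by apply: (ssZ (weight_subspace s k)).
  have cut r (h : nat -> A) : (r <= maxn n m)%N ->
      \sum_(k < maxn n m) (if (k < r)%N then h k else 0) = \sum_(k < r) h k.
    move=> hr; rewrite (sum_widen (n := r) (f := fun k => if (k < r)%N then h k else 0)) // => [|k].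
      by apply: eq_bigr => i _; rewrite ltn_ord.
    by rewrite ltnNge => ->.
  by rewrite big_split /= (cut n (fun k => c *: f k)) ?cut ?leq_maxl ?leq_maxr // scaler_sumr.
- by exists 1%N, (fun k => if k is 0%N then 1 else 0); rewrite big_ord1; split=> // -[|k]; [exact: weight1|exact: (ss0 (weight_subspace s _))].
- move=> k _ hk [n [f [hf ->]]].
  exists (wt k + n)%N, (fun i => if (wt k <= i)%N then v k * f (i - wt k)%N else 0); split.
    move=> i; case: leqP => hi; last exact: (ss0 (weight_subspace s i)).
    by rewrite -{1}(subnKC hi); apply: weightM => //; exact: hs.
  rewrite big_split_ord /= [X in _ = X + _]big1 ?add0r => [|i _]; last by rewrite leqNgt ltn_ord.
  by rewrite mulr_sumr; apply: eq_bigr => i _; rewrite leq_addr addKn.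
Qed.
End ScaledWeights.
(** * Pure families *)

(** The [x_i] come first, [Y] selects the [y_j], and the remaining generators are the
    [z_k]. *)
Definition pure_family (A : cdgaType) p N (deg : nat -> nat) (v : nat -> A) (Y : pred nat) :=
  [/\ free_family N deg v, (p <= N)%N,
      forall k, (k < N)%N -> odd (deg k) = (p <= k)%N /\ (0 < deg k)%N,
      forall k, (k < N)%N -> ~~ Y k -> diff (v k) = 0
    & forall k, (k < N)%N -> Y k -> (p <= k)%N /\ subalg_gen (gens p v) (diff (v k))].

Section Pure.
Variables (A : cdgaType) (p N : nat) (deg : nat -> nat) (v : nat -> A) (Y : pred nat).
Hypothesis pv : pure_family p N deg v Y.

Lemma pure_free : free_family N deg v. Proof. by case: pv. Qed.
Let hv := pure_free.

Lemma pure_lt i : (i < p)%N -> (i < N)%N.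
Proof. by move=> hi; have [_ h _ _ _] := pv; exact: leq_trans hi h. Qed.

Lemma pure_odd k : (k < N)%N -> odd (deg k) = (p <= k)%N.
Proof. by case: pv => _ _ h _ _ /h[]. Qed.

Lemma pure_deg k : (k < N)%N -> (0 < deg k)%N.
Proof. by case: pv => _ _ h _ _ /h[]. Qed.

Lemma pure_Yodd j : (j < N)%N -> Y j -> odd (deg j).
Proof. by move=> hj Yj; rewrite pure_odd //; have [_ _ _ _ /(_ j hj Yj)[]] := pv. Qed.

Lemma pure_d k : (k < N)%N -> ~~ Y k -> diff (v k) = 0.
Proof. by case: pv => _ _ _ h _; exact: h. Qed.

Lemma pure_dx i : (i < p)%N -> diff (v i) = 0.
Proof.
move=> hi; apply: pure_d; first exact: pure_lt.
apply/negP => Yi; have [_ _ _ _ /(_ i (pure_lt hi) Yi)[]] := pv.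
by rewrite leqNgt hi.
Qed.

Lemma pure_xC i a : (i < p)%N -> v i * a = a * v i.
Proof.
move=> hi; apply: (gr_evenC _ (v_gr hv (pure_lt hi))).
by rewrite pure_odd ?pure_lt // -ltnNge.
Qed.

Lemma xsub_cocycle a : subalg_gen (gens p v) a -> diff a = 0.
Proof.
by apply: (subalg_gen_min (cocycle_subalg A)) => _ [i hi ->]; exact: pure_dx.
Qed.

Lemma pure_dv k : (k < N)%N -> subalg_gen (gens p v) (diff (v k)).
Proof.
move=> hk; case: (boolP (Y k)) => Yk; first by have [_ _ _ _ /(_ k hk Yk)[]] := pv.
by rewrite pure_d //; apply: ss0; have [] := subalg_gen_subalg (gens p v).
Qed.

Lemma xsub_pd j a : (j < N)%N -> odd (deg j) -> subalg_gen (gens p v) a -> pd hv j a = 0.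
Proof.
move=> hj oj; apply: (@subalg_gen_min _ _ [set a | pd hv j a = 0]).
  split; [exact: ker_subspace|exact: pd1|move=> x y /= hx hy].
  by rewrite pdM // hx hy mul0r mulr0 addr0.
move=> _ [i hi ->] /=; rewrite pd_gen //; last exact: pure_lt.
by case: eqP => // e; move: oj; rewrite -e pure_odd ?pure_lt // leqNgt hi.
Qed.

Lemma pure_pd_d j a : (j < N)%N -> odd (deg j) -> pd hv j (diff a) = - diff (pd hv j a).
Proof. by move=> hj oj; apply: pd_d => // k hk; apply: xsub_pd => //; exact: pure_dv. Qed.

(** All generators have positive degree. *)
Lemma gr0_scalar b : gr 0 b -> exists c : rat, b = c *: 1 :> A.
Proof.
move=> hb; rewrite -(gr_cmp hb); move: b {hb}; apply: (family_ind hv).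
- split; first by exists 0; rewrite cmp0 scale0r.
  by move=> c x y [d hd] [e he]; exists (c * d + e); rewrite cmp_linear hd he scalerDl scalerA.
- by exists 1; rewrite (gr_cmp gr_one) scale1r.
- move=> k a hk _; exists 0; rewrite (cmpMl _ _ (v_gr hv hk)) scale0r.
  by rewrite leqNgt pure_deg.
Qed.

Lemma even_ideal a : exists f : nat -> A,
  a = kill hv (fun k => (k < p)%N) a + \sum_(i < p) v i * f i.
Proof.
move: a; apply: (family_ind hv).
- split; first by exists (fun=> 0); rewrite lr0 big1 ?addr0 // => i _; rewrite mulr0.
  move=> c x y [f hf] [g hg]; exists (fun i => c *: f i + g i).
  rewrite lrD lrZ {1}hf {1}hg scalerDr scaler_sumr.
  rewrite [X in _ = _ + X](_ : _ = \sum_(i < p) c *: (v i * f i) + \sum_(i < p) v i * g i).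
    by zmod.
  by rewrite -big_split; apply: eq_bigr => i _; rewrite /= mulrDr scalerAr.
- by exists (fun=> 0); rewrite lr1 big1 ?addr0 // => i _; rewrite mulr0.
- move=> k a hk [f hf]; rewrite lrM kill_gen //; case: (ltnP k p) => hkp.
    exists (fun i => if i == k then a else 0); rewrite mul0r add0r (bigD1 (Ordinal hkp)) //= eqxx.
    rewrite big1 ?addr0 // => i ne; case: eqP => [e|]; last by rewrite mulr0.
    by case/eqP: ne; exact/val_inj.
  exists (fun i => v k * f i); rewrite {1}hf mulrDr mulr_sumr; congr (_ + _).
  by apply: eq_bigr => i _; rewrite !mulrA (pure_xC (v k)).
Qed.

(** ** The weight that counts the generators in [Y] *)

Definition Yweights (s : {lrmorphism A -> A}) :=
  graded_mor s /\ forall k, (k < N)%N -> weight s (Y k) (v k).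

Lemma Yweights_ex : exists s, Yweights s.
Proof.
exists (scaling hv (fun k => Y k : nat)); split; first exact: scaling_gr.
by move=> k hk; rewrite /weight /= scaling_gen.
Qed.

Variable s : {lrmorphism A -> A}.
Hypothesis hs : Yweights s.

Lemma weight_x i : (i < p)%N -> weight s 0 (v i).
Proof.
move=> hi; have := hs.2 i (pure_lt hi); case: (boolP (Y i)) => // Yi.
by have := pure_Yodd (pure_lt hi) Yi; rewrite pure_odd ?pure_lt // leqNgt hi.
Qed.

Lemma xsub_weight a : subalg_gen (gens p v) a -> weight s 0 a.
Proof. by apply: (subalg_gen_min (weight0_subalg s)) => _ [i hi ->]; exact: weight_x. Qed.

Lemma weight_sum_ind (P : set A) : subspace P -> (forall w a, weight s w a -> P a) -> forall a, P a.
Proof.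
by move=> sP h a; have [n [f [hf ->]]] := family_weights hv hs.2 a; apply: ss_sum => // i _; exact: h (hf i).
Qed.

(** The differential lowers the weight by one. *)
Lemma s_d a : 2 *: s (diff a) = diff (s a).
Proof.
move: a; apply: (family_ind hv).
- split; first by rewrite /= !(d0, lr0) scaler0.
  by move=> c x y hx hy; rewrite /= diff_linear !lrD !lrZ diff_linear scalerDr -hx -hy !scalerA mulrC.
- by rewrite /= lr1 d1 lr0 scaler0.
- move=> k a hk ha; have e := hs.2 k hk; rewrite /weight /= in e.
  rewrite /= dM lrD !lrM (sg_mor hs.1) e -scalerAl dZ dM linearZ -ha !scalerDr -!scalerAl -!scalerAr.
  rewrite (xsub_weight (pure_dv hk)) expr0 scale1r !scalerA [2 * _]mulrC; congr (_ + _).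
  by case: (boolP (Y k)) => Yk; rewrite ?expr1 // pure_d // mul0r !scaler0.
Qed.

Lemma weight_d w a : weight s w.+1 a -> weight s w (diff a).
Proof.
rewrite /weight /= => ha; have := s_d a; rewrite ha dZ exprS -scalerA.
by apply: scalerI; rewrite pnatr_eq0.
Qed.

Lemma weight0_d a : weight s 0 a -> diff a = 0.
Proof.
rewrite /weight /= expr0 scale1r => ha; have := s_d a; rewrite ha.
have [n [f [hf ->]]] := family_weights hv hs.2 (diff a).
move/eqP; rewrite -subr_eq0 lr_sum scaler_sumr -sumrB => /eqP e.
apply: big1 => -[i hi] _ /=.
have e' : \sum_(k < n) (2 ^+ k.+1 - 1) *: f k = 0.
  rewrite -[RHS]e; apply: eq_bigr => k _.
  by have := hf k; rewrite /weight /= => ->; rewrite scalerA scalerBl scale1r exprS.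
have /eqP := weight_direct (fun k => ssZ (weight_subspace s k) (2 ^+ k.+1 - 1) (hf k)) e' hi.
by rewrite scaler_eq0 subr_eq0 -(expr0 2) => /orP[/eqP/pow2_inj|/eqP].
Qed.

Definition wproj := sval (cid (weight_proj (family_weights hv hs.2))).

Lemma wproj_weight w a : weight s w (wproj w a).
Proof. by rewrite /wproj; case: cid => P /= [h _ _]; exact: h. Qed.

Lemma wprojE w u a : weight s u a -> wproj w a = if w == u then a else 0.
Proof. by rewrite /wproj; case: cid => P /= [_ h _]; exact: h. Qed.

Lemma wproj_sum a : exists n, a = \sum_(k < n) wproj k a.
Proof. by rewrite /wproj; case: cid => P /= [_ _ h]; exact: h. Qed.

Lemma wproj_d w a : wproj w (diff a) = diff (wproj w.+1 a).
Proof.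
move: a; apply: weight_sum_ind; first exact: (eq_subspace (wproj w \o @dL A) (@dL A \o wproj w.+1)).
move=> [|u] a ha /=; first by rewrite (weight0_d ha) (wprojE _ ha) d0 linear0.
by rewrite (wprojE _ (weight_d ha)) (wprojE _ ha) eqSS; case: eqP; rewrite ?d0.
Qed.

Lemma wprojMl w x a : weight s 0 x -> wproj w (x * a) = x * wproj w a.
Proof.
move=> hx; move: a; apply: weight_sum_ind.
  split; first by rewrite /= mulr0 !linear0 mulr0.
  by move=> c a b ha hb; rewrite /= mulrDr -scalerAr !linearP ha hb mulrDr -scalerAr.
move=> u a ha /=; rewrite (wprojE _ ha) (wprojE _ (weightM hx ha)).
by rewrite add0n; case: eqP; rewrite ?mulr0.
Qed.

Lemma cob_weight w a : weight s w a -> coboundary a -> exists2 e, weight s w.+1 e & a = diff e.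
Proof.
move=> ha [e he]; exists (wproj w.+1 e); first exact: wproj_weight.
by rewrite -wproj_d -he (wprojE _ ha) eqxx.
Qed.

(** ** Exactness in positive weight *)

(** Minimality of [Y]: a cocycle of the form [c *: v j + b] with [c != 0] and [b] not
    involving [v j] could replace [v j] as a generator, and then [j] would leave
    [Y]. *)
Hypothesis minY : forall n j a c, (j < N)%N -> Y j -> gr n a -> diff a = 0 ->
  pd hv j a = c *: 1 -> c = 0.

Let X k := (k < p)%N.

(** Modulo the even generators, what remains is an exterior algebra; differentiate as
    long as the result is not zero there. *)
Lemma top_coefficient n b : gr n b -> kill hv X b != 0 ->
  exists J c, [/\ {in J, forall j, (j < N)%N /\ odd (deg j)}, c != 0
    & foldr (fun j x => pd hv j x) b J = c *: 1].
Proof.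
have [m] := ubnP n; elim: m n b => // m IH n b; rewrite ltnS => nm hb nz.
pose l := [seq k <- iota 0 N | (p <= k)%N].
have lP j : j \in l = ((p <= j) && (j < N))%N by rewrite mem_filter mem_iota.
have [[j [jl nzj]]|none] := pselect (exists j, j \in l /\ kill hv X (pd hv j b) != 0).
  move: jl; rewrite lP => /andP[pj hj]; have oj : odd (deg j) by rewrite pure_odd.
  case: (pd_shifted hv hj oj hb) => [e|[n' [e hb']]]; first by rewrite e lr0 eqxx in nzj.
  have [|J [c [h1 h2 h3]]] := IH n' _ _ hb' nzj.
    by apply: leq_trans nm; rewrite e -add1n leq_add2r pure_deg.
  exists (rcons J j), c; split=> //; last by rewrite foldr_rcons.
  by move=> i; rewrite mem_rcons inE => /orP[/eqP ->|/h1].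
have e : kill hv X b = kill hv X (kill hv (mem l) b).
  apply: kill_expand; first by rewrite filter_uniq // iota_uniq.
    by move=> j; rewrite lP => /andP[pj hj]; rewrite /X -leqNgt pure_odd.
  by move=> j jl; apply/eqP; apply: contra_notT none => h; exists j.
have [c ec] : exists c : rat, kill hv X (kill hv (mem l) b) = c *: 1.
  rewrite kill_kill; apply: kill_all => k hk /=; rewrite lP hk andbT /X.
  by case: ltnP.
have c0 : c != 0 by apply: contraNneq nz => c0; rewrite e ec c0 scale0r.
have n0 : n = 0%N.
  apply/eqP; apply: contraNT nz => n0; apply/eqP; rewrite e ec.
  apply: (gr_eq0 (m := 0) (n := n)); last by rewrite eq_sym.
    by apply: (ssZ (gr_subspace 0)); exact: gr_one.
  by rewrite -ec -e; exact: kill_gr.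
rewrite n0 in hb; have [d ed] := gr0_scalar hb.
exists [::], d; split=> //=; apply: contraNneq nz => d0; by rewrite ed d0 scale0r lr0.
Qed.

Lemma pd_anti_foldr j J a : (j < N)%N -> odd (deg j) -> {in J, forall j, (j < N)%N /\ odd (deg j)} ->
  exists c : rat, c != 0 /\
    pd hv j (foldr (fun j x => pd hv j x) a J) = c *: foldr (fun j x => pd hv j x) (pd hv j a) J.
Proof.
move=> hj oj; elim: J => [|i J IH] h /=; first by exists 1; rewrite oner_eq0 scale1r.
have [|c [c0 e]] := IH; first by move=> k hk; apply: h; rewrite inE hk orbT.
have [hi oi] := h i (mem_head _ _); exists (- c); rewrite oppr_eq0; split=> //.
by rewrite pd_anti // e linearZ scaleNr.
Qed.

Lemma pd_foldr_cocycle n J a : {in J, forall j, (j < N)%N /\ odd (deg j)} -> gr n a -> diff a = 0 ->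
  (exists m, gr m (foldr (fun j x => pd hv j x) a J)) /\ diff (foldr (fun j x => pd hv j x) a J) = 0.
Proof.
move=> h ha da; elim: J h => [|j J IH] h /=; first by split=> //; exists n.
have [|[m hm] dm] := IH; first by move=> k hk; apply: h; rewrite inE hk orbT.
have [hj oj] := h j (mem_head _ _); split.
  case: (pd_shifted hv hj oj hm) => [->|[m' [_ hm']]]; last by exists m'.
  by exists 0%N; exact: (ss0 (gr_subspace 0)).
by apply: oppr_inj; rewrite -pure_pd_d // dm linear0 oppr0.
Qed.

(** Otherwise further derivatives of [a] would produce a cocycle whose derivative with
    respect to [v j] is a nonzero scalar, against minimality. *)
Lemma kill_pd_cocycle n j a : (j < N)%N -> Y j -> gr n a -> diff a = 0 -> kill hv X (pd hv j a) = 0.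
Proof.
move=> hj Yj ha da; have oj := pure_Yodd hj Yj.
apply/eqP; apply: contraT => nz.
have [m hm] : exists m, gr m (pd hv j a).
  case: (pd_shifted hv hj oj ha) => [->|[m' [_ hm']]]; last by exists m'.
  by exists 0%N; exact: (ss0 (gr_subspace 0)).
have [J [c [h1 c0 e']]] := top_coefficient hm nz.
have [[m' hm'] dm'] := pd_foldr_cocycle h1 ha da.
have [d [d0 e]] := pd_anti_foldr a hj oj h1.
have /eqP : d * c = 0 by apply: (minY hj Yj hm' dm'); rewrite e e' scalerA.
by rewrite mulf_eq0 (negbTE d0) (negbTE c0).
Qed.

(** The part of [a] free of the generators in [Y] has weight zero, so it vanishes, and
    the derivatives in the remaining terms vanish modulo the even generators. *)
Lemma kill_positive_weight n k a : gr n a -> diff a = 0 -> weight s k.+1 a -> kill hv X a = 0.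
Proof.
move=> ha da wa; pose l := [seq j <- iota 0 N | Y j].
have lP j : j \in l = (Y j && (j < N)%N) by rewrite mem_filter mem_iota.
rewrite (kill_expand (l := l)).
- suff -> : kill hv (mem l) a = 0 by rewrite lr0.
  have e : kill hv (mem l) (s a) = kill hv (mem l) a.
    move: a {ha da wa}; apply: (family_lr_eq hv (f := kill hv (mem l) \o s)) => j hj /=.
    have := hs.2 j hj; rewrite /weight /= => ->; rewrite lrZ kill_gen //= lP hj andbT.
    by case: (Y j); rewrite ?scaler0 // expr0 scale1r.
  move: wa; rewrite /weight /= => wa; rewrite wa lrZ in e.
  have /eqP : (2 ^+ k.+1 - 1) *: kill hv (mem l) a = 0 by rewrite scalerBl scale1r e subrr.
  by rewrite scaler_eq0 subr_eq0 -(expr0 2) => /orP[/eqP/pow2_inj|/eqP].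
- by rewrite filter_uniq // iota_uniq.
- move=> j; rewrite lP => /andP[Yj hj]; split=> //; first exact: pure_Yodd.
  by rewrite /X -leqNgt -pure_odd //; exact: pure_Yodd.
- by move=> j; rewrite lP => /andP[Yj hj]; exact: kill_pd_cocycle ha da.
Qed.

Variable K : set A.
Hypothesis hK : acyclic_ideal K.

(** This is where formality is used.  By the preceding lemma [a] is a combination
    [\sum_i v i * f i]; modulo [K] each [f i] may be replaced by a cocycle, of
    the same positive weight and of smaller degree, which is exact by induction. *)
Lemma exact_positive_hom n k a : gr n a -> diff a = 0 -> weight s k.+1 a -> coboundary a.
Proof.
have [sK KMl KMr] : ideal K by case: hK.
have [m] := ubnP n; elim: m n a => // m IH n a; rewrite ltnS => nm ha da wa.
have [f] := even_ideal a; rewrite (kill_positive_weight ha da wa) add0r => ea.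
have /choice[b hb] : forall i, exists u, diff u = 0 /\ K (f i - u).
  by move=> i; exact: acyclic_cocycle_rep.
pose b' i := wproj k.+1 (b i).
have db' i : diff (b' i) = 0 by rewrite /b' -wproj_d (hb i).1 linear0.
have h1 : coboundary (a - \sum_(i < p) v i * b i).
  apply: (acyclic_exact hK).
    rewrite dB da sub0r d_sum big1 ?oppr0 // => i _.
    by rewrite dM pure_dx // (hb i).1 mul0r mulr0 addr0.
  rewrite {1}ea -sumrB; apply: ss_sum => // i _; rewrite -mulrBr.
  by apply: KMl; have [] := hb i.
have h2 : coboundary (a - \sum_(i < p) v i * b' i).
  have [e he] := h1; exists (wproj k.+2 e); rewrite -wproj_d -he linearB (linear_sum (wproj k.+1)).
  rewrite (wprojE _ wa) eqxx; congr (_ - _); apply: eq_bigr => i _.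
  by rewrite wprojMl //; exact: weight_x.
have h3 : coboundary (\sum_(i < p) cmp (v i * b' i) n).
  apply: ss_sum; first exact: cob_subspace.
  move=> i _; have hi := pure_lt (ltn_ord i).
  rewrite (cmpMl _ _ (v_gr hv hi)); case: leqP => hin; last exact: (ss0 (@cob_subspace A)).
  apply: cobMl; first exact: pure_dx.
  apply: (IH (n - deg i)%N) => //.
  - by apply: leq_trans nm; rewrite -{2}(subnK hin) -addn1 leq_add2l pure_deg.
  - exact: cmp_gr.
  - exact: cocycle_cmp.
  - by apply: weight_cmp hs.1 _; exact: wproj_weight.
have := cob_cmp n h2; rewrite cmpB (gr_cmp ha) -(cmpLE n (\sum_(i < p) _)) (linear_sum (cmpL n)) => h4.
have -> : a = (a - \sum_(i < p) cmp (v i * b' i) n) + \sum_(i < p) cmp (v i * b' i) n by zmod.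
by apply: (ssD (@cob_subspace A)).
Qed.

Lemma exact_positive k a : diff a = 0 -> weight s k.+1 a -> coboundary a.
Proof.
move=> da wa; have [n ->] := cmp_sum a; apply: ss_sum; first exact: cob_subspace.
move=> i _; apply: (exact_positive_hom (n := i) (k := k)); first exact: cmp_gr.
  exact: cocycle_cmp.
by apply: weight_cmp hs.1 _.
Qed.

(** The components of positive weight are exact, and the component of weight zero is
    what is left after killing the generators in [Y]. *)
Lemma cocycle_reduce a : diff a = 0 -> coboundary (a - kill hv Y a).
Proof.
move=> da; have e : kill hv Y a = wproj 0 a.
  have -> : kill hv Y a = wproj 0 (kill hv Y a).
    have hw : weight s 0 (kill hv Y a).
      move: (kill_in hv (B := Y) a); apply: subalg_gen_min; first exact: weight0_subalg.
      by move=> _ [k /andP[hk /negbTE Yk] ->]; have := hs.2 k hk; rewrite Yk.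
    by rewrite (wprojE _ hw) eqxx.
  move: a {da}; apply: (family_ind hv).
  - split; first by rewrite /= lr0.
    by move=> c x y hx hy; rewrite /= lrD lrZ !linearP hx hy.
  - by rewrite /= lr1.
  - move=> k a hk ha; rewrite /= lrM kill_gen //; have hw := hs.2 k hk; case: ifP hw => Yk hw.
      rewrite mul0r linear0; symmetry; move: a {ha}; apply: weight_sum_ind.
        by split; [rewrite /= mulr0 linear0|move=> c x y hx hy; rewrite /= mulrDr -scalerAr linearP hx hy scaler0 addr0].
      by move=> u a ha; rewrite /= (wprojE _ (weightM hw ha)).
    by rewrite !wprojMl // ha.
have [n ea] := wproj_sum a.
have : coboundary (\sum_(k < n) (wproj k a - (if k == 0%N :> nat then wproj 0 a else 0))).
  apply: ss_sum; first exact: cob_subspace.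
  move=> [[|k] hk] _ /=; first by rewrite subrr; exact: (ss0 (@cob_subspace A)).
  rewrite subr0; apply: (@exact_positive k); last exact: wproj_weight.
  by rewrite -wproj_d da linear0.
rewrite e sumrB -ea; case: n ea => [|n] ea; first by rewrite !big_ord0 in ea *; rewrite ea !subr0 linear0; rewrite ?subr0 => _; exact: (ss0 (@cob_subspace A)).
by rewrite big_ord_recl /= [X in _ - (_ + X)]big1 ?addr0 // => i _.
Qed.

End Pure.
(** * The number of generators that are not cocycles *)

(** Each odd generator occurs at most once in a word. *)
Lemma few_weights (A : cdgaType) N deg (v : nat -> A) (hv : free_family N deg v) l :
  uniq l -> {in l, forall j, (j < N)%N /\ odd (deg j)} -> forall a, exists f,
  (forall k, weight (scaling hv (fun i => i \in l)) k (f k)) /\ a = \sum_(k < (size l).+1) f k.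
Proof.
elim: l => [|j l IH] /=.
  move=> _ _ a; exists (fun k => if k is 0%N then a else 0); rewrite big_ord1; split=> //.
  case=> [|k]; last exact: (ss0 (weight_subspace _ _)).
  rewrite /weight /= expr0 scale1r; move: a; apply: (family_lr_eq hv (g := idfun)) => k hk.
  by rewrite scaling_gen // expr0 scale1r.
case/andP=> jl ul h a; have [hj oj] := h j (mem_head _ _).
have hl : {in l, forall j, (j < N)%N /\ odd (deg j)} by move=> i hi; apply: h; rewrite inE hi orbT.
have [f [hf ef]] := IH ul hl a; have [g [hg eg]] := IH ul hl (pd hv j a).
set s := scaling hv (fun i => i \in l) in hf hg; set s' := scaling hv _.
pose ki := kill hv (pred1 j).
have sk b : s' (ki b) = ki (s b).
  move: b; apply: (family_lr_eq hv (f := s' \o ki) (g := ki \o s)) => k hk /=.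
  rewrite kill_gen // scaling_gen // lrZ kill_gen //=; case: eqP => [_|/eqP/negbTE ne]; first by rewrite lr0 scaler0.
  by rewrite scaling_gen // inE ne.
have hki k b : weight s k b -> weight s' k (ki b).
  by rewrite /weight /= => hb; rewrite sk hb lrZ.
have hvj k b : weight s k b -> weight s' k.+1 (v j * ki b).
  move=> hb; rewrite -add1n; apply: weightM; last exact: hki.
  by rewrite /weight /= scaling_gen // mem_head.
have vv b : v j * ki b = v j * b.
  by rewrite [in RHS](pd_expand hv hj oj b) mulrDr mulrA (gr_odd_sqr (v_gr hv hj) oj) mul0r addr0.
exists (fun k => (if (k < (size l).+1)%N then ki (f k) else 0) + (if k is k'.+1 then v j * ki (g k') else 0)).
split.
  move=> k; apply: (ssD (weight_subspace _ k)).
    by case: ifP => _; [exact: hki|exact: (ss0 (weight_subspace _ k))].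
  by case: k => [|k]; [exact: (ss0 (weight_subspace _ 0))|exact: hvj].
rewrite big_split /= big_ord_recr /= ltnn addr0 [X in _ + X]big_ord_recl /= add0r.
rewrite (pd_expand hv hj oj a) -/ki {1}ef lr_sum; congr (_ + _).
  by apply: eq_bigr => i _; rewrite ltn_ord.
by rewrite eg mulr_sumr; apply: eq_bigr => i _; rewrite vv.
Qed.

Definition exact_above (A : cdgaType) (s : {lrmorphism A -> A}) m :=
  forall k a, (m < k)%N -> weight s k a -> diff a = 0 -> coboundary a.

Definition has_socle (A : cdgaType) p (v : nat -> A) (s : {lrmorphism A -> A}) m :=
  exists c, [/\ weight s m c, diff c = 0, ~ coboundary c
    & forall i, (i < p)%N -> coboundary (v i * c)].

(** An odd generator [w] with [dw = v i] is adjoined.  For a cocycle [a + w * b] of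
    weight [k + 1], the coefficient [b] is a cocycle of weight [k]; if it is
    [de], then subtracting a boundary leaves a cocycle without [w].  A socle
    element [c] with [v i * c = de] yields the socle element [w * c - e]. *)
Lemma tower_step (A : cdgaType) p N deg (v : nat -> A) Y (s : {lrmorphism A -> A}) i :
  pure_family p N deg v Y -> Yweights N v Y s -> (i < p)%N ->
  exists (C : cdgaType) deg' (v' : nat -> C) Y' (s' : {lrmorphism C -> C}),
  [/\ pure_family p N.+1 deg' v' Y', Yweights N.+1 v' Y' s',
      [/\ diff (v' N) = v' i, Y' N, deg' i = (deg' N).+1 & forall k, (k < N)%N -> deg' k = deg k /\ Y' k = Y k],
      forall k l, (k < N)%N -> (l < N)%N -> diff (v k) = v l -> diff (v' k) = v' l
    & forall m, exact_above s m -> exact_above s' m.+1 /\ (has_socle p v s m -> has_socle p v' s' m.+1)].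
Proof.
move=> pv hs hi; have hv := pure_free pv; have hiN := pure_lt pv hi.
have di : (0 < deg i)%N := pure_deg pv hiN.
have on : odd (deg i).-1 by move: (pure_odd pv hiN) di; rewrite leqNgt hi; case: (deg i) => //= n /negbFE.
have gvi : gr (deg i).-1.+1 (v i) by rewrite prednK //; exact: (v_gr hv hiN).
have [C [j [w [[mj gw dw] hdec hun univ]]]] := adjoin_odd on gvi (pure_dx pv hi).
pose v' k := if (k < N)%N then j (v k) else w.
pose deg' k := if (k < N)%N then deg k else (deg i).-1.
pose Y' := [pred k | if (k < N)%N then Y k else true].
have v'E k : (k < N)%N -> v' k = j (v k) by rewrite /v' => ->.
have v'N : v' N = w by rewrite /v' ltnn.
have jS a : subalg_gen (gens N.+1 v') (j a).
  have [[s0 sD] s1 sM] := subalg_gen_subalg (gens N.+1 v').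
  move: a; apply: (family_ind hv) => [||k a hk ha].
  - by split; [rewrite /= lr0|move=> c x y hx hy; rewrite /= lrD lrZ; exact: sD].
  - by rewrite /= lr1.
  - rewrite /= lrM; apply: sM => //; apply: subalg_gen_sub.
    by exists k; rewrite ?v'E // ltnS ltnW.
have fv' : free_family N.+1 deg' v'.
  split.
  - move=> k; rewrite ltnS leq_eqVlt => /orP[/eqP ->|hk]; rewrite /deg' ?v'N ?ltnn //.
    by rewrite v'E // hk; apply: mj.1; exact: (v_gr hv hk).
  - move=> e; have [a [b ->]] := hdec e; have [[_ sD] _ sM] := subalg_gen_subalg (gens N.+1 v').
    rewrite -[j a]scale1r; apply: sD => //; apply: sM => //; apply: subalg_gen_sub.
    by exists N; rewrite ?v'N.
  - move=> D c hc; have [_ _ uv] := hv.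
    have [|h0 [g0 e0]] := uv D c; first by move=> k hk; have := hc k (ltnW hk); rewrite /deg' hk.
    have [|h [gh hj hw]] := univ D h0 (c N) g0; first by have := hc N (ltnSn N); rewrite /deg' ltnn.
    exists h; split=> // k; rewrite ltnS leq_eqVlt => /orP[/eqP ->|hk]; first by rewrite v'N.
    by rewrite v'E // hj e0.
have jx a : subalg_gen (gens p v) a -> subalg_gen (gens p v') (j a).
  have [[s0 sD] s1 sM] := subalg_gen_subalg (gens p v').
  apply: (@subalg_gen_ind _ _ [set a | subalg_gen (gens p v') (j a)]).
  - by split; [rewrite /= lr0|move=> c x y hx hy; rewrite /= lrD lrZ; exact: sD].
  - by rewrite /= lr1.
  - move=> _ b [k hk ->] hb; rewrite /= lrM; apply: sM => //; apply: subalg_gen_sub.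
    by exists k => //; rewrite v'E //; exact: (pure_lt pv hk).
have pv' : pure_family p N.+1 deg' v' Y'.
  split=> //.
  - by case: pv => _ h _ _ _; exact: leqW.
  - move=> k; rewrite ltnS leq_eqVlt => /orP[/eqP ->|hk]; rewrite /deg' ?ltnn ?hk.
      case: pv => _ -> _ _ _; rewrite on; split=> //; by case: (deg i).-1 on.
    by split; [exact: (pure_odd pv hk)|exact: (pure_deg pv hk)].
  - move=> k; rewrite ltnS leq_eqVlt => /orP[/eqP ->|hk]; rewrite /= ?ltnn ?hk // => nY.
    by rewrite v'E // -mj.2 (pure_d pv hk nY) lr0.
  - move=> k; rewrite ltnS leq_eqVlt => /orP[/eqP ->|hk]; rewrite /= ?ltnn ?hk // => Yk.
      case: pv => _ h _ _ _; split=> //; rewrite v'N dw; apply: subalg_gen_sub.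
      by exists i; rewrite ?v'E.
    rewrite v'E // -mj.2; case: pv => _ _ _ _ /(_ k hk Yk)[h1 h2]; split=> //; exact: jx.
have [s' hs'] := Yweights_ex pv'.
exists C, deg', v', Y', s'; split=> //.
- split; rewrite ?v'N ?v'E //= ?ltnn //; first by rewrite /deg' hiN ltnn prednK.
  by move=> k hk; rewrite /deg' hk.
- by move=> k l hk hl e; rewrite !v'E // -mj.2 e.
have sj a : s' (j a) = j (s a).
  move: a; apply: (family_lr_eq hv (f := s' \o j) (g := j \o s)) => k hk /=.
  have := hs.2 k hk; rewrite /weight /= => ->; have := hs'.2 k (ltnW hk).
  by rewrite /weight /= hk v'E // lrZ.
have sw : s' w = 2 *: w.
  by have := hs'.2 N (ltnSn N); rewrite /weight /= ltnn v'N expr1.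
have un a b a' b' : j a + w * j b = j a' + w * j b' -> a = a' /\ b = b'.
  move=> e; have [|e1 e2] := hun (a - a') (b - b').
    by rewrite !lrB mulrBr -[RHS](subrr (j a' + w * j b')) -{1}e; zmod.
  by split; apply/eqP; rewrite -subr_eq0 ?e1 ?e2.
have wpair k a b : weight s' k.+1 (j a + w * j b) -> weight s k.+1 a /\ weight s k b.
  rewrite /weight /= lrD lrM !sj sw -scalerAl scalerDr => h.
  have [|e1 e2] := un (s a) (2 *: s b) (2 ^+ k.+1 *: a) (2 ^+ k.+1 *: b).
    by rewrite !lrZ -!scalerAr h.
  by split=> //; move: e2; rewrite exprS -scalerA => /scalerI -> //; rewrite pnatr_eq0.
have sgw : sg w = - w by rewrite (sgE gw) -signr_odd on expr1 scaleN1r.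
have dpair a b : diff (j a + w * j b) = j (diff a + v i * b) + w * j (- diff b).
  by rewrite dD dM dw sgw -!mj.2 lrD lrM lrN mulNr mulrN addrA.
have dpair0 a b : diff (j a + w * j b) = 0 -> diff b = 0 /\ diff a = - (v i * b).
  rewrite dpair => /hun[/eqP h1 /eqP h2]; move: h2 h1; rewrite oppr_eq0 => /eqP ->.
  by rewrite addr_eq0 => /eqP.
have wvi k a : weight s k a -> weight s k (v i * a).
  by move=> ha; rewrite -[k]add0n; apply: weightM => //; exact: (weight_x pv hs hi).
move=> m ex.
split.
  move=> [//|k] e; rewrite ltnS => mk; have [a [b ->]] := hdec e => /wpair[wa wb] /dpair0[db da].
  have [e' we' eb] := cob_weight pv hs wb (ex _ _ mk wb db).
  have [e'' ee''] : coboundary (a + v i * e').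
    apply: (ex k.+1); first exact: leq_trans mk (leqnSn k).
      by apply: (ssD (weight_subspace s k.+1)) => //; exact: wvi.
    by rewrite dD da dM (pure_dx pv hi) mul0r add0r (sgE gvi) -signr_odd /= on expr0 scale1r -eb addNr.
  exists (j e'' + w * j (- e')); rewrite dpair -ee'' dN opprK -eb.
  by congr (j _ + _); rewrite mulrN; zmod.
move=> [c [wc dc nc hc]].
have [e we ee] := cob_weight pv hs (wvi _ _ wc) (hc i hi).
exists (w * j c - j e); split.
- rewrite -add1n; apply: (ssB (weight_subspace s' _)).
    apply: weightM; first by rewrite /weight /= expr1.
    by move: wc; rewrite /weight /= => wc; rewrite sj wc lrZ.
  by move: we; rewrite /weight /= => we; rewrite sj we lrZ.
- by rewrite dB dM dw sgw -!mj.2 dc lr0 mulr0 addr0 -ee lrM subrr.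
- move=> [u eu]; apply: nc; have [a [b eab]] := hdec u.
  have [] := un (- e) c (diff a + v i * b) (- diff b).
    by rewrite -dpair -eab -eu lrN addrC.
  by move=> _ ->; exists (- b); rewrite dN.
- move=> k hk; have hkN := pure_lt pv hk.
  have xk b : v' k * (w * b) = w * (v' k * b).
    rewrite !mulrA v'E //; congr (_ * b); apply: (gr_evenC _ (mj.1 _ _ (v_gr hv hkN))).
    by rewrite (pure_odd pv hkN) -ltnNge.
  have wvk x : weight s m x -> weight s m (v k * x).
    by move=> hx; rewrite -[m]add0n; apply: weightM => //; exact: (weight_x pv hs hk).
  have [f wf ef] := cob_weight pv hs (wvk _ wc) (hc k hk).
  have [g eg] : coboundary (v i * f - v k * e).
    apply: (ex m.+1) => //.
      apply: (ssB (weight_subspace s _)); first exact: wvi.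
      by rewrite -[m.+1]add0n; apply: weightM => //; exact: (weight_x pv hs hk).
    rewrite dB !dM (pure_dx pv hi) (pure_dx pv hk) !mul0r !add0r -ef -ee.
    have sx l : (l < p)%N -> sg (v l) = v l.
      move=> hl; have hlN := pure_lt pv hl.
      by rewrite (sgE (v_gr hv hlN)) -signr_odd (pure_odd pv hlN) leqNgt hl expr0 scale1r.
    rewrite !sx // !mulrA (pure_xC pv (v k) hi) subrr //.
  exists (j g - w * j f).
  rewrite dB -mj.2 -eg dM dw sgw -mj.2 -ef mulrBr xk v'E // -!lrM lrB mulNr.
  by zmod.
Qed.

(** The Koszul construction on all even generators. *)
Lemma tower (A : cdgaType) p M deg (v : nat -> A) Y (s : {lrmorphism A -> A}) :
  pure_family p M deg v Y -> Yweights M v Y s -> exact_above s 0 -> has_socle p v s 0 ->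
  forall n, (n <= p)%N -> exists (C : cdgaType) deg' (v' : nat -> C) Y' (s' : {lrmorphism C -> C}),
  [/\ pure_family p (M + n) deg' v' Y', Yweights (M + n) v' Y' s',
      forall j, (j < n)%N -> [/\ diff (v' (M + j)%N) = v' j, Y' (M + j)%N & deg' j = (deg' (M + j)%N).+1],
      forall k, (k < M)%N -> Y' k = Y k & exact_above s' n /\ has_socle p v' s' n].
Proof.
move=> pv hs ex so; have [_ pM _ _ _] := pv; elim=> [_|n IH hn].
  by exists A, deg, v, Y, s; rewrite addn0; split.
have [C [deg1 [v1 [Y1 [s1 [pv1 hs1 h1 hY1 [ex1 so1]]]]]]] := IH (ltnW hn).
have [D [deg2 [v2 [Y2 [s2 [pv2 hs2 [d2 Y2N e2 hk2] hd2 hes]]]]]] := tower_step pv1 hs1 hn.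
have [ex2 so2] := hes _ ex1; exists D, deg2, v2, Y2, s2; rewrite addnS; split=> //.
- move=> j; rewrite ltnS leq_eqVlt => /orP[/eqP ->//|hj].
  have [dj Yj ej] := h1 j hj; have hM : (M + j < M + n)%N by rewrite ltn_add2l.
  have hjM : (j < M + n)%N by rewrite (leq_trans (leq_trans hj (ltnW hn))) // (leq_trans pM) ?leq_addr.
  split; first exact: hd2.
    by have [_ ->] := hk2 _ hM.
  by have [-> _] := hk2 _ hM; have [-> _] := hk2 _ hjM.
- by move=> k hk; have [_ ->] := hk2 _ (leq_trans hk (leq_addr n M)); exact: hY1.
- by split=> //; exact: so2.
Qed.
(** After the Koszul construction the cohomology is an exterior algebra on the [z_k]
    and on as many generators of weight one as there are elements in [l].  Exactness above weight [p] shows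
    that there are at most [p] of them, the socle element in weight [p] that
    there are at least [p]. *)
Section Count.
Variables (C : cdgaType) (p M : nat) (deg : nat -> nat) (v : nat -> C) (Y : pred nat).
Variable s : {lrmorphism C -> C}.
Hypotheses (pv : pure_family p (M + p) deg v Y) (hs : Yweights (M + p) v Y s) (pM : (p <= M)%N).
Hypothesis hT : forall j, (j < p)%N -> [/\ diff (v (M + j)%N) = v j, Y (M + j)%N & deg j = (deg (M + j)%N).+1].

Let hv := pure_free pv.
Let l := [seq k <- iota 0 M | Y k].
Let B k := (k < p)%N || (M <= k)%N.
Let lP k : k \in l = (Y k && (k < M)%N). Proof. by rewrite mem_filter mem_iota. Qed.
Let ul : uniq l. Proof. by rewrite filter_uniq // iota_uniq. Qed.
Let lN k : k \in l -> (k < M + p)%N. Proof. by rewrite lP => /andP[_ h]; exact: leq_trans h (leq_addr _ _). Qed.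
Let lodd k : k \in l -> odd (deg k).
Proof. by move=> hk; apply: (pure_Yodd pv (lN hk)); move: hk; rewrite lP => /andP[]. Qed.
Let lp k : k \in l -> (p <= k)%N. Proof. by move=> hk; rewrite -(pure_odd pv (lN hk)) lodd. Qed.
Let lB k : k \in l -> B k = false.
Proof. by move=> hk; rewrite /B ltnNge (lp hk) leqNgt /=; move: hk; rewrite lP => /andP[_ ->]. Qed.
Let pN i : (i < p)%N -> (i < M + p)%N. Proof. exact: (pure_lt pv). Qed.
Let MN j : (j < p)%N -> (M + j < M + p)%N. Proof. by rewrite ltn_add2l. Qed.

Lemma xsub_expand n a : subalg_gen (gens p v) a -> gr n.+1 a ->
  exists g : nat -> C, (forall i, subalg_gen (gens p v) (g i)) /\ a = \sum_(i < p) v i * g i.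
Proof.
have [sS s1 sM] := subalg_gen_subalg (gens p v); have [s0 sD] := sS.
have sv i : (i < p)%N -> subalg_gen (gens p v) (v i) by move=> hi; apply: subalg_gen_sub; exists i.
move=> xa ga.
have [c [g [hg ea]]] : exists (c : rat) (g : nat -> C), (forall i, subalg_gen (gens p v) (g i)) /\ a = c *: 1 + \sum_(i < p) v i * g i.
  move: a xa {ga}; apply: subalg_gen_ind.
  - split; first by exists 0, (fun=> 0); split=> //; rewrite scale0r add0r big1 // => i _; rewrite mulr0.
    move=> d x y [c [g [hg ->]]] [c' [g' [hg' ->]]]; exists (d * c + c'), (fun i => d *: g i + g' i).
    split; first by move=> i; exact: sD.
    rewrite scalerDl scalerDr scalerA scaler_sumr.
    rewrite [X in _ = _ + X](_ : _ = \sum_(i < p) d *: (v i * g i) + \sum_(i < p) v i * g' i); first by zmod.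
    by rewrite -big_split; apply: eq_bigr => i _; rewrite /= mulrDr scalerAr.
  - by exists 1, (fun=> 0); split=> //; rewrite scale1r big1 ?addr0 // => i _; rewrite mulr0.
  - move=> _ x [i hi ->] [c [g [hg ex]]].
    have xx : subalg_gen (gens p v) x.
      rewrite ex; apply: sD; first exact: s1.
      by apply: ss_sum => // j _; apply: sM => //; exact: sv.
    exists 0, (fun k => if k == i then x else 0); split; first by move=> k; case: eqP.
    rewrite scale0r add0r (bigD1 (Ordinal hi)) //= eqxx big1 ?addr0 // => j ne.
    by case: eqP => [e|]; [case/eqP: ne; exact/val_inj|rewrite mulr0].
exists g; split=> //; rewrite {1}ea.
have -> : c *: 1 = 0 :> C; last by rewrite add0r.
have e : kill hv B a = c *: 1.
  rewrite ea lrD lrZ lr1 lr_sum big1 ?addr0 // => i _.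
  by rewrite lrM kill_gen ?pN // /B ltn_ord mul0r.
apply: (gr_eq0 (m := 0) (n := n.+1)) => //; first by apply: (ssZ (gr_subspace 0)); exact: gr_one.
by rewrite -e; exact: kill_gr.
Qed.

Let G : set C := [set x | exists2 i, (i < M + p)%N && (i \notin l) & x = v i].

(** The generators [s_i = v (M + i)], for which [d s_i = v i], turn the other
    ones into cocycles [v k - \sum_i s_i * g_i]. *)
Lemma closed_correction k : k \in l -> exists u,
  [/\ gr (deg k) u, diff u = - diff (v k), weight s 1 u, subalg_gen G u & kill hv B u = 0].
Proof.
move=> kl; have hk := lN kl.
have [g [hg eg]] := xsub_expand (pure_dv pv hk) (diff_deg (v_gr hv hk)).
have [sG G1 GM] := subalg_gen_subalg G.
pose U := - \sum_(i < p) v (M + i)%N * g i.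
have dU : diff U = - diff (v k).
  rewrite dN d_sum eg; congr (- _); apply: eq_bigr => i _.
  by rewrite dM (xsub_cocycle pv (hg i)) mulr0 addr0; have [->] := hT (ltn_ord i).
exists (cmp U (deg k)); split.
- exact: cmp_gr.
- by rewrite -cmp_d dU -[RHS](@gr_cmp _ (deg k).+1) //; apply: (ssN (gr_subspace _)); apply: diff_deg; exact: (v_gr hv hk).
- apply: (weight_cmp _ hs.1); apply: (ssN (weight_subspace s 1)); apply: ss_sum; first exact: weight_subspace.
  move=> i _; rewrite -[1%N]addn0; apply: weightM; last exact: (xsub_weight pv hs (hg i)).
  by have := hs.2 _ (MN (ltn_ord i)); have [_ -> _] := hT (ltn_ord i).
- apply: subalg_gen_homogeneous; first by move=> _ [i /andP[hi _] ->]; exists (deg i); exact: (v_gr hv hi).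
  apply: (ssN sG); apply: (ss_sum sG) => i _; apply: GM.
    by apply: subalg_gen_sub; exists (M + i)%N => //; rewrite MN //= lP ltnNge leq_addr andbF.
  move: (hg i); apply: subalg_gen_mono => _ [j hj ->]; apply: subalg_gen_sub.
  by exists j => //; rewrite pN //=; apply/negP => /lp; rewrite leqNgt hj.
- rewrite (cmp_mor (@kill_gr _ _ _ _ hv B)) lrN lr_sum big1 ?oppr0 ?cmp0 // => i _.
  by rewrite lrM kill_gen ?MN // /B leq_addr orbT mul0r.
Qed.

Lemma weight_prod (r : seq nat) (F : nat -> C) : {in r, forall k, weight s 1 (F k)} ->
  weight s (size r) (\prod_(k <- r) F k).
Proof.
elim: r => [|k r IH] h; first by rewrite big_nil; exact: weight1.
rewrite big_cons /= -add1n; apply: weightM; first by apply: h; rewrite mem_head.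
by apply: IH => i hi; apply: h; rewrite inE hi orbT.
Qed.

Hypothesis ex : exact_above s p.

(** The product of the corrected generators is a cocycle of weight [size l].  Were it
    exact, killing the [v i] and the [s_i], after which the differential is zero,
    would show that the product of the generators in [l] vanishes. *)
Lemma count_le : (size l <= p)%N.
Proof.
rewrite leqNgt; apply/negP => lt.
have /choice[u hu] : forall k, exists u, k \in l ->
  [/\ gr (deg k) u, diff u = - diff (v k), weight s 1 u, subalg_gen G u & kill hv B u = 0].
  move=> k; case: (boolP (k \in l)) => hk; last by exists 0.
  by have [u h] := closed_correction hk; exists u.
have w1 : {in l, forall k, weight s 1 (v k + u k)}.
  move=> k kl; have [_ _ h _ _] := hu k kl; apply: (ssD (weight_subspace s 1)) => //.
  by have := hs.2 k (lN kl); move: kl; rewrite lP => /andP[->].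
have [e he] : coboundary (\prod_(k <- l) (v k + u k)).
  apply: (ex lt (weight_prod w1)).
  rewrite big_seq; change (cocycle (\prod_(k <- l | k \in l) (v k + u k))).
  apply: subalg_prod; first exact: cocycle_subalg.
  by move=> k kl; have [_ h _ _ _] := hu k kl; rewrite /cocycle /= dD h subrr.
have kd a : kill hv B (diff a) = 0.
  move: a; apply: (family_ind hv).
  - split; first by rewrite /= d0 lr0.
    by move=> c x y hx hy; rewrite /= diff_linear lrD lrZ hx hy scaler0 addr0.
  - by rewrite /= d1 lr0.
  - move=> k a hk ha; rewrite /= dM lrD !lrM ha mulr0 addr0.
    have [g [_ ->]] := xsub_expand (pure_dv pv hk) (diff_deg (v_gr hv hk)).
    rewrite lr_sum big1 ?mul0r // => i _.
    by rewrite lrM kill_gen ?pN // /B ltn_ord mul0r.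
have := kd e; rewrite -he lr_prod.
have -> : \prod_(k <- l) kill hv B (v k + u k) = \prod_(k <- l) v k.
  rewrite big_seq [RHS]big_seq; apply: eq_bigr => k kl.
  by have [_ _ _ _ h] := hu k kl; rewrite lrD h addr0 kill_gen ?lN // lB.
by apply/eqP; apply: (pd_prod_neq0 hv ul) => k kl; split; [exact: lN|exact: lodd].
Qed.

Hypothesis so : has_socle p v s p.

(** In the new generators the differential is that of a Koszul complex; the
    Euler operator [L = d h + h d] of its contracting derivation [h] is
    invertible on all words that contain some [v i], [i < p], or [s_i]. *)
Lemma count_ge : (p <= size l)%N.
Proof.
rewrite leqNgt; apply/negP => lt.
have /choice[u0 hu0] : forall k, exists u, k \in l ->
  [/\ gr (deg k) u, diff u = - diff (v k), weight s 1 u, subalg_gen G u & kill hv B u = 0].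
  move=> k; case: (boolP (k \in l)) => hk; last by exists 0.
  by have [u h] := closed_correction hk; exists u.
pose u k := if k \in l then u0 k else 0.
pose y k := v k + u k.
have yl k : k \notin l -> y k = v k by move=> h; rewrite /y /u (negbTE h) addr0.
have hy : free_family (M + p) deg y.
  apply: (free_family_change hv (B := fun k => k \notin l)) => k hk; rewrite /u.
  - by case: ifP => [/hu0[]|] // _; exact: (ss0 (gr_subspace _)).
  - by move/negbTE ->.
  - case: ifP => [/hu0[]|] // _; apply: ss0; have [] := subalg_gen_subalg [set x | exists2 i, (i < M + p)%N && (i \notin l) & x = v i].
    by [].
have dy k : (k < M + p)%N -> diff (y k) = if (M <= k)%N then y (k - M)%N else 0.
  move=> hk; case: leqP => hkM; last first.
    case: (boolP (k \in l)) => kl; last by rewrite yl // (pure_d pv hk) //; apply: contra kl; rewrite lP hkM andbT.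
    by rewrite /y /u kl dD; have [_ -> _ _ _] := hu0 k kl; rewrite subrr.
  have hj : (k - M < p)%N by rewrite ltn_subLR.
  have [+ _ _] := hT hj; rewrite subnKC // => dk.
  rewrite yl; last by rewrite lP ltnNge hkM andbF.
  by rewrite yl //; apply/negP => /lp; rewrite leqNgt hj.
have wy k : (k < M + p)%N -> weight s (Y k) (y k).
  move=> hk; case: (boolP (k \in l)) => kl; last by rewrite yl //; exact: hs.2.
  rewrite /y /u kl; apply: (ssD (weight_subspace s _)); first exact: hs.2.
  by have [_ _ h _ _] := hu0 k kl; move: (kl); rewrite lP => /andP[->].
clearbody y.
pose w k := if (k < p)%N then y (M + k)%N else 0.
have hw k : (k < M + p)%N -> shifted 1 (deg k) (w k).
  move=> hk; rewrite /w; case: ltnP => hkp; last by left.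
  by right; exists (deg (M + k)%N); have [_ _ ->] := hT hkp; rewrite add1n; split=> //; apply: (v_gr hy); exact: MN.
have [h [hg hM]] := odd_derivation hy (n := 1%N) isT hw.
have h1 : h 1 = 0.
  by have /eqP := hM 1 1; rewrite sg1 !mul1r mulr1 -subr_eq0 opprD addrA subrr add0r oppr_eq0 => /eqP.
have hsg a : h (sg a) = - sg (h a).
  move: a; apply: (family_ind hy).
  - split; first by rewrite /= !linear0 ?oppr0.
    by move=> c x z hx hz; rewrite /= !(linearP sg) !(linearP h) (linearP sg) hx hz scalerN; zmod.
  - by rewrite /= sg1 h1 linear0 ?oppr0.
  - move=> k a hk ha; rewrite /= sgM !hM [sg (_ + _)]linearD !sgM ha sgK mulrN opprD; congr (_ + _); rewrite -mulNr; congr (_ * _).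
    rewrite (sg_v hy hk) (linearZZ h) hg // /w; case: ltnP => hkp; last by rewrite scaler0 (linear0 sg) oppr0.
    rewrite (sg_v hy (MN hkp)); have [_ _ ->] := hT hkp.
    by rewrite /=; case: odd; rewrite /= ?expr0 ?expr1 ?scaleN1r ?scale1r ?opprK.
pose e k : nat := B k.
have [L LE] : exists L : {linear C -> C}, forall a, L a = diff (h a) + h (diff a).
  by exists ((@dL C \o h) \+ (h \o @dL C)).
have LM a b : L (a * b) = L a * b + a * L b.
  rewrite !LE !dM !hM !(linearD h) !hM !dD !dM hsg d_sg !sgK sg_d.
  rewrite !mulrDl !mulrDr !(mulNr, mulrN) opprK.
  have e1 : sg (diff a) = - diff (sg a) by rewrite sg_d.
  by rewrite ?hsg ?e1 ?mulNr; zmod.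
have Ly k : (k < M + p)%N -> L (y k) = (e k)%:R *: y k.
  move=> hk; rewrite LE dy // hg // /w /e /B; case: (leqP M k) => hkM.
    have hj : (k - M < p)%N by rewrite ltn_subLR.
    rewrite ltnNge (leq_trans pM hkM) /= d0 add0r hg ?pN // /w hj subnKC // scale1r //.
  rewrite linear0 addr0; case: (ltnP k p) => hkp /=; last by rewrite d0 scale0r.
  by rewrite dy ?MN // leq_addr addKn scale1r.
have [D DE] : exists D : nat -> {linear C -> C}, forall t a, D t a = L a - t%:R *: a.
  by exists (fun t => L \- (t%:R \*: idfun)).
(* the product of the commuting operators [L - t] for [t] in [r] *)
pose DD r a := foldr (fun t x => D t x) a r.
have DDlin r (c : rat) a b : DD r (c *: a + b) = c *: DD r a + DD r b.
  by elim: r => //= t r ->; rewrite linearP.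
have DDr0 r : DD r 0 = 0 by elim: r => //= t r ->; rewrite linear0.
have DDL r a : DD r (L a) = L (DD r a).
  by elim: r => //= t r ->; rewrite !DE (linearB L) (linearZZ L).
have DDD r t a : DD r (D t a) = D t (DD r a).
  by rewrite !DE -[L a - _]addrC -scaleNr DDlin DDL scaleNr addrC.
have DDC r r' a : DD r (DD r' a) = DD r' (DD r a).
  by elim: r' => //= t r' IH; rewrite DDD IH.
pose Np : set C := [set a | exists r, all (leq 1) r /\ DD r a = 0].
have sNp : subspace Np.
  split; first by exists [::].
  move=> c a b [r [hr ea]] [r' [hr' eb]]; exists (r ++ r'); rewrite all_cat hr hr'; split=> //.
  by rewrite /DD foldr_cat -!/(DD _ _) DDlin DDlin DDC ea eb !DDr0 scaler0 addr0.
(* if [(L - t) a] is exact and [a] is a cocycle, then so is [t *: a], as [L a = d (h a)] *)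
have exactNp a : Np a -> diff a = 0 -> coboundary a.
  case=> r []; elim: r a => [|t r IH] a /=; first by move=> _ -> _; exact: (ss0 (@cob_subspace C)).
  case/andP=> t0 hr ea da.
  have dL0 : diff (L a) = 0 by rewrite LE da linear0 addr0 diff_diff.
  have : coboundary (D t a).
    apply: IH => //; first by rewrite DDD.
    by rewrite DE dB dL0 dZ da scaler0 subrr.
  rewrite DE LE da linear0 addr0 => -[b eb]; exists (t%:R^-1 *: (h a - b)).
  rewrite dZ dB -eb opprB addrC subrK scalerA mulVf ?scale1r // pnatr_eq0.
  by case: (t) t0.
pose ka := kill hy B.
have Lk a : L (ka a) = 0.
  move: a; apply: (family_ind hy).
  - split; first by rewrite /= lr0 linear0.
    by move=> c x z hx hz; rewrite /= lrD lrZ (linearP L) hx hz scaler0 addr0.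
  - by rewrite /= lr1 LE h1 d0 d1 linear0 addr0.
  - move=> k a hk ha; rewrite /= lrM kill_gen //; case: ifP => Bk; first by rewrite mul0r linear0.
    by rewrite LM Ly // /e Bk scale0r mul0r ha mulr0 addr0.
have Npk a : Np (a - ka a).
  move: a; apply: (family_ind hy).
  - split; first by rewrite /= lr0 subr0; exact: ss0.
    move=> c x z hx hz; rewrite /= lrD lrZ.
    have -> : c *: x + z - (c *: ka x + ka z) = c *: (x - ka x) + (z - ka z).
      by rewrite scalerBr; zmod.
    exact: sNp.2.
  - by rewrite /= lr1 subrr; exact: ss0.
  - move=> k a hk [r [hr er]]; rewrite /= lrM kill_gen //.
    have sh r' b : DD [seq (e k + t)%N | t <- r'] (y k * b) = y k * DD r' b.
      elim: r' => //= t r' ->; rewrite !DE LM Ly // natrD scalerDl mulrBr -scalerAl -scalerAr.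
      by zmod.
    case: ifP => Bk; last first.
      rewrite -mulrBr; exists [seq (e k + t)%N | t <- r]; rewrite sh er mulr0; split=> //.
      by rewrite all_map; apply: sub_all hr => t h0; rewrite /= (leq_trans h0) // leq_addl.
    rewrite mul0r subr0.
    have -> : y k * a = y k * (a - ka a) + y k * ka a by rewrite -mulrDr subrK.
    apply: (ssD sNp).
      exists [seq (e k + t)%N | t <- r]; rewrite sh er mulr0; split=> //.
      by rewrite all_map; apply: sub_all hr => t h0; rewrite /= (leq_trans h0) // leq_addl.
    exists [:: 1%N]; split=> //=.
    by rewrite DE LM Lk mulr0 addr0 Ly // /e Bk !scale1r subrr.
(* what remains lies in the exterior algebra, of weight at most [size l] *)
have k0 m a : (size l < m)%N -> weight s m a -> ka a = 0.
  move=> hm wa; have hl : {in l, forall j, (j < M + p)%N /\ odd (deg j)}.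
    by move=> j jl; split; [exact: lN|exact: lodd].
  have [f [hf ea]] := few_weights hy ul hl a.
  set s' := scaling _ _ in hf.
  have sk b : s (ka b) = ka (s' b).
    move: b; apply: (family_lr_eq hy (f := s \o ka) (g := ka \o s')) => k hk /=.
    rewrite kill_gen // scaling_gen // lrZ kill_gen //; case: ifP => Bk; first by rewrite lr0 scaler0.
    have := wy k hk; rewrite /weight /= => ->; congr (_ ^+ _ *: _).
    by rewrite lP ltnNge; move: Bk; rewrite /B => /norP[_ ->]; rewrite andbT.
  have wka k b : weight s' k b -> weight s k (ka b) by rewrite /weight /= => hb; rewrite sk hb lrZ.
  have wm : weight s m (ka a).
    have ks b : ka (s b) = s (ka b).
      move: b; apply: (family_lr_eq hy (f := ka \o s) (g := s \o ka)) => k hk /=.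
      have := wy k hk; rewrite /weight /= => sy.
      by rewrite sy lrZ kill_gen //; case: ifP => _; rewrite ?lr0 ?scaler0.
    by move: wa; rewrite /weight /= => wa; rewrite -ks wa lrZ.
  have P m' : wproj pv hs m' (ka a) = if m' == m then ka a else 0 by exact: wprojE.
  rewrite -[LHS](_ : wproj pv hs m (ka a) = _); last by rewrite P eqxx.
  rewrite {1}ea lr_sum linear_sum big1 // => -[i hi] _ /=.
  rewrite (wprojE pv hs m (wka _ _ (hf i))); case: eqP => // em.
  by move: hm; rewrite em ltnNge -ltnS hi.
have [c [wc dc nc _]] := so; apply: nc; apply: exactNp => //.
by rewrite -[c]subr0 -(k0 p c lt wc); exact: Npk.
Qed.

Lemma count_eq : size l = p.
Proof. by apply/eqP; rewrite eqn_leq count_le count_ge. Qed.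

End Count.
(** * Structure of a pure formal algebra *)

Section Minimal.
Variables (A : cdgaType) (p N : nat) (deg : nat -> nat).

Lemma replace_generator (v : nat -> A) Y (pv : pure_family p N deg v Y) n j a c :
  (j < N)%N -> Y j -> gr n a -> diff a = 0 -> pd (pure_free pv) j a = c *: 1 -> c != 0 ->
  exists v' : nat -> A, pure_family p N deg v' [pred k | Y k && (k != j)].
Proof.
move=> hj Yj ha da ea c0; have hv := pure_free pv; have oj := pure_Yodd pv hj Yj.
have pj : (p <= j)%N by rewrite -(pure_odd pv hj).
have ndeg : n = deg j.
  case: (pd_shifted (pure_free pv) hj oj ha) => [|[m [-> hm]]].
    by rewrite ea => /eqP; rewrite scaler_eq0 (negbTE c0) oner_eq0.
  have [->|m0] := eqVneq m 0%N; first by rewrite addn0.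
  have /eqP : c *: 1 = 0 :> A.
    apply: (gr_eq0 (m := 0) (n := m)); last by rewrite eq_sym.
      by apply: (ssZ (gr_subspace 0)); exact: gr_one.
    by rewrite -ea.
  by rewrite scaler_eq0 (negbTE c0) oner_eq0.
pose u k := if k == j then c^-1 *: kill (pure_free pv) (pred1 j) a else 0.
have uj : v j + u j = c^-1 *: a.
  rewrite /u eqxx [in RHS](pd_expand (pure_free pv) hj oj a) ea -scalerAr mulr1 scalerDr scalerA.
  by rewrite mulVf // scale1r addrC.
have uk k : k != j -> v k + u k = v k by move=> h; rewrite /u (negbTE h) addr0.
exists (fun k => v k + u k).
have fv : free_family N deg (fun k => v k + u k).
  apply: (free_family_change hv (B := fun k => k != j)) => k hk; rewrite /u.
  - case: eqP => [->|_]; last exact: (ss0 (gr_subspace _)).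
    by apply: (ssZ (gr_subspace _)); apply: kill_gr; rewrite -ndeg.
  - by move/negbTE ->.
  - have [sG _ _] := subalg_gen_subalg [set x | exists2 i, (i < N)%N && (i != j) & x = v i].
    by case: eqP => [_|_]; [apply: (ssZ sG); exact: kill_in|exact: (ss0 sG)].
have [_ pN h1 h2 h3] := pv; split=> //.
- move=> k hk /=; have [->|kj] := eqVneq k j; first by rewrite uj dZ da scaler0.
  by rewrite andbT uk // => nY; exact: h2.
- move=> k hk /= /andP[Yk kj]; rewrite uk //; have [pk hd] := h3 k hk Yk; split=> //.
  move: hd; apply: subalg_gen_mono => _ [i hi ->]; apply: subalg_gen_sub; exists i => //.
  by rewrite uk // neq_ltn (leq_trans hi pj).
Qed.

(** Descent on the number of generators in [Y]. *)
Lemma minimal_family (v : nat -> A) Y : pure_family p N deg v Y ->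
  exists (v' : nat -> A) Y' (pv' : pure_family p N deg v' Y'),
  forall n j a c, (j < N)%N -> Y' j -> gr n a -> diff a = 0 ->
    pd (pure_free pv') j a = c *: 1 -> c = 0.
Proof.
have [m] := ubnP (count Y (iota 0 N)); elim: m v Y => // m IH v Y; rewrite ltnS => hm pv.
have [h|h] := pselect (forall n j a c, (j < N)%N -> Y j -> gr n a -> diff a = 0 ->
    pd (pure_free pv) j a = c *: 1 -> c = 0); first by exists v, Y, pv.
have [n [j [a [c [[hj Yj ha] [da ea /eqP c0]]]]]] : exists n j a c,
    [/\ (j < N)%N, Y j & gr n a] /\ [/\ diff a = 0, pd (pure_free pv) j a = c *: 1 & c <> 0].
  apply: contrapT => none; apply: h => n j a c hj Yj ha da ea; apply: contrapT => c0.
  by apply: none; exists n, j, a, c.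
have [v' pv'] := replace_generator hj Yj ha da ea c0; apply: (IH v' _ _ pv').
apply: leq_trans hm; set r := [seq k <- iota 0 N | Y k].
have e1 : size r = (count (pred1 j) r + count (predC (pred1 j)) r)%N by rewrite count_predC.
have e2 : count (predC (pred1 j)) r = count [pred k | Y k && (k != j)] (iota 0 N).
  by rewrite count_filter; apply: eq_count => k /=; rewrite andbC.
rewrite -[count Y _]size_filter -/r e1 -e2 -add1n leq_add2r -has_count.
by apply/hasP; exists j => //=; rewrite mem_filter Yj mem_iota.
Qed.
End Minimal.

(** A finite list of representatives has bounded degree. *)
Lemma high_degree_exact (A : cdgaType) : fin_dim_cohomology A ->
  exists D, forall n (a : A), (D < n)%N -> gr n a -> diff a = 0 -> coboundary a.
Proof.
case=> s [hs hz].
have [D hD] : exists D, forall n, (D < n)%N -> {in s, forall a, cmp a n = 0}.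
  elim: s {hs hz} => [|a s [D IH]]; first by exists 0%N.
  have [m hm] := cmp_bound a; exists (maxn D m) => n; rewrite gtn_max => /andP[Dn mn] b.
  by rewrite inE => /orP[/eqP ->|/(IH n Dn)//]; apply: hm; exact: ltnW.
exists D => n a Dn ga da; have [b hb] := hz a da.
have : cmp (a - diff b) n = 0.
  have sP : subspace [set x : A | cmp x n = 0].
    by split=> [|c x y /= hx hy]; rewrite /= ?cmp0 // cmp_linear hx hy scaler0 addr0.
  by apply: (span_min sP _ hb) => x /(hD n Dn).
rewrite cmpB (gr_cmp ga) => /eqP; rewrite subr_eq0 => /eqP ->.
by apply: cob_cmp; exists b.
Qed.

(** Elimination of coefficients by substituting [t] and [2 t]. *)
Lemma poly_coefficients (M : lmodType rat) (K : set M) n (m : nat -> M) : subspace K ->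
  (forall t : rat, K (\sum_(i < n) t ^+ i *: m i)) -> forall i, (i < n)%N -> K (m i).
Proof.
move=> sK; elim: n m => // n IH m h.
have hlow i : (i < n)%N -> K (m i).
  move=> hi; have : K ((2 ^+ i - 2 ^+ n) *: m i).
    apply: (IH (fun i => (2 ^+ i - 2 ^+ n) *: m i)) => // t.
    have := ssB sK (h (2 * t)) (ssZ sK (2 ^+ n) (h t)).
    rewrite scaler_sumr -sumrB big_ord_recr /= exprMn scalerA subrr addr0.
    congr K; apply: eq_bigr => j _; rewrite exprMn !scalerA -scalerBl; congr (_ *: _).
    by rewrite mulrBr [t ^+ j * 2 ^+ j]mulrC [t ^+ j * _]mulrC.
  move/(ssZ sK (2 ^+ i - 2 ^+ n)^-1); rewrite scalerA mulVf ?scale1r //.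
  by rewrite subr_eq0; apply/eqP => /pow2_inj e; rewrite e ltnn in hi.
move=> i; rewrite ltnS leq_eqVlt => /orP[/eqP ->|]; last exact: hlow.
have := h 1; rewrite big_ord_recr /= expr1n scale1r => hn.
have -> : m n = (\sum_(i < n) 1 ^+ i *: m i + m n) - \sum_(i < n) 1 ^+ i *: m i by zmod.
by apply: (ssB sK) => //; apply: (ss_sum sK) => j _; apply: (ssZ sK); exact: hlow.
Qed.

(** Replacing [u] by [u + t *: x] in a power and comparing the coefficients of [t] turns
    one factor [u] into [x]; so [c]-th powers span the products of [c] factors. *)
Lemma polarization (A : algType rat) (X K : set A) c : subspace K ->
  (forall x, span X x -> forall y, span X y -> x * y = y * x) ->
  (forall u, span X u -> K (u ^+ c)) ->
  forall s, size s = c -> {in s, forall x, X x} -> K (\prod_(x <- s) x).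
Proof.
move=> sK com h s hs hX.
suff H r : forall k u, size r = k -> (k <= c)%N -> {in r, forall x, X x} -> span X u ->
    K (\prod_(x <- r) x * u ^+ (c - k)).
  have := H s c 0 hs (leqnn c) hX (ss0 (span_subspace X)).
  by rewrite subnn expr0 mulr1.
elim/last_ind: r => [|r x IH] k u.
  by move=> <- _ _ hu; rewrite big_nil mul1r subn0; exact: h.
rewrite size_rcons => <- kc hr hu.
have hr' : {in r, forall x, X x} by move=> y hy; apply: hr; rewrite mem_rcons inE hy orbT.
have hx : span X x by apply: span_sub; apply: hr; rewrite mem_rcons mem_head.
pose e := (c - size r)%N; have e1 : e = (c - (size r).+1).+1 by rewrite /e subnSK.
have ht t : K (\sum_(i < e.+1) t ^+ i *: (\prod_(y <- r) y * (u ^+ (e - i) * x ^+ i *+ 'C(e, i)))).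
  have := IH (size r) (u + t *: x) erefl (ltnW kc) hr'.
  have hut : span X (u + t *: x).
    by apply: (ssD (span_subspace X)) => //; apply: (ssZ (span_subspace X)).
  move/(_ hut); rewrite -/e exprDn_comm; last first.
    by apply: com => //; apply: (ssZ (span_subspace X)).
  rewrite mulr_sumr; congr K; apply: eq_bigr => i _.
  by rewrite exprZn -scalerAr scalerMnr -scalerAr.
have := @poly_coefficients _ K e.+1 (fun i => \prod_(y <- r) y * (u ^+ (e - i) * x ^+ i *+ 'C(e, i))) sK ht 1%N.
rewrite e1 ltnS => /(_ isT); rewrite subn1 /= expr1 bin1 -scaler_nat -scalerAr.
move/(ssZ sK (((c - (size r).+1).+1)%:R^-1)); rewrite scalerA mulVf ?pnatr_eq0 // scale1r.
rewrite -cats1 big_cat big_seq1 /= -mulrA; congr (K (_ * _)).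
elim: (c - _)%N => [|i IHi]; first by rewrite expr0 mul1r mulr1.
by rewrite exprS -mulrA IHi !mulrA (com u hu x hx).
Qed.

Section Structure.
Variables (A : cdgaType) (p q : nat) (deg : nat -> nat) (v0 : nat -> A) (Y0 : pred nat) (K : set A).
Hypotheses (pv0 : pure_family p (p + q) deg v0 Y0) (hK : acyclic_ideal K) (fA : fin_dim_cohomology A).

(** A boundary has no component in degree zero. *)
Lemma acyclic_1 : ~ K 1.
Proof.
move=> K1; have [y ey] := acyclic_exact hK (d1 A) K1.
have := gr_cmp (@gr_one A); rewrite ey cmp_d0 -ey => /eqP.
by rewrite eq_sym oner_eq0.
Qed.

Definition words (X : set A) n a := exists s : seq A, [/\ size s = n, {in s, forall x, X x} & a = \prod_(x <- s) x].

(** Both bounds use only this.  [X] is the set of the [x_i] of a minimal choice, and [zs]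
    is the list of its [z_k]; the last condition is the survival of the top class. *)
Theorem structure : exists (X : set A) (zs : seq A) c u,
  [/\ (p <= q)%N /\ size zs = (q - p)%N,
      forall x, X x -> (exists2 n, gr n x & ~~ odd n && (0 < n)%N) /\ diff x = 0,
      {in zs, forall z, (exists2 n, gr n z & odd n) /\ diff z = 0},
      [/\ forall n w, (c < n)%N -> words X n w -> K w,
         forall a, exists b, subalg_gen (X `|` [set z | z \in zs]) b /\ K (a - b)
       & forall n a, gr n a -> (0 < n)%N -> exists b, K (a - b) /\
         exists s : seq (A * A), {in s, forall t, X t.1 \/ t.1 \in zs} /\ b = \sum_(t <- s) t.1 * t.2]
    & span X u /\ ~ K (u ^+ c * \prod_(z <- zs) z)].
Proof.
have [v [Y [pv minY]]] := minimal_family pv0.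
have hv := pure_free pv; have [s hs] := Yweights_ex pv.
set N := (p + q)%N in pv hv hs minY *.
have [sK KMl KMr] : ideal K by case: hK.
pose X := gens p v.
have hX x : X x -> (exists2 n, gr n x & ~~ odd n && (0 < n)%N) /\ diff x = 0.
  case=> i hi ->; have hiN := pure_lt pv hi; split; last exact: (pure_dx pv hi).
  by exists (deg i); [exact: (v_gr hv hiN)|rewrite (pure_odd pv hiN) -ltnNge hi (pure_deg pv hiN)].
have [D hD] := high_degree_exact fA.
have hword w n : words X n w -> [/\ exists2 m, gr m w & (n <= m)%N, diff w = 0 & weight s 0 w].
  case=> r [<- hr ->]; elim: r hr => [|x r IH] hr.
    by rewrite big_nil; split; [exists 0%N => //; exact: gr_one|exact: d1|exact: weight1].
  have [|[m gm rm] dm wm] := IH; first by move=> y hy; apply: hr; rewrite inE hy orbT.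
  have Xx : X x by apply: hr; rewrite mem_head.
  have [[n' gx /andP[_ n0]] dx] := hX x Xx; rewrite big_cons; split.
  - by exists (n' + m)%N; [exact: gr_mul|rewrite /= -add1n leq_add].
  - by rewrite dM dx dm mul0r mulr0 addr0.
  - by rewrite -[0%N]addn0; apply: weightM => //; case: Xx => i hi ->; exact: (weight_x pv hs hi).
have longK w n : (D < n)%N -> words X n w -> K w.
  move=> Dn /hword[[m gm nm] dw _]; apply: (coboundary_acyclic hK).
  by apply: hD gm dw; exact: leq_trans Dn nm.
have [c [[w [hw nKw]] hc]] : exists c, (exists w, words X c w /\ ~ K w) /\
    forall n w, (c < n)%N -> words X n w -> K w.
  have w0 : exists w, words X 0 w /\ ~ K w.
    by exists 1; split; [exists [::]; rewrite big_nil|exact: acyclic_1].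
  suff H d c : (exists w, words X c w /\ ~ K w) -> (D <= c + d)%N ->
      exists c, (exists w, words X c w /\ ~ K w) /\ forall n w, (c < n)%N -> words X n w -> K w.
    by apply: (H D 0%N).
  elim: d c => [|d IH] c hc Dc.
    by exists c; split=> // n w cn; apply: longK; apply: leq_trans cn; rewrite ltnS -[c]addn0.
  have [[n [w [cn [hw nK]]]]|none] := pselect (exists n w, (c < n)%N /\ (words X n w /\ ~ K w)).
    by apply: (IH n); [exists w|apply: leq_trans Dc _; rewrite addnS -addSn leq_add2r].
  by exists c; split=> // n w cn hw; apply: contrapT => nK; apply: none; exists n, w.
have exab : exact_above s 0.
  by move=> [//|k] a _ wa da; exact: (exact_positive hs minY hK da wa).
have soc : has_socle p v s 0.
  have [_ dw ww] := hword _ _ hw; exists w; split=> //.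
    by move/(coboundary_acyclic hK).
  move=> i hi; apply: (acyclic_exact hK); first by rewrite dM (pure_dx pv hi) dw mul0r mulr0 addr0.
  apply: (hc c.+1) => //; have [r [hr rX ->]] := hw; exists (v i :: r); split.
  - by rewrite /= hr.
  - by move=> x; rewrite inE => /orP[/eqP ->|/rX//]; exists i.
  - by rewrite big_cons.
have pN : (p <= N)%N by exact: leq_addr.
have cnt : size [seq k <- iota 0 N | Y k] = p.
  have [C [deg' [v' [Y' [s' [pv' hs' hT hY' [ex' so']]]]]]] := tower pv hs exab soc (leqnn p).
  rewrite -[RHS](count_eq pv' hs' pN hT ex' so'); congr size.
  by apply: eq_in_filter => k; rewrite mem_iota => /andP[_ hk]; rewrite hY'.
pose zi := [seq k <- iota 0 N | ~~ Y k && (p <= k)%N].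
have ziP k : k \in zi = [&& ~~ Y k, (p <= k)%N & (k < N)%N] by rewrite mem_filter mem_iota /= andbA.
pose zs := [seq v k | k <- zi].
have Yp k : (k < N)%N -> Y k -> (p <= k)%N.
  by move=> hk Yk; rewrite -(pure_odd pv hk); exact: (pure_Yodd pv hk Yk).
have szi : (p + size zi)%N = q.
  have e1 : (count Y (iota 0 N) + count (predC Y) (iota 0 N))%N = N.
    by rewrite count_predC size_iota.
  have e2 : count (predC Y) (iota 0 N) = (p + size zi)%N.
    rewrite size_filter iotaD !count_cat add0n; congr (_ + _)%N.
      rewrite -[RHS](size_iota 0) -size_filter; apply/eqP; rewrite size_filter -all_count; apply/allP.
      move=> k; rewrite mem_iota /= => hk; apply/negP => Yk.
      by have := Yp k (leq_trans hk pN) Yk; rewrite leqNgt hk.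
    rewrite [X in (X + _)%N](_ : _ = 0%N); last first.
      apply/eqP; rewrite -leqn0 leqNgt -has_count; apply/hasPn => k.
      by rewrite mem_iota /= => hk; rewrite leqNgt hk andbF.
    by rewrite add0n; apply: eq_in_count => k; rewrite mem_iota /= => /andP[-> _]; rewrite andbT.
  rewrite -size_filter cnt e2 in e1.
  by move/eqP: e1; rewrite /N -{1}[(_ + _)%N]addn0 -!addnA !eqn_add2l addn0 => /eqP.
have com x : span X x -> forall y, span X y -> x * y = y * x.
  move=> hx y _; move: x hx; apply: span_min.
    by split=> [|d x1 x2 /= h1 h2]; rewrite /= ?mul0r ?mulr0 // mulrDl mulrDr -scalerAl -scalerAr h1 h2.
  by move=> _ [i hi ->]; exact: (pure_xC pv _ hi).
have [u [hu nKu]] : exists u, span X u /\ ~ K (u ^+ c).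
  apply: contrapT => none; apply: nKw; have [r [hr rX ->]] := hw.
  apply: (polarization sK com _ hr rX) => u hu.
  by apply: contrapT => nK; apply: none; exists u.
have xu a : span X a -> subalg_gen (gens p v) a.
  have [sS _ _] := subalg_gen_subalg (gens p v).
  by apply: (span_min sS); exact: subalg_gen_sub.
have xuc : subalg_gen (gens p v) (u ^+ c) by apply: (subalgX _ (subalg_gen_subalg _)); exact: xu.
exists X, zs, c, u; split=> //.
- by rewrite size_map; split; [rewrite -szi leq_addr|rewrite -szi addKn].
- move=> _ /mapP[k hk ->]; move: hk; rewrite ziP => /and3P[nY pk hk].
  by split; [exists (deg k); [exact: (v_gr hv hk)|rewrite (pure_odd pv hk)]|exact: (pure_d pv hk nY)].
- split=> // [a|n a ga n0].
    have [t [dt Kt]] := acyclic_cocycle_rep hK a.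
    exists (kill (pure_free pv) Y t); split.
      move: (kill_in (pure_free pv) (B := Y) t); apply: subalg_gen_mono => _ [k /andP[hk nY] ->].
      apply: subalg_gen_sub; case: (ltnP k p) => hkp; first by left; exists k.
      by right; apply/mapP; exists k => //; rewrite ziP nY hkp hk.
    have -> : a - kill (pure_free pv) Y t = (a - t) + (t - kill (pure_free pv) Y t) by zmod.
    apply: (ssD sK) => //; apply: (coboundary_acyclic hK).
    exact: (cocycle_reduce hs minY hK dt).
  have [t [dt Kt]] := acyclic_cocycle_rep hK a.
  pose t' := cmp t n; have dt' : diff t' = 0 by exact: cocycle_cmp.
  have Kt' : K (a - t').
    by have [_ hh _ _] := hK; rewrite -(gr_cmp ga) -cmpB; exact: hh.
  exists (kill (pure_free pv) Y t'); split.
    have -> : a - kill (pure_free pv) Y t' = (a - t') + (t' - kill (pure_free pv) Y t') by zmod.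
    apply: (ssD sK) => //; apply: (coboundary_acyclic hK).
    exact: (cocycle_reduce hs minY hK dt').
  have red b : exists (d : rat) (r : seq (A * A)), {in r, forall t, X t.1 \/ t.1 \in zs} /\
      kill (pure_free pv) Y b = d *: 1 + \sum_(t <- r) t.1 * t.2.
    move: b; apply: (family_ind hv).
    - split; first by exists 0, [::]; rewrite lr0 scale0r big_nil addr0.
      move=> d x y [d1 [r1 [h1 e1]]] [d2 [r2 [h2 e2]]].
      exists (d * d1 + d2), ([seq (t.1, d *: t.2) | t <- r1] ++ r2); split.
        by move=> z; rewrite mem_cat => /orP[/mapP[z' /h1 hz' ->]|/h2].
      rewrite lrD lrZ e1 e2 big_cat big_map scalerDl !scalerDr scalerA scaler_sumr /=.
      have -> : \sum_(i <- r1) i.1 * (d *: i.2) = \sum_(i <- r1) d *: (i.1 * i.2).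
        by apply: eq_bigr => i _; rewrite scalerAr.
      by zmod.
    - by exists 1, [::]; rewrite lr1 scale1r big_nil addr0.
    - move=> k b hk _; rewrite /= lrM kill_gen //; case: ifP => Yk.
        by exists 0, [::]; rewrite mul0r scale0r big_nil addr0.
      exists 0, [:: (v k, kill (pure_free pv) Y b)]; rewrite big_seq1 scale0r add0r; split=> //.
      move=> z; rewrite inE => /eqP -> /=; case: (ltnP k p) => hkp; first by left; exists k.
      by right; apply/mapP; exists k => //; rewrite ziP Yk hkp hk.
  have [d [r [hr er]]] := red t'; exists r; split=> //.
  rewrite er; suff -> : d *: 1 = 0 :> A by rewrite add0r.
  pose ka := kill (pure_free pv) xpredT.
  have kX x : X x \/ x \in zs -> ka x = 0.
    case=> [[i hi ->]|/mapP[k + ->]]; first by rewrite /ka kill_gen //; exact: (pure_lt pv hi).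
    by rewrite ziP => /and3P[_ _ hk]; rewrite /ka kill_gen.
  have : ka (kill (pure_free pv) Y t') = d *: 1.
    rewrite er lrD lrZ lr1 lr_sum big_seq big1 ?addr0 // => z /hr hz.
    by rewrite lrM kX // mul0r.
  move=> ed; apply: (gr_eq0 (m := 0) (n := n)); last by rewrite neq_ltn n0.
    by apply: (ssZ (gr_subspace 0)); exact: gr_one.
  by rewrite -ed; apply: kill_gr; apply: kill_gr; exact: cmp_gr.
- split=> // hKz; apply: nKu.
  have uC b : u ^+ c * b = b * u ^+ c.
    move: (u ^+ c) xuc; apply: subalg_gen_ind.
    - by split=> [|d x y /= hx hy]; rewrite /= ?mul0r ?mulr0 // mulrDl mulrDr -scalerAl -scalerAr hx hy.
    - by rewrite mul1r mulr1.
    - by move=> _ x [i hi ->] hx; rewrite -mulrA hx !mulrA (pure_xC pv b hi).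
  rewrite uC big_map in hKz.
  have dzs r : {in r, forall k, [&& ~~ Y k, (p <= k)%N & (k < N)%N]} -> diff (\prod_(k <- r) v k * u ^+ c) = 0.
    elim: r => [|k r IH] hr; first by rewrite big_nil mul1r; exact: (xsub_cocycle pv xuc).
    rewrite big_cons -mulrA dM IH => [|i hi]; last by apply: hr; rewrite inE hi orbT.
    have /and3P[nY _ hk] := hr k (mem_head _ _).
    by rewrite (pure_d pv hk nY) mul0r mulr0 addr0.
  apply: (coboundary_acyclic hK).
  (* differentiating with respect to the [z]s removes them one by one *)
  suff H r : uniq r -> {in r, forall k, [&& ~~ Y k, (p <= k)%N & (k < N)%N]} ->
      coboundary (\prod_(k <- r) v k * u ^+ c) -> coboundary (u ^+ c).
    apply: (H zi) => [||]; [by rewrite filter_uniq // iota_uniq|by move=> k; rewrite ziP|].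
    by apply: (acyclic_exact hK) => //; apply: dzs => k; rewrite ziP.
  elim: r => [|k r IH] /=; first by rewrite big_nil mul1r.
  case/andP=> kr ur hr [e ee]; have /and3P[nY pk hk] := hr k (mem_head _ _).
  have hr' : {in r, forall k, [&& ~~ Y k, (p <= k)%N & (k < N)%N]} by move=> i hi; apply: hr; rewrite inE hi orbT.
  apply: IH => //; have ok : odd (deg k) by rewrite (pure_odd pv hk).
  exists (- pd (pure_free pv) k e); rewrite dN -(pure_pd_d pv) // -ee big_cons -mulrA pd_vM // eqxx mul1r.
  suff -> : pd (pure_free pv) k (\prod_(i <- r) v i * u ^+ c) = 0 by rewrite mulr0 scaler0 addr0.
  elim: r kr hr' {ur hr ee} => [|i r IH]; first by rewrite big_nil mul1r => _ _; exact: (xsub_pd pv hk ok xuc).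
  rewrite inE negb_or eq_sym => /andP[/negbTE ki kr] hr'; have /and3P[_ _ hi] := hr' i (mem_head _ _).
  rewrite big_cons -mulrA pd_vM // ki mul0r add0r IH ?mulr0 ?scaler0 // => j hj.
  by apply: hr'; rewrite inE hj orbT.
Qed.
End Structure.
(** * Nilpotence and the upper bounds *)

Section Filtrations.
Variable T : gcaType.
Implicit Types (F G : nat -> set T) (K E R : set T).

Definition filtration F := [/\ forall n, ideal (F n), forall n, sg_stable (F n),
  forall n, F n.+1 `<=` F n & forall t, F 0%N t].

(** The elements that raise the filtration form an ideal, and a product of [m] of them
    lies in the [m]-th step; so nilpotence is checked on generators. *)
Definition raises F : set T := [set j | forall n x, F n x -> F n.+1 (j * x)].

Lemma raises_ideal F : filtration F -> ideal (raises F).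
Proof.
move=> [hI _ _ _]; split.
- split; first by move=> n x _; rewrite mul0r; have [sF _ _] := hI n.+1; exact: ss0 sF.
  by move=> c i j hi hj n x hx; rewrite mulrDl -scalerAl; have [[_ sF] _ _] := hI n.+1; apply: sF; [exact: hi|exact: hj].
- by move=> a j hj n x hx; rewrite -mulrA; have [_ h _] := hI n.+1; apply: h; exact: hj.
- by move=> a j hj n x hx; rewrite -mulrA; apply: hj; have [_ h _] := hI n; exact: h.
Qed.

Lemma filtration_le F m n : filtration F -> (m <= n)%N -> F n `<=` F m.
Proof.
move=> [_ _ hd _] /subnK <-; elim: (n - m)%N => // k IH x hx; apply: IH.
by rewrite addSn in hx; exact: hd.
Qed.

Lemma ideal_exp_raises F m : filtration F -> ideal_exp (raises F) m `<=` F m.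
Proof.
move=> hF; have [hI _ _ h0] := hF; apply: span_min; first by case: (hI m).
move=> _ [s [hs sR ->]]; apply: (filtration_le hF hs); elim: s sR {hs} => [|a s IH] sR.
  by rewrite big_nil.
rewrite big_cons; apply: (sR a (mem_head _ _)); apply: IH => b hb.
by apply: sR; rewrite inE hb orbT.
Qed.

(** Colon ideals: the [n]-th step consists of the elements sent to [K] by all words of
    at least [N + 1 - n] letters. *)
Lemma filtration_even K E N : ideal K -> sg_stable K ->
  (forall e, E e -> exists2 n, gr n e & ~~ odd n) ->
  (forall s : seq T, (N < size s)%N -> {in s, forall e, E e} -> K (\prod_(e <- s) e)) ->
  exists F, [/\ filtration F, E `<=` raises F, forall n, K `<=` F n & F N.+1 `<=` K].
Proof.
move=> [sK KMl KMr] sgK' hE hs.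
pose F n : set T := [set t | forall s : seq T, {in s, forall e, E e} -> (N < n + size s)%N ->
  K (\prod_(e <- s) e * t)].
have central s b : {in s, forall e, E e} -> \prod_(e <- s) e * b = b * \prod_(e <- s) e /\
    sg (\prod_(e <- s) e) = \prod_(e <- s) e.
  elim: s b => [|e s IH] b h; first by rewrite big_nil mul1r mulr1 sg1.
  have hs' : {in s, forall e, E e} by move=> i hi; apply: h; rewrite inE hi orbT.
  have [n ge on] := hE e (h e (mem_head _ _)).
  rewrite big_cons sgM (IH 1 hs').2 (sgE ge) -signr_odd (negbTE on) expr0 scale1r; split=> //.
  by rewrite -mulrA (IH b hs').1 !mulrA (gr_evenC b ge on).
exists F; split.
- split.
  + move=> n; split.
    * split; first by move=> s _ _; rewrite mulr0; exact: ss0.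
      by move=> c x y hx hy s h1 h2; rewrite mulrDr -scalerAr; apply: sK.2; [exact: hx|exact: hy].
    * by move=> a x hx s h1 h2; rewrite mulrA (central s a h1).1 -mulrA; apply: KMl; exact: hx.
    * by move=> a x hx s h1 h2; rewrite mulrA; apply: KMr; exact: hx.
  + by move=> n x hx s h1 h2; rewrite -(central s 1 h1).2 -sgM; apply: sgK'; exact: hx.
  + by move=> n x hx s h1 h2; apply: hx => //; rewrite addSn ltnS ltnW.
  + by move=> t s h1 h2; apply: KMr; exact: hs.
- move=> e Ee n x hx s h1 h2; rewrite mulrA.
  have -> : \prod_(i <- s) i * e = \prod_(i <- rcons s e) i by rewrite -cats1 big_cat big_seq1.
  apply: hx; last by rewrite size_rcons addnS -addSn.
  by move=> i; rewrite mem_rcons inE => /orP[/eqP ->|/h1].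
- by move=> n k hk s _ _; exact: KMl.
- by move=> x /(_ [::]); rewrite big_nil mul1r addn0; apply.
Qed.

(** As [o] has square zero, the steps [F m + o * F (m - 1)] form a filtration raised by
    [o], at the price of one more step before [K] is reached. *)
Lemma filtration_odd F o n : filtration F -> gr n o -> odd n ->
  exists G, [/\ filtration G, raises G o, raises F `<=` raises G, forall m, F m `<=` G m
    & forall m K, ideal K -> F m `<=` K -> G m.+1 `<=` K].
Proof.
move=> hF go on; have [hI hsg hd h0] := hF.
pose G m : set T := [set x | exists a b, [/\ F m a, F m.-1 b & x = a + o * b]].
have F0 m : F m 0 by have [s _ _] := hI m; exact: ss0 s.
have FD m (c : rat) x y : F m x -> F m y -> F m (c *: x + y) by have [[_ s] _ _] := hI m; exact: s.
have FMl m a x : F m x -> F m (a * x) by have [_ h _] := hI m; exact: h.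
have FMr m a x : F m x -> F m (x * a) by have [_ _ h] := hI m; exact: h.
have oC g : g * o = o * sg g by rewrite (grC _ go) on.
have sF g : raises F g -> raises F (sg g).
  by move=> hg m x hx; rewrite -[x]sgK -sgM; apply: (hsg _); apply: hg; exact: hsg.
have hd' m : F m `<=` F m.-1 by case: m => //= m; exact: hd.
exists G; split.
- split.
  + move=> m; split.
    * split; first by exists 0, 0; rewrite mulr0 addr0.
      move=> c _ _ [a [b [ha hb ->]]] [a' [b' [ha' hb' ->]]].
      exists (c *: a + a'), (c *: b + b'); split; [exact: FD|exact: FD|].
      by rewrite mulrDr -scalerAr scalerDr; zmod.
    * move=> g _ [a [b [ha hb ->]]]; exists (g * a), (sg g * b); split; [exact: FMl|exact: FMl|].
      by rewrite mulrDr [g * (o * b)]mulrA oC mulrA.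
    * move=> g _ [a [b [ha hb ->]]]; exists (a * g), (b * g); split; [exact: FMr|exact: FMr|].
      by rewrite mulrDl -mulrA.
  + move=> m _ [a [b [ha hb ->]]]; exists (sg a), (- sg b); split; first exact: hsg.
      by rewrite -scaleN1r -[X in F _ X]addr0; apply: FD => //; exact: hsg.
    by rewrite linearD sgM (sgE go) -signr_odd on expr1 scaleN1r mulrN mulNr.
  + by move=> m _ [a [b [ha hb ->]]]; exists a, b; split; [exact: hd|exact: hd'|].
  + by move=> t; exists t, 0; rewrite mulr0 addr0.
- move=> m _ [a [b [ha hb ->]]]; exists 0, a; split=> //.
  by rewrite mulrDr [o * (o * b)]mulrA (gr_odd_sqr go on) mul0r addr0 add0r.
- move=> g hg m _ [a [b [ha hb ->]]]; exists (g * a), (sg g * b); split.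
  + exact: hg.
  + by case: m hb {ha} => [|m] hb //=; exact: (sF _ hg).
  + by rewrite mulrDr [g * (o * b)]mulrA oC mulrA.
- by move=> m x hx; exists x, 0; rewrite mulr0 addr0.
- move=> m K [[_ sK] KMl _] hK _ [a [b [ha hb ->]]]; rewrite -[a]scale1r; apply: sK.
    by apply: hK; exact: hd.
  by apply: KMl; exact: hK.
Qed.

(** Each odd element adds one step to the filtration defined by the even ones. *)
Lemma nilpotence K E N (os : seq T) : ideal K -> sg_stable K ->
  (forall e, E e -> exists2 n, gr n e & ~~ odd n) ->
  (forall s : seq T, (N < size s)%N -> {in s, forall e, E e} -> K (\prod_(e <- s) e)) ->
  {in os, forall o, exists2 n, gr n o & odd n} ->
  exists R, [/\ ideal R, K `<=` R, E `<=` R, {in os, forall o, R o}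
    & ideal_exp R (N + size os).+1 `<=` K].
Proof.
move=> iK sgK' hE hs ho.
suff [F [hF KF EF oF FK]] : exists F, [/\ filtration F, forall n, K `<=` F n, E `<=` raises F,
    {in os, forall o, raises F o} & F (N + size os).+1 `<=` K].
  exists (raises F); split=> //; first exact: raises_ideal.
    by move=> k Kk n x _; apply: KF; have [_ _ h] := iK; exact: h.
  by move=> x /(ideal_exp_raises hF)/FK.
elim: os ho => [|o os IH] ho.
  by have [F [h1 h2 h3 h4]] := filtration_even iK sgK' hE hs; exists F; rewrite addn0; split.
have [|F [hF KF EF oF FK]] := IH; first by move=> i hi; apply: ho; rewrite inE hi orbT.
have [n go on] := ho o (mem_head _ _).
have [G [hG Go FG FmG GK]] := filtration_odd hF go on; exists G; split=> //.
- by move=> m k /(KF m)/FmG.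
- by move=> e /EF/FG.
- by move=> i; rewrite inE => /orP[/eqP ->//|/oF/FG].
- by rewrite /= addnS; apply: GK.
Qed.
End Filtrations.

Section Powers.
Variables (T : cdgaType) (S : set T).
Implicit Types m n : nat.

Let I m := span (prods_ge S m).

Lemma pow_subspace m : subspace (I m). Proof. exact: span_subspace. Qed.

Lemma pow_le m n : (m <= n)%N -> I n `<=` I m.
Proof.
move=> mn; apply: span_min; first exact: pow_subspace.
by move=> x [s [h1 h2 h3]]; apply: span_sub; exists s; split=> //; exact: leq_trans mn h1.
Qed.

Lemma prods_geM m n a b : prods_ge S m a -> prods_ge S n b -> prods_ge S (m + n) (a * b).
Proof.
move=> [s [h1 h2 ->]] [t [g1 g2 ->]]; exists (s ++ t); rewrite size_cat leq_add // big_cat; split=> //.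
by move=> x; rewrite mem_cat => /orP[/h2|/g2].
Qed.

Lemma powM m n a b : I m a -> I n b -> I (m + n) (a * b).
Proof.
move=> ha hb; move: a ha; apply: span_min.
  split; first by rewrite /= mul0r; exact: (ss0 (pow_subspace _)).
  by move=> c x y hx hy; rewrite /= mulrDl -scalerAl; apply: (pow_subspace _).2.
move=> a ha; move: b hb; apply: span_min.
  split; first by rewrite /= mulr0; exact: (ss0 (pow_subspace _)).
  by move=> c x y hx hy; rewrite /= mulrDr -scalerAr; apply: (pow_subspace _).2.
by move=> b hb; apply: span_sub; exact: prods_geM.
Qed.

Lemma pow_mem a : S a -> I 1 a.
Proof.
by move=> ha; apply: span_sub; exists [:: a]; rewrite big_seq1; split=> // x; rewrite inE => /eqP ->.
Qed.

Lemma pow_prod s : {in s, forall x, S x} -> I (size s) (\prod_(x <- s) x).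
Proof. by move=> h; apply: span_sub; exists s. Qed.

Lemma pow_ind m (P : set T) : subspace P -> (forall a b, S a -> I m b -> P (a * b)) -> I m.+1 `<=` P.
Proof.
move=> sP h; apply: span_min => // _ [[|a s] [hs hS ->]] //; rewrite big_cons.
apply: h; first by apply: hS; rewrite mem_head.
apply: (pow_le (n := size s)); first exact: hs.
by apply: pow_prod => x hx; apply: hS; rewrite inE hx orbT.
Qed.

Hypothesis hS : homogeneous S.

Lemma pow_homogeneous m : homogeneous (I m).
Proof.
move=> x k hx; move: x hx k; apply: span_min.
  split=> [k|c x y hx hy k]; first by rewrite cmp0; exact: (ss0 (pow_subspace _)).
  by rewrite cmp_linear; apply: (pow_subspace _).2.
move=> _ [s [hs sS ->]] k; apply: (pow_le hs).
elim: s sS {hs} k => [|a s IH] sS k.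
  rewrite big_nil (cmp_hom _ gr_one); case: eqP => _; last exact: (ss0 (pow_subspace _)).
  by apply: span_sub; exists [::]; rewrite big_nil.
have [n ea] := cmp_sum a.
rewrite big_cons /=; move: (\prod_(x <- s) x) (IH (fun b hb => sS b (mem_behead (s := a :: s) hb))) => b hb.
rewrite ea mulr_suml -cmpLE linear_sum; apply: (ss_sum (pow_subspace _)) => i _.
rewrite cmpLE (cmpMl _ _ (cmp_gr a i)); case: leqP => _; last exact: (ss0 (pow_subspace _)).
rewrite -add1n; apply: powM; last exact: hb.
by apply: pow_mem; apply: hS; apply: sS; rewrite mem_head.
Qed.

Lemma pow_diff m : (forall a, S a -> I 1 (diff a)) -> diff_stable (I m).
Proof.
move=> hd; apply: span_min.
  split; first by rewrite /= d0; exact: (ss0 (pow_subspace _)).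
  by move=> c x y hx hy; rewrite /= diff_linear; apply: (pow_subspace _).2.
move=> _ [s [hs sS ->]] /=; apply: (pow_le hs).
elim: s sS {hs} => [|a s IH] sS; first by rewrite big_nil d1; exact: (ss0 (pow_subspace _)).
have Sa : S a by apply: sS; rewrite mem_head.
have sS' : {in s, forall x, S x} by move=> b hb; apply: sS; rewrite inE hb orbT.
rewrite big_cons dM /= -add1n; apply: (ssD (pow_subspace _)); apply: powM.
- exact: hd.
- exact: pow_prod.
- by apply: (homogeneous_sg (pow_subspace _) (@pow_homogeneous 1)); exact: pow_mem.
- exact: IH.
Qed.

Lemma pow_ideal m : (forall a x, S x -> I 1 (a * x)) -> ideal (I m.+1).
Proof.
move=> hl; have sI := pow_subspace m.+1.
have l a x : I m.+1 x -> I m.+1 (a * x).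
  move: x; apply: pow_ind.
    split; first by rewrite /= mulr0; exact: ss0.
    by move=> c x y hx hy; rewrite /= mulrDr -scalerAr; apply: sI.2.
  by move=> x b Sx Ib; rewrite /= mulrA -add1n; apply: powM => //; exact: hl.
split=> // a x hx; move: a; apply: hom_ind.
  split; first by rewrite /= mulr0; exact: ss0.
  by move=> c y z hy hz; rewrite /= mulrDr -scalerAr; apply: sI.2.
move=> n a ga /=; rewrite (grC _ ga); apply: l.
rewrite /sgp; case: odd => //; exact: (homogeneous_sg sI (@pow_homogeneous m.+1)).
Qed.
End Powers.

(** The common source of the upper bounds. *)
Lemma quotient_retraction (T : cdgaType) (K I : set T) : acyclic_ideal K -> fin_gen T ->
  ideal I -> homogeneous I -> diff_stable I -> I `<=` K ->
  exists (B : cdgaType) (rho : {lrmorphism T -> B}), is_projection rho I /\ homotopy_retraction rho.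
Proof.
move=> hK fT iI hI dI IK; have [iK hKh Kd _] := hK.
have I1 : ~ I 1 by move/IK; exact: acyclic_1.
have [B [rho hrho]] := quotient_cdga iI I1 hI dI; exists B, rho; split=> //.
have [mrho rho_surj ker] := hrho.
apply: (homotopy_retraction_of_ideal mrho rho_surj iK hKh) => //.
- by move=> t ht; apply: IK; rewrite -ker.
- by move=> t; exact: acyclic_cocycle_rep.
- by move=> t dt Kt; exact: (acyclic_exact hK dt Kt).
Qed.
(** A retraction makes the projection injective in cohomology; hence the lower bounds. *)
Lemma retraction_exact (T B : cdgaType) (rho : {lrmorphism T -> B}) t :
  homotopy_retraction rho -> diff t = 0 -> rho t = 0 -> coboundary t.
Proof.
case=> E [i [W [g [tau [[mi _ _ _] [_ inj _] gi [_ mt] ti]]]]] dt rt.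
have [||e ee] := inj (i t); first by rewrite -mi.2 dt lr0.
  by exists 0; rewrite d0 -rt -gi.
by exists (tau e); rewrite -mt -ee -[RHS]/((tau \o i) t) ti.
Qed.

Lemma repeated_odd (A : gcaType) (s : seq A) z : {in s, forall z, exists2 n, gr n z & odd n} ->
  z \in s -> \prod_(a <- s) a * z = 0.
Proof.
elim: s => // a s IH h; rewrite inE big_cons => /orP[/eqP ->|hz].
  have [n ga on] := h a (mem_head _ _).
  by rewrite -mulrA (grC _ ga) mulrA (gr_odd_sqr ga on) mul0r.
by rewrite -mulrA IH ?mulr0 // => b hb; apply: h; rewrite inE hb orbT.
Qed.

Section Bounds.
Variables (A : cdgaType) (V : nat -> set A) (K X : set A) (zs : seq A) (c : nat) (u : A).
Hypotheses (gV : graded_subspace V) (Vgen : forall a, subalg_gen (gtotal V) a) (V0 : V 0%N = [set 0]).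
Hypotheses (minV : minimal V) (fA : fin_gen A) (hK : acyclic_ideal K).
Hypothesis hX : forall x, X x -> (exists2 n, gr n x & ~~ odd n && (0 < n)%N) /\ diff x = 0.
Hypothesis hz : {in zs, forall z, (exists2 n, gr n z & odd n) /\ diff z = 0}.
Hypothesis hc : forall n w, (c < n)%N -> words X n w -> K w.
Hypothesis hgen : forall a, exists b, subalg_gen (X `|` [set z | z \in zs]) b /\ K (a - b).
Hypothesis hpos : forall n a, gr n a -> (0 < n)%N -> exists b, K (a - b) /\
  exists s : seq (A * A), {in s, forall t, X t.1 \/ t.1 \in zs} /\ b = \sum_(t <- s) t.1 * t.2.
Hypotheses (hu : span X u) (hw : ~ K (u ^+ c * \prod_(z <- zs) z)).

Let iK : ideal K. Proof. by case: hK. Qed.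
Let sK : subspace K. Proof. by case: iK. Qed.
Let l := size zs.
Let ztop := \prod_(z <- zs) z.
Let w := u ^+ c * ztop.

Let sgK' : sg_stable K. Proof. by case: hK => _ h _ _; exact: homogeneous_sg. Qed.
Let Xev x : X x -> exists2 n, gr n x & ~~ odd n.
Proof. by move=> /hX[[n h /andP[on _]] _]; exists n. Qed.
Let zodd : {in zs, forall z, exists2 n, gr n z & odd n}. Proof. by move=> z /hz[]. Qed.
Let Xprod (s : seq A) : (c < size s)%N -> {in s, forall e, X e} -> K (\prod_(e <- s) e).
Proof. by move=> h1 h2; apply: (hc h1); exists s. Qed.

Let J m := wordlength_ge V m.

Lemma gtotal_homogeneous : homogeneous (gtotal V).
Proof.
move=> a k [n _ hn]; rewrite (cmp_hom _ ((gV n).2 _ hn)); case: eqP => _; first by exists n.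
by exists 0%N => //; rewrite V0.
Qed.

(** Modulo [K] the elements of positive degree are generated by [X] and [zs]. *)
Lemma cat_upper : cat_le V (c + l).
Proof.
have [R [[sR RMl RMr] KR XR zR Rnil]] := nilpotence iK sgK' Xev Xprod zodd.
have VR : gtotal V `<=` R.
  move=> a [[|n] _ hn]; first by rewrite V0 in hn; rewrite hn; exact: ss0.
  have [b [Kb [s [hs eb]]]] := hpos ((gV n.+1).2 _ hn) (ltn0Sn n).
  have -> : a = (a - b) + b by zmod.
  apply: (ssD sR); first exact: KR.
  rewrite eb big_seq; apply: (ss_sum sR) => t /hs ht; apply: RMr.
  by case: ht; [exact: XR|exact: zR].
have [||||B [rho [h1 h2]]] := quotient_retraction (I := J (c + l).+1) hK fA; last by exists B, rho.
- apply: pow_ideal; first exact: gtotal_homogeneous.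
  move=> a x Sx; move: (Vgen a); apply: (@subalg_gen_ind _ _ [set a | J 1 (a * x)]).
  + split; first by rewrite /= mul0r; exact: (ss0 (span_subspace _)).
    by move=> d y z h1 h2; rewrite /= mulrDl -scalerAl; apply: (span_subspace _).2.
  + by rewrite /= mul1r; exact: pow_mem.
  + move=> g b Sg hb; rewrite /= -mulrA; apply: (pow_le (n := 2)) => //.
    by apply: (@powM _ _ 1 1) => //; exact: pow_mem.
- by apply: pow_homogeneous; exact: gtotal_homogeneous.
- apply: pow_diff; first exact: gtotal_homogeneous.
  by move=> a Sa; apply: (pow_le (n := 2)) => //; exact: minV.
- move=> x; apply: span_min => // _ [s [s1 s2 ->]]; apply: Rnil; apply: span_sub.
  by exists s; split=> // a /s2; exact: VR.
Qed.

Lemma positive_word n a : gr n a -> (0 < n)%N -> J 1 a.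
Proof.
move=> ga n0.
have [d hd] : exists d : rat, J 1 (a - d *: 1).
  move: (Vgen a); apply: (@subalg_gen_ind _ _ [set a | exists d : rat, J 1 (a - d *: 1)]).
  - split; first by exists 0; rewrite scale0r subrr; exact: (ss0 (span_subspace _)).
    move=> e x y [d1 h1] [d2 h2]; exists (e * d1 + d2).
    have -> : e *: x + y - (e * d1 + d2) *: 1 = e *: (x - d1 *: 1) + (y - d2 *: 1).
      by rewrite scalerBr scalerDl scalerA; zmod.
    by apply: (span_subspace _).2.
  - by exists 1; rewrite scale1r subrr; exact: (ss0 (span_subspace _)).
  - move=> g b Sg [d hd]; exists 0; rewrite scale0r subr0.
    have -> : g * b = g * (b - d *: 1) + d *: g by rewrite mulrBr -scalerAr mulr1 subrK.
    apply: (ssD (span_subspace _)); last by apply: (ssZ (span_subspace _)); exact: pow_mem.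
    by apply: (pow_le (n := 2)) => //; apply: (@powM _ _ 1 1) => //; exact: pow_mem.
have := pow_homogeneous gtotal_homogeneous n hd.
by rewrite cmpB (gr_cmp ga) cmpZ (cmp_hom _ gr_one) gtn_eqF // scaler0 subr0.
Qed.

Lemma w_cocycle : diff w = 0.
Proof.
have [sC C1 CM] := cocycle_subalg A.
apply: CM; first apply: (subalgX _ (cocycle_subalg A)).
  by apply: (span_min sC _ hu) => x /hX[].
by rewrite /ztop big_seq; apply: subalg_prod; [exact: cocycle_subalg|move=> z /hz[]].
Qed.

Lemma cat_lower m : cat_le V m -> (c + l <= m)%N.
Proof.
case=> B [rho [[_ _ ker] hret]]; rewrite leqNgt; apply/negP => lt; apply: hw.
apply: (coboundary_acyclic hK); apply: (retraction_exact hret); first exact: w_cocycle.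
suff : [set a | rho a = 0] w by [].
rewrite ker; apply: (pow_le lt); apply: powM.
  have hu1 : J 1 u.
    apply: (span_min (span_subspace _) _ hu) => x /hX[[n gx /andP[_ n0]] _].
    exact: positive_word gx n0.
  elim: c => [|k IH]; first by apply: span_sub; exists [::]; rewrite big_nil expr0.
  by rewrite exprS -add1n; apply: powM.
rewrite /ztop /l; elim: zs hz => [|z s IH] h; first by apply: span_sub; exists [::]; rewrite big_nil.
rewrite big_cons /= -add1n; apply: powM; last by apply: IH => y hy; apply: h; rewrite inE hy orbT.
have [[n gz on] _] := h z (mem_head _ _); apply: positive_word gz _.
by case: n on.
Qed.

Section Upper.
Variable n : nat.

(** The kernel of the multiplication is generated by the differences [dl i a].  Modulo
    the acyclic ideal those with [a] in [X] and those with [a] in [zs] suffice;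
    the first are combinations of the letters [iota i x], whose words of more than
    [(n + 1) * c] letters vanish, the second are [n * l] odd elements. *)
Lemma TC_upper : TC_le n.+1 A (n.+1 * c + n * l).
Proof.
have [T [iota [mu [KT [hT [mmu emu] hKT hKi fT]]]]] := tensor_power n hK fA.
have miota i : cdga_mor (iota i) by case: hT.
have iKT : ideal KT by case: hKT.
have [sKT KTl KTr] := iKT.
have sgKT : sg_stable KT by case: hKT => _ h _ _; exact: homogeneous_sg.
pose E : set T := [set e | exists i x, X x /\ e = iota i x].
have hE e : E e -> exists2 n, gr n e & ~~ odd n.
  by case=> i [x [/Xev[m gx om] ->]]; exists m => //; exact: (miota i).1.
(* the letters of [ps] from the factor [i] are collected into one word *)
have extract i (ps : seq ('I_n.+1 * A)) : {in ps, forall t, X t.2} ->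
    exists a t, words X (count (fun t => t.1 == i) ps) a /\ \prod_(t <- ps) iota t.1 t.2 = iota i a * t.
  elim: ps => [|[j x] ps IH] h.
    by exists 1, 1; rewrite big_nil lr1 mulr1; split=> //; exists [::]; rewrite big_nil.
  have [|a [t [[s [s1 s2 ->]] e]]] := IH; first by move=> t ht; apply: h; rewrite inE ht orbT.
  have Xx : X x by exact: (h (j, x) (mem_head _ _)).
  rewrite big_cons e /=; case: eqP => [->|_].
    exists (\prod_(y <- x :: s) y), t; rewrite big_cons lrM mulrA; split=> //.
    exists (x :: s); rewrite big_cons /= s1; split=> // y.
    by rewrite inE => /orP[/eqP ->|/s2].
  exists (\prod_(y <- s) y), (iota j x * t); split; first by exists s; rewrite s1.
  have [m gx om] := Xev Xx; rewrite !mulrA; congr (_ * _).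
  by apply: (gr_evenC _ ((miota j).1 _ _ gx)).
have Eprod (s : seq T) : (n.+1 * c < size s)%N -> {in s, forall e, E e} -> KT (\prod_(e <- s) e).
  move=> hs sE.
  have [ps [hps eps]] : exists ps : seq ('I_n.+1 * A), {in ps, forall t, X t.2} /\ s = [seq iota t.1 t.2 | t <- ps].
    elim: s sE {hs} => [|e s IH] h; first by exists [::].
    have [|ps [h1 h2]] := IH; first by move=> y hy; apply: h; rewrite inE hy orbT.
    have [i [x [Xx ex]]] := h e (mem_head _ _).
    exists ((i, x) :: ps); split; last by rewrite /= -h2 ex.
    by move=> t; rewrite inE => /orP[/eqP ->|/h1].
  (* one of the [n + 1] factors contains more than [c] letters *)
  have [i hi] : exists i, (c < count (fun t => t.1 == i) ps)%N.
    apply: contrapT => none.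
    have : (\sum_(i < n.+1) count (fun t => t.1 == i) ps <= \sum_(i < n.+1) c)%N.
      by apply: leq_sum => i _; rewrite leqNgt; apply/negP => h; apply: none; exists i.
    have -> : (\sum_(i < n.+1) count (fun t : 'I_n.+1 * A => t.1 == i) ps)%N = size ps.
      elim: (ps) => [|t r IH] /=; first by rewrite big1.
      rewrite big_split /= IH (bigD1 t.1) //= eqxx big1 // => i.
      by rewrite eq_sym => /negbTE ->.
    by rewrite sum_nat_const card_ord leqNgt; move: hs; rewrite eps size_map => ->.
  have [a [t [hwa e]]] := extract i ps hps.
  by rewrite eps big_map e; apply: KTr; apply: hKi; exact: hc hi hwa.
pose dl i a := iota i a - iota ord0 a.
pose os := [seq dl (lift ord0 i) z | i <- enum 'I_n, z <- zs].
have hos : {in os, forall o, exists2 m, gr m o & odd m}.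
  move=> _ /allpairsP[[i z] [_ /= /zodd[m gz om] ->]]; exists m => //.
  by apply: (ssB (gr_subspace m)); apply: (miota _).1.
have [R [iR KR ER oR Rnil]] := nilpotence iKT sgKT hE Eprod hos.
have [sR RMl RMr] := iR.
rewrite size_allpairs size_enum_ord -/l in Rnil.
have dlM i a b : dl i (a * b) = iota i a * dl i b + dl i a * iota ord0 b.
  by rewrite /dl !lrM mulrBr mulrBl; zmod.
have Rdl i a : R (dl i a).
  have [k ->|->] := unliftP ord0 i; last by rewrite /dl subrr; exact: ss0.
  have [b [hb Kb]] := hgen a.
  have -> : dl (lift ord0 k) a = dl (lift ord0 k) (a - b) + dl (lift ord0 k) b by rewrite /dl !lrB; zmod.
  apply: (ssD sR); first by apply: KR; apply: (ssB sKT); exact: hKi.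
  move: b hb {Kb}; apply: (@subalg_gen_ind _ _ [set b | R (dl (lift ord0 k) b)]).
  - split; first by rewrite /= /dl !lr0 subr0; exact: ss0.
    move=> d x y h1 h2; rewrite /=.
    have -> : dl (lift ord0 k) (d *: x + y) = d *: dl (lift ord0 k) x + dl (lift ord0 k) y.
      by rewrite /dl !lrD !lrZ scalerBr; zmod.
    exact: sR.2.
  - by rewrite /= /dl !lr1 subrr; exact: ss0.
  - move=> g b hg hb; rewrite /= dlM; apply: (ssD sR); [exact: RMl|apply: RMr].
    case: hg => [Xg|zg]; last by apply: oR; apply/allpairsP; exists (k, g); rewrite /= mem_enum.
    by apply: (ssB sR); apply: ER; [exists (lift ord0 k), g|exists ord0, g].
have Rmu t : R (t - iota ord0 (mu t)).
  move: t; apply: (gen_ind (tensor_power_gen hT)).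
  - split; first by rewrite /= !lr0 subr0; exact: ss0.
    move=> d x y h1 h2; rewrite /= !(lrD, lrZ).
    have -> : d *: x + y - (d *: iota ord0 (mu x) + iota ord0 (mu y)) =
      d *: (x - iota ord0 (mu x)) + (y - iota ord0 (mu y)) by rewrite scalerBr; zmod.
    exact: sR.2.
  - by rewrite /= !lr1 subrr; exact: ss0.
  - move=> g t [i _ [a _ <-]] ht; rewrite /= !lrM emu.
    have -> : iota i a * t - iota ord0 a * iota ord0 (mu t) =
      iota i a * (t - iota ord0 (mu t)) + dl i a * iota ord0 (mu t).
      by rewrite /dl mulrBr mulrBl; zmod.
    by apply: (ssD sR); [exact: RMl|apply: RMr; exact: Rdl].
pose ker : set T := [set t | mu t = 0].
have hker : homogeneous ker by exact: ker_homogeneous mmu.1.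
have kerR : ker `<=` R by move=> t ht; have := Rmu t; rewrite ht lr0 subr0.
have [||||B [rho [h1 h2]]] := quotient_retraction (I := ideal_exp ker (n.+1 * c + n * l).+1) hKT fT.
- by apply: pow_ideal => // a x hx; apply: pow_mem; rewrite /ker /= lrM hx mulr0.
- exact: pow_homogeneous.
- by apply: pow_diff => // a ha; apply: pow_mem; rewrite /ker /= mmu.2 ha d0.
- move=> x; apply: span_min => // _ [s [s1 s2 ->]]; apply: Rnil; apply: span_sub.
  by exists s; split=> // a /s2; exact: kerR.
exists T, iota, mu, B, rho; split=> // a.
by rewrite lr_prod; apply: eq_bigr => i _; rewrite emu.
Qed.
End Upper.
End Bounds.
(** * The lower bound for the topological complexity *)

Lemma prod_single r (B : algType rat) (F : 'I_r -> B) i :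
  (forall j, j != i -> F j = 1) -> \prod_j F j = F i.
Proof.
move=> Fj; elim: (index_enum _) (index_enum_uniq 'I_r) (mem_index_enum i) => //= j s IH /andP[js us].
rewrite inE big_cons; case: eqVneq => [e _|ne /= /(IH us) ->]; last by rewrite Fj ?mul1r // eq_sym.
rewrite -e big_seq big1 ?mulr1 // => k ks; apply: Fj; apply: contraNneq js => ek.
by rewrite -e -ek.
Qed.

Section TensorIdeal.
Variables (r : nat) (A T : cdgaType) (iota : 'I_r -> {lrmorphism A -> T}) (K : set A).
Hypotheses (hT : is_tensor_power iota) (hK : acyclic_ideal K).

Let miota i : cdga_mor (iota i). Proof. by case: hT. Qed.

(** The ideal generated by the copies of [K]: the kernel of the map to the
    tensor power of [A / K]. *)
Definition factor_ideal : set T :=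
  span [set t | exists f : 'I_r -> A, (exists i, K (f i)) /\ t = \prod_i iota i (f i)].

Let S := factor_ideal.
Let sS : subspace S. Proof. exact: span_subspace. Qed.
Let iK : ideal K. Proof. by case: hK. Qed.
Let sgK' : sg_stable K. Proof. by case: hK => [[h _ _] h2 _ _]; exact: homogeneous_sg. Qed.

(** The functional on pure tensors that multiplies the values of a functional with
    [f w = 1] and [f = 0] on [K]. *)
Lemma factor_ideal_notin w : ~ K w -> ~ S (\prod_i iota i w).
Proof.
move=> nw; have [sK _ _] := iK; have [f [f0 f1]] := functional sK nw.
pose phi (a : 'I_r -> A) : rat^o := \prod_i (f (a i) : rat).
have phi_lin : multilinear phi.
  move=> a i d x y; have e b : phi (@dfwith _ _ a i b) = (f b : rat) * \prod_(j < r | j != i) (f (a j) : rat).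
    rewrite /phi (bigD1 i) //= dfwith_in; congr (_ * _); apply: eq_bigr => j ne.
    by rewrite dfwith_out // eq_sym.
  rewrite !e; have -> : f (d *: x + y) = (d * f x + f y : rat) by rewrite linearP.
  by rewrite mulrDl -mulrA.
have [h [hh _]] := hT.2 rat^o phi phi_lin.
have hS : S `<=` [set t | h t = 0].
  apply: span_min; first exact: ker_subspace.
  by move=> _ [g [[i Kg] ->]]; rewrite /= hh /phi (bigD1 i) //= f0 // mul0r.
by move/hS; rewrite /= hh /phi big1 => [/eqP|i _]; rewrite ?oner_eq0 ?f1.
Qed.

Lemma move_factor j n a (s : seq 'I_r) (f : 'I_r -> A) : gr n a -> uniq s -> j \in s ->
  exists e : 'I_r -> bool, iota j a * \prod_(i <- s) iota i (f i) =
    \prod_(i <- s) iota i (if i == j then a * f i else sgp (e i) (f i)).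
Proof.
move=> ga; elim: s => //= i s IH /andP[ni us]; rewrite inE !big_cons.
have [->|ij] := eqVneq j i => /= js.
  exists (fun=> false); rewrite big_cons eqxx mulrA -lrM; congr (_ * _).
  rewrite big_seq [RHS]big_seq; apply: eq_bigr => k ks.
  by case: eqP => // e; rewrite -e ks in ni.
have [e ee] := IH us js; exists (fun k => if k == i then odd n else e k).
rewrite big_cons eq_sym (negbTE ij) eqxx.
have -> : \prod_(k <- s) iota k (if k == j then a * f k else sgp (if k == i then odd n else e k) (f k)) =
    \prod_(k <- s) iota k (if k == j then a * f k else sgp (e k) (f k)).
  rewrite big_seq [RHS]big_seq; apply: eq_bigr => k ks.
  by case: (k =P i) => // ki; rewrite -ki ks in ni.
rewrite -ee !mulrA; congr (_ * _); rewrite (grC' _ ((miota j).1 _ _ ga)); congr (_ * _).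
by rewrite /sgp; case: odd => //; rewrite (sg_mor (miota i).1).
Qed.

Lemma factor_ideal_ideal : ideal S.
Proof.
have [sK KMl KMr] := iK.
have l a x : S x -> S (a * x).
  move=> Sx; have Sl : forall b, S b -> S (a * b).
    apply: (gen_ind (tensor_power_gen hT) (P := [set a | forall b, S b -> S (a * b)])).
    - split; first by move=> b _; rewrite mul0r; exact: ss0.
      by move=> d y z hy hz b hb; rewrite mulrDl -scalerAl; apply: sS.2; [exact: hy|exact: hz].
    - by move=> b; rewrite mul1r.
    - move=> _ y [j _ [b _ <-]] hy t ht; rewrite -mulrA; move/hy: ht.
      move: (y * t); apply: span_min.
        split; first by rewrite /= mulr0; exact: ss0.
        by move=> d p q hp hq; rewrite /= mulrDr -scalerAr; apply: sS.2.
      move=> _ [f [[i0 Kf] ->]] /=; move: b; apply: hom_ind.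
        split; first by rewrite /= lr0 mul0r; exact: ss0.
        by move=> d p q hp hq; rewrite /= lrD lrZ mulrDl -scalerAl; apply: sS.2.
      move=> n b gb /=; have [e ->] := move_factor f gb (index_enum_uniq _) (mem_index_enum j).
      apply: span_sub; exists (fun i => if i == j then b * f i else sgp (e i) (f i)); split=> //.
      by exists i0; case: eqP => _; [exact: KMl|rewrite /sgp; case: (e i0) => //; exact: sgK'].
  exact: Sl.
have Ssg : sg_stable S.
  apply: span_min.
    split; first by rewrite /= linear0; exact: ss0.
    by move=> d y z hy hz; rewrite /= linearP; apply: sS.2.
  move=> _ [f [[i Kf] ->]]; apply: span_sub; exists (fun i => sg (f i)); split.
    by exists i; exact: sgK'.
  elim: (index_enum _) => [|k s IH]; first by rewrite !big_nil sg1.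
  by rewrite !big_cons sgM IH -(sg_mor (miota k).1).
split=> // a x Sx; move: a; apply: hom_ind.
  split; first by rewrite /= mulr0; exact: ss0.
  by move=> d y z hy hz; rewrite /= mulrDr -scalerAr; apply: sS.2.
by move=> n a ga /=; rewrite (grC _ ga); apply: l; rewrite /sgp; case: odd => //; exact: Ssg.
Qed.

Lemma factor_ideal_iota i k : K k -> S (iota i k).
Proof.
move=> Kk; apply: span_sub; exists (fun j => if j == i then k else 1); split.
  by exists i; rewrite eqxx.
rewrite (prod_single (i := i)) ?eqxx // => j /negbTE ->; exact: lr1.
Qed.

Lemma coboundary_factor_ideal t : coboundary t -> S t.
Proof.
have [_ Sl Sr] := factor_ideal_ideal; have [_ _ Kd _] := hK.
case=> y ->; move: y; apply: (gen_ind (tensor_power_gen hT)).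
- split; first by rewrite /= d0; exact: ss0.
  by move=> d y z hy hz; rewrite /= diff_linear; apply: sS.2.
- by rewrite /= d1; exact: ss0.
- move=> _ y [i _ [a _ <-]] hy; rewrite /= dM; apply: (ssD sS); last exact: Sl.
  by apply: Sr; rewrite -(miota i).2; exact: factor_ideal_iota.
Qed.
End TensorIdeal.

Section IdealCongruence.
Variables (T : algType rat) (I : set T).
Hypothesis iI : ideal I.

Lemma congM x x' y y' : I (x - x') -> I (y - y') -> I (x * y - x' * y').
Proof.
have [sI Il Ir] := iI => h1 h2.
have -> : x * y - x' * y' = x * (y - y') + (x - x') * y' by rewrite mulrBr mulrBl; zmod.
by apply: (ssD sI); [exact: Il|exact: Ir].
Qed.

Lemma congX x y n : I (x - y) -> I (x ^+ n - y ^+ n).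
Proof.
have [sI _ _] := iI; move=> h; elim: n => [|n IH]; first by rewrite !expr0 subrr; exact: ss0.
by rewrite !exprS; exact: congM.
Qed.

Lemma cong_prod (J : eqType) (s : seq J) (F G : J -> T) : {in s, forall j, I (F j - G j)} ->
  I (\prod_(j <- s) F j - \prod_(j <- s) G j).
Proof.
have [sI _ _] := iI; elim: s => [|j s IH] h; first by rewrite !big_nil subrr; exact: ss0.
rewrite !big_cons; apply: congM; first by apply: h; rewrite mem_head.
by apply: IH => i hi; apply: h; rewrite inE hi orbT.
Qed.

(** All other terms of the binomial formula contain [a ^+ c.+1] or [b ^+ c.+1]. *)
Lemma cong_binomial a b c : a * b = b * a -> I (a ^+ c.+1) -> I (b ^+ c.+1) ->
  I ((a - b) ^+ (c + c) - ((-1) ^+ c * ('C(c + c, c))%:R) *: (a ^+ c * b ^+ c)).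
Proof.
have [sI Il Ir] := iI => ab ha hb.
have hX x m : I (x ^+ c.+1) -> (c < m)%N -> I (x ^+ m).
  by move=> hx /subnK <-; rewrite exprD; exact: Il.
rewrite exprBn_comm // (bigD1 (inord c)) //= inordK; last by rewrite ltnS leq_addr.
rewrite addKn.
have -> : (-1) ^+ c * a ^+ c * b ^+ c *+ 'C(c + c, c) =
    ((-1) ^+ c * ('C(c + c, c))%:R) *: (a ^+ c * b ^+ c).
  by rewrite -mulrA signE -scaler_nat scalerA mulrC.
rewrite addrAC subrr add0r; apply: (ss_sum sI) => i ne.
rewrite -scaler_nat -mulrA signE; apply: (ssZ sI); apply: (ssZ sI).
case: (ltngtP i c) => h.
- apply: Ir; apply: (hX a) => //; rewrite ltn_subRL addnC ltn_add2l //.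
- by apply: Il; exact: (hX b).
- by case/eqP: ne; apply: val_inj; rewrite /= inordK // ltnS leq_addr.
Qed.
End IdealCongruence.

Section Lower.
Variables (A : cdgaType) (K X : set A) (zs : seq A) (c : nat) (u : A).
Hypothesis hK : acyclic_ideal K.
Hypothesis hX : forall x, X x -> (exists2 n, gr n x & ~~ odd n && (0 < n)%N) /\ diff x = 0.
Hypothesis hz : {in zs, forall z, (exists2 n, gr n z & odd n) /\ diff z = 0}.
Hypothesis hc : forall n w, (c < n)%N -> words X n w -> K w.
Hypotheses (hu : span X u) (hw : ~ K (u ^+ c * \prod_(z <- zs) z)).

Let iK : ideal K. Proof. by case: hK. Qed.
Let l := size zs.
Let ztop := \prod_(z <- zs) z.
Let w := u ^+ c * ztop.
Let zodd : {in zs, forall z, exists2 n, gr n z & odd n}. Proof. by move=> z /hz[]. Qed.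

Lemma power_in_ideal : K (u ^+ c.+1).
Proof.
have [sK _ _] := iK.
have sgK' : sg_stable K by case: hK => _ h _ _; exact: homogeneous_sg.
have [|||R [[sR _ _] _ XR _ Rnil]] := nilpotence (E := X) (N := c) (os := [::]) iK sgK' => //.
- by move=> x /hX[[n h /andP[on _]] _]; exists n.
- by move=> s h1 h2; apply: (hc h1); exists s.
apply: Rnil; apply: span_sub; exists (nseq c.+1 u); rewrite size_nseq addn0; split=> //.
  by move=> x; rewrite mem_nseq /= => /eqP ->; exact: (span_min sR XR hu).
by rewrite big_nseq -Monoid.iteropE.
Qed.

Variables (n : nat) (T : cdgaType) (iota : 'I_n.+2 -> {lrmorphism A -> T}).
Hypothesis hT : is_tensor_power iota.
Let miota i : cdga_mor (iota i). Proof. by case: hT. Qed.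
Let S := factor_ideal iota K.
Let iS : ideal S. Proof. exact: factor_ideal_ideal. Qed.

Lemma iota_central i t : iota i u * t = t * iota i u.
Proof.
move: u hu; apply: span_min.
  split; first by rewrite /= lr0 mul0r mulr0.
  by move=> d x y hx hy; rewrite /= lrD lrZ mulrDl mulrDr -scalerAl -scalerAr hx hy.
by move=> x /hX[[m gx /andP[om _]] _]; apply: (gr_evenC _ ((miota i).1 _ _ gx)).
Qed.

Let dl i a := iota i a - iota ord0 a.
Let i1 : 'I_n.+2 := lift ord0 ord0.
Let i2 (k : 'I_n) : 'I_n.+2 := lift ord0 (lift ord0 k).
Let tail := \prod_(z <- zs) dl i1 z *
  \prod_(k <- enum 'I_n) (dl (i2 k) u ^+ c * \prod_(z <- zs) dl (i2 k) z).

(** The factor [dl i1 u] is repeated [2 * c] times, in order to produce [u ^+ c] both in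
    the factor [i1] and in the factor [ord0]. *)
Definition long_product := dl i1 u ^+ (c + c) * tail.

Lemma long_product_cocycle : diff long_product = 0.
Proof.
have hC := cocycle_subalg T; have [sC _ CM] := hC.
have du : diff u = 0.
  by have [sA _ _] := cocycle_subalg A; apply: (span_min sA _ hu) => x /hX[].
have ddl i a : diff a = 0 -> diff (dl i a) = 0.
  by move=> h; rewrite /dl dB -!(miota _).2 h !lr0 subrr.
have hzs i : cocycle (\prod_(z <- zs) dl i z).
  by rewrite big_seq; apply: subalg_prod; [exact: hC|move=> z /hz[_ dz]; exact: ddl].
apply: (CM _ _); first by apply: (subalgX _ hC); exact: ddl.
apply: (CM _ _); first exact: hzs.
apply: subalg_prod; first exact: hC.
move=> k _; apply: (CM _ _); last exact: hzs.
by apply: (subalgX _ hC); exact: ddl.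
Qed.

Lemma long_product_length (I : set T) : (forall i a, I (dl i a)) ->
  ideal_exp I (n.+2 * c + n.+1 * l) long_product.
Proof.
move=> hI.
have h1 i a m : prods_ge I m (dl i a ^+ m).
  exists (nseq m (dl i a)); rewrite size_nseq; split=> //.
    by move=> x; rewrite mem_nseq => /andP[_ /eqP ->].
  by rewrite big_nseq -Monoid.iteropE.
have h2 i : prods_ge I l (\prod_(z <- zs) dl i z).
  exists [seq dl i z | z <- zs]; rewrite size_map big_map; split=> //.
  by move=> _ /mapP[z _ ->].
apply: span_sub.
have -> : (n.+2 * c + n.+1 * l = (c + c) + (l + size (enum 'I_n) * (c + l)))%N.
  by rewrite size_enum_ord !mulSn mulnDr !addnA (addnAC (c + c) (n * c) l)%N.
apply: prods_geM; first exact: h1.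
apply: prods_geM; first exact: h2.
elim: (enum _) => [|k s IH]; first by exists [::]; rewrite !big_nil.
by rewrite big_cons /= mulSn; apply: prods_geM => //; apply: prods_geM.
Qed.

(** Multiplied by [zeta = iota ord0 ztop], the product becomes a nonzero multiple of
    the pure tensor with all factors [w]: modulo the classes annihilated by
    [zeta * iota ord0 u ^+ c], each difference [dl i a] equals [iota i a], and the
    binomial formula leaves a single term of [dl i1 u ^+ (c + c)]. *)
Lemma long_product_notin : ~ S long_product.
Proof.
have [sS Sl Sr] := iS; move=> ht.
pose U0 := iota ord0 w.
(* the two-sided ideal of the elements that [U0] annihilates modulo [S] *)
pose N' : set T := [set y | forall b, S (U0 * (b * y))].
have iN : ideal N'.
  split.
  - split; first by move=> b; rewrite !mulr0; exact: ss0.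
    by move=> d x y hx hy b; rewrite !mulrDr -!scalerAr; apply: sS.2; [exact: hx|exact: hy].
  - by move=> a x hx b; rewrite [b * _]mulrA; exact: hx.
  - by move=> a x hx b; rewrite !mulrA -[_ * b * x]mulrA; apply: Sr; exact: hx.
have [sN Nl Nr] := iN.
have uK : K (w * u).
  have uC : ztop * u = u * ztop.
    move: u hu; apply: span_min.
      split; first by rewrite /= mul0r mulr0.
      by move=> d x y hx hy; rewrite /= mulrDl mulrDr -scalerAl -scalerAr hx hy.
    by move=> x /hX[[m gx /andP[om _]] _]; rewrite /= (gr_evenC _ gx om).
  rewrite /w -mulrA uC mulrA -exprSr; have [_ _ h] := iK; apply: h; exact: power_in_ideal.
have Nu : N' (iota ord0 u).
  move=> b; rewrite -iota_central mulrA -lrM; apply: Sr; exact: factor_ideal_iota uK.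
have Nz : {in zs, forall z, N' (iota ord0 z)}.
  move=> z zz b; have [m gz om] := zodd zz.
  rewrite (grC _ ((miota ord0).1 _ _ gz)) mulrA -lrM /w -mulrA /ztop (repeated_odd zodd zz).
  by rewrite mulr0 lr0 mul0r; exact: (ss0 sS).
have dlN i a : N' (iota ord0 a) -> N' (dl i a - iota i a).
  by move=> h; rewrite /dl addrAC subrr add0r; exact: (ssN sN).
pose P := iota i1 w * \prod_(k <- enum 'I_n) iota (i2 k) w.
have NP : N' (iota i1 u ^+ c * tail - P).
  rewrite /tail mulrA; apply: (congM iN).
    rewrite /w lrM lrX; apply: (congM iN); first by rewrite subrr; exact: (ss0 sN).
    by rewrite /ztop lr_prod; apply: (cong_prod iN) => z /Nz h; exact: dlN.
  apply: (cong_prod iN) => k _; rewrite /w lrM lrX; apply: (congM iN).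
    by apply: (congX iN); exact: dlN.
  by rewrite /ztop lr_prod; apply: (cong_prod iN) => z /Nz h; exact: dlN.
set a := iota i1 u; set b := iota ord0 u.
have aC t : a ^+ c * t = t * a ^+ c.
  by elim: c => [|m IH]; rewrite ?mul1r ?mulr1 // exprS -mulrA IH mulrA iota_central mulrA.
have bC t : b ^+ c * t = t * b ^+ c.
  by elim: c => [|m IH]; rewrite ?mul1r ?mulr1 // exprS -mulrA IH mulrA iota_central mulrA.
have Sa i : S (iota i u ^+ c.+1) by rewrite -lrX; apply: factor_ideal_iota; exact: power_in_ideal.
have hbin := cong_binomial iS (iota_central i1 b) (Sa i1) (Sa ord0).
set g := (_ * _) in hbin.
have g0 : g != 0 by rewrite mulf_neq0 ?signr_eq0 // pnatr_eq0 -lt0n bin_gt0 leq_addr.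
have S1 : S (a ^+ c * b ^+ c * tail).
  have : S (g *: (a ^+ c * b ^+ c * tail)).
    have -> : g *: (a ^+ c * b ^+ c * tail) =
        long_product - ((a - b) ^+ (c + c) - g *: (a ^+ c * b ^+ c)) * tail.
      by rewrite mulrBl -scalerAl /long_product /dl -/a -/b; zmod.
    by apply: (ssB sS) => //; exact: Sr.
  by move/(ssZ sS g^-1); rewrite scalerA mulVf // scale1r.
have S2 : S (U0 * (a ^+ c * tail)).
  have -> : U0 * (a ^+ c * tail) = iota ord0 ztop * (a ^+ c * b ^+ c * tail).
    rewrite /U0 /w lrM lrX -/b; move: tail (iota ord0 ztop) => t y.
    by rewrite (bC y) -!mulrA; congr (_ * _); rewrite !mulrA (bC (a ^+ c)).
  exact: Sl.
have S3 := NP 1; rewrite mul1r mulrBr in S3.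
have : S (U0 * P).
  have -> : U0 * P = U0 * (a ^+ c * tail) - (U0 * (a ^+ c * tail) - U0 * P) by zmod.
  exact: (ssB sS).
have -> : U0 * P = \prod_i iota i w.
  rewrite big_ord_recl big_ord_recl; congr (_ * (_ * _)).
  by rewrite [index_enum 'I_n]unlock -enumT.
exact: factor_ideal_notin.
Qed.

Lemma TC_lower_tensor (mu : {lrmorphism T -> A}) (B : cdgaType) (rho : {lrmorphism T -> B}) m :
  (forall a : 'I_n.+2 -> A, mu (\prod_i iota i (a i)) = \prod_i a i) ->
  is_projection rho (ideal_exp [set t | mu t = 0] m.+1) ->
  homotopy_retraction rho -> (n.+2 * c + n.+1 * l <= m)%N.
Proof.
move=> hmu [_ _ ker] hret; rewrite leqNgt; apply/negP => lt.
have emu i a : mu (iota i a) = a.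
  have := hmu (fun j => if j == i then a else 1).
  by rewrite !(prod_single (i := i)) ?eqxx // => j /negbTE ->; rewrite ?lr1.
apply: long_product_notin; apply: (coboundary_factor_ideal hT hK).
apply: (retraction_exact hret long_product_cocycle).
suff : [set t | rho t = 0] long_product by [].
rewrite ker; apply: (pow_le lt); apply: long_product_length => i a.
by rewrite /= /dl lrB !emu subrr.
Qed.
End Lower.
(** * The invariants of a pure formal algebra *)

Lemma pure_family_of_pure (A : cdgaType) (V : nat -> set A) p q deg v :
  pure V -> free_family (p + q) deg v ->
  (forall k, (k < p + q)%N -> V (deg k) (v k) /\ odd (deg k) = (p <= k)%N) ->
  (forall k, (k < p + q)%N -> (2 <= deg k)%N) ->
  span (gparity false V) `<=` span (gens p v) ->
  pure_family p (p + q) deg v (fun k => (p <= k)%N).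
Proof.
move=> [dV0 dV1] fv hv hdeg Vp; split=> //.
- exact: leq_addr.
- by move=> k hk; split; [case: (hv k hk)|exact: leq_trans (hdeg k hk)].
- by move=> k hk; rewrite -ltnNge => kp; have [Vk ok] := hv k hk; apply: dV0; exists (deg k) => //=; rewrite ok leqNgt kp.
- move=> k hk pk; split=> //; have [Vk ok] := hv k hk.
  have [sG _ _] := subalg_gen_subalg (gens p v).
  have : subalg_gen (gparity false V) (diff (v k)) by apply: dV1; exists (deg k) => //=; rewrite ok pk.
  apply: subalg_gen_mono => x hx; have : span (gens p v) x by apply: Vp; exact: span_sub.
  by apply: (span_min sG); exact: subalg_gen_sub.
Qed.

Theorem theorem1 (r : nat) (hr : (2 <= r)%N)
    (A : cdgaType) (V : nat -> set A)
    (hS : sullivan V) (hmin : minimal V)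
    (hpure : pure V) (hell : elliptic V) (hformal : formal A) :
  exists (t c : nat) (chi : int),
    [/\ is_TC r A t, is_cat V c, is_chi_pi V chi
      & t%:Z = r%:Z * c%:Z + chi].
Proof.
have [freeV [V0 V1] _ _] := hS; have [finV finH] := hell; have [gV _] := freeV.
have [H [cls [phi [[dH _ _ _ _] qphi]]]] := hformal.
have hK := acyclic_kernel dH qphi; set K := [set x | phi x = 0] in hK.
have V2 n x : V n x -> x != 0 -> (2 <= n)%N.
  by case: n => [|[|n]] //; rewrite ?V0 ?V1 => ->; rewrite eqxx.
have [p [q [deg [v [fv hv hdeg [dim0 Vp] dim1]]]]] := free_family_of_free_gca freeV V2 finV.
have fA : fin_gen A.
  have [gv hg _] := fv; exists [seq v k | k <- iota 0 (p + q)]; split.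
    move=> _ /mapP[k + ->]; rewrite mem_iota => hk; exists (deg k).
    by split; [exact: hdeg|exact: gv].
  move=> a; move: (hg a); apply: subalg_gen_mono => _ [k hk ->]; apply: subalg_gen_sub.
  by apply/mapP; exists k => //; rewrite mem_iota.
have pv : pure_family p (p + q) deg v (fun k => (p <= k)%N).
  exact: (pure_family_of_pure hpure fv hv hdeg Vp).
have [X [zs [c [u [[pq szs] hX hz [hc hgen hpos] [hu hw]]]]]] := structure pv hK finH.
have Vgen := free_gca_gen freeV.
case: r hr => [|[|n]] // _.
exists (n.+2 * c + n.+1 * size zs)%N, (c + size zs)%N, (p%:Z - q%:Z); split.
- split; first exact: (TC_upper fA hK hX hz hc hgen n.+1).
  move=> m [T [iota [mu [B [rho [hT hmu hrho hret]]]]]].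
  exact: (TC_lower_tensor hK hX hz hc hu hw hT hmu hrho hret).
- split; first exact: (cat_upper gV Vgen V0 hmin fA hK hX hz hc hpos).
  by move=> m; exact: (cat_lower gV Vgen V0 hK hX hz hu hw).
- by exists p, q.
- have e : n.+2%:Z = n.+1%:Z + 1 by rewrite -addn1 PoszD.
  rewrite szs -[in RHS](subnK pq) addnK; move: (q - p)%N => m.
  by rewrite !(PoszD, PoszM) e mulrDr !mulrDl !mul1r; zmod.
Qed.
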